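(* Let $x>0$, $0<\theta,\psi<1$, and let $\nu\in\mathbb{C}\setminus\mathbb{Z}$ with $\Re(\nu)\geq 0$. Let $N$ be any integer with $N\geq\lfloor\frac{\Re(\nu)+1}{2}\rfloor$, and suppose $x\notin\{(n-\theta)(r-\psi):\ n,r\in\mathbb{N}\}$. Then \begin{align*} &8\pi x^{\nu/2}\sum_{n=1}^{\infty}n^{\nu/2}K_{\nu}(4\pi\sqrt{nx})\sum_{d\mid n}d^{-\nu}\cos(2\pi d\theta)\cos\left(\frac{2\pi n\psi}{d}\right)\\ &=-\frac{\pi x^{\nu}}{2\cos(\frac{\pi\nu}{2})}\bigl\{\zeta(1+\nu,\psi)+\zeta(1+\nu,1-\psi)\bigr\}-\frac{\pi}{2\cos(\frac{\pi\nu}{2})}\bigl(\zeta(1-\nu,\theta)+\zeta(1-\nu,1-\theta)\bigr)\\ &\quad+\frac{1}{2\sin(\frac{\pi\nu}{2})}\sum_{j=1}^{N}x^{2j-1}\bigl\{\zeta(2j,\psi)+\zeta(2j,1-\psi)\bigr\}\bigl\{\zeta(2j-\nu,\theta)+\zeta(2j-\nu,1-\theta)\bigr\}\\ &\quad+\frac{1}{2\sin(\frac{\pi\nu}{2})}x^{2N+1}\sum_{m,n\geq 0}\Bigl\{G(n+\psi,m+\theta)+G(n+1-\psi,m+\theta)+G(n+\psi,m+1-\theta)+G(n+1-\psi,m+1-\theta)\Bigr\}, \end{align*} where for $u,v>0$ with $uv\neq x$, \[ G(u,v)=u^{-\nu}\cdot\frac{(uv)^{\nu-2N}-x^{\nu-2N}}{(uv)^2-x^2}.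 \]
   Context: $K_\nu$ denotes the modified Bessel function of the second kind of order $\nu$. $\zeta(s,\alpha)$ is the Hurwitz zeta function ($\sum_{n\ge0}(n+\alpha)^{-s}$ for $\Re s>1$, meromorphically continued to $\mathbb{C}$). $\mathbb{N}=\{1,2,\dots\}$; the double sum runs over all pairs of non-negative integers $m,n$.
   Formalization: The hypothesis on x does not exclude uv = x for all terms (e.g. θ=ψ=1/3, x=1/9), where G is undefined; there G(u,v) is given its limiting value u^{-ν}(ν−2N)x^{ν−2N−2}/2. The double sum is taken as the iterated sum over m, then n. *)

(* Defs.v *)
From Stdlib Require Import Reals ZArith List ClassicalEpsilon.
From Coquelicot Require Import Coquelicot.
Import ListNotations.
Open Scope R_scope.

Definition cexp (z : C) : C :=
  (exp (Re z) * cos (Im z), exp (Re z) * sin (Im z)).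

Definition cpow (x : R) (z : C) : C := cexp (Cmult z (RtoC (ln x))).

Definition ccos (z : C) : C :=
  Cdiv (Cplus (cexp (Cmult Ci z)) (cexp (Copp (Cmult Ci z)))) (RtoC 2).
Definition csin (z : C) : C :=
  Cdiv (Cminus (cexp (Cmult Ci z)) (cexp (Copp (Cmult Ci z)))) (Cmult (RtoC 2) Ci).
Definition ccosh (z : C) : C :=
  Cdiv (Cplus (cexp z) (cexp (Copp z))) (RtoC 2).

Definition BesselK (nu : C) (z : R) : C :=
  RInt_gen (V := C_R_CompleteNormedModule)
    (fun t => Cmult (RtoC (exp (- z * cosh t))) (ccosh (Cmult nu (RtoC t))))
    (at_point 0) (Rbar_locally p_infty).

(* Hurwitz zeta function zeta(s, a) (a > 0), s <> 1: the value at s of the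
   holomorphic function on C \ {1} that equals sum_{n>=0} (n+a)^(-s) for Re s > 1
   (its meromorphic continuation; unique by the identity theorem). *)
Definition hurwitz_zeta (s : C) (a : R) : C :=
  epsilon (inhabits (RtoC 0)) (fun w =>
    exists f : C -> C,
      (forall z : C, z <> RtoC 1 -> @ex_derive C_AbsRing C_NormedModule f z) /\
      (forall z : C, 1 < Re z ->
         @is_series C_AbsRing C_NormedModule
           (fun n => cpow (INR n + a) (Copp z)) (f z)) /\
      f s = w).

(* Value of a complex series (meaningful when it converges) *)
Definition CSeries (a : nat -> C) : C :=
  (Series (fun n => Re (a n)), Series (fun n => Im (a n))).

Definition Cex_series (a : nat -> C) : Prop :=
  @ex_series C_AbsRing C_NormedModule a.

Definition Csum_list (l : list nat) (f : nat -> C) : C :=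
  fold_right (fun d acc => Cplus (f d) acc) (RtoC 0) l.

Definition divisor_sum (n : nat) (f : nat -> C) : C :=
  Csum_list (filter (fun d => Nat.eqb (n mod d) 0) (seq 1 n)) f.

Definition sum_1_to (N : nat) (f : nat -> C) : C := Csum_list (seq 1 N) f.

(* G(u,v) = u^{-nu} ((uv)^{nu-2N} - x^{nu-2N}) / ((uv)^2 - x^2) for uv <> x;
   at uv = x (excluded in the paper) we use the removable-singularity value
   u^{-nu} (nu-2N) x^{nu-2N-2} / 2. *)
Definition Gfun (x : R) (nu : C) (N : Z) (u v : R) : C :=
  let a := Cminus nu (RtoC (2 * IZR N)) in
  if Req_EM_T (u * v) x then
    Cmult (cpow u (Copp nu)) (Cdiv (Cmult a (cpow x (Cminus a (RtoC 2)))) (RtoC 2))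
  else
    Cmult (cpow u (Copp nu))
      (Cdiv (Cminus (cpow (u * v) a) (cpow x a)) (RtoC ((u * v) ^ 2 - x ^ 2))).

(* Main.v *)
Require Import Defs.
From Stdlib Require Import Reals ZArith List.
From Coquelicot Require Import Coquelicot.
From Stdlib Require Import Lra Lia Psatz ClassicalEpsilon.
Open Scope R_scope.

(** Put [A_th(t) = sum_(n >= 1) cos (2 pi n th) e^(- 2 pi n t)] and
    [Z_th(s) = zeta(s, th) + zeta(s, 1 - th)].  Writing [K_nu] as an integral over [t > 0] and summing
    over the divisors turns the left-hand side into [4 pi] times the integral of
    [t^nu A_theta(t) A_psi(x / t)] against [dt / t].  By the partial fractions of the cotangent,
    [2 pi (A_psi(w) + 1/2)] is the sum of [w / (w^2 + u^2)] over the [u] of the form [n + psi] or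
    [n + 1 - psi].  Expanding each summand as a geometric series to order [N] gives a polynomial in [w]
    with coefficients [Z_psi(2j)] and a remainder [R_N(w)].  Since the Mellin transform of [A_theta] is
    [Z_theta(1 - s)] up to a cosine, the constant [-1/2] yields the term in [zeta(1 - nu, .)] and the
    polynomial yields the finite sum; writing [A_theta = (A_theta + 1/2) - 1/2] in front of [R_N] yields
    the term in [zeta(1 + nu, .)] and, after expanding [A_theta + 1/2] as well, the double series, whose
    terms are integrals of products of two kernels [1 / (t^2 + v^2)].

    This is legitimate for [Re nu > 0] and [2N - 1 < Re nu < 2N + 1].  The boundary cases [Re nu = 0] and
    [Re nu = 2N - 1] follow by letting [nu + e] tend to [nu], because all terms are holomorphic there, and
    larger [N] by induction from [G_N - x^2 G_(N+1) = u^(-2N-2) v^(nu-2N-2)].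

    The continuation of [zeta(s, th)] is given by Mellin transforms for [Re s < 1] and near [Re s = 1],
    and by the series for [Re s > 1]; the identity theorem shows that it is the value [hurwitz_zeta]
    selects.  The identity theorem itself is derived from Goursat's theorem without Cauchy's formula: a
    lower bound for the integral of [1 / (z - z0)] around a square bounds a holomorphic function at the
    centre by its values on the boundary. *)

(** All integrals over the half-line are rewritten in y = log t and kept in one class: continuous
    functions bounded by K e^(-d |y|). A Mellin integrand inside its strip is of this kind, and a
    series of such functions with a common d and summable constants may be integrated termwise,
    which takes the place of dominated convergence. Decay in y and summability over the parameters u
    and v come from one source, a weighted geometric mean of t^2 and v^2 whose free exponent is
    chosen differently on the two sides of y = 0.

    The cotangent expansion rests on Euler's integrals of cos (a t) cos^n t: their recursion in n,
    together with its derivative in a, makes the sum telescope.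

    At the left ends of the range of nu the transform of R_N alone diverges, although that of R_N
    times (A_theta + 1/2) does not; hence the passage to the limit there.

    In the identity theorem the boundary bound carries a factor 2 instead of 1. This is harmless,
    since it is applied to a quotient by (w - c)^n for every n. *)

Notation CR := C_R_CompleteNormedModule.

(** * Complex arithmetic, the exponential, and complex powers of positive reals *)

Lemma Ceq_pair (z w : C) : Re z = Re w -> Im z = Im w -> z = w.
Proof. destruct z, w; simpl; intros; subst; reflexivity. Qed.

Lemma Re_plus (z w : C) : Re (Cplus z w) = Re z + Re w. Proof. reflexivity. Qed.
Lemma Im_plus (z w : C) : Im (Cplus z w) = Im z + Im w. Proof. reflexivity. Qed.
Lemma Re_minus (z w : C) : Re (Cminus z w) = Re z - Re w. Proof. reflexivity. Qed.
Lemma Im_minus (z w : C) : Im (Cminus z w) = Im z - Im w. Proof. reflexivity. Qed.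
Lemma Re_opp (z : C) : Re (Copp z) = - Re z. Proof. reflexivity. Qed.
Lemma Im_opp (z : C) : Im (Copp z) = - Im z. Proof. reflexivity. Qed.
Lemma Re_mult (z w : C) : Re (Cmult z w) = Re z * Re w - Im z * Im w. Proof. reflexivity. Qed.
Lemma Im_mult (z w : C) : Im (Cmult z w) = Re z * Im w + Im z * Re w. Proof. reflexivity. Qed.
Lemma Re_RtoC (r : R) : Re (RtoC r) = r. Proof. reflexivity. Qed.
Lemma Im_RtoC (r : R) : Im (RtoC r) = 0. Proof. reflexivity. Qed.
Lemma Re_Ci : Re Ci = 0. Proof. reflexivity. Qed.
Lemma Im_Ci : Im Ci = 1. Proof. reflexivity. Qed.

Hint Rewrite Re_plus Im_plus Re_minus Im_minus Re_opp Im_opp Re_mult Im_mult Re_RtoC Im_RtoC Re_Ci Im_Ci : cri.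
Ltac cri := autorewrite with cri.

Lemma Cmod_minus_sym (z w : C) : Cmod (Cminus z w) = Cmod (Cminus w z).
Proof. rewrite <- Cmod_opp. f_equal. ring. Qed.

Lemma Cmod_triangle_minus (z w : C) : Cmod (Cminus z w) <= Cmod z + Cmod w.
Proof. unfold Cminus. rewrite <- (Cmod_opp w). apply Cmod_triangle. Qed.

Lemma im_le_Cmod (z : C) : Rabs (Im z) <= Cmod z.
Proof. generalize (Rmax_Cmod z). intros. eapply Rle_trans; [|exact H]. apply Rmax_r. Qed.

Lemma Cmod_le_re_im (z : C) : Cmod z <= Rabs (Re z) + Rabs (Im z).
Proof.
  replace z with (Cplus (RtoC (Re z)) (Cmult Ci (RtoC (Im z)))) at 1 by (apply Ceq_pair; cri; ring).
  eapply Rle_trans; [apply Cmod_triangle|]. rewrite Cmod_mult, Cmod_Ci, !Cmod_R. lra.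
Qed.

Lemma RtoC_neq (r : R) : r <> 0 -> RtoC r <> RtoC 0.
Proof. intros H E. apply H. exact (f_equal fst E). Qed.

Lemma Cmod_pos_neq (z : C) : 0 < Cmod z -> z <> RtoC 0.
Proof. intros H. apply Cmod_gt_0. exact H. Qed.

Lemma Cmod_eq_intro (z w : C) : (forall eps, 0 < eps -> Cmod (Cminus z w) <= eps) -> z = w.
Proof.
  intros H. apply Ceq_minus. apply Cmod_eq_0.
  destruct (Rle_lt_or_eq_dec 0 (Cmod (Cminus z w)) (Cmod_ge_0 _)) as [h|h]; [|auto].
  specialize (H (Cmod (Cminus z w) / 2)). lra.
Qed.

Lemma cexp_add (z w : C) : cexp (Cplus z w) = Cmult (cexp z) (cexp w).
Proof.
  unfold cexp. apply Ceq_pair; cri; simpl; rewrite exp_plus, ?cos_plus, ?sin_plus; ring.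
Qed.

Lemma cexp_0 : cexp (RtoC 0) = RtoC 1.
Proof. unfold cexp; apply Ceq_pair; simpl; rewrite exp_0, ?cos_0, ?sin_0; ring. Qed.

Lemma cexp_RtoC (r : R) : cexp (RtoC r) = RtoC (exp r).
Proof. unfold cexp; apply Ceq_pair; simpl; rewrite ?cos_0, ?sin_0; ring. Qed.

Lemma Cmod_cexp (z : C) : Cmod (cexp z) = exp (Re z).
Proof.
  unfold Cmod, cexp. simpl.
  replace (exp (Re z) * cos (Im z) * (exp (Re z) * cos (Im z) * 1) + exp (Re z) * sin (Im z) * (exp (Re z) * sin (Im z) * 1))
    with ((exp (Re z))^2 * (Rsqr (sin (Im z)) + Rsqr (cos (Im z)))) by (unfold Rsqr; ring).
  rewrite sin2_cos2, Rmult_1_r. apply sqrt_pow2. left; apply exp_pos.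
Qed.

Lemma cexp_neq_0 (z : C) : cexp z <> RtoC 0.
Proof. apply Cmod_pos_neq. rewrite Cmod_cexp. apply exp_pos. Qed.

Lemma cexp_opp (z : C) : cexp (Copp z) = Cinv (cexp z).
Proof.
  assert (H : Cmult (cexp z) (cexp (Copp z)) = RtoC 1).
  { rewrite <- cexp_add. replace (Cplus z (Copp z)) with (RtoC 0) by ring. apply cexp_0. }
  rewrite <- (Cmult_1_l (Cinv _)). rewrite <- H. field. apply cexp_neq_0.
Qed.

Lemma cpow_add (x : R) (z w : C) : cpow x (Cplus z w) = Cmult (cpow x z) (cpow x w).
Proof. unfold cpow. rewrite <- cexp_add. f_equal. ring. Qed.

Lemma cpow_opp (x : R) (z : C) : cpow x (Copp z) = Cinv (cpow x z).
Proof. unfold cpow. rewrite <- cexp_opp. f_equal. ring. Qed.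

Lemma cpow_neq_0 (x : R) (z : C) : cpow x z <> RtoC 0.
Proof. apply cexp_neq_0. Qed.

Lemma cpow_minus (x : R) (z w : C) : cpow x (Cminus z w) = Cdiv (cpow x z) (cpow x w).
Proof. unfold Cminus. rewrite cpow_add, cpow_opp. reflexivity. Qed.

Lemma cpow_mult_base (x y : R) (z : C) : 0 < x -> 0 < y -> cpow (x * y) z = Cmult (cpow x z) (cpow y z).
Proof. intros. unfold cpow. rewrite ln_mult by auto. rewrite <- cexp_add. f_equal. rewrite RtoC_plus. ring. Qed.

Lemma cpow_div_base (x y : R) (z : C) : 0 < x -> 0 < y -> cpow (x / y) z = Cdiv (cpow x z) (cpow y z).
Proof.
  intros. unfold Rdiv. rewrite cpow_mult_base by (auto; apply Rinv_0_lt_compat; auto).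
  unfold Cdiv. f_equal. rewrite <- cpow_opp. unfold cpow. rewrite ln_Rinv by auto. f_equal. rewrite RtoC_opp. ring.
Qed.

Lemma Cmod_cpow (x : R) (z : C) : Cmod (cpow x z) = Rpower x (Re z).
Proof. unfold cpow, Rpower. rewrite Cmod_cexp. f_equal. cri. ring. Qed.

Lemma cpow_RtoC (x r : R) : cpow x (RtoC r) = RtoC (Rpower x r).
Proof. unfold cpow, Rpower. rewrite <- cexp_RtoC, <- RtoC_mult. reflexivity. Qed.

Lemma cpow_INR (x : R) (n : nat) : 0 < x -> cpow x (RtoC (INR n)) = RtoC (x ^ n).
Proof. intros. rewrite cpow_RtoC, Rpower_pow; auto. Qed.

Lemma cpow_1 (x : R) : 0 < x -> cpow x (RtoC 1) = RtoC x.
Proof. intros. rewrite cpow_RtoC, Rpower_1; auto. Qed.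

Lemma cpow_1_base (z : C) : cpow 1 z = RtoC 1.
Proof. unfold cpow. rewrite ln_1. rewrite <- cexp_0. f_equal. ring. Qed.

Lemma cexp_Ci (r : R) : cexp (Cmult Ci (RtoC r)) = (cos r, sin r).
Proof.
  unfold cexp. apply Ceq_pair; cri; simpl.
  - replace (0 * r - 1 * 0) with 0 by ring. rewrite exp_0. replace (0 * 0 + 1 * r) with r by ring. ring.
  - replace (0 * r - 1 * 0) with 0 by ring. rewrite exp_0. replace (0 * 0 + 1 * r) with r by ring. ring.
Qed.

(** * Complex-valued functions of a real variable *)

Lemma norm_CR (z : C) : @norm R_AbsRing C_R_NormedModule z = Cmod z.
Proof.
  unfold norm; simpl. unfold prod_norm, Cmod, norm; simpl. unfold abs; simpl.
  change (sqrt (Rabs (fst z) ^ 2 + Rabs (snd z) ^ 2) = sqrt (fst z ^ 2 + snd z ^ 2)). rewrite !pow2_abs. reflexivity.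
Qed.

Lemma scal_CR (a : R) (z : C) : @scal R_AbsRing C_R_NormedModule a z = Cmult (RtoC a) z.
Proof. apply injective_projections; simpl; unfold scal; simpl; unfold mult; simpl; ring. Qed.

Lemma is_derive_pair (f : R -> C) (t : R) (l : C) :
  is_derive (fun t => Re (f t)) t (Re l) -> is_derive (fun t => Im (f t)) t (Im l) ->
  @is_derive R_AbsRing C_R_NormedModule f t l.
Proof.
  intros [_ H1] [_ H2]. split.
  - apply @is_linear_scal_l.
  - intros y Hy. specialize (H1 y Hy). specialize (H2 y Hy).
    intros eps.
    assert (He : 0 < eps / 2) by (destruct eps; simpl; lra).
    specialize (H1 (mkposreal _ He)). specialize (H2 (mkposreal _ He)).
    generalize (filter_and _ _ H1 H2). apply filter_imp. intros s [K1 K2].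
    rewrite norm_CR. change (Cmod (Cminus (Cminus (f s) (f y)) (@scal R_AbsRing C_R_NormedModule (minus s y) l)) <= eps * norm (minus s y)).
    eapply Rle_trans; [apply Cmod_le_re_im|].
    assert (K1' : Rabs (Re (f s) - Re (f y) - (minus s y) * Re l) <= eps / 2 * norm (minus s y)) by exact K1.
    assert (K2' : Rabs (Im (f s) - Im (f y) - (minus s y) * Im l) <= eps / 2 * norm (minus s y)) by exact K2.
    cri.
    change (Re (@scal R_AbsRing C_R_NormedModule (minus s y) l)) with ((minus s y) * Re l).
    change (Im (@scal R_AbsRing C_R_NormedModule (minus s y) l)) with ((minus s y) * Im l).
    lra.
Qed.

Lemma is_derive_unpair (f : R -> C) (t : R) (l : C) :
  @is_derive R_AbsRing C_R_NormedModule f t l ->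
  is_derive (fun t => Re (f t)) t (Re l) /\ is_derive (fun t => Im (f t)) t (Im l).
Proof.
  intros [_ H]. split; (split; [apply @is_linear_scal_l|]); intros y Hy; specialize (H y Hy); intros eps;
  specialize (H eps); revert H; apply filter_imp; intros s K.
  - rewrite norm_CR in K. change (Cmod (Cminus (Cminus (f s) (f y)) (@scal R_AbsRing C_R_NormedModule (minus s y) l)) <= eps * norm (minus s y)) in K.
    eapply Rle_trans; [|exact K]. eapply Rle_trans; [|apply re_le_Cmod]. apply Req_le. reflexivity.
  - rewrite norm_CR in K. change (Cmod (Cminus (Cminus (f s) (f y)) (@scal R_AbsRing C_R_NormedModule (minus s y) l)) <= eps * norm (minus s y)) in K.
    eapply Rle_trans; [|exact K]. eapply Rle_trans; [|apply im_le_Cmod]. apply Req_le. reflexivity.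
Qed.

Lemma continuous_pair (f : R -> C) (t : R) :
  continuous (fun t => Re (f t)) t -> continuous (fun t => Im (f t)) t ->
  @continuous R_UniformSpace C_R_NormedModule f t.
Proof.
  intros H1 H2 P [eps HP].
  specialize (H1 _ (locally_ball _ eps)). specialize (H2 _ (locally_ball _ eps)).
  unfold filtermap in *. generalize (filter_and _ _ H1 H2). apply filter_imp. intros s [K1 K2]. apply HP.
  split; assumption.
Qed.

Lemma continuous_unpair (f : R -> C) (t : R) :
  @continuous R_UniformSpace C_R_NormedModule f t ->
  continuous (fun t => Re (f t)) t /\ continuous (fun t => Im (f t)) t.
Proof.
  intros H. split; intros P [eps HP]; specialize (H _ (locally_ball _ eps)); unfold filtermap in *;
  revert H; apply filter_imp; intros s [K1 K2]; apply HP; assumption.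
Qed.

Definition ccontR (f : R -> C) : Prop := forall t, @continuous R_UniformSpace C_R_NormedModule f t.

Lemma continuous_Rmult (f g : R -> R) t : continuous f t -> continuous g t -> continuous (fun t => f t * g t) t.
Proof. intros. apply (@continuous_mult R_UniformSpace R_AbsRing f g t); auto. Qed.
Lemma continuous_Rplus (f g : R -> R) t : continuous f t -> continuous g t -> continuous (fun t => f t + g t) t.
Proof. intros. apply (@continuous_plus R_UniformSpace R_AbsRing R_NormedModule f g t); auto. Qed.
Lemma continuous_Rminus (f g : R -> R) t : continuous f t -> continuous g t -> continuous (fun t => f t - g t) t.
Proof. intros. apply (@continuous_minus R_UniformSpace R_AbsRing R_NormedModule f g t); auto. Qed.
Lemma continuous_Ropp (f : R -> R) t : continuous f t -> continuous (fun t => - f t) t.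
Proof. intros. apply (@continuous_opp R_UniformSpace R_AbsRing R_NormedModule f t); auto. Qed.
Lemma continuous_Rinv' (f : R -> R) t : continuous f t -> f t <> 0 -> continuous (fun t => / f t) t.
Proof. intros. apply (continuous_comp f Rinv); auto. apply continuous_Rinv. auto. Qed.

Lemma continuous_Rpow (f : R -> R) n t : continuous f t -> continuous (fun t => f t ^ n) t.
Proof.
  intros H. induction n; simpl; [apply continuous_const|].
  apply (continuous_Rmult f (fun t => f t ^ n)); auto.
Qed.

Lemma continuous_Cplus (f g : R -> C) t :
  @continuous R_UniformSpace C_R_NormedModule f t -> @continuous R_UniformSpace C_R_NormedModule g t ->
  @continuous R_UniformSpace C_R_NormedModule (fun t => Cplus (f t) (g t)) t.
Proof. intros. apply (@continuous_plus R_UniformSpace R_AbsRing C_R_NormedModule f g t); auto. Qed.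
Lemma continuous_Cminus (f g : R -> C) t :
  @continuous R_UniformSpace C_R_NormedModule f t -> @continuous R_UniformSpace C_R_NormedModule g t ->
  @continuous R_UniformSpace C_R_NormedModule (fun t => Cminus (f t) (g t)) t.
Proof. intros. apply (@continuous_minus R_UniformSpace R_AbsRing C_R_NormedModule f g t); auto. Qed.
Lemma continuous_Copp (f : R -> C) t :
  @continuous R_UniformSpace C_R_NormedModule f t ->
  @continuous R_UniformSpace C_R_NormedModule (fun t => Copp (f t)) t.
Proof. intros. apply (@continuous_opp R_UniformSpace R_AbsRing C_R_NormedModule f t); auto. Qed.

Lemma continuous_Cmult (f g : R -> C) t :
  @continuous R_UniformSpace C_R_NormedModule f t -> @continuous R_UniformSpace C_R_NormedModule g t ->
  @continuous R_UniformSpace C_R_NormedModule (fun t => Cmult (f t) (g t)) t.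
Proof.
  intros Hf Hg. apply continuous_unpair in Hf. apply continuous_unpair in Hg. destruct Hf, Hg.
  apply continuous_pair; cbn -[Rmult Rplus Rminus].
  - apply continuous_Rminus; apply continuous_Rmult; assumption.
  - apply continuous_Rplus; apply continuous_Rmult; assumption.
Qed.

Lemma continuous_Cinv (f : R -> C) t :
  @continuous R_UniformSpace C_R_NormedModule f t -> f t <> RtoC 0 ->
  @continuous R_UniformSpace C_R_NormedModule (fun t => Cinv (f t)) t.
Proof.
  intros Hf Hn. apply continuous_unpair in Hf. destruct Hf as [H1 H2].
  assert (K : Re (f t) ^ 2 + Im (f t) ^ 2 <> 0).
  { intros E. apply Hn. apply Cmod_eq_0. unfold Cmod. unfold Re, Im in E. rewrite E. apply sqrt_0. }
  assert (D : continuous (fun t => / (Re (f t) ^ 2 + Im (f t) ^ 2)) t).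
  { apply continuous_Rinv'; [|exact K].
    apply (continuous_Rplus (fun t => Re (f t) ^ 2) (fun t => Im (f t) ^ 2)).
    - apply continuous_ext with (fun t => Re (f t) * Re (f t)); [intros; simpl; ring|].
      apply (continuous_Rmult (fun t => Re (f t)) (fun t => Re (f t))); auto.
    - apply continuous_ext with (fun t => Im (f t) * Im (f t)); [intros; simpl; ring|].
      apply (continuous_Rmult (fun t => Im (f t)) (fun t => Im (f t))); auto. }
  apply continuous_pair; cbn -[Rmult Rplus Rminus pow]; unfold Rdiv; apply continuous_Rmult; auto.
  apply continuous_Ropp. auto.
Qed.

Lemma continuous_RtoC (f : R -> R) t :
  continuous f t -> @continuous R_UniformSpace C_R_NormedModule (fun t => RtoC (f t)) t.
Proof. intros. apply continuous_pair; simpl; auto. apply continuous_const. Qed.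

Lemma continuous_Cconst (c : C) t : @continuous R_UniformSpace C_R_NormedModule (fun t => c) t.
Proof. apply continuous_const. Qed.

Lemma continuous_exp_comp (f : R -> R) t : continuous f t -> continuous (fun t => exp (f t)) t.
Proof. intros. apply (continuous_comp f exp); auto. apply continuous_exp. Qed.

Lemma continuous_cos_comp (f : R -> R) t : continuous f t -> continuous (fun t => cos (f t)) t.
Proof. intros. apply (continuous_comp f cos); auto. apply continuous_cos. Qed.
Lemma continuous_sin_comp (f : R -> R) t : continuous f t -> continuous (fun t => sin (f t)) t.
Proof. intros. apply (continuous_comp f sin); auto. apply continuous_sin. Qed.

Lemma continuous_cexp (f : R -> C) t :
  @continuous R_UniformSpace C_R_NormedModule f t ->
  @continuous R_UniformSpace C_R_NormedModule (fun t => cexp (f t)) t.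
Proof.
  intros Hf. apply continuous_unpair in Hf. destruct Hf as [H1 H2].
  apply continuous_pair.
  - apply (continuous_Rmult (fun t => exp (Re (f t))) (fun t => cos (Im (f t)))).
    + apply continuous_exp_comp; exact H1.
    + apply continuous_cos_comp; exact H2.
  - apply (continuous_Rmult (fun t => exp (Re (f t))) (fun t => sin (Im (f t)))).
    + apply continuous_exp_comp; exact H1.
    + apply continuous_sin_comp; exact H2.
Qed.

Lemma continuous_Rid (t : R) : continuous (fun t : R => t) t.
Proof. apply continuous_id. Qed.
Lemma continuous_Cmod (f : R -> C) t :
  @continuous R_UniformSpace C_R_NormedModule f t -> continuous (fun t => Cmod (f t)) t.
Proof.
  intros. apply continuous_ext with (fun t => @norm R_AbsRing C_R_NormedModule (f t)); [intros; apply norm_CR|].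
  apply (continuous_comp f (fun z => @norm R_AbsRing C_R_NormedModule z)); auto.
  apply (@filterlim_norm R_AbsRing C_R_NormedModule).
Qed.

Ltac cont := repeat lazymatch goal with
  | |- continuous (fun _ => ?c) _ => apply continuous_const
  | |- continuous (fun _ => Cplus _ _) _ => apply continuous_Cplus
  | |- continuous (fun _ => Cminus _ _) _ => apply continuous_Cminus
  | |- continuous (fun _ => Cmult _ _) _ => apply continuous_Cmult
  | |- continuous (fun _ => Cdiv _ _) _ => apply continuous_Cmult
  | |- continuous (fun _ => Copp _) _ => apply continuous_Copp
  | |- continuous (fun _ => Cinv _) _ => apply continuous_Cinv
  | |- continuous (fun _ => RtoC _) _ => apply continuous_RtoC
  | |- continuous (fun _ => cexp _) _ => apply continuous_cexp
  | |- continuous (fun _ => exp _) _ => apply continuous_exp_comp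
  | |- continuous (fun _ => cos _) _ => apply continuous_cos_comp
  | |- continuous (fun _ => sin _) _ => apply continuous_sin_comp
  | |- continuous (fun _ => Cmod _) _ => apply continuous_Cmod
  | |- continuous (fun _ => Rplus _ _) _ => apply continuous_Rplus
  | |- continuous (fun _ => Rminus _ _) _ => apply continuous_Rminus
  | |- continuous (fun _ => Rmult _ _) _ => apply continuous_Rmult
  | |- continuous (fun _ => Rdiv _ _) _ => apply continuous_Rmult
  | |- continuous (fun _ => pow _ _) _ => apply continuous_Rpow
  | |- continuous (fun _ => Ropp _) _ => apply continuous_Ropp
  | |- continuous (fun _ => Rinv _) _ => apply continuous_Rinv'
  | |- continuous (fun t => t) _ => apply continuous_Rid
  | |- continuous RtoC _ => apply (continuous_RtoC (fun t => t))
  | |- continuous (Rmult ?c) _ => apply (continuous_Rmult (fun _ => c) (fun t => t))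
  | |- continuous (Rplus ?c) _ => apply (continuous_Rplus (fun _ => c) (fun t => t))
  | |- continuous (Rminus ?c) _ => apply (continuous_Rminus (fun _ => c) (fun t => t))
  | |- continuous exp _ => apply continuous_exp
  | |- continuous Ropp _ => apply (continuous_Ropp (fun t => t))
  end.

Lemma is_derive_Rmult (f g : R -> R) t a b :
  is_derive f t a -> is_derive g t b -> is_derive (fun t => f t * g t) t (a * g t + f t * b).
Proof. intros. apply (@is_derive_mult R_AbsRing f g); auto. apply Rmult_comm. Qed.

Notation is_derC := (@is_derive R_AbsRing C_R_NormedModule).

Lemma is_derC_Cplus (f g : R -> C) t a b :
  is_derC f t a -> is_derC g t b -> is_derC (fun t => Cplus (f t) (g t)) t (Cplus a b).
Proof. intros. apply (@is_derive_plus R_AbsRing C_R_NormedModule f g); auto. Qed.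

Lemma is_derC_Cminus (f g : R -> C) t a b :
  is_derC f t a -> is_derC g t b -> is_derC (fun t => Cminus (f t) (g t)) t (Cminus a b).
Proof. intros. apply (@is_derive_minus R_AbsRing C_R_NormedModule f g); auto. Qed.

Lemma is_derC_Cmult (f g : R -> C) t a b :
  is_derC f t a -> is_derC g t b ->
  is_derC (fun t => Cmult (f t) (g t)) t (Cplus (Cmult a (g t)) (Cmult (f t) b)).
Proof.
  intros Hf Hg. apply is_derive_unpair in Hf. apply is_derive_unpair in Hg.
  destruct Hf as [f1 f2], Hg as [g1 g2]. apply is_derive_pair.
  - replace (Re _) with ((Re a * Re (g t) + Re (f t) * Re b) - (Im a * Im (g t) + Im (f t) * Im b)) by (cri; ring).
    apply (@is_derive_minus R_AbsRing R_NormedModule (fun t => Re (f t) * Re (g t)) (fun t => Im (f t) * Im (g t)));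
    apply is_derive_Rmult; auto.
  - replace (Im _) with ((Re a * Im (g t) + Re (f t) * Im b) + (Im a * Re (g t) + Im (f t) * Re b)) by (cri; ring).
    apply (@is_derive_plus R_AbsRing R_NormedModule (fun t => Re (f t) * Im (g t)) (fun t => Im (f t) * Re (g t)));
    apply is_derive_Rmult; auto.
Qed.

Lemma is_derC_const (c : C) t : is_derC (fun _ => c) t (RtoC 0).
Proof. apply (@is_derive_const R_AbsRing C_R_NormedModule). Qed.

Lemma is_derC_RtoC (f : R -> R) t a : is_derive f t a -> is_derC (fun t => RtoC (f t)) t (RtoC a).
Proof. intros. apply is_derive_pair; simpl; auto. apply (@is_derive_const R_AbsRing R_NormedModule). Qed.

Lemma is_derC_cexp (f : R -> C) t a :
  is_derC f t a -> is_derC (fun t => cexp (f t)) t (Cmult a (cexp (f t))).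
Proof.
  intros H. apply is_derive_unpair in H. destruct H as [H1 H2].
  assert (E : is_derive (fun t => exp (Re (f t))) t (Re a * exp (Re (f t)))).
  { apply (is_derive_comp exp (fun t => Re (f t))); auto. apply is_derive_Reals, derivable_pt_lim_exp. }
  assert (Cc : is_derive (fun t => cos (Im (f t))) t (Im a * - sin (Im (f t)))).
  { apply (is_derive_comp cos (fun t => Im (f t))); auto. apply is_derive_Reals, derivable_pt_lim_cos. }
  assert (S : is_derive (fun t => sin (Im (f t))) t (Im a * cos (Im (f t)))).
  { apply (is_derive_comp sin (fun t => Im (f t))); auto. apply is_derive_Reals, derivable_pt_lim_sin. }
  apply is_derive_pair.
  - replace (Re (Cmult a (cexp (f t)))) with (Re a * exp (Re (f t)) * cos (Im (f t)) + exp (Re (f t)) * (Im a * - sin (Im (f t)))) by (cri; simpl; ring).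
    apply (is_derive_Rmult (fun t => exp (Re (f t))) (fun t => cos (Im (f t)))); auto.
  - replace (Im (Cmult a (cexp (f t)))) with (Re a * exp (Re (f t)) * sin (Im (f t)) + exp (Re (f t)) * (Im a * cos (Im (f t)))) by (cri; simpl; ring).
    apply (is_derive_Rmult (fun t => exp (Re (f t))) (fun t => sin (Im (f t)))); auto.
Qed.

(** * Integrals of complex-valued functions over an interval *)

Definition CInt (f : R -> C) (a b : R) : C := @RInt CR f a b.
Notation exCI := (@ex_RInt C_R_NormedModule).

Lemma ccontR_ex (f : R -> C) a b : ccontR f -> exCI f a b.
Proof. intros H. apply (@ex_RInt_continuous CR). intros; apply H. Qed.

Lemma CInt_ext_le (f g : R -> C) a b :
  (forall t, Rmin a b <= t <= Rmax a b -> f t = g t) -> CInt f a b = CInt g a b.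
Proof. intros H. apply (@RInt_ext CR). intros; apply H; lra. Qed.

Lemma CInt_ext (f g : R -> C) a b : (forall t, f t = g t) -> CInt f a b = CInt g a b.
Proof. intros H. apply (@RInt_ext CR). intros; apply H. Qed.

Lemma CInt_plus (f g : R -> C) a b : exCI f a b -> exCI g a b ->
  CInt (fun t => Cplus (f t) (g t)) a b = Cplus (CInt f a b) (CInt g a b).
Proof. intros. apply (@RInt_plus CR f g a b); auto. Qed.

Lemma CInt_minus (f g : R -> C) a b : exCI f a b -> exCI g a b ->
  CInt (fun t => Cminus (f t) (g t)) a b = Cminus (CInt f a b) (CInt g a b).
Proof. intros. apply (@RInt_minus CR f g a b); auto. Qed.

Lemma is_RInt_Cscal (c : C) (f : R -> C) a b l :
  @is_RInt C_R_NormedModule f a b l ->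
  @is_RInt C_R_NormedModule (fun t => Cmult c (f t)) a b (Cmult c l).
Proof.
  intros H.
  pose proof (@is_RInt_fct_extend_fst R_NormedModule R_NormedModule f a b l H) as H1.
  pose proof (@is_RInt_fct_extend_snd R_NormedModule R_NormedModule f a b l H) as H2.
  apply (@is_RInt_fct_extend_pair R_NormedModule R_NormedModule); simpl.
  - apply (@is_RInt_minus R_NormedModule (fun t => fst c * fst (f t)) (fun t => snd c * snd (f t)));
      apply (@is_RInt_scal R_NormedModule); assumption.
  - apply (@is_RInt_plus R_NormedModule (fun t => fst c * snd (f t)) (fun t => snd c * fst (f t)));
      apply (@is_RInt_scal R_NormedModule); assumption.
Qed.

Lemma exCI_scal (c : C) (f : R -> C) a b : exCI f a b -> exCI (fun t => Cmult c (f t)) a b.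
Proof. intros [l H]. exists (Cmult c l). apply is_RInt_Cscal; auto. Qed.

Lemma CInt_scal (c : C) (f : R -> C) a b : exCI f a b ->
  CInt (fun t => Cmult c (f t)) a b = Cmult c (CInt f a b).
Proof. intros H. apply (@is_RInt_unique CR). apply is_RInt_Cscal. apply (@RInt_correct CR); auto. Qed.


Lemma CInt_swap (f : R -> C) a b : exCI f a b -> CInt f b a = Copp (CInt f a b).
Proof. intros. symmetry. apply (@opp_RInt_swap CR f a b); auto. Qed.

Lemma CInt_Chasles (f : R -> C) a b c : exCI f a b -> exCI f b c ->
  CInt f a c = Cplus (CInt f a b) (CInt f b c).
Proof. intros. symmetry. apply (@RInt_Chasles CR); auto. Qed.

Lemma CInt_const (c : C) a b : CInt (fun _ => c) a b = Cmult (RtoC (b - a)) c.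
Proof. unfold CInt. rewrite (@RInt_const CR). apply scal_CR. Qed.

Lemma Cmod_CInt_le (f : R -> C) (g : R -> R) a b : a <= b ->
  exCI f a b -> ex_RInt g a b ->
  (forall t, a <= t <= b -> Cmod (f t) <= g t) -> Cmod (CInt f a b) <= RInt g a b.
Proof.
  intros Hab Hf Hg H. rewrite <- norm_CR.
  eapply (@norm_RInt_le C_R_NormedModule f g a b); auto.
  - intros. rewrite norm_CR. auto.
  - apply (@RInt_correct CR); auto.
  - apply (@RInt_correct R_CompleteNormedModule); auto.
Qed.

Lemma Cmod_CInt_const (f : R -> C) M a b :
  exCI f a b ->
  (forall t, Rmin a b <= t <= Rmax a b -> Cmod (f t) <= M) -> Cmod (CInt f a b) <= Rabs (b - a) * M.
Proof.
  assert (G : forall a b, a <= b -> exCI f a b ->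
    (forall t, a <= t <= b -> Cmod (f t) <= M) -> Cmod (CInt f a b) <= (b - a) * M).
  { intros a' b' Hab Hf H. rewrite <- norm_CR.
    apply (@norm_RInt_le_const C_R_NormedModule f a' b'); auto.
    - intros. rewrite norm_CR. auto.
    - apply (@RInt_correct CR); auto. }
  intros Hf H. destruct (Rle_dec a b) as [h|h].
  - rewrite Rabs_pos_eq by lra. apply G; auto. intros. apply H. rewrite Rmin_left, Rmax_right; auto.
  - rewrite CInt_swap by (apply ex_RInt_swap; auto). rewrite Cmod_opp. rewrite Rabs_minus_sym, Rabs_pos_eq by lra.
    apply G; [lra|apply ex_RInt_swap; auto|]. intros. apply H. rewrite Rmin_right, Rmax_left; lra.
Qed.

Lemma CInt_FTC (F f : R -> C) a b :
  (forall t, Rmin a b <= t <= Rmax a b -> is_derC F t (f t)) ->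
  (forall t, Rmin a b <= t <= Rmax a b -> @continuous R_UniformSpace C_R_NormedModule f t) ->
  CInt f a b = Cminus (F b) (F a).
Proof.
  intros H1 H2. apply (@is_RInt_unique CR). apply (@is_RInt_derive CR F f a b); auto.
Qed.

Lemma CInt_comp_lin (f : R -> C) (u v a b : R) : u <> 0 ->
  exCI f (u * a + v) (u * b + v) ->
  Cmult (RtoC u) (CInt (fun y => f (u * y + v)) a b) = CInt f (u * a + v) (u * b + v).
Proof.
  intros hu H. unfold CInt. rewrite <- (@RInt_comp_lin CR) by auto.
  rewrite <- scal_CR. symmetry. apply (@RInt_scal CR).
    apply ex_RInt_ext with (fun y => scal (/u) (scal u (f (u * y + v)))).
    + intros. rewrite scal_assoc. unfold mult; simpl. rewrite Rinv_l by auto. apply @scal_one.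
    + apply (@ex_RInt_scal C_R_NormedModule). apply (@ex_RInt_comp_lin C_R_NormedModule); auto.
Qed.

Lemma CInt_shift (f : R -> C) (v a b : R) : ccontR f ->
  CInt (fun y => f (y + v)) a b = CInt f (a + v) (b + v).
Proof.
  intros H. pose proof (CInt_comp_lin f 1 v a b R1_neq_R0 (ccontR_ex _ _ _ H)) as K.
  rewrite !Rmult_1_l in K. rewrite <- K, Cmult_1_l. apply CInt_ext. intros. rewrite Rmult_1_l. reflexivity.
Qed.

Lemma CInt_neg (f : R -> C) (a b : R) : ccontR f ->
  CInt (fun y => f (- y)) a b = CInt f (-b) (-a).
Proof.
  intros H. pose proof (CInt_comp_lin f (-1) 0 a b (Rlt_not_eq (-1) 0 ltac:(lra)) (ccontR_ex _ _ _ H)) as K.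
  rewrite (CInt_ext (fun y => f (- y)) (fun y => f (-1 * y + 0))) by (intros; f_equal; ring).
  replace (-1 * a + 0) with (-a) in K by ring. replace (-1 * b + 0) with (-b) in K by ring.
  rewrite (CInt_swap f (-a) (-b)), <- K by (apply ccontR_ex; auto).
  apply Ceq_pair; cri; ring.
Qed.

(** * The exponential near the origin *)

Lemma is_derC_eq (f : R -> C) t (a b : C) : is_derC f t a -> a = b -> is_derC f t b.
Proof. intros H <-. exact H. Qed.

Lemma is_derC_id t : is_derC (fun t => RtoC t) t (RtoC 1).
Proof. apply (is_derC_RtoC (fun t => t)). apply (@is_derive_id R_AbsRing). Qed.

Lemma is_derC_lin (z : C) t : is_derC (fun t => Cmult z (RtoC t)) t z.
Proof.
  eapply is_derC_eq; [apply is_derC_Cmult; [apply is_derC_const|apply is_derC_id]|]. cbv beta; ring.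
Qed.

Lemma ccontR_cexp_lin (z : C) : ccontR (fun t => cexp (Cmult z (RtoC t))).
Proof. intros t. cont. Qed.

(** The fundamental theorem along the segment from 0 to z. Used once here and once more in
    [Cmod_cexp_taylor], it yields the remainder bounds of first and second order without the power
    series. *)
Lemma cexp_minus_1 (z : C) : Cminus (cexp z) (RtoC 1) = Cmult z (CInt (fun t => cexp (Cmult z (RtoC t))) 0 1).
Proof.
  rewrite <- CInt_scal by (apply ccontR_ex, ccontR_cexp_lin).
  rewrite (CInt_FTC (fun t => cexp (Cmult z (RtoC t)))).
  - rewrite Cmult_1_r, Cmult_0_r, cexp_0. reflexivity.
  - intros. apply is_derC_cexp, is_derC_lin.
  - intros. cont.
Qed.

Lemma exp_le (a b : R) : a <= b -> exp a <= exp b.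
Proof. intros [H|H]; [left; apply exp_increasing; auto|right; subst; auto]. Qed.

Lemma Cmod_cexp_minus_1 (z : C) : Cmod (Cminus (cexp z) (RtoC 1)) <= Cmod z * exp (Cmod z).
Proof.
  rewrite cexp_minus_1, Cmod_mult. apply Rmult_le_compat_l; [apply Cmod_ge_0|].
  eapply Rle_trans; [apply Cmod_CInt_const with (M := exp (Cmod z))|].
  - apply ccontR_ex, ccontR_cexp_lin.
  - intros t Ht. rewrite Rmin_left, Rmax_right in Ht by lra. rewrite Cmod_cexp. apply exp_le.
    cri. pose proof (re_le_Cmod z). apply Rabs_le_between in H. nra.
  - rewrite Rabs_pos_eq by lra. lra.
Qed.

Lemma Cmod_cexp_taylor (z : C) :
  Cmod (Cminus (Cminus (cexp z) (RtoC 1)) z) <= (Cmod z) ^ 2 * exp (Cmod z).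
Proof.
  rewrite cexp_minus_1.
  replace (Cminus (Cmult z (CInt (fun t => cexp (Cmult z (RtoC t))) 0 1)) z)
    with (Cmult z (CInt (fun t => Cminus (cexp (Cmult z (RtoC t))) (RtoC 1)) 0 1)).
  - rewrite Cmod_mult. replace (Cmod z ^ 2 * exp (Cmod z)) with (Cmod z * (Cmod z * exp (Cmod z))) by ring.
    apply Rmult_le_compat_l; [apply Cmod_ge_0|].
    eapply Rle_trans; [apply Cmod_CInt_const with (M := Cmod z * exp (Cmod z))|].
    + apply ccontR_ex. intros t. cont.
    + intros t Ht. rewrite Rmin_left, Rmax_right in Ht by lra.
      eapply Rle_trans; [apply Cmod_cexp_minus_1|]. rewrite Cmod_mult, Cmod_R, Rabs_pos_eq by lra.
      pose proof (Cmod_ge_0 z). apply Rmult_le_compat; [nra|left; apply exp_pos|nra|].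
      apply exp_le. nra.
    + rewrite Rabs_pos_eq by lra. lra.
  - rewrite CInt_minus. 2: apply ccontR_ex, ccontR_cexp_lin. 2: apply ccontR_ex; intros t; cont.
    rewrite CInt_const. rewrite Rminus_0_r. ring.
Qed.

(** * Complex differentiability *)

(** A form equivalent to [is_derive] for two module structures on C: [C_NormedModule], in which
    [hurwitz_zeta] is stated, and [AbsRing_NormedModule C_AbsRing], to which the product and chain
    rules apply. *)
Definition cderiv (f : C -> C) (z l : C) : Prop :=
  forall eps, 0 < eps -> exists d, 0 < d /\ forall w, Cmod (Cminus w z) < d ->
    Cmod (Cminus (Cminus (f w) (f z)) (Cmult (Cminus w z) l)) <= eps * Cmod (Cminus w z).

Definition cdiff (f : C -> C) (z : C) : Prop := exists l, cderiv f z l.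

Lemma cderiv_is_derive (f : C -> C) (z l : C) :
  cderiv f z l <-> @is_derive C_AbsRing C_NormedModule f z l.
Proof.
  split.
  - intros H. split; [apply @is_linear_scal_l|].
    intros y Hy eps.
    assert (y = z) as -> by (symmetry; apply (@is_filter_lim_locally_unique C_AbsRing (AbsRing_NormedModule C_AbsRing)); exact Hy).
    destruct (H eps (cond_pos eps)) as [d [Hd K]]. exists (mkposreal d Hd). intros w Hw. apply K. exact Hw.
  - intros [_ H] eps Heps. specialize (H z (fun P HP => HP) (mkposreal eps Heps)).
    destruct H as [d Hd]. exists d. split; [apply cond_pos|]. intros w Hw. apply Hd. exact Hw.
Qed.

Lemma cderiv_is_derive' (f : C -> C) (z l : C) :
  cderiv f z l <-> @is_derive C_AbsRing (AbsRing_NormedModule C_AbsRing) f z l.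
Proof.
  split.
  - intros H. split; [apply @is_linear_scal_l|].
    intros y Hy eps.
    assert (y = z) as -> by (symmetry; apply (@is_filter_lim_locally_unique C_AbsRing (AbsRing_NormedModule C_AbsRing)); exact Hy).
    destruct (H eps (cond_pos eps)) as [d [Hd K]]. exists (mkposreal d Hd). intros w Hw. apply K. exact Hw.
  - intros [_ H] eps Heps. specialize (H z (fun P HP => HP) (mkposreal eps Heps)).
    destruct H as [d Hd]. exists d. split; [apply cond_pos|]. intros w Hw. apply Hd. exact Hw.
Qed.

Lemma cdiff_ex_derive (f : C -> C) (z : C) : cdiff f z <-> @ex_derive C_AbsRing C_NormedModule f z.
Proof. split; intros [l H]; exists l; apply cderiv_is_derive; exact H. Qed.

Lemma cderiv_const (c z : C) : cderiv (fun _ => c) z (RtoC 0).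
Proof. apply cderiv_is_derive'. apply (@is_derive_const C_AbsRing (AbsRing_NormedModule C_AbsRing)). Qed.

Lemma cderiv_id (z : C) : cderiv (fun w => w) z (RtoC 1).
Proof. apply cderiv_is_derive'. apply (@is_derive_id C_AbsRing). Qed.

Lemma cderiv_plus f g z a b : cderiv f z a -> cderiv g z b -> cderiv (fun w => Cplus (f w) (g w)) z (Cplus a b).
Proof. rewrite !cderiv_is_derive'. apply (@is_derive_plus C_AbsRing (AbsRing_NormedModule C_AbsRing)). Qed.

Lemma cderiv_minus f g z a b : cderiv f z a -> cderiv g z b -> cderiv (fun w => Cminus (f w) (g w)) z (Cminus a b).
Proof. rewrite !cderiv_is_derive'. apply (@is_derive_minus C_AbsRing (AbsRing_NormedModule C_AbsRing)). Qed.

Lemma cderiv_mult f g z a b : cderiv f z a -> cderiv g z b ->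
  cderiv (fun w => Cmult (f w) (g w)) z (Cplus (Cmult a (g z)) (Cmult (f z) b)).
Proof. rewrite !cderiv_is_derive'. intros. apply (@is_derive_mult C_AbsRing); auto. intros; apply Cmult_comm. Qed.

Lemma cderiv_comp f g z a b : cderiv f (g z) a -> cderiv g z b ->
  cderiv (fun w => f (g w)) z (Cmult b a).
Proof. rewrite !cderiv_is_derive'. intros. apply (@is_derive_comp C_AbsRing (AbsRing_NormedModule C_AbsRing)); auto. Qed.

Lemma cdiff_const c z : cdiff (fun _ => c) z. Proof. eexists; apply cderiv_const. Qed.
Lemma cdiff_id z : cdiff (fun w => w) z. Proof. eexists; apply cderiv_id. Qed.
Lemma cdiff_plus f g z : cdiff f z -> cdiff g z -> cdiff (fun w => Cplus (f w) (g w)) z.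
Proof. intros [a Ha] [b Hb]. eexists; apply cderiv_plus; eauto. Qed.
Lemma cdiff_minus f g z : cdiff f z -> cdiff g z -> cdiff (fun w => Cminus (f w) (g w)) z.
Proof. intros [a Ha] [b Hb]. eexists; apply cderiv_minus; eauto. Qed.
Lemma cdiff_mult f g z : cdiff f z -> cdiff g z -> cdiff (fun w => Cmult (f w) (g w)) z.
Proof. intros [a Ha] [b Hb]. eexists; apply cderiv_mult; eauto. Qed.
Lemma cdiff_comp f g z : cdiff f (g z) -> cdiff g z -> cdiff (fun w => f (g w)) z.
Proof. intros [a Ha] [b Hb]. eexists; apply cderiv_comp; eauto. Qed.

Lemma cdiff_loc f g z r : 0 < r -> (forall w, Cmod (Cminus w z) < r -> f w = g w) -> cdiff f z -> cdiff g z.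
Proof.
  intros Hr E [l H]. exists l. intros eps Heps. destruct (H eps Heps) as [d [Hd K]].
  exists (Rmin d r). split; [apply Rmin_pos; auto|]. intros w Hw.
  assert (Cmod (Cminus w z) < d /\ Cmod (Cminus w z) < r) as [h1 h2].
  { split; eapply Rlt_le_trans; eauto; [apply Rmin_l|apply Rmin_r]. }
  rewrite <- E by auto. rewrite <- E. apply K; auto.
  replace (Cminus z z) with (RtoC 0) by ring. rewrite Cmod_0. auto.
Qed.

Lemma cdiff_ext f g z : (forall w, f w = g w) -> cdiff f z -> cdiff g z.
Proof. intros E. apply cdiff_loc with 1; auto; lra. Qed.

Lemma cdiff_opp f z : cdiff f z -> cdiff (fun w => Copp (f w)) z.
Proof.
  intros H. apply cdiff_ext with (fun w => Cminus (RtoC 0) (f w)); [intros; ring|].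
  apply cdiff_minus; auto. apply cdiff_const.
Qed.

Lemma cderiv_cexp z : cderiv cexp z (cexp z).
Proof.
  intros eps Heps. pose proof (exp_pos (Re z)) as HE. pose proof (exp_pos 1) as H1.
  exists (Rmin 1 (eps / (exp (Re z) * exp 1))). split.
  { apply Rmin_pos; [lra|]. apply Rdiv_lt_0_compat; auto. nra. }
  intros w Hw. set (h := Cminus w z) in *.
  replace w with (Cplus z h) by (unfold h; ring). rewrite cexp_add.
  replace (Cminus (Cminus (Cmult (cexp z) (cexp h)) (cexp z)) (Cmult h (cexp z)))
    with (Cmult (cexp z) (Cminus (Cminus (cexp h) (RtoC 1)) h)) by ring.
  rewrite Cmod_mult, Cmod_cexp. pose proof (Cmod_ge_0 h).
  assert (h1 : Cmod h < 1) by (eapply Rlt_le_trans; [apply Hw|apply Rmin_l]).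
  assert (h2 : Cmod h < eps / (exp (Re z) * exp 1)) by (eapply Rlt_le_trans; [apply Hw|apply Rmin_r]).
  assert (h3 : Cmod h * (exp (Re z) * exp 1) <= eps).
  { apply Rmult_lt_compat_r with (r := exp (Re z) * exp 1) in h2; [|nra].
    unfold Rdiv in h2. rewrite Rmult_assoc, Rinv_l, Rmult_1_r in h2 by nra. lra. }
  eapply Rle_trans; [apply Rmult_le_compat_l; [lra|apply Cmod_cexp_taylor]|].
  assert (exp (Cmod h) <= exp 1) by (apply exp_le; lra).
  assert (Cmod h ^ 2 * exp (Cmod h) <= Cmod h ^2 * exp 1) by (apply Rmult_le_compat_l; [nra|auto]).
  nra.
Qed.

Lemma cdiff_cexp z : cdiff cexp z. Proof. eexists; apply cderiv_cexp. Qed.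

Lemma cdiff_bounded f z : cdiff f z -> exists K d, 0 <= K /\ 0 < d /\
  forall w, Cmod (Cminus w z) < d -> Cmod (Cminus (f w) (f z)) <= K * Cmod (Cminus w z).
Proof.
  intros [l H]. destruct (H 1 Rlt_0_1) as [d [Hd K]]. exists (1 + Cmod l), d.
  pose proof (Cmod_ge_0 l). repeat split; try lra. intros w Hw. specialize (K w Hw).
  replace (Cminus (f w) (f z)) with (Cplus (Cminus (Cminus (f w) (f z)) (Cmult (Cminus w z) l)) (Cmult (Cminus w z) l)) by ring.
  eapply Rle_trans; [apply Cmod_triangle|]. rewrite Cmod_mult. pose proof (Cmod_ge_0 (Cminus w z)). nra.
Qed.

Lemma cdiff_continuous f z : cdiff f z -> forall eps, 0 < eps -> exists d, 0 < d /\
  forall w, Cmod (Cminus w z) < d -> Cmod (Cminus (f w) (f z)) < eps.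
Proof.
  intros H eps Heps. destruct (cdiff_bounded f z H) as [K [d [HK [Hd B]]]].
  exists (Rmin d (eps / (K + 1))). split; [apply Rmin_pos; auto; apply Rdiv_lt_0_compat; lra|].
  intros w Hw.
  assert (h1 : Cmod (Cminus w z) < d) by (eapply Rlt_le_trans; [apply Hw|apply Rmin_l]).
  assert (h2 : Cmod (Cminus w z) < eps / (K + 1)) by (eapply Rlt_le_trans; [apply Hw|apply Rmin_r]).
  eapply Rle_lt_trans; [apply B; auto|].
  apply Rle_lt_trans with ((K) * (eps / (K+1))). { apply Rmult_le_compat_l; lra. }
  apply Rmult_lt_reg_r with (K + 1); [lra|]. field_simplify; [|lra]. nra.
Qed.

Lemma cdiff_Cinv z : z <> RtoC 0 -> cdiff Cinv z.
Proof.
  intros Hz. exists (Copp (Cinv (Cmult z z))). intros eps Heps.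
  assert (Hm : 0 < Cmod z) by (apply Cmod_gt_0; auto). set (m := Cmod z) in *.
  (* Within m / 2 of z one has |w| > m / 2, so the error (w - z)^2 / (w z^2) is at most 2 |w - z|^2
     / m^3. *)
  exists (Rmin (m / 2) (eps * (m * m * m) / 2)).
  split; [apply Rmin_pos; [lra|]; apply Rdiv_lt_0_compat; [|lra]; repeat apply Rmult_lt_0_compat; auto|].
  intros w Hw.
  assert (h1 : Cmod (Cminus w z) < m / 2) by (eapply Rlt_le_trans; [apply Hw|apply Rmin_l]).
  assert (h2 : Cmod (Cminus w z) < eps * (m * m * m) / 2) by (eapply Rlt_le_trans; [apply Hw|apply Rmin_r]).
  assert (h3 : m / 2 < Cmod w).
  { pose proof (Cmod_triangle_minus w (Cminus w z)) as T. replace (Cminus w (Cminus w z)) with z in T by ring. fold m in T. lra. }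
  assert (Hw0 : w <> RtoC 0) by (apply Cmod_pos_neq; lra).
  replace (Cminus (Cminus (Cinv w) (Cinv z)) (Cmult (Cminus w z) (Copp (Cinv (Cmult z z)))))
    with (Cdiv (Cmult (Cminus w z) (Cminus w z)) (Cmult w (Cmult z z))) by (field; auto).
  rewrite Cmod_div by (repeat apply Cmult_neq_0; auto). rewrite !Cmod_mult. fold m.
  set (a := Cmod (Cminus w z)) in *. assert (0 <= a) by apply Cmod_ge_0. set (b := Cmod w) in *.
  apply Rmult_le_reg_r with (b * (m * m)); [repeat apply Rmult_lt_0_compat; lra|].
  unfold Rdiv. rewrite Rmult_assoc, Rinv_l, Rmult_1_r by (apply Rgt_not_eq; repeat apply Rmult_lt_0_compat; lra).
  assert (eps * (m * m * m) / 2 <= eps * (b * (m * m))).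
  { assert (m / 2 * (m * m) <= b * (m * m)) by (apply Rmult_le_compat_r; nra). nra. }
  rewrite (Rmult_comm eps a), Rmult_assoc. apply Rmult_le_compat_l; lra.
Qed.

Lemma cdiff_inv f z : cdiff f z -> f z <> RtoC 0 -> cdiff (fun w => Cinv (f w)) z.
Proof. intros H Hn. apply (cdiff_comp Cinv f); auto. apply cdiff_Cinv; auto. Qed.

Lemma cdiff_div f g z : cdiff f z -> cdiff g z -> g z <> RtoC 0 -> cdiff (fun w => Cdiv (f w) (g w)) z.
Proof. intros. apply cdiff_mult; auto. apply cdiff_inv; auto. Qed.

Lemma cdiff_pow f n z : cdiff f z -> cdiff (fun w => Cpow (f w) n) z.
Proof. intros H. induction n; simpl; [apply cdiff_const|]. apply cdiff_mult; auto. Qed.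

Lemma cdiff_cexp_comp f z : cdiff f z -> cdiff (fun w => cexp (f w)) z.
Proof. intros. apply (cdiff_comp cexp f); auto. apply cdiff_cexp. Qed.

Lemma cdiff_cpow x f z : cdiff f z -> cdiff (fun w => cpow x (f w)) z.
Proof. intros. unfold cpow. apply cdiff_cexp_comp. apply cdiff_mult; auto. apply cdiff_const. Qed.

Ltac cdiffs := repeat lazymatch goal with
  | |- cdiff (fun _ => ?c) _ => apply cdiff_const
  | |- cdiff (fun _ => Cplus _ _) _ => apply cdiff_plus
  | |- cdiff (fun _ => Cminus _ _) _ => apply cdiff_minus
  | |- cdiff (fun _ => Cmult _ _) _ => apply cdiff_mult
  | |- cdiff (fun _ => Cdiv _ _) _ => apply cdiff_div
  | |- cdiff (fun _ => Copp _) _ => apply cdiff_opp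
  | |- cdiff (fun _ => Cinv _) _ => apply cdiff_inv
  | |- cdiff (fun _ => cexp _) _ => apply cdiff_cexp_comp
  | |- cdiff (fun _ => cpow _ _) _ => apply cdiff_cpow
  | |- cdiff (fun _ => Cpow _ _) _ => apply cdiff_pow
  | |- cdiff (fun w => w) _ => apply cdiff_id
  | |- cdiff (Cminus ?c) _ => apply (cdiff_minus (fun _ => c) (fun w => w))
  | |- cdiff (Cplus ?c) _ => apply (cdiff_plus (fun _ => c) (fun w => w))
  | |- cdiff (Cmult ?c) _ => apply (cdiff_mult (fun _ => c) (fun w => w))
  end.

Lemma cdiff_ccos f z : cdiff f z -> cdiff (fun w => ccos (f w)) z.
Proof. intros. unfold ccos, Cdiv. cdiffs; auto. Qed.
Lemma cdiff_csin f z : cdiff f z -> cdiff (fun w => csin (f w)) z.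
Proof. intros. unfold csin, Cdiv. cdiffs; auto. Qed.

Definition ccont (h : C -> C) (z : C) : Prop :=
  forall eps, 0 < eps -> exists d, 0 < d /\ forall w, Cmod (Cminus w z) < d -> Cmod (Cminus (h w) (h z)) < eps.

Lemma ccont_line (h : C -> C) (g : R -> C) (t : R) :
  ccont h (g t) -> @continuous R_UniformSpace C_R_NormedModule g t ->
  @continuous R_UniformSpace C_R_NormedModule (fun t => h (g t)) t.
Proof.
  intros Hh Hg. apply (proj2 (@filterlim_locally _ C_R_NormedModule _ _ (fun t => h (g t)) (h (g t)))). intros eps.
  destruct (Hh eps (cond_pos eps)) as [d [Hd K]].
  assert (Hd2 : 0 < d / 2) by lra.
  pose proof (proj1 (@filterlim_locally _ C_R_NormedModule _ _ g (g t)) Hg (mkposreal _ Hd2)) as L.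
  revert L. apply filter_imp. intros s Hs.
  assert (B : Cmod (Cminus (g s) (g t)) < d).
  { destruct Hs as [B1 B2]. eapply Rle_lt_trans; [apply Cmod_le_re_im|].
    assert (Rabs (Re (Cminus (g s) (g t))) < d / 2) by exact B1.
    assert (Rabs (Im (Cminus (g s) (g t))) < d / 2) by exact B2. lra. }
  specialize (K _ B). split.
  - eapply Rle_lt_trans; [|exact K]. apply (re_le_Cmod (Cminus (h (g s)) (h (g t)))).
  - eapply Rle_lt_trans; [|exact K]. apply (im_le_Cmod (Cminus (h (g s)) (h (g t)))).
Qed.

(** * Goursat's theorem and the identity theorem *)

(** The contour integral of h (z) dz, counterclockwise when [p1 <= p2] and [q1 <= q2]: bottom and
    right sides minus top and left sides. *)
Definition Rect (h : C -> C) (p1 p2 q1 q2 : R) : C :=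
  Cminus (Cplus (CInt (fun x => h (x, q1)) p1 p2) (Cmult Ci (CInt (fun y => h (p2, y)) q1 q2)))
         (Cplus (CInt (fun x => h (x, q2)) p1 p2) (Cmult Ci (CInt (fun y => h (p1, y)) q1 q2))).

Definition cdiff_on (h : C -> C) (a b c d : R) : Prop :=
  forall z : C, a <= Re z <= b -> c <= Im z <= d -> cdiff h z.

Lemma continuous_hor (y x : R) : @continuous R_UniformSpace C_R_NormedModule (fun x => (x, y) : C) x.
Proof. apply continuous_pair; simpl. apply continuous_Rid. apply continuous_const. Qed.

Lemma continuous_ver (x y : R) : @continuous R_UniformSpace C_R_NormedModule (fun y => (x, y) : C) y.
Proof. apply continuous_pair; simpl. apply continuous_const. apply continuous_Rid. Qed.

Definition ccont_on (h : C -> C) (a b c d : R) : Prop :=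
  forall z : C, a <= Re z <= b -> c <= Im z <= d -> ccont h z.

Lemma cdiff_ccont_on h a b c d : cdiff_on h a b c d -> ccont_on h a b c d.
Proof. intros H z H1 H2 eps. apply cdiff_continuous. apply H; auto. Qed.

Lemma hor_ex h a b c d p1 p2 q : ccont_on h a b c d -> a <= p1 <= b -> a <= p2 <= b -> c <= q <= d ->
  exCI (fun x => h (x, q)) p1 p2.
Proof.
  intros H H1 H2 Hq. apply (@ex_RInt_continuous CR). intros x Hx.
  apply (ccont_line h (fun x => (x, q))); [|apply continuous_hor].
  apply H; simpl; auto. unfold Rmin, Rmax in Hx. destruct (Rle_dec p1 p2); lra.
Qed.

Lemma ver_ex h a b c d p q1 q2 : ccont_on h a b c d -> a <= p <= b -> c <= q1 <= d -> c <= q2 <= d ->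
  exCI (fun y => h (p, y)) q1 q2.
Proof.
  intros H Hp H1 H2. apply (@ex_RInt_continuous CR). intros y Hy.
  apply (ccont_line h (fun y => (p, y))); [|apply continuous_ver].
  apply H; simpl; auto. unfold Rmin, Rmax in Hy. destruct (Rle_dec q1 q2); lra.
Qed.

(** The inner sides cancel. The subdivision points are not ordered, so sides may run backwards, as
    in [Rect_corner_iter]. *)
Lemma Rect_quarter h a b c d p1 pm p2 q1 qm q2 : ccont_on h a b c d ->
  a <= p1 <= b -> a <= pm <= b -> a <= p2 <= b -> c <= q1 <= d -> c <= qm <= d -> c <= q2 <= d ->
  Rect h p1 p2 q1 q2 = Cplus (Cplus (Rect h p1 pm q1 qm) (Rect h pm p2 q1 qm))
                             (Cplus (Rect h p1 pm qm q2) (Rect h pm p2 qm q2)).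
Proof.
  intros H ? ? ? ? ? ?. unfold Rect.
  rewrite (CInt_Chasles (fun x => h (x, q1)) p1 pm p2) by (eapply hor_ex; eauto).
  rewrite (CInt_Chasles (fun x => h (x, q2)) p1 pm p2) by (eapply hor_ex; eauto).
  rewrite (CInt_Chasles (fun y => h (p1, y)) q1 qm q2) by (eapply ver_ex; eauto).
  rewrite (CInt_Chasles (fun y => h (p2, y)) q1 qm q2) by (eapply ver_ex; eauto).
  ring.
Qed.

Lemma Rect_bound h p1 p2 q1 q2 M : p1 <= p2 -> q1 <= q2 ->
  exCI (fun x => h (x, q1)) p1 p2 -> exCI (fun x => h (x, q2)) p1 p2 ->
  exCI (fun y => h (p1, y)) q1 q2 -> exCI (fun y => h (p2, y)) q1 q2 ->
  (forall x, p1 <= x <= p2 -> Cmod (h (x, q1)) <= M /\ Cmod (h (x, q2)) <= M) ->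
  (forall y, q1 <= y <= q2 -> Cmod (h (p1, y)) <= M /\ Cmod (h (p2, y)) <= M) ->
  Cmod (Rect h p1 p2 q1 q2) <= 2 * ((p2 - p1) + (q2 - q1)) * M.
Proof.
  intros Hp Hq E1 E2 E3 E4 B1 B2. unfold Rect.
  pose proof (Cmod_CInt_const (fun x => h (x, q1)) M p1 p2 E1) as K1.
  pose proof (Cmod_CInt_const (fun x => h (x, q2)) M p1 p2 E2) as K2.
  pose proof (Cmod_CInt_const (fun y => h (p1, y)) M q1 q2 E3) as K3.
  pose proof (Cmod_CInt_const (fun y => h (p2, y)) M q1 q2 E4) as K4.
  rewrite Rmin_left, Rmax_right, Rabs_pos_eq in * by lra.
  specialize (K1 (fun t Ht => proj1 (B1 t Ht))). specialize (K2 (fun t Ht => proj2 (B1 t Ht))).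
  specialize (K3 (fun t Ht => proj1 (B2 t Ht))). specialize (K4 (fun t Ht => proj2 (B2 t Ht))).
  eapply Rle_trans; [apply Cmod_triangle_minus|].
  eapply Rle_trans; [apply Rplus_le_compat; apply Cmod_triangle|].
  rewrite !Cmod_mult, Cmod_Ci, !Rmult_1_l. lra.
Qed.

Lemma Rect_minus f g p1 p2 q1 q2 :
  (forall q, q = q1 \/ q = q2 -> exCI (fun x => f (x, q)) p1 p2 /\ exCI (fun x => g (x, q)) p1 p2) ->
  (forall p, p = p1 \/ p = p2 -> exCI (fun y => f (p, y)) q1 q2 /\ exCI (fun y => g (p, y)) q1 q2) ->
  Rect (fun z => Cminus (f z) (g z)) p1 p2 q1 q2 = Cminus (Rect f p1 p2 q1 q2) (Rect g p1 p2 q1 q2).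
Proof.
  intros H1 H2. unfold Rect.
  destruct (H1 q1 (or_introl eq_refl)), (H1 q2 (or_intror eq_refl)), (H2 p1 (or_introl eq_refl)), (H2 p2 (or_intror eq_refl)).
  rewrite (CInt_minus (fun x => f (x, q1)) (fun x => g (x, q1))) by auto.
  rewrite (CInt_minus (fun x => f (x, q2)) (fun x => g (x, q2))) by auto.
  rewrite (CInt_minus (fun y => f (p1, y)) (fun y => g (p1, y))) by auto.
  rewrite (CInt_minus (fun y => f (p2, y)) (fun y => g (p2, y))) by auto.
  ring.
Qed.

Lemma is_derC_hor (q x : R) : is_derC (fun x => (x, q) : C) x (RtoC 1).
Proof. apply is_derive_pair; simpl. apply (@is_derive_id R_AbsRing). apply (@is_derive_const R_AbsRing R_NormedModule). Qed.
Lemma is_derC_ver (p y : R) : is_derC (fun y => (p, y) : C) y Ci.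
Proof. apply is_derive_pair; simpl. apply (@is_derive_const R_AbsRing R_NormedModule). apply (@is_derive_id R_AbsRing). Qed.

(** The polynomial [F] is a primitive. In Goursat's argument this removes the first-order
    approximation of [h] at the limit point. *)
Lemma Rect_affine (A B : C) p1 p2 q1 q2 :
  Rect (fun z => Cplus A (Cmult z B)) p1 p2 q1 q2 = RtoC 0.
Proof.
  set (F := fun z : C => Cplus (Cmult z A) (Cmult (Cmult z z) (Cdiv B (RtoC 2)))).
  assert (n2 : RtoC 2 <> RtoC 0) by (apply RtoC_neq; lra).
  assert (Hh : forall q, CInt (fun x => Cplus A (Cmult (x, q) B)) p1 p2 = Cminus (F (p2, q)) (F (p1, q))).
  { intros q. apply (CInt_FTC (fun x => F (x, q))).
    - intros t _. unfold F. eapply is_derC_eq.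
      + apply (is_derC_Cplus (fun x => Cmult (x, q) A) (fun x => Cmult (Cmult (x, q) (x, q)) (Cdiv B (RtoC 2)))).
        * apply (is_derC_Cmult (fun x => (x, q)) (fun _ => A)). apply is_derC_hor. apply is_derC_const.
        * apply (is_derC_Cmult (fun x => Cmult (x, q) (x, q)) (fun _ => Cdiv B (RtoC 2))); [|apply is_derC_const].
          apply (is_derC_Cmult (fun x => (x, q)) (fun x => (x, q))); apply is_derC_hor.
      + cbv beta. set (z := (t, q) : C). change (t, q) with z. field. auto.
    - intros t _. cont. apply continuous_hor. }
  assert (Hv : forall p, Cmult Ci (CInt (fun y => Cplus A (Cmult (p, y) B)) q1 q2) = Cminus (F (p, q2)) (F (p, q1))).
  { intros p. rewrite <- CInt_scal.
    - apply (CInt_FTC (fun y => F (p, y))).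
      + intros t _. unfold F. eapply is_derC_eq.
        * apply (is_derC_Cplus (fun y => Cmult (p, y) A) (fun y => Cmult (Cmult (p, y) (p, y)) (Cdiv B (RtoC 2)))).
          -- apply (is_derC_Cmult (fun y => (p, y)) (fun _ => A)). apply is_derC_ver. apply is_derC_const.
          -- apply (is_derC_Cmult (fun y => Cmult (p, y) (p, y)) (fun _ => Cdiv B (RtoC 2))); [|apply is_derC_const].
             apply (is_derC_Cmult (fun y => (p, y)) (fun y => (p, y))); apply is_derC_ver.
        * cbv beta. set (z := (p, t) : C). change (p, t) with z. field. auto.
      + intros t _. cont. apply continuous_ver.
    - apply ccontR_ex. intros t. cont. apply continuous_ver. }
  unfold Rect. rewrite !Hh, !Hv. ring.
Qed.

Definition rquad : Type := (R * R * (R * R))%type.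
Definition qA (Q : rquad) := fst (fst Q).
Definition qB (Q : rquad) := snd (fst Q).
Definition qC (Q : rquad) := fst (snd Q).
Definition qD (Q : rquad) := snd (snd Q).
Definition qRect h Q := Rect h (qA Q) (qB Q) (qC Q) (qD Q).
Definition qsize Q := (qB Q - qA Q) + (qD Q - qC Q).

(* The bisection step: a quarter of [Q] on which the integral is still larger than [eps * size ^ 2]. *)
Definition qnext (h : C -> C) (eps : R) (Q : rquad) : rquad :=
  let m := (qA Q + qB Q) / 2 in let n := (qC Q + qD Q) / 2 in
  let Q1 := ((qA Q, m), (qC Q, n)) in let Q2 := ((m, qB Q), (qC Q, n)) in
  let Q3 := ((qA Q, m), (n, qD Q)) in let Q4 := ((m, qB Q), (n, qD Q)) in
  if Rlt_dec (eps * qsize Q1 ^ 2) (Cmod (qRect h Q1)) then Q1 else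
  if Rlt_dec (eps * qsize Q2 ^ 2) (Cmod (qRect h Q2)) then Q2 else
  if Rlt_dec (eps * qsize Q3 ^ 2) (Cmod (qRect h Q3)) then Q3 else Q4.

Definition qgood h a b c d eps Q :=
  a <= qA Q /\ qA Q <= qB Q /\ qB Q <= b /\ c <= qC Q /\ qC Q <= qD Q /\ qD Q <= d /\
  eps * qsize Q ^ 2 < Cmod (qRect h Q).

Lemma qnext_good h a b c d eps Q : cdiff_on h a b c d -> qgood h a b c d eps Q ->
  let Q' := qnext h eps Q in qgood h a b c d eps Q' /\ qsize Q' = qsize Q / 2 /\
  qA Q <= qA Q' /\ qB Q' <= qB Q /\ qC Q <= qC Q' /\ qD Q' <= qD Q.
Proof.
  intros H. destruct Q as [[p1 p2] [q1 q2]]. unfold qgood, qnext, qsize, qRect, qA, qB, qC, qD; simpl fst; simpl snd.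
  intros [G1 [G2 [G3 [G4 [G5 [G6 G7]]]]]].
  pose proof (Rect_quarter h a b c d p1 ((p1 + p2) / 2) p2 q1 ((q1 + q2) / 2) q2 (cdiff_ccont_on _ _ _ _ _ H)) as E.
  specialize (E ltac:(lra) ltac:(lra) ltac:(lra) ltac:(lra) ltac:(lra) ltac:(lra)).
  set (m := (p1 + p2) / 2) in *. set (n := (q1 + q2) / 2) in *.
  assert (Hm : m = (p1 + p2) / 2) by reflexivity. assert (Hn : n = (q1 + q2) / 2) by reflexivity.
  match goal with |- context [if Rlt_dec ?u ?v then _ else _] => destruct (Rlt_dec u v) as [L1|L1] end; [simpl fst; simpl snd; repeat split; try lra; exact L1|].
  match goal with |- context [if Rlt_dec ?u ?v then _ else _] => destruct (Rlt_dec u v) as [L2|L2] end; [simpl fst; simpl snd; repeat split; try lra; exact L2|].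
  match goal with |- context [if Rlt_dec ?u ?v then _ else _] => destruct (Rlt_dec u v) as [L3|L3] end; [simpl fst; simpl snd; repeat split; try lra; exact L3|].
  simpl fst; simpl snd. repeat split; try lra.
  (* Were the fourth quarter small as well, the four integrals would add up to at most 4 eps (s /
     2)^2 = eps s^2. *)
  rewrite E in G7.
  match type of G7 with _ < Cmod (Cplus (Cplus ?x ?y) (Cplus ?z ?w)) =>
    pose proof (Cmod_triangle (Cplus x y) (Cplus z w)) as T1;
    pose proof (Cmod_triangle x y) as T2; pose proof (Cmod_triangle z w) as T3 end.
  replace ((m - p1) + (n - q1)) with ((p2 - p1 + (q2 - q1)) / 2) in L1 by lra.
  replace ((p2 - m) + (n - q1)) with ((p2 - p1 + (q2 - q1)) / 2) in L2 by lra.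
  replace ((m - p1) + (q2 - n)) with ((p2 - p1 + (q2 - q1)) / 2) in L3 by lra.
  replace ((p2 - m) + (q2 - n)) with ((p2 - p1 + (q2 - q1)) / 2) by lra.
  set (s := p2 - p1 + (q2 - q1)) in *.
  replace (eps * (s / 2) ^ 2) with (eps * s ^ 2 / 4) in * by field. lra.
Qed.

Lemma nested_point (u v : nat -> R) :
  (forall n, u n <= u (S n)) -> (forall n, v (S n) <= v n) -> (forall n, u n <= v n) ->
  exists L, forall n, u n <= L <= v n.
Proof.
  intros Hu Hv Huv.
  assert (Mu : forall n m, (n <= m)%nat -> u n <= u m).
  { intros n m Hnm. induction Hnm; [lra|]. specialize (Hu m). lra. }
  assert (Mv : forall n m, (n <= m)%nat -> v m <= v n).
  { intros n m Hnm. induction Hnm; [lra|]. specialize (Hv m). lra. }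
  assert (X : forall n m, u n <= v m).
  { intros n m. destruct (le_ge_dec n m) as [l|l]; [specialize (Mu _ _ l); specialize (Huv m); lra|].
    specialize (Mv _ _ l). specialize (Huv n). lra. }
  destruct (completeness (fun x => exists n, x = u n)) as [L [HL1 HL2]].
  - exists (v O). intros x [n ->]. apply X.
  - exists (u O). exists O; auto.
  - exists L. intros n. split; [apply HL1; exists n; auto|]. apply HL2. intros x [m ->]. apply X.
Qed.

Lemma Goursat h p1 p2 q1 q2 : p1 <= p2 -> q1 <= q2 -> cdiff_on h p1 p2 q1 q2 -> Rect h p1 p2 q1 q2 = RtoC 0.
Proof.
  intros Hp Hq H.
  set (s0 := (p2 - p1) + (q2 - q1)).
  assert (Hs0 : 0 <= s0) by (unfold s0; lra).
  assert (Main : forall eps, 0 < eps -> Cmod (Rect h p1 p2 q1 q2) <= eps * s0 ^ 2).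
  { intros eps Heps. apply Rnot_lt_le. intros L.
    set (Q := fun n => Nat.iter n (qnext h eps) ((p1, p2), (q1, q2))).
    assert (G : forall n, qgood h p1 p2 q1 q2 eps (Q n) /\ qsize (Q n) = s0 / 2 ^ n).
    { induction n.
      - split; [|simpl; unfold qsize, qA, qB, qC, qD, s0; simpl; field].
        unfold qgood, qRect, qsize, Q, qA, qB, qC, qD; simpl Nat.iter; simpl fst; simpl snd.
        repeat split; try lra. exact L.
      - destruct IHn as [G1 G2]. destruct (qnext_good _ _ _ _ _ _ _ H G1) as [K1 [K2 _]].
        split; [exact K1|]. change (Q (S n)) with (qnext h eps (Q n)). rewrite K2, G2. simpl. field. apply pow_nonzero; lra. }
    assert (N : forall n, qA (Q n) <= qA (Q (S n)) /\ qB (Q (S n)) <= qB (Q n) /\ qC (Q n) <= qC (Q (S n)) /\ qD (Q (S n)) <= qD (Q n)).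
    { intros n. destruct (qnext_good _ _ _ _ _ _ _ H (proj1 (G n))) as [_ [_ K]]. exact K. }
    destruct (nested_point (fun n => qA (Q n)) (fun n => qB (Q n))) as [P HP]; try (intros n; apply N); [intros n; apply G|].
    destruct (nested_point (fun n => qC (Q n)) (fun n => qD (Q n))) as [P' HP']; try (intros n; apply N); [intros n; apply G|].
    destruct (H (P, P')) as [l Hl]; [apply (HP O)|apply (HP' O)|].
    (* The perimeter is twice [qsize], so an integrand of size eps / 4 times [qsize] gives an
       integral of at most eps / 2 times its square, against [qgood]. *)
    destruct (Hl (eps / 4)) as [d [Hd K]]; [lra|].
    destruct (nfloor_ex (s0 / d)) as [n0 Hn0]; [apply Rdiv_le_0_compat; lra|].
    assert (Hn : exists n, s0 / 2 ^ n < d).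
    { exists (S n0). assert (INR (S n0) <= 2 ^ (S n0)).
      { clear. induction n0 as [|n IH]; [simpl; lra|]. rewrite S_INR. simpl pow in *.
        pose proof (pow_le 2 n ltac:(lra)). assert (1 <= 2 ^ n) by (apply pow_R1_Rle; lra). lra. }
      apply Rmult_lt_reg_r with (2 ^ S n0); [apply pow_lt; lra|].
      unfold Rdiv. rewrite Rmult_assoc, Rinv_l, Rmult_1_r by (apply pow_nonzero; lra).
      rewrite S_INR in H0. destruct Hn0 as [_ Hn0]. apply Rmult_lt_compat_r with (r := d) in Hn0; [|lra].
      unfold Rdiv in Hn0. rewrite Rmult_assoc, Rinv_l, Rmult_1_r in Hn0 by lra. nra. }
    destruct Hn as [n Hn]. destruct (G n) as [[G1 [G2 [G3 [G4 [G5 [G6 G7]]]]]] G8].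
    specialize (HP n). specialize (HP' n). simpl in HP, HP'.
    set (a := qA (Q n)) in *. set (b := qB (Q n)) in *. set (c := qC (Q n)) in *. set (e := qD (Q n)) in *.
    assert (Hsz : qsize (Q n) = (b - a) + (e - c)) by reflexivity.
    change (qRect h (Q n)) with (Rect h a b c e) in G7.
    set (A := Cminus (h (P, P')) (Cmult (P, P') l)).
    assert (E : Rect h a b c e = Rect (fun z => Cminus (h z) (Cplus A (Cmult z l))) a b c e).
    { rewrite Rect_minus.
      - rewrite Rect_affine. ring.
      - intros q Hq'. split; [eapply hor_ex; [apply cdiff_ccont_on; exact H|lra|lra|destruct Hq'; subst; lra]|].
        apply ccontR_ex. intros t. cont. apply continuous_hor.
      - intros p Hp'. split; [eapply ver_ex; [apply cdiff_ccont_on; exact H|destruct Hp'; subst; lra|lra|lra]|].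
        apply ccontR_ex. intros t. cont. apply continuous_ver. }
    assert (B : forall z : C, a <= Re z <= b -> c <= Im z <= e ->
      Cmod (Cminus (h z) (Cplus A (Cmult z l))) <= eps / 4 * qsize (Q n)).
    { intros z Hz1 Hz2. assert (D : Cmod (Cminus z (P, P')) <= qsize (Q n)).
      { eapply Rle_trans; [apply Cmod_le_re_im|]. rewrite Hsz. simpl. apply Rplus_le_compat; apply Rabs_le; unfold Re, Im in *; lra. }
      replace (Cminus (h z) (Cplus A (Cmult z l))) with (Cminus (Cminus (h z) (h (P, P'))) (Cmult (Cminus z (P, P')) l)) by (unfold A; ring).
      eapply Rle_trans; [apply K; rewrite G8 in D; lra|]. apply Rmult_le_compat_l; lra. }
    assert (HB : Cmod (Rect h a b c e) <= 2 * ((b - a) + (e - c)) * (eps / 4 * qsize (Q n))).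
    { rewrite E. apply Rect_bound; auto.
      1,2: apply (@ex_RInt_minus C_R_NormedModule); [eapply hor_ex; [apply cdiff_ccont_on; exact H|lra|lra|lra]|apply ccontR_ex; intros t; cont; apply continuous_hor].
      1,2: apply (@ex_RInt_minus C_R_NormedModule); [eapply ver_ex; [apply cdiff_ccont_on; exact H|lra|lra|lra]|apply ccontR_ex; intros t; cont; apply continuous_ver].
      - intros x Hx. split; apply B; simpl; lra.
      - intros y Hy. split; apply B; simpl; lra. }
    rewrite <- Hsz in HB. assert (0 <= eps * qsize (Q n) ^ 2) by (apply Rmult_le_pos; [lra|apply pow2_ge_0]). lra. }
  apply Cmod_eq_0. apply Rle_antisym; [|apply Cmod_ge_0].
  apply Rnot_lt_le. intros L.
  specialize (Main (Cmod (Rect h p1 p2 q1 q2) / (2 * (s0 ^ 2 + 1)))).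
  assert (0 < s0 ^ 2 + 1) by (pose proof (pow2_ge_0 s0); lra).
  assert (0 < Cmod (Rect h p1 p2 q1 q2) / (2 * (s0 ^ 2 + 1))) by (apply Rdiv_lt_0_compat; lra).
  specialize (Main H1). set (M := Cmod _) in *.
  assert (M / (2 * (s0 ^ 2 + 1)) * s0 ^ 2 <= M / 2).
  { apply Rle_trans with (M / (2 * (s0 ^ 2 + 1)) * (s0 ^ 2 + 1)); [apply Rmult_le_compat_l; lra|]. right. field. lra. }
  lra.
Qed.

(** * Rectangles of either orientation, and an exceptional point of mere continuity *)

Lemma Copp_involutive (z : C) : Copp (Copp z) = z.
Proof. ring. Qed.

Lemma Rect_flip_h h p1 p2 q1 q2 :
  (forall q, q = q1 \/ q = q2 -> exCI (fun x => h (x, q)) p1 p2) ->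
  Rect h p2 p1 q1 q2 = Copp (Rect h p1 p2 q1 q2).
Proof.
  intros H. unfold Rect. rewrite (CInt_swap (fun x => h (x, q1)) p1 p2), (CInt_swap (fun x => h (x, q2)) p1 p2) by auto.
  ring.
Qed.

Lemma Rect_flip_v h p1 p2 q1 q2 :
  (forall p, p = p1 \/ p = p2 -> exCI (fun y => h (p, y)) q1 q2) ->
  Rect h p1 p2 q2 q1 = Copp (Rect h p1 p2 q1 q2).
Proof.
  intros H. unfold Rect. rewrite (CInt_swap (fun y => h (p1, y)) q1 q2), (CInt_swap (fun y => h (p2, y)) q1 q2) by auto.
  ring.
Qed.

Ltac minmax_split a b :=
  let l := fresh "l" in
  destruct (Rle_dec a b) as [l|l];
  [ try rewrite (Rmin_left a b l) in *; try rewrite (Rmax_right a b l) in *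
  | try rewrite (Rmin_right a b (Rlt_le _ _ (Rnot_le_lt _ _ l))) in *;
    try rewrite (Rmax_left a b (Rlt_le _ _ (Rnot_le_lt _ _ l))) in * ].
Ltac minmax := repeat match goal with
  | |- context [Rmin ?a ?b] => minmax_split a b
  | |- context [Rmax ?a ?b] => minmax_split a b
  | H : context [Rmin ?a ?b] |- _ => minmax_split a b
  | H : context [Rmax ?a ?b] |- _ => minmax_split a b
  end.

Lemma Goursat_signed h p1 p2 q1 q2 :
  cdiff_on h (Rmin p1 p2) (Rmax p1 p2) (Rmin q1 q2) (Rmax q1 q2) -> Rect h p1 p2 q1 q2 = RtoC 0.
Proof.
  intros H. pose proof (cdiff_ccont_on _ _ _ _ _ H) as Hc.
  assert (E1 : forall q, q = q1 \/ q = q2 -> exCI (fun x => h (x, q)) p1 p2).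
  { intros q Hq. eapply hor_ex; [exact Hc| | |]; destruct Hq; subst; minmax; lra. }
  assert (E2 : forall p, p = p1 \/ p = p2 -> exCI (fun y => h (p, y)) q1 q2).
  { intros p Hp. eapply ver_ex; [exact Hc| | |]; destruct Hp; subst; minmax; lra. }
  destruct (Rle_dec p1 p2) as [a|a]; destruct (Rle_dec q1 q2) as [b|b].
  - rewrite (Rmin_left p1), (Rmax_right p1), (Rmin_left q1), (Rmax_right q1) in H by lra. apply Goursat; auto.
  - rewrite (Rmin_left p1), (Rmax_right p1), (Rmin_right q1), (Rmax_left q1) in H by lra.
    pose proof (Goursat h p1 p2 q2 q1 a ltac:(lra) H) as G. rewrite Rect_flip_v in G by auto.
    rewrite <- (Copp_involutive (Rect h p1 p2 q1 q2)), G. ring.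
  - rewrite (Rmin_right p1), (Rmax_left p1), (Rmin_left q1), (Rmax_right q1) in H by lra.
    pose proof (Goursat h p2 p1 q1 q2 ltac:(lra) b H) as G. rewrite Rect_flip_h in G by auto.
    rewrite <- (Copp_involutive (Rect h p1 p2 q1 q2)), G. ring.
  - rewrite (Rmin_right p1), (Rmax_left p1), (Rmin_right q1), (Rmax_left q1) in H by lra.
    pose proof (Goursat h p2 p1 q2 q1 ltac:(lra) ltac:(lra) H) as G.
    rewrite Rect_flip_h in G. rewrite Rect_flip_v in G by auto.
    + rewrite <- G. ring.
    + intros q Hq. apply E1. tauto.
Qed.

Lemma Rect_bound_signed h p1 p2 q1 q2 M :
  ccont_on h (Rmin p1 p2) (Rmax p1 p2) (Rmin q1 q2) (Rmax q1 q2) ->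
  (forall z : C, Rmin p1 p2 <= Re z <= Rmax p1 p2 -> Rmin q1 q2 <= Im z <= Rmax q1 q2 -> Cmod (h z) <= M) ->
  Cmod (Rect h p1 p2 q1 q2) <= 2 * (Rabs (p2 - p1) + Rabs (q2 - q1)) * M.
Proof.
  intros Hc B.
  assert (E1 : forall q, q = q1 \/ q = q2 -> exCI (fun x => h (x, q)) p1 p2).
  { intros q Hq. eapply hor_ex; [exact Hc| | |]; destruct Hq; subst; minmax; lra. }
  assert (E2 : forall p, p = p1 \/ p = p2 -> exCI (fun y => h (p, y)) q1 q2).
  { intros p Hp. eapply ver_ex; [exact Hc| | |]; destruct Hp; subst; minmax; lra. }
  unfold Rect.
  pose proof (Cmod_CInt_const (fun x => h (x, q1)) M p1 p2 (E1 _ (or_introl eq_refl))) as K1.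
  pose proof (Cmod_CInt_const (fun x => h (x, q2)) M p1 p2 (E1 _ (or_intror eq_refl))) as K2.
  pose proof (Cmod_CInt_const (fun y => h (p1, y)) M q1 q2 (E2 _ (or_introl eq_refl))) as K3.
  pose proof (Cmod_CInt_const (fun y => h (p2, y)) M q1 q2 (E2 _ (or_intror eq_refl))) as K4.
  eapply Rle_trans; [apply Cmod_triangle_minus|].
  eapply Rle_trans; [apply Rplus_le_compat; apply Cmod_triangle|].
  rewrite !Cmod_mult, Cmod_Ci, !Rmult_1_l.
  assert (Cmod (CInt (fun x => h (x, q1)) p1 p2) <= Rabs (p2 - p1) * M).
  { apply K1. intros. apply B; simpl; auto. minmax; lra. }
  assert (Cmod (CInt (fun x => h (x, q2)) p1 p2) <= Rabs (p2 - p1) * M).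
  { apply K2. intros. apply B; simpl; auto. minmax; lra. }
  assert (Cmod (CInt (fun y => h (p1, y)) q1 q2) <= Rabs (q2 - q1) * M).
  { apply K3. intros. apply B; simpl; auto. minmax; lra. }
  assert (Cmod (CInt (fun y => h (p2, y)) q1 q2) <= Rabs (q2 - q1) * M).
  { apply K4. intros. apply B; simpl; auto. minmax; lra. }
  lra.
Qed.

Lemma ccont_on_sub h a b c d a' b' c' d' : ccont_on h a b c d ->
  a <= a' -> b' <= b -> c <= c' -> d' <= d -> ccont_on h a' b' c' d'.
Proof. intros H ? ? ? ? z ? ?. apply H; lra. Qed.

(** Of the four quarters only the one touching the corner (p, q) can escape Goursat's theorem; the
    other three contribute nothing. The steps [l] and [m] may be negative, so the corner may be any
    of the four. *)
Lemma Rect_corner_iter k p q n : forall l m, l <> 0 -> m <> 0 ->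
  ccont_on k (Rmin p (p + l)) (Rmax p (p + l)) (Rmin q (q + m)) (Rmax q (q + m)) ->
  (forall z : C, z <> (p, q) -> Rmin p (p + l) <= Re z <= Rmax p (p + l) ->
     Rmin q (q + m) <= Im z <= Rmax q (q + m) -> cdiff k z) ->
  Rect k p (p + l) q (q + m) = Rect k p (p + l / 2 ^ n) q (q + m / 2 ^ n).
Proof.
  induction n as [|n IH]; intros l m Hl Hm Hc Hd.
  - simpl. replace (l / 1) with l by field. replace (m / 1) with m by field. reflexivity.
  - assert (T : forall l, l <> 0 -> l / 2 ^ S n = (l / 2) / 2 ^ n) by (intros; simpl; field; apply pow_nonzero; lra).
    rewrite (T l), (T m) by auto. rewrite <- IH.
    + rewrite (Rect_quarter k _ _ _ _ p (p + l / 2) (p + l) q (q + m / 2) (q + m) Hc); try (minmax; lra).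
      rewrite (Goursat_signed k (p + l / 2) (p + l) q (q + m / 2)).
      2:{ intros z H1 H2. apply Hd; [intros ->; simpl in H1; minmax; lra|minmax; lra|minmax; lra]. }
      rewrite (Goursat_signed k p (p + l / 2) (q + m / 2) (q + m)).
      2:{ intros z H1 H2. apply Hd; [intros ->; simpl in H2; minmax; lra|minmax; lra|minmax; lra]. }
      rewrite (Goursat_signed k (p + l / 2) (p + l) (q + m / 2) (q + m)).
      2:{ intros z H1 H2. apply Hd; [intros ->; simpl in H1; minmax; lra|minmax; lra|minmax; lra]. }
      ring.
    + lra.
    + lra.
    + eapply ccont_on_sub; [exact Hc| | | |]; minmax; lra.
    + intros z Hz H1 H2. apply Hd; auto; minmax; lra.
Qed.

(** Halving towards the corner keeps the integral unchanged, while the integrand stays bounded by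
    continuity and the perimeter tends to 0. *)
Lemma Rect_corner k p q l m : l <> 0 -> m <> 0 ->
  ccont_on k (Rmin p (p + l)) (Rmax p (p + l)) (Rmin q (q + m)) (Rmax q (q + m)) ->
  (forall z : C, z <> (p, q) -> Rmin p (p + l) <= Re z <= Rmax p (p + l) ->
     Rmin q (q + m) <= Im z <= Rmax q (q + m) -> cdiff k z) ->
  Rect k p (p + l) q (q + m) = RtoC 0.
Proof.
  intros Hl Hm Hc Hd.
  assert (Hpq : ccont k (p, q)) by (apply Hc; simpl; minmax; lra).
  destruct (Hpq 1 Rlt_0_1) as [d [Hd0 Hdd]]. set (M := 1 + Cmod (k (p, q))).
  assert (HM : 0 < M) by (unfold M; pose proof (Cmod_ge_0 (k (p, q))); lra).
  set (s := Rabs l + Rabs m). assert (Hs : 0 < s) by (unfold s; pose proof (Rabs_pos_lt l Hl); pose proof (Rabs_pos_lt m Hm); lra).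
  apply Cmod_eq_intro. intros eps Heps. replace (Cminus _ (RtoC 0)) with (Rect k p (p + l) q (q + m)) by ring.
  destruct (nfloor_ex (s / Rmin d (eps / (2 * M)))) as [n0 Hn0].
  { apply Rdiv_le_0_compat; [lra|]. apply Rmin_pos; [auto|apply Rdiv_lt_0_compat; lra]. }
  assert (Hr : 0 < Rmin d (eps / (2 * M))) by (apply Rmin_pos; [auto|apply Rdiv_lt_0_compat; lra]).
  assert (Hn : s / 2 ^ (S n0) < Rmin d (eps / (2 * M))).
  { assert (INR (S n0) <= 2 ^ (S n0)).
    { clear. induction n0 as [|n IH]; [simpl; lra|]. rewrite S_INR. simpl pow in *.
      assert (1 <= 2 ^ n) by (apply pow_R1_Rle; lra). lra. }
    apply Rmult_lt_reg_r with (2 ^ S n0); [apply pow_lt; lra|].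
    unfold Rdiv at 1. rewrite Rmult_assoc, Rinv_l, Rmult_1_r by (apply pow_nonzero; lra).
    rewrite S_INR in H. destruct Hn0 as [_ Hn0]. apply Rmult_lt_compat_r with (r := Rmin d (eps / (2 * M))) in Hn0; [|lra].
    unfold Rdiv at 1 in Hn0. rewrite Rmult_assoc, Rinv_l, Rmult_1_r in Hn0 by lra. nra. }
  set (N := S n0) in *.
  rewrite (Rect_corner_iter k p q N l m) by auto.
  assert (H2N : 1 <= 2 ^ N) by (apply pow_R1_Rle; lra).
  assert (Hsc : forall l, Rabs (l / 2 ^ N) = Rabs l / 2 ^ N).
  { intros l'. unfold Rdiv. rewrite Rabs_mult, (Rabs_pos_eq (/ _)); auto. left. apply Rinv_0_lt_compat. lra. }
  assert (Hin : forall l', Rmin 0 l' <= l' / 2 ^ N <= Rmax 0 l').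
  { intros l'. assert (0 < / 2 ^ N <= 1). { split; [apply Rinv_0_lt_compat; lra|]. rewrite <- Rinv_1. apply Rinv_le_contravar; lra. }
    unfold Rdiv. minmax; nra. }
  assert (Hd1 : s / 2 ^ N < d) by (eapply Rlt_le_trans; [exact Hn|apply Rmin_l]).
  assert (Hd2 : s / 2 ^ N < eps / (2 * M)) by (eapply Rlt_le_trans; [exact Hn|apply Rmin_r]).
  eapply Rle_trans; [apply (Rect_bound_signed k p (p + l / 2 ^ N) q (q + m / 2 ^ N) M)|].
  - eapply ccont_on_sub; [exact Hc| | | |]; pose proof (Hin l); pose proof (Hin m); minmax; lra.
  - intros z H1 H2. unfold M.
    replace (k z) with (Cplus (Cminus (k z) (k (p, q))) (k (p, q))) by ring.
    eapply Rle_trans; [apply Cmod_triangle|]. apply Rplus_le_compat_r. left. apply Hdd.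
    eapply Rle_lt_trans; [apply Cmod_le_re_im|]. eapply Rle_lt_trans; [|exact Hd1].
    unfold s. replace ((Rabs l + Rabs m) / 2 ^ N) with (Rabs (l / 2 ^ N) + Rabs (m / 2 ^ N)) by (rewrite !Hsc; field; lra).
    rewrite Re_minus, Im_minus. simpl (Re (p, q)). simpl (Im (p, q)).
    apply Rplus_le_compat; minmax; unfold Rabs; repeat destruct Rcase_abs; lra.
  - replace (p + l / 2 ^ N - p) with (l / 2 ^ N) by ring. replace (q + m / 2 ^ N - q) with (m / 2 ^ N) by ring.
    rewrite !Hsc. replace (Rabs l / 2 ^ N + Rabs m / 2 ^ N) with (s / 2 ^ N) by (unfold s; field; lra).
    apply Rmult_lt_compat_r with (r := 2 * M) in Hd2; [|lra].
    replace (eps / (2 * M) * (2 * M)) with eps in Hd2 by (field; lra). lra.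
Qed.

(** Cutting the square through its centre puts the exceptional point at a corner of each of the four
    parts. *)
Lemma Rect_center k p q L : 0 < L ->
  ccont_on k (p - L) (p + L) (q - L) (q + L) ->
  (forall z : C, z <> (p, q) -> p - L <= Re z <= p + L -> q - L <= Im z <= q + L -> cdiff k z) ->
  Rect k (p - L) (p + L) (q - L) (q + L) = RtoC 0.
Proof.
  intros HL Hc Hd.
  rewrite (Rect_quarter k _ _ _ _ (p - L) p (p + L) (q - L) q (q + L) Hc); try lra.
  assert (K : forall l m, Rabs l = L -> Rabs m = L -> Rect k p (p + l) q (q + m) = RtoC 0).
  { intros l m Hl Hm. assert (l = L \/ l = -L) by (unfold Rabs in Hl; destruct Rcase_abs; lra).
    assert (m = L \/ m = -L) by (unfold Rabs in Hm; destruct Rcase_abs; lra).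
    apply Rect_corner; try lra.
    - eapply ccont_on_sub; [exact Hc| | | |]; minmax; lra.
    - intros z Hz H1 H2. apply Hd; auto; minmax; lra. }
  assert (E1 : forall q' p1 p2, q - L <= q' <= q + L -> p - L <= p1 <= p + L -> p - L <= p2 <= p + L -> exCI (fun x => k (x, q')) p1 p2).
  { intros. eapply hor_ex; eauto. }
  assert (E2 : forall p' q1 q2, p - L <= p' <= p + L -> q - L <= q1 <= q + L -> q - L <= q2 <= q + L -> exCI (fun y => k (p', y)) q1 q2).
  { intros. eapply ver_ex; eauto. }
  assert (RL : Rabs L = L) by (apply Rabs_pos_eq; lra).
  assert (RL' : Rabs (- L) = L) by (rewrite Rabs_Ropp; auto).
  pose proof (K L L RL RL) as K1. pose proof (K (-L) L RL' RL) as K2.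
  pose proof (K L (-L) RL RL') as K3. pose proof (K (-L) (-L) RL' RL') as K4.
  change (p + - L) with (p - L) in *. change (q + - L) with (q - L) in *.
  rewrite Rect_flip_h in K2 by (intros ? [|]; subst; apply E1; lra).
  rewrite Rect_flip_v in K3 by (intros ? [|]; subst; apply E2; lra).
  rewrite Rect_flip_h in K4 by (intros ? [|]; subst; apply E1; lra).
  rewrite Rect_flip_v in K4 by (intros ? [|]; subst; apply E2; lra).
  rewrite K1. rewrite <- (Copp_involutive (Rect k (p - L) p q (q + L))), K2.
  rewrite <- (Copp_involutive (Rect k p (p + L) (q - L) q)), K3.
  rewrite <- (Copp_involutive (Rect k (p - L) p (q - L) q)). rewrite Copp_involutive in K4. rewrite K4. ring.
Qed.

(** * Bounding a holomorphic function at the centre of a square *)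

Lemma CInt_RtoC (g : R -> R) a b : ex_RInt g a b -> CInt (fun t => RtoC (g t)) a b = RtoC (RInt g a b).
Proof.
  intros H. apply (@is_RInt_unique CR).
  apply (@is_RInt_fct_extend_pair R_NormedModule R_NormedModule (fun t => (g t, 0)) a b (RInt g a b) 0); simpl.
  - apply (@RInt_correct R_CompleteNormedModule); auto.
  - assert (E : @scal R_AbsRing R_NormedModule (b - a) 0 = 0) by (apply Rmult_0_r).
    apply (eq_ind _ (fun l => @is_RInt R_NormedModule (fun _ => 0) a b l) (@is_RInt_const R_NormedModule a b 0) _ E).
Qed.

Lemma Rect_ext_boundary f g p1 p2 q1 q2 : p1 <= p2 -> q1 <= q2 ->
  (forall x, p1 <= x <= p2 -> f (x, q1) = g (x, q1) /\ f (x, q2) = g (x, q2)) ->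
  (forall y, q1 <= y <= q2 -> f (p1, y) = g (p1, y) /\ f (p2, y) = g (p2, y)) ->
  Rect f p1 p2 q1 q2 = Rect g p1 p2 q1 q2.
Proof.
  intros Hp Hq H1 H2. unfold Rect.
  rewrite (CInt_ext_le (fun x => f (x, q1)) (fun x => g (x, q1))) by (intros t Ht; rewrite Rmin_left, Rmax_right in Ht by lra; apply H1; auto).
  rewrite (CInt_ext_le (fun x => f (x, q2)) (fun x => g (x, q2))) by (intros t Ht; rewrite Rmin_left, Rmax_right in Ht by lra; apply H1; auto).
  rewrite (CInt_ext_le (fun y => f (p1, y)) (fun y => g (p1, y))) by (intros t Ht; rewrite Rmin_left, Rmax_right in Ht by lra; apply H2; auto).
  rewrite (CInt_ext_le (fun y => f (p2, y)) (fun y => g (p2, y))) by (intros t Ht; rewrite Rmin_left, Rmax_right in Ht by lra; apply H2; auto).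
  reflexivity.
Qed.

Lemma RInt_Poisson_ge (x0 L : R) : 0 < L ->
  ex_RInt (fun x => / ((x - x0) ^ 2 + L ^ 2)) (x0 - L) (x0 + L) /\
  / L <= RInt (fun x => / ((x - x0) ^ 2 + L ^ 2)) (x0 - L) (x0 + L).
Proof.
  intros HL.
  assert (P : forall x, 0 < (x - x0) ^ 2 + L ^ 2) by (intros; pose proof (pow2_ge_0 (x - x0)); nra).
  assert (E : ex_RInt (fun x => / ((x - x0) ^ 2 + L ^ 2)) (x0 - L) (x0 + L)).
  { apply (@ex_RInt_continuous R_CompleteNormedModule). intros t _.
    apply continuous_Rinv'; [|specialize (P t); lra].
    cont. }
  split; [exact E|].
  (* On the interval (x - x0)^2 is at most L^2, so the integrand is at least 1 / (2 L^2), over a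
     length 2 L. *)
  apply Rle_trans with (RInt (fun _ => / (2 * L ^ 2)) (x0 - L) (x0 + L)).
  - rewrite RInt_const. unfold scal; simpl; unfold mult; simpl. right. field. lra.
  - apply RInt_le; [lra|apply ex_RInt_const|exact E|].
    intros t Ht. apply Rinv_le_contravar; [apply P|]. nra.
Qed.

(* The integral of [1 / (z - z0)] around the square is [2 i L] times two Poisson-type
   integrals; only a lower bound is needed, not the value [2 pi i]. *)
Lemma Rect_kernel_ge (p q L : R) : 0 < L ->
  4 <= Cmod (Rect (fun z => Cinv (Cminus z (p, q))) (p - L) (p + L) (q - L) (q + L)).
Proof.
  intros HL. destruct (RInt_Poisson_ge p L HL) as [E1 I1]. destruct (RInt_Poisson_ge q L HL) as [E2 I2].
  set (J1 := RInt (fun x => / ((x - p) ^ 2 + L ^ 2)) (p - L) (p + L)) in *.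
  set (J2 := RInt (fun x => / ((x - q) ^ 2 + L ^ 2)) (q - L) (q + L)) in *.
  assert (N : forall a b : R, (a <> 0 \/ b <> 0) -> ((a, b) : C) <> RtoC 0).
  { intros a b H E. apply (f_equal Re) in E as E'. apply (f_equal Im) in E. simpl in *. tauto. }
  assert (Hh : forall y x, y <> q -> exCI (fun x => Cinv (Cminus (x, y) (p, q))) x (x + 2 * L)).
  { intros y x Hy. apply ccontR_ex. intros t. cont; [apply continuous_hor|].
    apply (N (t - p) (y - q)). right; lra. }
  assert (Hv : forall x y, x <> p -> exCI (fun y => Cinv (Cminus (x, y) (p, q))) y (y + 2 * L)).
  { intros x y Hy. apply ccontR_ex. intros t. cont; [apply continuous_ver|].
    apply (N (x - p) (t - q)). left; lra. }
  pose proof (fun y => Hh y (p - L)) as Hh'. pose proof (fun x => Hv x (q - L)) as Hv'.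
  replace (p - L + 2 * L) with (p + L) in Hh' by ring. replace (q - L + 2 * L) with (q + L) in Hv' by ring.
  assert (A1 : Cminus (CInt (fun x => Cinv (Cminus (x, q - L) (p, q))) (p - L) (p + L))
                 (CInt (fun x => Cinv (Cminus (x, q + L) (p, q))) (p - L) (p + L)) = Cmult (Cmult (RtoC (2 * L)) Ci) (RtoC J1)).
  { rewrite <- CInt_minus by (apply Hh'; lra). unfold J1. rewrite <- (CInt_RtoC _ _ _ E1).
    rewrite <- CInt_scal.
    - apply CInt_ext. intros t. assert (0 < (t - p) ^ 2 + L ^ 2) by (pose proof (pow2_ge_0 (t - p)); nra).
      apply Ceq_pair; cri; simpl; field; simpl in *; repeat split; nra.
    - apply ccontR_ex. intros t. cont.
      pose proof (pow2_ge_0 (t - p)); nra. }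
  assert (A2 : Cminus (CInt (fun y => Cinv (Cminus (p + L, y) (p, q))) (q - L) (q + L))
                 (CInt (fun y => Cinv (Cminus (p - L, y) (p, q))) (q - L) (q + L)) = Cmult (RtoC (2 * L)) (RtoC J2)).
  { rewrite <- CInt_minus by (apply Hv'; lra). unfold J2. rewrite <- (CInt_RtoC _ _ _ E2).
    rewrite <- CInt_scal.
    - apply CInt_ext. intros t. assert (0 < (t - q) ^ 2 + L ^ 2) by (pose proof (pow2_ge_0 (t - q)); nra).
      apply Ceq_pair; cri; simpl; field; simpl in *; repeat split; nra.
    - apply ccontR_ex. intros t. cont.
      pose proof (pow2_ge_0 (t - q)); nra. }
  replace (Rect (fun z => Cinv (Cminus z (p, q))) (p - L) (p + L) (q - L) (q + L)) with (Cmult Ci (RtoC (2 * L * (J1 + J2)))).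
  - rewrite Cmod_mult, Cmod_Ci, Cmod_R, Rmult_1_l.
    assert (2 * L * / L = 2) by (field; lra).
    assert (2 * L * / L <= 2 * L * J1) by (apply Rmult_le_compat_l; lra).
    assert (2 * L * / L <= 2 * L * J2) by (apply Rmult_le_compat_l; lra).
    rewrite Rabs_pos_eq; lra.
  - unfold Rect.
    match goal with |- _ = Cminus (Cplus ?a (Cmult Ci ?b)) (Cplus ?c (Cmult Ci ?d)) =>
      replace (Cminus (Cplus a (Cmult Ci b)) (Cplus c (Cmult Ci d))) with (Cplus (Cminus a c) (Cmult Ci (Cminus b d))) by ring end.
    rewrite A1, A2. apply Ceq_pair; cri; ring.
Qed.

(** The difference quotient, completed by the derivative at [z0], is the function with one
    exceptional point to which [Rect_center] is applied. *)
Lemma cderiv_slope_ccont h z0 l : cderiv h z0 l ->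
  ccont (fun z => if Ceq_dec z z0 then l else Cdiv (Cminus (h z) (h z0)) (Cminus z z0)) z0.
Proof.
  intros H eps Heps. destruct (H (eps / 2)) as [d [Hd K]]; [lra|]. exists d. split; auto.
  intros w Hw. destruct (Ceq_dec z0 z0) as [_|n]; [|exfalso; apply n; auto].
  destruct (Ceq_dec w z0) as [->|n].
  - replace (Cminus l l) with (RtoC 0) by ring. rewrite Cmod_0. auto.
  - specialize (K w Hw). assert (N : Cminus w z0 <> RtoC 0) by (intros E; apply n, Ceq_minus; auto).
    replace (Cminus (Cdiv (Cminus (h w) (h z0)) (Cminus w z0)) l)
      with (Cdiv (Cminus (Cminus (h w) (h z0)) (Cmult (Cminus w z0) l)) (Cminus w z0)) by (field; auto).
    rewrite Cmod_div by auto. assert (0 < Cmod (Cminus w z0)) by (apply Cmod_gt_0; auto).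
    apply Rle_lt_trans with (eps / 2); [|lra]. apply Rmult_le_reg_r with (Cmod (Cminus w z0)); auto.
    unfold Rdiv at 1. rewrite Rmult_assoc, Rinv_l, Rmult_1_r by lra. exact K.
Qed.

Lemma cdiff_slope h z0 l z : z <> z0 -> cdiff h z ->
  cdiff (fun z => if Ceq_dec z z0 then l else Cdiv (Cminus (h z) (h z0)) (Cminus z z0)) z.
Proof.
  intros Hz H. assert (N : Cminus z z0 <> RtoC 0) by (intros E; apply Hz, Ceq_minus; auto).
  apply cdiff_loc with (f := fun z => Cdiv (Cminus (h z) (h z0)) (Cminus z z0)) (r := Cmod (Cminus z z0)).
  - apply Cmod_gt_0; auto.
  - intros w Hw. destruct (Ceq_dec w z0) as [->|_]; [|reflexivity].
    rewrite Cmod_minus_sym in Hw. lra.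
  - cdiffs; auto.
Qed.

(** The completed difference quotient integrates to 0, so [h (p, q)] times the integral of the
    kernel equals the integral of [h] times the kernel. The first kernel integral has modulus at
    least 4; the second integral is at most the perimeter 8 L times M / L. Hence the constant 2. *)
Lemma boundary_bound_center h p q L M : 0 < L ->
  cdiff_on h (p - L) (p + L) (q - L) (q + L) ->
  (forall z : C, p - L <= Re z <= p + L -> q - L <= Im z <= q + L ->
     Rabs (Re z - p) = L \/ Rabs (Im z - q) = L -> Cmod (h z) <= M) ->
  Cmod (h (p, q)) <= 2 * M.
Proof.
  intros HL Hd HM. set (z0 := (p, q) : C).
  destruct (Hd z0) as [l Hl]; [simpl; lra|simpl; lra|].
  set (k := fun z => if Ceq_dec z z0 then l else Cdiv (Cminus (h z) (h z0)) (Cminus z z0)).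
  assert (Hk : Rect k (p - L) (p + L) (q - L) (q + L) = RtoC 0).
  { apply Rect_center; auto.
    - intros z H1 H2. destruct (Ceq_dec z z0) as [->|n].
      + apply cderiv_slope_ccont; auto.
      + intros eps. apply cdiff_continuous. apply cdiff_slope; auto.
    - intros z Hz H1 H2. apply cdiff_slope; auto. }
  set (kap := fun z => Cinv (Cminus z z0)).
  pose proof (Rect_kernel_ge p q L HL) as K4. change (fun z => Cinv (Cminus z (p, q))) with kap in K4.
  assert (Nb : forall z : C, Rabs (Re z - p) = L \/ Rabs (Im z - q) = L -> z <> z0).
  { intros z [Hz|Hz] E; rewrite E in Hz; simpl in Hz; rewrite Rminus_diag, Rabs_R0 in Hz; lra. }
  assert (Nb' : forall z : C, Rabs (Re z - p) = L \/ Rabs (Im z - q) = L -> Cminus z z0 <> RtoC 0).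
  { intros z Hz E. apply (Nb z Hz), Ceq_minus; auto. }
  assert (Rp : forall a, Rabs (a + L - a) = L) by (intros; replace (a + L - a) with L by ring; apply Rabs_pos_eq; lra).
  assert (Rm : forall a, Rabs (a - L - a) = L) by (intros; replace (a - L - a) with (- L) by ring; rewrite Rabs_Ropp; apply Rabs_pos_eq; lra).
  assert (Ck : forall z : C, Rabs (Re z - p) = L \/ Rabs (Im z - q) = L -> cdiff kap z).
  { intros z Hz. unfold kap. cdiffs. auto. }
  assert (Ch : forall z : C, p - L <= Re z <= p + L -> q - L <= Im z <= q + L ->
     Rabs (Re z - p) = L \/ Rabs (Im z - q) = L -> cdiff (fun z => Cmult (h z) (kap z)) z).
  { intros z H1 H2 Hz. apply cdiff_mult; auto. }
  assert (EX : forall f, (forall z : C, p - L <= Re z <= p + L -> q - L <= Im z <= q + L ->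
     Rabs (Re z - p) = L \/ Rabs (Im z - q) = L -> cdiff f z) ->
     (forall y, y = q - L \/ y = q + L -> exCI (fun x => f (x, y)) (p - L) (p + L)) /\
     (forall x, x = p - L \/ x = p + L -> exCI (fun y => f (x, y)) (q - L) (q + L))).
  { intros f Hf. split; intros y Hy; apply (@ex_RInt_continuous CR); intros t Ht; rewrite Rmin_left, Rmax_right in Ht by lra.
    - apply (ccont_line f (fun x => (x, y))); [|apply continuous_hor]. intros eps. apply cdiff_continuous. apply Hf; simpl.
      + lra. + destruct Hy; subst; lra. + right. destruct Hy; subst; auto.
    - apply (ccont_line f (fun x => (y, x))); [|apply continuous_ver]. intros eps. apply cdiff_continuous. apply Hf; simpl.
      + destruct Hy; subst; lra. + lra. + left. destruct Hy; subst; auto. }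
  destruct (EX _ Ch) as [E1 E2]. destruct (EX kap (fun z _ _ => Ck z)) as [F1 F2].
  assert (Hsub : Rect k (p - L) (p + L) (q - L) (q + L) =
     Cminus (Rect (fun z => Cmult (h z) (kap z)) (p - L) (p + L) (q - L) (q + L))
            (Rect (fun z => Cmult (h z0) (kap z)) (p - L) (p + L) (q - L) (q + L))).
  { rewrite <- Rect_minus.
    - assert (G : forall z, Rabs (Re z - p) = L \/ Rabs (Im z - q) = L -> k z = Cminus (Cmult (h z) (kap z)) (Cmult (h z0) (kap z))).
      { intros z Hz. unfold k, kap. destruct (Ceq_dec z z0) as [e|_]; [exfalso; apply (Nb z); auto|]. unfold Cdiv. ring. }
      apply Rect_ext_boundary; [lra|lra| |]; intros; split; apply G; simpl; auto.
    - intros y Hy. split; [apply E1; auto|apply exCI_scal, F1; auto].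
    - intros y Hy. split; [apply E2; auto|apply exCI_scal, F2; auto]. }
  assert (Hsc : Rect (fun z => Cmult (h z0) (kap z)) (p - L) (p + L) (q - L) (q + L) = Cmult (h z0) (Rect kap (p - L) (p + L) (q - L) (q + L))).
  { unfold Rect. rewrite !CInt_scal by (try apply F1; try apply F2; auto). ring. }
  rewrite Hk, Hsc in Hsub.
  assert (Heq : Cmult (h z0) (Rect kap (p - L) (p + L) (q - L) (q + L)) = Rect (fun z => Cmult (h z) (kap z)) (p - L) (p + L) (q - L) (q + L)).
  { match type of Hsub with _ = Cminus ?a ?b => replace b with (Cminus a (Cminus a b)) by ring; rewrite <- Hsub end. ring. }
  assert (Hb : Cmod (Rect (fun z => Cmult (h z) (kap z)) (p - L) (p + L) (q - L) (q + L)) <= 2 * ((p + L - (p - L)) + (q + L - (q - L))) * (M / L)).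
  { assert (G : forall z : C, p - L <= Re z <= p + L -> q - L <= Im z <= q + L ->
     Rabs (Re z - p) = L \/ Rabs (Im z - q) = L -> Cmod (Cmult (h z) (kap z)) <= M / L).
    { intros z H1 H2 Hz. rewrite Cmod_mult. unfold kap, Rdiv. rewrite Cmod_inv by auto.
      assert (LL : L <= Cmod (Cminus z z0)).
      { destruct Hz as [E|E]; rewrite <- E; [apply (re_le_Cmod (Cminus z z0))|apply (im_le_Cmod (Cminus z z0))]. }
      apply Rmult_le_compat; [apply Cmod_ge_0|left; apply Rinv_0_lt_compat; lra|auto|apply Rinv_le_contravar; auto]. }
    apply Rect_bound; try lra; try (apply E1; auto); try (apply E2; auto).
    - intros x Hx. split; apply G; simpl; auto; lra.
    - intros x Hx. split; apply G; simpl; auto; lra. }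
  rewrite <- Heq, Cmod_mult in Hb.
  replace (2 * (p + L - (p - L) + (q + L - (q - L))) * (M / L)) with (8 * M) in Hb by (field; lra).
  pose proof (Cmod_ge_0 (h z0)). nra.
Qed.

Lemma cont_bounded (f : R -> C) a b : a <= b -> (forall t, a <= t <= b -> @continuous R_UniformSpace C_R_NormedModule f t) ->
  exists M, forall t, a <= t <= b -> Cmod (f t) <= M.
Proof.
  intros Hab H. destruct (continuity_ab_maj (fun t => Cmod (f t)) a b Hab) as [m [Hm _]].
  - intros t Ht. apply continuity_pt_filterlim. apply (continuous_Cmod f). auto.
  - exists (Cmod (f m)). exact Hm.
Qed.

Lemma square_boundary_bounded h p q L : 0 < L -> cdiff_on h (p - L) (p + L) (q - L) (q + L) ->
  exists M, 0 <= M /\ forall z : C, p - L <= Re z <= p + L -> q - L <= Im z <= q + L ->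
     Rabs (Re z - p) = L \/ Rabs (Im z - q) = L -> Cmod (h z) <= M.
Proof.
  intros HL H. pose proof (cdiff_ccont_on _ _ _ _ _ H) as Hc.
  assert (HH : forall y, q - L <= y <= q + L -> exists M, forall t, p - L <= t <= p + L -> Cmod (h (t, y)) <= M).
  { intros y Hy. apply (cont_bounded (fun t => h (t, y))); [lra|]. intros t Ht.
    apply (ccont_line h (fun x => (x, y))); [|apply continuous_hor]. apply Hc; simpl; lra. }
  assert (HV : forall x, p - L <= x <= p + L -> exists M, forall t, q - L <= t <= q + L -> Cmod (h (x, t)) <= M).
  { intros x Hx. apply (cont_bounded (fun t => h (x, t))); [lra|]. intros t Ht.
    apply (ccont_line h (fun y => (x, y))); [|apply continuous_ver]. apply Hc; simpl; lra. }
  destruct (HH (q - L)) as [M1 B1]; [lra|]. destruct (HH (q + L)) as [M2 B2]; [lra|].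
  destruct (HV (p - L)) as [M3 B3]; [lra|]. destruct (HV (p + L)) as [M4 B4]; [lra|].
  exists (Rmax 0 (Rmax (Rmax M1 M2) (Rmax M3 M4))). split; [apply Rmax_l|].
  intros [x y] H1 H2 Hz. simpl in *. eapply Rle_trans; [|apply Rmax_r].
  assert (C4 : x = p - L \/ x = p + L \/ y = q - L \/ y = q + L).
  { destruct Hz as [Hz|Hz]; unfold Rabs in Hz; destruct Rcase_abs; lra. }
  destruct C4 as [E|[E|[E|E]]]; rewrite E in *.
  - eapply Rle_trans; [apply B3; auto|]. eapply Rle_trans; [apply Rmax_l|apply Rmax_r].
  - eapply Rle_trans; [apply B4; auto|]. eapply Rle_trans; [apply Rmax_r|apply Rmax_r].
  - eapply Rle_trans; [apply B1; auto|]. eapply Rle_trans; [apply Rmax_l|apply Rmax_l].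
  - eapply Rle_trans; [apply B2; auto|]. eapply Rle_trans; [apply Rmax_r|apply Rmax_l].
Qed.

(* Apply the boundary bound to [h w / (w - c) ^ n], which is still holomorphic because [h] vanishes near [c]. *)
Lemma identity_local h p q L (c : C) r : 0 < L -> 0 < r ->
  cdiff_on h (p - L) (p + L) (q - L) (q + L) ->
  (forall w, Cmod (Cminus w c) < r -> h w = RtoC 0) ->
  2 * Cmod (Cminus (p, q) c) < L -> h (p, q) = RtoC 0.
Proof.
  intros HL Hr Hd Hz Hc. set (z0 := (p, q) : C) in *.
  destruct (Rlt_dec (Cmod (Cminus z0 c)) r) as [h0|h0]; [apply Hz; auto|].
  set (s := Cmod (Cminus z0 c)) in *. assert (Hs : 0 < s) by lra.
  destruct (square_boundary_bounded h p q L HL Hd) as [M [HM0 HM]].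
  assert (Key : forall n, Cmod (h z0) <= 2 * M * (s / (L - s)) ^ n).
  { intros n.
    assert (Hd' : cdiff_on (fun w => Cmult (h w) (Cinv (Cpow (Cminus w c) n))) (p - L) (p + L) (q - L) (q + L)).
    { intros w H1 H2. destruct (Rlt_dec (Cmod (Cminus w c)) r) as [hw|hw].
      - apply cdiff_loc with (f := fun _ => RtoC 0) (r := r - Cmod (Cminus w c)); [lra| |apply cdiff_const].
        intros v Hv. rewrite Hz; [ring|].
        replace (Cminus v c) with (Cplus (Cminus v w) (Cminus w c)) by ring.
        eapply Rle_lt_trans; [apply Cmod_triangle|]. lra.
      - cdiffs; [apply Hd; auto|]. apply Cpow_nz. apply Cmod_pos_neq. lra. }
    pose proof (boundary_bound_center _ p q L (M * / (L - s) ^ n) HL Hd') as B. fold z0 in B. cbv beta in B.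
    rewrite Cmod_mult, Cmod_inv, Cmod_pow in B by (apply Cpow_nz, Cmod_pos_neq; unfold s in Hs; lra).
    fold s in B.
    assert (B' : Cmod (h z0) * / s ^ n <= 2 * (M * / (L - s) ^ n)).
    { apply B. intros z H1 H2 H3.
      assert (LL : L <= Cmod (Cminus z z0)).
      { destruct H3 as [E|E]; rewrite <- E; [apply (re_le_Cmod (Cminus z z0))|apply (im_le_Cmod (Cminus z z0))]. }
      assert (L2 : L - s <= Cmod (Cminus z c)).
      { unfold s. replace (Cminus z z0) with (Cminus (Cminus z c) (Cminus z0 c)) in LL by ring.
        pose proof (Cmod_triangle_minus (Cminus z c) (Cminus z0 c)). lra. }
      rewrite Cmod_mult, Cmod_inv, Cmod_pow by (apply Cpow_nz, Cmod_pos_neq; lra).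
      apply Rmult_le_compat; [apply Cmod_ge_0| |auto|].
      - left. apply Rinv_0_lt_compat, pow_lt. lra.
      - apply Rinv_le_contravar; [apply pow_lt; lra|]. apply pow_incr. lra. }
    apply Rmult_le_reg_r with (/ s ^ n); [apply Rinv_0_lt_compat, pow_lt; auto|].
    eapply Rle_trans; [exact B'|]. right. unfold Rdiv. rewrite Rpow_mult_distr, pow_inv. field. split; apply pow_nonzero; lra. }
  apply Cmod_eq_0. apply Rle_antisym; [|apply Cmod_ge_0]. apply Rnot_lt_le. intros Hp.
  assert (Hq : Rabs (s / (L - s)) < 1).
  { rewrite Rabs_pos_eq by (apply Rdiv_le_0_compat; lra). apply Rmult_lt_reg_r with (L - s); [lra|].
    unfold Rdiv. rewrite Rmult_assoc, Rinv_l by lra. lra. }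
  destruct (pow_lt_1_zero _ Hq (Cmod (h z0) / (2 * M + 1))) as [N HN]; [apply Rdiv_lt_0_compat; lra|].
  specialize (HN N (le_n N)). specialize (Key N).
  assert (Hpow : (s / (L - s)) ^ N <= Cmod (h z0) / (2 * M + 1)) by (eapply Rle_trans; [apply Rle_abs|left; exact HN]).
  assert (2 * M * (s / (L - s)) ^ N <= 2 * M * (Cmod (h z0) / (2 * M + 1))) by (apply Rmult_le_compat_l; lra).
  assert (2 * M * (Cmod (h z0) / (2 * M + 1)) < Cmod (h z0)).
  { apply Rmult_lt_reg_r with (2 * M + 1); [lra|]. field_simplify; [|lra]. nra. }
  lra.
Qed.

(** Vanishing is pushed leftwards by |Im z| / 8 at a time. The square of half side |Im z| / 2 around
    z stays off the real axis, hence off the excluded point 1, and a zero disc at distance |Im z| /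
    8 is close enough for [identity_local]. *)
Lemma identity_nonreal h : (forall z, z <> RtoC 1 -> cdiff h z) -> (forall z, 1 < Re z -> h z = RtoC 0) ->
  forall n z, Im z <> 0 -> 1 - INR n * Rabs (Im z) / 8 < Re z -> h z = RtoC 0.
Proof.
  intros Hd H0. induction n as [|n IH]; intros [x y] Hy Hx; simpl Im in *; simpl Re in *.
  - apply H0. simpl in *. lra.
  - assert (Ha : 0 < Rabs y) by (apply Rabs_pos_lt; auto). set (a := Rabs y) in *.
    rewrite S_INR in Hx. pose proof (pos_INR n) as Hn.
    (* The slack of the induction hypothesis at the point (x + a / 8, y). A displacement of less
       than r costs less than r in the real part and at most n r / 8 through the imaginary part,
       which dictates the radius below. *)
    set (g := x + a / 8 - 1 + INR n * a / 8). assert (Hg : 0 < g) by (unfold g; lra).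
    set (r := Rmin a (g / (1 + INR n / 8))).
    assert (Hgr : 0 < g / (1 + INR n / 8)) by (apply Rdiv_lt_0_compat; lra).
    assert (Hr : 0 < r) by (apply Rmin_pos; auto).
    apply (identity_local h x y (a / 2) (x + a / 8, y) r); auto.
    + lra.
    + intros z H1 H2. apply Hd. intros E. rewrite E in H2. simpl in H2. unfold a, Rabs in *. destruct (Rcase_abs y); lra.
    + intros [u v] Hw.
      assert (W1 : Rabs (u - (x + a / 8)) < r) by (eapply Rle_lt_trans; [apply (re_le_Cmod (Cminus (u, v) (x + a / 8, y)))|exact Hw]).
      assert (W2 : Rabs (v - y) < r) by (eapply Rle_lt_trans; [apply (im_le_Cmod (Cminus (u, v) (x + a / 8, y)))|exact Hw]).
      assert (R1 : r <= a) by apply Rmin_l. assert (R2 : r <= g / (1 + INR n / 8)) by apply Rmin_r.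
      assert (R3 : r * (1 + INR n / 8) <= g).
      { apply Rmult_le_compat_r with (r := 1 + INR n / 8) in R2; [|lra]. unfold Rdiv at 2 in R2.
        rewrite Rmult_assoc, Rinv_l, Rmult_1_r in R2 by lra. exact R2. }
      assert (V1 : a - r < Rabs v) by (unfold a in *; revert W2; unfold Rabs; repeat destruct Rcase_abs; lra).
      apply IH; simpl.
      * intros ->. rewrite Rabs_R0 in V1. lra.
      * apply Rabs_lt_between in W1. unfold g in R3.
        assert (INR n * (a - r) <= INR n * Rabs v) by (apply Rmult_le_compat_l; lra). lra.
    + replace (Cminus (x, y) (x + a / 8, y)) with (RtoC (- (a / 8))).
      * rewrite Cmod_R, Rabs_Ropp, Rabs_pos_eq; lra.
      * apply Ceq_pair; simpl; ring.
Qed.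

(** A nonreal point is reached after finitely many steps of [identity_nonreal]; a real point other
    than 1 is a limit of nonreal ones. *)
Lemma identity_theorem h : (forall z, z <> RtoC 1 -> cdiff h z) -> (forall z, 1 < Re z -> h z = RtoC 0) ->
  forall z, z <> RtoC 1 -> h z = RtoC 0.
Proof.
  intros Hd H0.
  assert (NR : forall z, Im z <> 0 -> h z = RtoC 0).
  { intros z Hz. assert (0 < Rabs (Im z)) by (apply Rabs_pos_lt; auto).
    destruct (nfloor_ex (8 * (1 + Rabs (Re z)) / Rabs (Im z))) as [n [_ Hn]].
    { apply Rdiv_le_0_compat; [pose proof (Rabs_pos (Re z)); lra|auto]. }
    apply (identity_nonreal h Hd H0 (S n)); auto. rewrite S_INR.
    apply Rmult_lt_compat_r with (r := Rabs (Im z)) in Hn; [|auto].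
    unfold Rdiv in Hn. rewrite Rmult_assoc, Rinv_l, Rmult_1_r in Hn by lra.
    pose proof (Rle_abs (- Re z)). rewrite Rabs_Ropp in H1. lra. }
  intros z Hz. destruct (Req_dec (Im z) 0) as [Hi|Hi]; [|auto].
  apply Cmod_eq_intro. intros eps Heps.
  destruct (cdiff_continuous h z (Hd z Hz) eps Heps) as [d [Hdd K]].
  specialize (K (Re z, d / 2)). rewrite (NR (Re z, d / 2)) in K by (simpl; lra).
  rewrite Cmod_minus_sym. left. apply K.
  replace (Cminus (Re z, d / 2) z) with (Cmult Ci (RtoC (d / 2))).
  - rewrite Cmod_mult, Cmod_Ci, Cmod_R, Rabs_pos_eq; lra.
  - apply Ceq_pair; cri; simpl; rewrite ?Hi; ring.
Qed.

(** * Complex series *)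

(** The terms of index below n, so that the empty sum is included; [sum_n a n] is [csum a (S n)],
    whence the shifts when passing to [is_series]. *)
Fixpoint csum (a : nat -> C) (n : nat) : C :=
  match n with O => RtoC 0 | S n => Cplus (csum a n) (a n) end.

Fixpoint rsum (a : nat -> R) (n : nat) : R :=
  match n with O => 0 | S n => rsum a n + a n end.

Definition clim (u : nat -> C) (l : C) : Prop :=
  forall eps, 0 < eps -> exists N, forall n, (N <= n)%nat -> Cmod (Cminus (u n) l) < eps.

Definition cser (a : nat -> C) (S : C) : Prop := clim (csum a) S.

Lemma csum_sum_n a n : @sum_n C_AbelianMonoid a n = csum a (S n).
Proof. induction n; [rewrite sum_O; symmetry; exact (Cplus_0_l (a O))|]. rewrite sum_Sn, IHn. reflexivity. Qed.

Lemma rsum_sum_n a n : @sum_n R_AbelianMonoid a n = rsum a (S n).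
Proof. induction n; [rewrite sum_O; symmetry; exact (Rplus_0_l (a O))|]. rewrite sum_Sn, IHn. reflexivity. Qed.

Lemma clim_unique u l l' : clim u l -> clim u l' -> l = l'.
Proof.
  intros H H'. apply Cmod_eq_intro. intros eps Heps.
  destruct (H (eps / 2)) as [N HN]; [lra|]. destruct (H' (eps / 2)) as [N' HN']; [lra|].
  specialize (HN (N + N')%nat ltac:(lia)). specialize (HN' (N + N')%nat ltac:(lia)).
  replace (Cminus l l') with (Cminus (Cminus (u (N + N')%nat) l') (Cminus (u (N + N')%nat) l)) by ring.
  eapply Rle_trans; [apply Cmod_triangle_minus|]. lra.
Qed.

Lemma clim_ext u v l : (forall n, u n = v n) -> clim u l -> clim v l.
Proof. intros E H eps Heps. destruct (H eps Heps) as [N HN]. exists N. intros n Hn. rewrite <- E. auto. Qed.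

Lemma clim_plus u v a b : clim u a -> clim v b -> clim (fun n => Cplus (u n) (v n)) (Cplus a b).
Proof.
  intros H H' eps Heps. destruct (H (eps / 2)) as [N HN]; [lra|]. destruct (H' (eps / 2)) as [N' HN']; [lra|].
  exists (N + N')%nat. intros n Hn. specialize (HN n ltac:(lia)). specialize (HN' n ltac:(lia)).
  replace (Cminus (Cplus (u n) (v n)) (Cplus a b)) with (Cplus (Cminus (u n) a) (Cminus (v n) b)) by ring.
  eapply Rle_lt_trans; [apply Cmod_triangle|]. lra.
Qed.

Lemma clim_const c : clim (fun _ => c) c.
Proof. intros eps Heps. exists O. intros. replace (Cminus c c) with (RtoC 0) by ring. rewrite Cmod_0. auto. Qed.

Lemma clim_scal c u a : clim u a -> clim (fun n => Cmult c (u n)) (Cmult c a).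
Proof.
  intros H eps Heps. pose proof (Cmod_ge_0 c). destruct (H (eps / (Cmod c + 1))) as [N HN]; [apply Rdiv_lt_0_compat; lra|].
  exists N. intros n Hn. specialize (HN n Hn).
  replace (Cminus (Cmult c (u n)) (Cmult c a)) with (Cmult c (Cminus (u n) a)) by ring. rewrite Cmod_mult.
  apply Rle_lt_trans with (Cmod c * (eps / (Cmod c + 1))); [apply Rmult_le_compat_l; lra|].
  apply Rmult_lt_reg_r with (Cmod c + 1); [lra|]. field_simplify; [|lra]. nra.
Qed.

Lemma clim_minus u v a b : clim u a -> clim v b -> clim (fun n => Cminus (u n) (v n)) (Cminus a b).
Proof.
  intros H1 H2. apply clim_ext with (fun n => Cplus (u n) (Cmult (RtoC (-1)) (v n))).
  - intros. apply Ceq_pair; cri; ring.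
  - replace (Cminus a b) with (Cplus a (Cmult (RtoC (-1)) b)) by (apply Ceq_pair; cri; ring).
    apply clim_plus; auto. apply clim_scal; auto.
Qed.

Lemma clim_shift u l : clim u l <-> clim (fun n => u (S n)) l.
Proof.
  split; intros H eps Heps; destruct (H eps Heps) as [N HN].
  - exists N. intros n Hn. apply HN. lia.
  - exists (S N). intros [|n] Hn; [lia|]. apply HN. lia.
Qed.

Lemma cser_is_series a s : cser a s <-> @is_series C_AbsRing C_NormedModule a s.
Proof.
  unfold cser. rewrite clim_shift. split.
  - intros H. apply (proj2 (@filterlim_locally _ C_NormedModule _ _ (sum_n a) s)). intros eps.
    destruct (H eps (cond_pos eps)) as [N HN]. exists N. intros n Hn. specialize (HN n Hn).
    rewrite <- csum_sum_n in HN. apply C_NormedModule_mixin_compat1. exact HN.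
  - intros H eps Heps. assert (He : 0 < eps / 2) by lra.
    pose proof (proj1 (@filterlim_locally _ C_NormedModule _ _ (sum_n a) s) H (mkposreal _ He)) as [N HN].
    exists N. intros n Hn. specialize (HN n Hn). destruct HN as [H1 H2].
    rewrite <- csum_sum_n. eapply Rle_lt_trans; [apply Cmod_le_re_im|].
    assert (Rabs (Re (Cminus (sum_n a n) s)) < eps / 2) by exact H1.
    assert (Rabs (Im (Cminus (sum_n a n) s)) < eps / 2) by exact H2. lra.
Qed.

Lemma csum_Re a n : Re (csum a n) = rsum (fun k => Re (a k)) n.
Proof. induction n; cbn [csum rsum]; auto. rewrite Re_plus, IHn. auto. Qed.
Lemma csum_Im a n : Im (csum a n) = rsum (fun k => Im (a k)) n.
Proof. induction n; cbn [csum rsum]; auto. rewrite Im_plus, IHn. auto. Qed.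

Lemma cser_CSeries a s : cser a s -> CSeries a = s.
Proof.
  intros H. unfold cser in H. rewrite clim_shift in H. unfold CSeries. apply Ceq_pair; simpl; apply is_series_unique.
  - apply (proj2 (@filterlim_locally _ R_NormedModule _ _ (sum_n (fun k => Re (a k))) (Re s))). intros eps.
    destruct (H eps (cond_pos eps)) as [N HN]. exists N. intros n Hn. specialize (HN n Hn).
    rewrite rsum_sum_n, <- csum_Re. eapply Rle_lt_trans; [|exact HN].
    apply (re_le_Cmod (Cminus (csum a (S n)) s)).
  - apply (proj2 (@filterlim_locally _ R_NormedModule _ _ (sum_n (fun k => Im (a k))) (Im s))). intros eps.
    destruct (H eps (cond_pos eps)) as [N HN]. exists N. intros n Hn. specialize (HN n Hn).
    rewrite rsum_sum_n, <- csum_Im. eapply Rle_lt_trans; [|exact HN].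
    apply (im_le_Cmod (Cminus (csum a (S n)) s)).
Qed.

Lemma cser_ex a s : cser a s -> Cex_series a.
Proof. intros H. exists s. apply cser_is_series; auto. Qed.

Lemma cser_unique a s s' : cser a s -> cser a s' -> s = s'.
Proof. apply clim_unique. Qed.

Lemma csum_ext a b n : (forall k, a k = b k) -> csum a n = csum b n.
Proof. intros E. induction n; simpl; auto. rewrite IHn, E. auto. Qed.

Lemma csum_ext_lt a b n : (forall k, (k < n)%nat -> a k = b k) -> csum a n = csum b n.
Proof. intros E. induction n; simpl; auto. rewrite IHn by (intros; apply E; lia). rewrite E by lia. auto. Qed.

Lemma cser_ext a b s : (forall n, a n = b n) -> cser a s -> cser b s.
Proof. intros E. apply clim_ext. intros. apply csum_ext; auto. Qed.

Lemma csum_plus a b n : csum (fun k => Cplus (a k) (b k)) n = Cplus (csum a n) (csum b n).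
Proof. induction n; simpl; [ring|]. rewrite IHn. ring. Qed.
Lemma csum_minus a b n : csum (fun k => Cminus (a k) (b k)) n = Cminus (csum a n) (csum b n).
Proof. induction n; simpl; [ring|]. rewrite IHn. ring. Qed.
Lemma csum_scal c a n : csum (fun k => Cmult c (a k)) n = Cmult c (csum a n).
Proof. induction n; simpl; [ring|]. rewrite IHn. ring. Qed.

Lemma cser_plus a b s t : cser a s -> cser b t -> cser (fun k => Cplus (a k) (b k)) (Cplus s t).
Proof. intros H1 H2. eapply clim_ext; [|exact (clim_plus _ _ _ _ H1 H2)]. intros; symmetry; apply csum_plus. Qed.
Lemma cser_minus a b s t : cser a s -> cser b t -> cser (fun k => Cminus (a k) (b k)) (Cminus s t).
Proof. intros H1 H2. eapply clim_ext; [|exact (clim_minus _ _ _ _ H1 H2)]. intros; symmetry; apply csum_minus. Qed.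
Lemma cser_scal c a s : cser a s -> cser (fun k => Cmult c (a k)) (Cmult c s).
Proof. intros H. eapply clim_ext; [|exact (clim_scal c _ _ H)]. intros; symmetry; apply csum_scal. Qed.

Lemma rsum_plus a b n : rsum (fun k => a k + b k) n = rsum a n + rsum b n.
Proof. induction n; simpl; [ring|]. rewrite IHn. ring. Qed.
Lemma rsum_scal c a n : rsum (fun k => c * a k) n = c * rsum a n.
Proof. induction n; simpl; [ring|]. rewrite IHn. ring. Qed.

(** * Comparison with summable majorants *)

Lemma Cmod_csum_le a b m n : (forall k, Cmod (a k) <= b k) -> (n <= m)%nat ->
  Cmod (Cminus (csum a m) (csum a n)) <= rsum b m - rsum b n.
Proof.
  intros H Hnm. induction Hnm.
  - replace (Cminus _ _) with (RtoC 0) by ring. rewrite Cmod_0. lra.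
  - simpl. replace (Cminus (Cplus (csum a m) (a m)) (csum a n)) with (Cplus (Cminus (csum a m) (csum a n)) (a m)) by ring.
    eapply Rle_trans; [apply Cmod_triangle|]. specialize (H m). lra.
Qed.

Definition summable (b : nat -> R) : Prop := (forall n, 0 <= b n) /\ exists B, forall n, rsum b n <= B.

Lemma summable_lim b : summable b -> exists B, 0 <= B /\ (forall n, rsum b n <= B) /\
  forall eps, 0 < eps -> exists N, forall n, (N <= n)%nat -> B - rsum b n < eps.
Proof.
  intros [H0 [B0 HB0]].
  assert (Hi : forall n, rsum b n <= rsum b (S n)) by (intros n; simpl; specialize (H0 n); lra).
  destruct (ex_finite_lim_seq_incr _ B0 Hi HB0) as [B HB].
  assert (HL : forall n, rsum b n <= B).
  { intros n. apply (is_lim_seq_incr_compare _ _ HB Hi). }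
  exists B. split; [apply (HL O)|]. split; [exact HL|].
  intros eps Heps. apply is_lim_seq_spec in HB. destruct (HB (mkposreal eps Heps)) as [N HN]. exists N. intros n Hn.
  specialize (HN n Hn). simpl in HN. apply Rabs_lt_between in HN. lra.
Qed.

Lemma clim_Cauchy u : (forall eps, 0 < eps -> exists N, forall n m, (N <= n)%nat -> (N <= m)%nat -> Cmod (Cminus (u m) (u n)) < eps) ->
  exists l, clim u l.
Proof.
  intros H.
  assert (HR : forall f : C -> R, (forall z w, Rabs (f z - f w) <= Cmod (Cminus z w)) -> exists l, is_lim_seq (fun n => f (u n)) (Finite l)).
  { intros f Hf. assert (E : ex_finite_lim_seq (fun n => f (u n))).
    { apply ex_lim_seq_cauchy_corr. intros eps. destruct (H eps (cond_pos eps)) as [N HN]. exists N. intros n m Hn Hm.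
      eapply Rle_lt_trans; [apply Hf|]. auto. }
    exact E. }
  destruct (HR Re) as [a Ha]; [intros z w; rewrite <- Re_minus; apply re_le_Cmod|].
  destruct (HR Im) as [b Hb]; [intros z w; rewrite <- Im_minus; apply im_le_Cmod|].
  exists (a, b). intros eps Heps. apply is_lim_seq_spec in Ha. apply is_lim_seq_spec in Hb.
  assert (He : 0 < eps / 2) by lra.
  destruct (Ha (mkposreal _ He)) as [N HN]. destruct (Hb (mkposreal _ He)) as [M HM]. exists (N + M)%nat.
  intros n Hn. specialize (HN n ltac:(lia)). specialize (HM n ltac:(lia)). simpl in HN, HM.
  eapply Rle_lt_trans; [apply Cmod_le_re_im|]. rewrite Re_minus, Im_minus. simpl. unfold Re, Im in *. lra.
Qed.

Lemma cser_compare a b : (forall k, Cmod (a k) <= b k) -> summable b -> exists s, cser a s.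
Proof.
  intros H Hb. destruct (summable_lim b Hb) as [B [_ [HB1 HB2]]]. apply clim_Cauchy. intros eps Heps.
  destruct (HB2 eps Heps) as [N HN]. exists N.
  assert (K : forall n m, (N <= n)%nat -> (n <= m)%nat -> Cmod (Cminus (csum a m) (csum a n)) < eps).
  { intros n m Hn Hm. eapply Rle_lt_trans; [apply Cmod_csum_le; eauto|]. specialize (HN n Hn). specialize (HB1 m). lra. }
  intros n m Hn Hm. destruct (Nat.le_ge_cases n m); [auto|]. rewrite Cmod_minus_sym. auto.
Qed.

Lemma cser_tail a b s n B : (forall k, Cmod (a k) <= b k) -> cser a s -> (forall n, rsum b n <= B) ->
  Cmod (Cminus s (csum a n)) <= B - rsum b n.
Proof.
  intros H Hs HB. apply le_epsilon. intros eps Heps. destruct (Hs eps Heps) as [N HN].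
  set (m := (N + n)%nat). specialize (HN m ltac:(unfold m; lia)). rewrite Cmod_minus_sym in HN.
  replace (Cminus s (csum a n)) with (Cplus (Cminus s (csum a m)) (Cminus (csum a m) (csum a n))) by ring.
  eapply Rle_trans; [apply Cmod_triangle|].
  pose proof (Cmod_csum_le a b m n H ltac:(unfold m; lia)). specialize (HB m). lra.
Qed.

Lemma cser_bound a b s B : (forall k, Cmod (a k) <= b k) -> cser a s -> (forall n, rsum b n <= B) -> Cmod s <= B.
Proof.
  intros H Hs HB. pose proof (cser_tail a b s O B H Hs HB) as K. simpl in K.
  replace (Cminus s (RtoC 0)) with s in K by ring. lra.
Qed.

Lemma summable_plus a b : summable a -> summable b -> summable (fun k => a k + b k).
Proof.
  intros [A1 [A A2]] [B1 [B B2]]. split; [intros n; specialize (A1 n); specialize (B1 n); lra|].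
  exists (A + B). intros n. rewrite rsum_plus. specialize (A2 n); specialize (B2 n); lra.
Qed.

Lemma summable_scal c a : 0 <= c -> summable a -> summable (fun k => c * a k).
Proof.
  intros Hc [A1 [A A2]]. split; [intros n; apply Rmult_le_pos; auto|].
  exists (c * A). intros n. rewrite rsum_scal. apply Rmult_le_compat_l; auto.
Qed.

Lemma rsum_le a b n : (forall k, a k <= b k) -> rsum a n <= rsum b n.
Proof. intros H. induction n; simpl; [lra|]. specialize (H n). lra. Qed.

Lemma summable_le a b : (forall k, 0 <= a k <= b k) -> summable b -> summable a.
Proof.
  intros H [_ [B HB]]. split; [apply H|]. exists B. intros n. eapply Rle_trans; [|apply HB]. apply rsum_le. apply H.
Qed.

Lemma summable_power (a p : R) : 0 < a -> 1 < p -> summable (fun n => Rpower (INR n + a) (- p)).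
Proof.
  intros Ha Hp. split; [intros; left; apply exp_pos|].
  exists (Rpower a (- p) + Rpower a (1 - p) / (p - 1)).
  (* The mean value theorem for t^(1 - p) on [u, u + 1] bounds each term by a telescoping
     difference. *)
  assert (K : forall n, Rpower (INR n + 1 + a) (- p) <= (Rpower (INR n + a) (1 - p) - Rpower (INR n + 1 + a) (1 - p)) / (p - 1)).
  { intros n. pose proof (pos_INR n) as Hn. set (u := INR n + a). assert (Hu : 0 < u) by (unfold u; lra).
    replace (INR n + 1 + a) with (u + 1) by (unfold u; ring).
    destruct (MVT_gen (fun t => Rpower t (1 - p)) u (u + 1) (fun t => (1 - p) * Rpower t (- p))) as [c [Hc1 Hc2]].
    - intros t Ht. rewrite Rmin_left, Rmax_right in Ht by lra.
      replace ((1 - p) * Rpower t (- p)) with ((1 - p) * Rpower t (1 - p - 1)) by (do 2 f_equal; ring).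
      apply is_derive_Reals. apply derivable_pt_lim_power. lra.
    - intros t Ht. rewrite Rmin_left, Rmax_right in Ht by lra.
      apply derivable_continuous_pt. exists ((1 - p) * Rpower t (1 - p - 1)). apply derivable_pt_lim_power. lra.
    - rewrite Rmin_left, Rmax_right in Hc1 by lra.
      replace (u + 1 - u) with 1 in Hc2 by ring. rewrite Rmult_1_r in Hc2.
      replace (Rpower u (1 - p) - Rpower (u + 1) (1 - p)) with ((p - 1) * Rpower c (- p)) by lra.
      replace ((p - 1) * Rpower c (- p) / (p - 1)) with (Rpower c (- p)) by (field; lra).
      rewrite !Rpower_Ropp. apply Rinv_le_contravar; [apply exp_pos|]. apply Rle_Rpower_l; lra. }
  assert (L : forall n, rsum (fun n => Rpower (INR n + a) (- p)) (S n) <=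
    Rpower a (- p) + (Rpower a (1 - p) - Rpower (INR n + a) (1 - p)) / (p - 1)).
  { induction n.
    - simpl. rewrite !(Rplus_0_l a). unfold Rdiv. lra.
    - cbn [rsum] in *. specialize (K n). rewrite S_INR in *. unfold Rdiv in *. lra. }
  intros [|n].
  - simpl. pose proof (exp_pos (- p * ln a)). pose proof (exp_pos ((1 - p) * ln a)). unfold Rpower.
    assert (0 < exp ((1 - p) * ln a) / (p - 1)) by (apply Rdiv_lt_0_compat; lra). lra.
  - eapply Rle_trans; [apply L|]. apply Rplus_le_compat_l. apply Rmult_le_compat_r; [left; apply Rinv_0_lt_compat; lra|].
    pose proof (exp_pos ((1 - p) * ln (INR n + a))). unfold Rpower. lra.
Qed.

(** * The partial fraction expansion of the cotangent *)

Lemma Cinv_neq_0 (z : C) : z <> RtoC 0 -> Cinv z <> RtoC 0.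
Proof. intros H. apply Cmod_pos_neq. rewrite Cmod_inv by auto. apply Rinv_0_lt_compat. apply Cmod_gt_0. auto. Qed.

Lemma C2_neq : RtoC 2 <> RtoC 0. Proof. apply RtoC_neq; lra. Qed.
Lemma Ci_neq : Ci <> RtoC 0. Proof. intros E. apply (f_equal Im) in E. simpl in E. lra. Qed.
Lemma C2i_neq : Cmult (RtoC 2) Ci <> RtoC 0. Proof. apply Cmult_neq_0; [apply C2_neq|apply Ci_neq]. Qed.
Lemma Ci_sqr : Cmult Ci Ci = Copp (RtoC 1). Proof. apply Ceq_pair; cri; ring. Qed.

Ltac cfield := field; repeat split; auto using Ci_neq, C2_neq.

Lemma ccos_0 : ccos (RtoC 0) = RtoC 1.
Proof. unfold ccos. rewrite Cmult_0_r. replace (Copp (RtoC 0)) with (RtoC 0) by ring. rewrite cexp_0. field. Qed.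
Lemma csin_0 : csin (RtoC 0) = RtoC 0.
Proof. unfold csin. rewrite Cmult_0_r. replace (Copp (RtoC 0)) with (RtoC 0) by ring. rewrite cexp_0. unfold Cdiv. ring. Qed.

Lemma is_derC_ccos (a : C) t : is_derC (fun t => ccos (Cmult a (RtoC t))) t (Copp (Cmult a (csin (Cmult a (RtoC t))))).
Proof.
  unfold ccos, csin. eapply is_derC_eq.
  - apply (is_derC_Cmult _ (fun _ => Cinv (RtoC 2))); [|apply is_derC_const].
    apply is_derC_Cplus; apply is_derC_cexp.
    + apply (is_derC_Cmult (fun _ => Ci)); [apply is_derC_const|apply is_derC_lin].
    + eapply is_derC_eq; [apply (@is_derive_opp R_AbsRing C_R_NormedModule); apply (is_derC_Cmult (fun _ => Ci)); [apply is_derC_const|apply is_derC_lin]|reflexivity].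
  - change (@opp C_R_NormedModule) with Copp. cbv beta. field_simplify_eq; [|repeat split; auto using Ci_neq, C2_neq].
    change (Cpow Ci 2) with (Cmult Ci (Cmult Ci (RtoC 1))). rewrite Cmult_1_r, Ci_sqr. ring.
Qed.

Lemma is_derC_csin (a : C) t : is_derC (fun t => csin (Cmult a (RtoC t))) t (Cmult a (ccos (Cmult a (RtoC t)))).
Proof.
  unfold ccos, csin. eapply is_derC_eq.
  - apply (is_derC_Cmult _ (fun _ => Cinv (Cmult (RtoC 2) Ci))); [|apply is_derC_const].
    apply is_derC_Cminus; apply is_derC_cexp.
    + apply (is_derC_Cmult (fun _ => Ci)); [apply is_derC_const|apply is_derC_lin].
    + eapply is_derC_eq; [apply (@is_derive_opp R_AbsRing C_R_NormedModule); apply (is_derC_Cmult (fun _ => Ci)); [apply is_derC_const|apply is_derC_lin]|reflexivity].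
  - change (@opp C_R_NormedModule) with Copp. cbv beta. cfield.
Qed.

Lemma continuous_ccos_comp (f : R -> C) t : @continuous R_UniformSpace C_R_NormedModule f t ->
  @continuous R_UniformSpace C_R_NormedModule (fun t => ccos (f t)) t.
Proof. intros. unfold ccos. cont; auto. Qed.
Lemma continuous_csin_comp (f : R -> C) t : @continuous R_UniformSpace C_R_NormedModule f t ->
  @continuous R_UniformSpace C_R_NormedModule (fun t => csin (f t)) t.
Proof. intros. unfold csin. cont; auto. Qed.

Lemma Cmod_csin_le (w : C) : Cmod (csin w) <= Cmod w * exp (Cmod w).
Proof.
  unfold csin. rewrite Cmod_div by apply C2i_neq. rewrite Cmod_mult, Cmod_Ci, Cmod_R, Rabs_pos_eq by lra.
  replace (Cminus (cexp (Cmult Ci w)) (cexp (Copp (Cmult Ci w))))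
    with (Cminus (Cminus (cexp (Cmult Ci w)) (RtoC 1)) (Cminus (cexp (Copp (Cmult Ci w))) (RtoC 1))) by ring.
  pose proof (Cmod_cexp_minus_1 (Cmult Ci w)) as H1. pose proof (Cmod_cexp_minus_1 (Copp (Cmult Ci w))) as H2.
  rewrite Cmod_opp, Cmod_mult, Cmod_Ci, Rmult_1_l in H2. rewrite Cmod_mult, Cmod_Ci, Rmult_1_l in H1.
  match goal with |- Cmod (Cminus ?a ?b) / _ <= _ => pose proof (Cmod_triangle_minus a b) end. lra.
Qed.

Lemma Cmod_ccos_minus_1_le (w : C) : Cmod (Cminus (ccos w) (RtoC 1)) <= Cmod w ^ 2 * exp (Cmod w).
Proof.
  unfold ccos.
  replace (Cminus (Cdiv (Cplus (cexp (Cmult Ci w)) (cexp (Copp (Cmult Ci w)))) (RtoC 2)) (RtoC 1))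
    with (Cdiv (Cplus (Cminus (Cminus (cexp (Cmult Ci w)) (RtoC 1)) (Cmult Ci w))
                       (Cminus (Cminus (cexp (Copp (Cmult Ci w))) (RtoC 1)) (Copp (Cmult Ci w)))) (RtoC 2)) by cfield.
  rewrite Cmod_div by apply C2_neq. rewrite Cmod_R, Rabs_pos_eq by lra.
  pose proof (Cmod_cexp_taylor (Cmult Ci w)) as H1. pose proof (Cmod_cexp_taylor (Copp (Cmult Ci w))) as H2.
  rewrite !Cmod_opp, Cmod_mult, Cmod_Ci, Rmult_1_l in H2. rewrite Cmod_mult, Cmod_Ci, Rmult_1_l in H1.
  match goal with |- Cmod (Cplus ?a ?b) / _ <= _ => pose proof (Cmod_triangle a b) end. lra.
Qed.

(* Euler's integrals: [ccos (a t) cos^n t] and (up to a factor) its derivative in [a]. *)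
Definition eulI (a : C) (n : nat) : C := CInt (fun t => Cmult (ccos (Cmult a (RtoC t))) (RtoC (cos t ^ n))) 0 (PI / 2).
Definition eulJ (a : C) (n : nat) : C :=
  CInt (fun t => Cmult (Cmult (RtoC t) (csin (Cmult a (RtoC t)))) (RtoC (cos t ^ n))) 0 (PI / 2).

Ltac cont2 := repeat (cont; try (lazymatch goal with
  | |- continuous (fun _ => ccos _) _ => apply continuous_ccos_comp
  | |- continuous (fun _ => csin _) _ => apply continuous_csin_comp end)).

Lemma eulI_ex a n u v : exCI (fun t => Cmult (ccos (Cmult a (RtoC t))) (RtoC (cos t ^ n))) u v.
Proof. apply ccontR_ex. intros t. cont2; apply continuous_cos. Qed.
Lemma eulJ_ex a n u v : exCI (fun t => Cmult (Cmult (RtoC t) (csin (Cmult a (RtoC t)))) (RtoC (cos t ^ n))) u v.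
Proof. apply ccontR_ex. intros t. cont2; apply continuous_cos. Qed.

Lemma is_derC_cospow n t : is_derC (fun t => RtoC (cos t ^ S n)) t (RtoC (- INR (S n) * sin t * cos t ^ n)).
Proof.
  apply is_derC_RtoC. replace (- INR (S n) * sin t * cos t ^ n) with (INR (S n) * - sin t * cos t ^ n) by ring.
  apply (is_derive_pow cos (S n) t (- sin t)). apply is_derive_Reals, derivable_pt_lim_cos.
Qed.

Lemma is_derC_sin t : is_derC (fun t => RtoC (sin t)) t (RtoC (cos t)).
Proof. apply is_derC_RtoC. apply is_derive_Reals, derivable_pt_lim_sin. Qed.

Lemma Csin2 t : Cmult (RtoC (sin t)) (RtoC (sin t)) = Cminus (RtoC 1) (Cmult (RtoC (cos t)) (RtoC (cos t))).
Proof. rewrite <- !RtoC_mult, <- RtoC_minus. f_equal. pose proof (sin2_cos2 t). unfold Rsqr in H. lra. Qed.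

(** Two integrations by parts, done at once through the primitive [F] of the difference of the two
    integrands; [F] vanishes at 0 and at pi / 2. *)
Lemma eulI_rec a n : Cmult (RtoC (INR (S (S n)) * INR (S n))) (eulI a n) =
  Cmult (Cminus (RtoC (INR (S (S n)) ^ 2)) (Cmult a a)) (eulI a (S (S n))).
Proof.
  unfold eulI. rewrite <- !CInt_scal by apply eulI_ex. apply Ceq_minus.
  rewrite <- CInt_minus by (apply exCI_scal, eulI_ex).
  set (N := INR (S (S n))).
  set (F := fun t => Cminus (Cmult a (Cmult (RtoC (cos t ^ S (S n))) (csin (Cmult a (RtoC t)))))
     (Cmult (RtoC N) (Cmult (Cmult (RtoC (cos t ^ S n)) (RtoC (sin t))) (ccos (Cmult a (RtoC t)))))).
  rewrite (CInt_FTC F).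
  - unfold F. rewrite !cos_PI2, sin_0, !pow_i by lia. rewrite (Cmult_0_r a), csin_0. ring.
  - intros t _. unfold F. eapply is_derC_eq.
    + apply is_derC_Cminus.
      * apply (is_derC_Cmult (fun _ => a)); [apply is_derC_const|].
        apply is_derC_Cmult; [apply is_derC_cospow|apply is_derC_csin].
      * apply (is_derC_Cmult (fun _ => RtoC N)); [apply is_derC_const|].
        apply is_derC_Cmult; [|apply is_derC_ccos]. apply is_derC_Cmult; [apply is_derC_cospow|apply is_derC_sin].
    + cbv beta. fold N. assert (HN : INR (S n) = N - 1) by (unfold N; rewrite (S_INR (S n)); ring). rewrite HN.
      generalize (ccos (Cmult a (RtoC t))) (csin (Cmult a (RtoC t))). intros cc ss.
      simpl pow. generalize (cos t ^ n). intros r. rewrite !RtoC_mult, !RtoC_opp, !RtoC_minus.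
      pose proof (Csin2 t) as S2.
      rewrite ?RtoC_mult, ?RtoC_opp, ?RtoC_minus, ?RtoC_mult.
      set (c := RtoC (cos t)) in *. set (s := RtoC (sin t)) in *. set (M := RtoC N). set (q := RtoC r).
      transitivity (Cplus (Cminus (Cmult (Cmult (Cmult M (Cminus M (RtoC 1))) (Cmult q cc)) (Cmult s s)) (Cmult M (Cmult (Cmult c (Cmult c q)) cc)))
        (Cmult (Cmult a a) (Cmult cc (Cmult c (Cmult c q))))); [ring|]. rewrite S2. ring.
  - intros t _. cont2; apply continuous_cos.
Qed.

(** The derivative of [eulI_rec] in [a], since [eulJ] is minus the derivative of [eulI]; accordingly
    the primitive is minus the derivative in [a] of the one used there. *)
Lemma eulJ_rec a n : Cmult (RtoC (INR (S (S n)) * INR (S n))) (eulJ a n) =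
  Cplus (Cmult (Cminus (RtoC (INR (S (S n)) ^ 2)) (Cmult a a)) (eulJ a (S (S n))))
        (Cmult (Cmult (RtoC 2) a) (eulI a (S (S n)))).
Proof.
  unfold eulI, eulJ. rewrite <- !CInt_scal by (apply ccontR_ex; intros t; cont2; apply continuous_cos).
  apply Ceq_minus.
  rewrite <- CInt_plus by (apply ccontR_ex; intros t; cont2; apply continuous_cos).
  rewrite <- CInt_minus by (apply ccontR_ex; intros t; cont2; apply continuous_cos).
  set (N := INR (S (S n))).
  set (F := fun t => Copp (Cplus (Cplus (Cmult (RtoC N) (Cmult (Cmult (RtoC (cos t ^ S n)) (RtoC (sin t))) (Cmult (RtoC t) (csin (Cmult a (RtoC t))))))
      (Cmult (RtoC (cos t ^ S (S n))) (csin (Cmult a (RtoC t)))))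
      (Cmult a (Cmult (RtoC (cos t ^ S (S n))) (Cmult (RtoC t) (ccos (Cmult a (RtoC t)))))))).
  rewrite (CInt_FTC F).
  - unfold F. rewrite !cos_PI2, sin_0, !pow_i by lia. rewrite (Cmult_0_r a), csin_0. ring.
  - intros t _. unfold F. eapply is_derC_eq.
    + apply (@is_derive_opp R_AbsRing C_R_NormedModule). apply is_derC_Cplus; [apply is_derC_Cplus|].
      * apply (is_derC_Cmult (fun _ => RtoC N)); [apply is_derC_const|].
        apply is_derC_Cmult. apply is_derC_Cmult; [apply is_derC_cospow|apply is_derC_sin].
        apply is_derC_Cmult; [apply is_derC_id|apply is_derC_csin].
      * apply is_derC_Cmult; [apply is_derC_cospow|apply is_derC_csin].
      * apply (is_derC_Cmult (fun _ => a)); [apply is_derC_const|].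
        apply is_derC_Cmult; [apply is_derC_cospow|]. apply is_derC_Cmult; [apply is_derC_id|apply is_derC_ccos].
    + change (@opp C_R_NormedModule) with Copp. cbv beta. fold N.
      assert (HN : INR (S n) = N - 1) by (unfold N; rewrite (S_INR (S n)); ring). rewrite HN.
      generalize (ccos (Cmult a (RtoC t))) (csin (Cmult a (RtoC t))). intros cc ss.
      simpl pow. generalize (cos t ^ n). intros r. rewrite !RtoC_mult, !RtoC_opp, !RtoC_minus.
      pose proof (Csin2 t) as S2.
      rewrite ?RtoC_mult, ?RtoC_opp, ?RtoC_minus, ?RtoC_mult.
      set (c := RtoC (cos t)) in *. set (s := RtoC (sin t)) in *. set (M := RtoC N). set (q := RtoC r). set (tt := RtoC t).
      transitivity (Cplus (Cminus (Cmult (Cmult (Cmult M (Cminus M (RtoC 1))) (Cmult q (Cmult tt ss))) (Cmult s s)) (Cmult M (Cmult (Cmult c (Cmult c q)) (Cmult tt ss))))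
        (Cminus (Cmult (Cmult a a) (Cmult (Cmult tt ss) (Cmult c (Cmult c q)))) (Cmult (RtoC 2) (Cmult a (Cmult cc (Cmult c (Cmult c q))))))); [ring|]. rewrite S2. ring.
  - intros t _. cont2; apply continuous_cos.
Qed.

Lemma eulI_0 a : a <> RtoC 0 -> eulI a 0 = Cdiv (csin (Cmult a (RtoC (PI / 2)))) a.
Proof.
  intros Ha. unfold eulI. rewrite (CInt_FTC (fun t => Cmult (csin (Cmult a (RtoC t))) (Cinv a))).
  - rewrite (Cmult_0_r a), csin_0. unfold Cdiv. ring.
  - intros t _. eapply is_derC_eq; [apply (is_derC_Cmult _ (fun _ => Cinv a)); [apply is_derC_csin|apply is_derC_const]|].
    cbv beta. simpl pow. cfield.
  - intros t _. cont2; apply continuous_cos.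
Qed.

Lemma eulJ_0 a : a <> RtoC 0 -> eulJ a 0 =
  Cminus (Cdiv (csin (Cmult a (RtoC (PI / 2)))) (Cmult a a)) (Cdiv (Cmult (RtoC (PI / 2)) (ccos (Cmult a (RtoC (PI / 2))))) a).
Proof.
  intros Ha. unfold eulJ.
  rewrite (CInt_FTC (fun t => Cminus (Cmult (csin (Cmult a (RtoC t))) (Cinv (Cmult a a))) (Cmult (Cmult (RtoC t) (ccos (Cmult a (RtoC t)))) (Cinv a)))).
  - rewrite (Cmult_0_r a), csin_0. unfold Cdiv. ring.
  - intros t _. eapply is_derC_eq.
    + apply is_derC_Cminus; [apply (is_derC_Cmult _ (fun _ => Cinv (Cmult a a))); [apply is_derC_csin|apply is_derC_const]|].
      apply (is_derC_Cmult _ (fun _ => Cinv a)); [|apply is_derC_const]. apply is_derC_Cmult; [apply is_derC_id|apply is_derC_ccos].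
    + cbv beta. simpl pow. cfield.
  - intros t _. cont2; apply continuous_cos.
Qed.

Definition wallis (n : nat) : R := RInt (fun t => cos t ^ n) 0 (PI / 2).

Lemma wallis_ex n : ex_RInt (fun t => cos t ^ n) 0 (PI / 2).
Proof. apply (@ex_RInt_continuous R_CompleteNormedModule). intros t _. cont. apply continuous_cos. Qed.

Lemma wallis_eul n : eulI (RtoC 0) n = RtoC (wallis n).
Proof.
  unfold eulI, wallis. rewrite <- CInt_RtoC by apply wallis_ex. apply CInt_ext. intros. rewrite Cmult_0_l, ccos_0. ring.
Qed.

Lemma wallis_rec n : INR (S (S n)) * INR (S n) * wallis n = INR (S (S n)) ^ 2 * wallis (S (S n)).
Proof.
  pose proof (eulI_rec (RtoC 0) n) as H. rewrite !wallis_eul in H.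
  replace (Cminus (RtoC (INR (S (S n)) ^ 2)) (Cmult (RtoC 0) (RtoC 0))) with (RtoC (INR (S (S n)) ^ 2)) in H by ring.
  rewrite <- !RtoC_mult in H. apply (f_equal Re) in H. exact H.
Qed.

Lemma wallis_pos n : 0 < wallis (2 * n).
Proof.
  induction n.
  - unfold wallis. simpl. rewrite RInt_const. unfold scal; simpl; unfold mult; simpl. pose proof PI_RGT_0. lra.
  - replace (2 * S n)%nat with (S (S (2 * n))) by lia. pose proof (wallis_rec (2 * n)) as H.
    assert (0 < INR (S (S (2 * n)))) by (apply lt_0_INR; lia).
    assert (0 < INR (S (2 * n))) by (apply lt_0_INR; lia).
    apply Rmult_lt_reg_l with (INR (S (S (2 * n))) ^ 2); [apply pow_lt; auto|].
    rewrite Rmult_0_r, <- H. repeat apply Rmult_lt_0_compat; auto.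
Qed.

Lemma t_cos_le_sin t : 0 <= t <= PI / 2 -> t * cos t <= sin t.
Proof.
  intros Ht. set (f := fun t => sin t - t * cos t).
  assert (H : f 0 <= f t).
  { destruct (Req_dec t 0) as [->|Hn]; [lra|].
    destruct (MVT_gen f 0 t (fun t => t * sin t)) as [c [Hc1 Hc2]].
    - intros u _. unfold f. auto_derive; auto. ring.
    - intros u _. apply derivable_continuous_pt. exists (u * sin u). apply is_derive_Reals. unfold f. auto_derive; auto. ring.
    - rewrite Rmin_left, Rmax_right in Hc1 by lra. assert (0 <= sin c) by (apply sin_ge_0; pose proof PI_RGT_0; lra).
      assert (0 <= c * sin c * (t - 0)) by (repeat apply Rmult_le_pos; lra). lra. }
  unfold f in H. rewrite sin_0 in H. lra.
Qed.

(** From t cos t <= sin t follows t^2 cos^(n+2) t <= sin^2 t cos^n t = cos^n t - cos^(n+2) t. *)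
Lemma t2_wallis n : ex_RInt (fun t => t ^ 2 * cos t ^ S (S n)) 0 (PI / 2) /\
  RInt (fun t => t ^ 2 * cos t ^ S (S n)) 0 (PI / 2) <= wallis n - wallis (S (S n)).
Proof.
  assert (E : ex_RInt (fun t => t ^ 2 * cos t ^ S (S n)) 0 (PI / 2)).
  { apply (@ex_RInt_continuous R_CompleteNormedModule). intros t _. cont. apply continuous_cos. }
  split; [exact E|]. unfold wallis.
  pose proof (@RInt_minus R_CompleteNormedModule (fun t => cos t ^ n) (fun t => cos t ^ S (S n)) 0 (PI / 2) (wallis_ex _) (wallis_ex _)) as M.
  change (RInt (fun t => cos t ^ n - cos t ^ S (S n)) 0 (PI / 2) = RInt (fun t => cos t ^ n) 0 (PI / 2) - RInt (fun t => cos t ^ S (S n)) 0 (PI / 2)) in M.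
  rewrite <- M. apply RInt_le; [pose proof PI_RGT_0; lra|exact E| |].
  - apply (@ex_RInt_minus R_NormedModule); apply wallis_ex.
  - intros t Ht. assert (0 <= cos t) by (apply cos_ge_0; lra).
    assert (T := t_cos_le_sin t ltac:(lra)). assert (0 <= cos t ^ n) by (apply pow_le; auto).
    assert (T2 : (t * cos t) ^ 2 <= sin t ^ 2) by (apply pow_incr; split; [nra|auto]).
    pose proof (sin2_cos2 t) as S. unfold Rsqr in S. simpl pow in *. nra.
Qed.

(** Both t sin (a t) and cos (a t) - 1 are bounded by a constant times t^2 on [0, pi / 2], so
    [t2_wallis] applies to both. The right-hand side is small compared with [wallis] itself, which
    forces the ratio of [eulJ] to [eulI] to 0. *)
Lemma eul_ratio_bound (a : C) : exists K, 0 <= K /\ forall n,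
  Cmod (eulJ a (S (S n))) <= K * (wallis n - wallis (S (S n))) /\
  Cmod (Cminus (eulI a (S (S n))) (RtoC (wallis (S (S n))))) <= K * (wallis n - wallis (S (S n))).
Proof.
  set (m := Cmod a). assert (Hm : 0 <= m) by apply Cmod_ge_0.
  pose proof PI_RGT_0 as HP. pose proof PI_4 as HP4.
  set (E := exp (m * 2)). assert (HE : 0 < E) by apply exp_pos.
  assert (HA : forall t, 0 <= t <= PI / 2 -> Cmod (Cmult a (RtoC t)) = m * t /\ exp (m * t) <= E).
  { intros t Ht. rewrite Cmod_mult, Cmod_R, Rabs_pos_eq by lra. split; auto. apply exp_le. apply Rmult_le_compat_l; lra. }
  assert (Ex : forall n c, ex_RInt (fun t => c * (t ^ 2 * cos t ^ S (S n))) 0 (PI / 2)).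
  { intros. apply (@ex_RInt_scal R_NormedModule). apply t2_wallis. }
  assert (Sc : forall n c, RInt (fun t => c * (t ^ 2 * cos t ^ S (S n))) 0 (PI / 2) = c * RInt (fun t => t ^ 2 * cos t ^ S (S n)) 0 (PI / 2)).
  { intros. apply (@RInt_scal R_CompleteNormedModule). apply t2_wallis. }
  exists (m * E + m ^ 2 * E). split; [nra|]. intros n. destruct (t2_wallis n) as [E1 E2].
  assert (P0 : 0 <= RInt (fun t => t ^ 2 * cos t ^ S (S n)) 0 (PI / 2)).
  { apply RInt_ge_0; auto; [lra|]. intros t Ht. apply Rmult_le_pos; [apply pow2_ge_0|apply pow_le, cos_ge_0; lra]. }
  assert (PW : 0 <= wallis n - wallis (S (S n))) by lra.
  assert (Hm2 : 0 <= m ^ 2 * E) by (apply Rmult_le_pos; [apply pow2_ge_0|lra]).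
  assert (Hm1 : 0 <= m * E) by nra.
  split.
  - apply Rle_trans with (m * E * (wallis n - wallis (S (S n)))); [|apply Rmult_le_compat_r; lra].
    eapply Rle_trans; [apply (Cmod_CInt_le _ (fun t => (m * E) * (t ^ 2 * cos t ^ S (S n)))); [lra|apply eulJ_ex|apply Ex|]|].
    + intros t Ht. destruct (HA t Ht) as [A1 A2]. rewrite !Cmod_mult, !Cmod_R.
      assert (0 <= cos t) by (apply cos_ge_0; lra).
      rewrite (Rabs_pos_eq t), (Rabs_pos_eq (cos t ^ _)) by (try apply pow_le; lra).
      assert (B := Cmod_csin_le (Cmult a (RtoC t))). rewrite A1 in B.
      assert (m * t * exp (m * t) <= m * t * E) by (apply Rmult_le_compat_l; [nra|auto]).
      replace (m * E * (t ^ 2 * cos t ^ S (S n))) with (t * (m * t * E) * cos t ^ S (S n)) by ring.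
      apply Rmult_le_compat_r; [apply pow_le; auto|]. apply Rmult_le_compat_l; lra.
    + rewrite Sc. apply Rmult_le_compat_l; auto.
  - apply Rle_trans with (m ^ 2 * E * (wallis n - wallis (S (S n)))); [|apply Rmult_le_compat_r; lra].
    rewrite <- wallis_eul. unfold eulI. rewrite <- CInt_minus by apply eulI_ex.
    eapply Rle_trans; [apply (Cmod_CInt_le _ (fun t => (m ^ 2 * E) * (t ^ 2 * cos t ^ S (S n)))); [lra| |apply Ex|]|].
    + apply (@ex_RInt_minus C_R_NormedModule); apply eulI_ex.
    + intros t Ht. destruct (HA t Ht) as [A1 A2]. rewrite Cmult_0_l, ccos_0.
      replace (Cminus (Cmult (ccos (Cmult a (RtoC t))) (RtoC (cos t ^ S (S n)))) (Cmult (RtoC 1) (RtoC (cos t ^ S (S n)))))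
        with (Cmult (Cminus (ccos (Cmult a (RtoC t))) (RtoC 1)) (RtoC (cos t ^ S (S n)))) by ring.
      assert (0 <= cos t) by (apply cos_ge_0; lra).
      rewrite Cmod_mult, Cmod_R, (Rabs_pos_eq (cos t ^ _)) by (try apply pow_le; lra).
      assert (B := Cmod_ccos_minus_1_le (Cmult a (RtoC t))). rewrite A1 in B.
      assert ((m * t) ^ 2 * exp (m * t) <= (m * t) ^ 2 * E) by (apply Rmult_le_compat_l; [apply pow2_ge_0|auto]).
      replace (m ^ 2 * E * (t ^ 2 * cos t ^ S (S n))) with ((m * t) ^ 2 * E * cos t ^ S (S n)) by ring.
      apply Rmult_le_compat_r; [apply pow_le; auto|]. lra.
    + rewrite Sc. apply Rmult_le_compat_l; auto.
Qed.

Definition ccot (z : C) : C := Cdiv (ccos z) (csin z).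

(** With a = 2 z and the even indices, dividing the recursion of [eulJ] by that of [eulI] shows that
    the ratio J / I drops by z / ((k + 1)^2 - z^2) from 2 k to 2 k + 2. The sum telescopes from the
    explicit ratio at index 0, half of 1 / z - pi cot (pi z), down to the limit 0. *)
Lemma cot_expansion (z : C) : z <> RtoC 0 -> csin (Cmult (RtoC PI) z) <> RtoC 0 ->
  (forall k : nat, Cmult z z <> RtoC (INR (S k) ^ 2)) ->
  cser (fun k => Cdiv (Cmult (RtoC 2) z) (Cminus (RtoC (INR (S k) ^ 2)) (Cmult z z)))
       (Cminus (Cinv z) (Cmult (RtoC PI) (ccot (Cmult (RtoC PI) z)))).
Proof.
  intros Hz Hs Hk. set (a := Cmult (RtoC 2) z).
  assert (Ha : a <> RtoC 0) by (apply Cmult_neq_0; auto; apply C2_neq).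
  assert (Ea : Cmult a (RtoC (PI / 2)) = Cmult (RtoC PI) z).
  { unfold a. rewrite RtoC_div by lra. cfield. }
  assert (HD : forall k, Cminus (RtoC (INR (S k) ^ 2)) (Cmult z z) <> RtoC 0).
  { intros k E. apply (Hk k). symmetry. apply Ceq_minus. auto. }
  assert (Hn2 : forall k, Cminus (RtoC (INR (2 * S k) ^ 2)) (Cmult a a) = Cmult (RtoC 4) (Cminus (RtoC (INR (S k) ^ 2)) (Cmult z z))).
  { intros k. unfold a. replace (INR (2 * S k) ^ 2) with (4 * INR (S k) ^ 2) by (rewrite mult_INR; simpl (INR 2); ring).
    rewrite RtoC_mult. replace (RtoC 4) with (Cmult (RtoC 2) (RtoC 2)) by (rewrite <- RtoC_mult; f_equal; ring). ring. }
  assert (C4 : RtoC 4 <> RtoC 0) by (apply RtoC_neq; lra).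
  assert (NZ : forall k, eulI a (2 * k) <> RtoC 0).
  { induction k.
    - simpl. rewrite eulI_0, Ea by auto. unfold Cdiv. apply Cmult_neq_0; auto. apply Cinv_neq_0; auto.
    - replace (2 * S k)%nat with (S (S (2 * k))) by lia. intros E. pose proof (eulI_rec a (2 * k)) as H.
      rewrite E, Cmult_0_r in H. revert H. apply Cmult_neq_0; auto. apply RtoC_neq.
      apply Rgt_not_eq, Rmult_lt_0_compat; apply lt_0_INR; lia. }
  assert (Step : forall k, Cdiv (eulJ a (2 * k)) (eulI a (2 * k)) =
     Cplus (Cdiv (eulJ a (2 * S k)) (eulI a (2 * S k))) (Cdiv z (Cminus (RtoC (INR (S k) ^ 2)) (Cmult z z)))).
  { intros k. pose proof (eulI_rec a (2 * k)) as H1. pose proof (eulJ_rec a (2 * k)) as H2.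
    replace (S (S (2 * k))) with (2 * S k)%nat in H1, H2 by lia.
    rewrite Hn2 in H1, H2.
    set (c := RtoC (INR (2 * S k) * INR (S (2 * k)))) in *.
    assert (Hc : c <> RtoC 0) by (apply RtoC_neq, Rgt_not_eq, Rmult_lt_0_compat; apply lt_0_INR; lia).
    specialize (HD k). set (D := Cminus _ _) in *. pose proof (NZ k) as N1. pose proof (NZ (S k)) as N2.
    set (I0 := eulI a (2 * k)) in *. set (I1 := eulI a (2 * S k)) in *. set (J0 := eulJ a (2 * k)) in *. set (J1 := eulJ a (2 * S k)) in *.
    replace (Cdiv J0 I0) with (Cdiv (Cmult c J0) (Cmult c I0)) by (field; auto).
    rewrite H1, H2. unfold a. replace (RtoC 4) with (Cmult (RtoC 2) (RtoC 2)) by (rewrite <- RtoC_mult; f_equal; ring).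
    cfield. }
  assert (Sum : forall K, Cdiv (eulJ a 0) (eulI a 0) = Cplus (Cdiv (eulJ a (2 * K)) (eulI a (2 * K)))
      (csum (fun k => Cdiv z (Cminus (RtoC (INR (S k) ^ 2)) (Cmult z z))) K)).
  { induction K; [change (2 * 0)%nat with O; cbn [csum]; ring|]. cbn [csum]. rewrite IHK, Step. ring. }
  assert (Base : Cmult (RtoC 2) (Cdiv (eulJ a 0) (eulI a 0)) = Cminus (Cinv z) (Cmult (RtoC PI) (ccot (Cmult (RtoC PI) z)))).
  { rewrite eulI_0, eulJ_0, Ea by auto. unfold ccot, a. rewrite RtoC_div by lra. cfield. }
  rewrite <- Base.
  destruct (eul_ratio_bound a) as [K [HK HB]].
  assert (HW : forall n, wallis (2 * n) - wallis (2 * S n) = wallis (2 * S n) / INR (S (2 * n))).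
  { intros n. pose proof (wallis_rec (2 * n)) as H. replace (S (S (2 * n))) with (2 * S n)%nat in H by lia.
    assert (0 < INR (2 * S n)) by (apply lt_0_INR; lia). assert (0 < INR (S (2 * n))) by (apply lt_0_INR; lia).
    assert (E : INR (2 * S n) = INR (S (2 * n)) + 1) by (rewrite <- S_INR; f_equal; lia).
    assert (W0 : wallis (2 * n) = INR (2 * S n) * wallis (2 * S n) / INR (S (2 * n))).
    { apply Rmult_eq_reg_l with (INR (2 * S n) * INR (S (2 * n))); [rewrite H; field; lra|nra]. }
    rewrite W0, E. field. lra. }
  assert (L0 : clim (fun n => Cdiv (eulJ a (2 * n)) (eulI a (2 * n))) (RtoC 0)).
  (* By [HW] the error bound is K W / i with i = 2 n + 1. An index i above 2 K gives |I| >= W / 2,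
     and i above 2 K / eps makes |J| < eps W / 2. *)
  { intros eps Heps. destruct (nfloor_ex (2 * K + 2 * K / eps)) as [n0 [_ Hn0]].
    { apply Rplus_le_le_0_compat; [lra|apply Rdiv_le_0_compat; lra]. }
    exists (S (S n0)). intros n Hn. destruct n as [|n]; [lia|].
    destruct (HB (2 * n)%nat) as [B1 B2]. replace (S (S (2 * n))) with (2 * S n)%nat in B1, B2 by lia.
    rewrite HW in B1, B2. pose proof (wallis_pos (S n)) as WP. set (W := wallis (2 * S n)) in *.
    assert (Hi : 2 * K + 2 * K / eps < INR (S (2 * n))).
    { eapply Rlt_le_trans; [exact Hn0|]. rewrite <- S_INR. apply le_INR. lia. }
    set (i := INR (S (2 * n))) in *. assert (0 <= 2 * K / eps) by (apply Rdiv_le_0_compat; lra).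
    assert (Pi : 0 < i) by lra.
    assert (Q1 : K * (W / i) <= W / 2).
    { apply Rmult_le_reg_r with (2 * i); [lra|]. field_simplify; [|lra]. nra. }
    assert (Q2 : Cmod (eulI a (2 * S n)) >= W / 2).
    { pose proof (Cmod_triangle_minus (RtoC W) (Cminus (RtoC W) (eulI a (2 * S n)))) as T.
      replace (Cminus (RtoC W) (Cminus (RtoC W) (eulI a (2 * S n)))) with (eulI a (2 * S n)) in T by ring.
      pose proof (Cmod_triangle_minus (eulI a (2 * S n)) (Cminus (eulI a (2 * S n)) (RtoC W))) as T2.
      replace (Cminus (eulI a (2 * S n)) (Cminus (eulI a (2 * S n)) (RtoC W))) with (RtoC W) in T2 by ring.
      rewrite (Cmod_R W), Rabs_pos_eq in T2 by lra. lra. }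
    replace (Cminus (Cdiv (eulJ a (2 * S n)) (eulI a (2 * S n))) (RtoC 0)) with (Cdiv (eulJ a (2 * S n)) (eulI a (2 * S n))) by ring.
    rewrite Cmod_div by auto. set (I := Cmod (eulI a (2 * S n))) in *. set (J := Cmod (eulJ a (2 * S n))) in *.
    apply Rmult_lt_reg_r with I; [lra|]. unfold Rdiv. rewrite Rmult_assoc, Rinv_l, Rmult_1_r by lra.
    apply Rle_lt_trans with (K * (W / i)); [exact B1|]. apply Rlt_le_trans with (eps * (W / 2)); [|apply Rmult_le_compat_l; lra].
    apply Rmult_lt_reg_r with (2 * i / W); [apply Rdiv_lt_0_compat; lra|]. field_simplify; [|lra|lra].
    apply Rmult_lt_reg_r with (/ eps); [apply Rinv_0_lt_compat; auto|]. field_simplify; [|lra|lra]. lra. }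
  unfold cser. apply clim_ext with (fun n => Cmult (RtoC 2) (Cminus (Cdiv (eulJ a 0) (eulI a 0)) (Cdiv (eulJ a (2 * n)) (eulI a (2 * n))))).
  - intros n. rewrite (Sum n).
    assert (E : csum (fun k => Cdiv a (Cminus (RtoC (INR (S k) ^ 2)) (Cmult z z))) n =
      Cmult (RtoC 2) (csum (fun k => Cdiv z (Cminus (RtoC (INR (S k) ^ 2)) (Cmult z z))) n)).
    { rewrite <- csum_scal. apply csum_ext. intros k. unfold a, Cdiv. ring. }
    rewrite E. ring.
  - apply clim_scal. replace (Cdiv (eulJ a 0) (eulI a 0)) with (Cminus (Cdiv (eulJ a 0) (eulI a 0)) (RtoC 0)) at 1 by ring.
    apply clim_minus; [apply clim_const|exact L0].
Qed.

(** * Integrals over the real line of continuous functions with exponential decay *)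

Definition edecay (f : R -> C) (K d : R) : Prop := forall y, Cmod (f y) <= K * exp (- d * Rabs y).

(** The class of admissible integrands. It is stable under sums, scalar multiples and translations,
    and [mdec] below expresses membership for a Mellin integrand. *)
Definition good (f : R -> C) : Prop := ccontR f /\ exists K d, 0 < d /\ edecay f K d.

(** The two ends go to infinity independently, which makes invariance under translation
    immediate. *)
Definition is_int (f : R -> C) (I : C) : Prop :=
  forall eps, 0 < eps -> exists T, forall a b, T < a -> T < b -> Cmod (Cminus (CInt f (- a) b) I) < eps.

Definition Int (f : R -> C) : C := epsilon (inhabits (RtoC 0)) (is_int f).

Lemma edecay_nonneg f K d : edecay f K d -> 0 <= K.
Proof.
  intros H. specialize (H 0). pose proof (Cmod_ge_0 (f 0)). rewrite Rabs_R0, Rmult_0_r, exp_0 in H. lra.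
Qed.

Lemma RInt_exp_decay K d a b : 0 < d ->
  is_RInt (fun y => K * exp (- d * y)) a b (K / d * (exp (- d * a) - exp (- d * b))).
Proof.
  intros Hd. replace (K / d * (exp (- d * a) - exp (- d * b)))
    with (minus (- (K / d) * exp (- d * b)) (- (K / d) * exp (- d * a))) by (unfold minus, plus, opp; simpl; ring).
  apply (@is_RInt_derive R_CompleteNormedModule (fun y => - (K / d) * exp (- d * y))).
  - intros y _. auto_derive; auto. field. lra.
  - intros y _. cont.
Qed.

Lemma CInt_tail_pos f K d a b : ccontR f -> 0 < d -> edecay f K d -> 0 <= a <= b ->
  Cmod (CInt f a b) <= K / d * exp (- d * a).
Proof.
  intros Hc Hd H Hab. pose proof (edecay_nonneg _ _ _ H) as HK.
  eapply Rle_trans.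
  - apply (Cmod_CInt_le f (fun y => K * exp (- d * y))); [lra|apply ccontR_ex; auto|eexists; apply RInt_exp_decay; auto|].
    intros t Ht. specialize (H t). rewrite Rabs_pos_eq in H by lra. exact H.
  - rewrite (is_RInt_unique _ _ _ _ (RInt_exp_decay K d a b Hd)).
    apply Rmult_le_compat_l; [apply Rdiv_le_0_compat; auto|]. pose proof (exp_pos (- d * b)). lra.
Qed.

Lemma ccontR_neg f : ccontR f -> ccontR (fun y => f (- y)).
Proof. intros H t. apply (@continuous_comp R_UniformSpace R_UniformSpace C_R_NormedModule Ropp f t); [cont|apply H]. Qed.

Lemma ccontR_shift f v : ccontR f -> ccontR (fun y => f (y + v)).
Proof. intros H t. apply (@continuous_comp R_UniformSpace R_UniformSpace C_R_NormedModule (fun y => y + v) f t); [cont|apply H]. Qed.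

Lemma edecay_neg f K d : edecay f K d -> edecay (fun y => f (- y)) K d.
Proof. intros H y. specialize (H (- y)). rewrite Rabs_Ropp in H. exact H. Qed.

Lemma CInt_tail_neg f K d a b : ccontR f -> 0 < d -> edecay f K d -> 0 <= a <= b ->
  Cmod (CInt f (- b) (- a)) <= K / d * exp (- d * a).
Proof.
  intros Hc Hd H Hab. rewrite <- CInt_neg by auto. apply CInt_tail_pos; auto.
  - apply ccontR_neg; auto.
  - apply edecay_neg; auto.
Qed.

Lemma CInt_tails f K d T a b : ccontR f -> 0 < d -> edecay f K d -> 0 <= T -> T <= a -> T <= b ->
  Cmod (Cminus (CInt f (- a) b) (CInt f (- T) T)) <= 2 * (K / d) * exp (- d * T).
Proof.
  intros Hc Hd H HT Ha Hb.
  rewrite (CInt_Chasles f (- a) (- T) b), (CInt_Chasles f (- T) T b) by (apply ccontR_ex; auto).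
  replace (Cminus _ _) with (Cplus (CInt f (- a) (- T)) (CInt f T b)) by ring.
  eapply Rle_trans; [apply Cmod_triangle|].
  pose proof (CInt_tail_neg f K d T a Hc Hd H ltac:(lra)). pose proof (CInt_tail_pos f K d T b Hc Hd H ltac:(lra)). lra.
Qed.

Lemma exp_small (K d eps : R) : 0 < d -> 0 < eps -> exists T, 0 <= T /\ forall t, T <= t -> K * exp (- d * t) < eps.
Proof.
  intros Hd He. set (K' := Rabs K + 1). assert (HK : 0 < K') by (unfold K'; pose proof (Rabs_pos K); lra).
  exists (Rmax 0 (ln (K' / eps) / d)). split; [apply Rmax_l|]. intros t Ht.
  assert (ln (K' / eps) / d <= t) by (eapply Rle_trans; [apply Rmax_r|exact Ht]).
  assert (Hl : ln (K' / eps) <= d * t).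
  { apply Rmult_le_reg_r with (/ d); [apply Rinv_0_lt_compat; auto|]. replace (d * t * / d) with t by (field; lra). exact H. }
  assert (E : exp (- d * t) <= eps / K').
  { replace (eps / K') with (exp (- ln (K' / eps))).
    - apply exp_le. lra.
    - rewrite exp_Ropp, exp_ln by (apply Rdiv_lt_0_compat; auto). field. lra. }
  pose proof (exp_pos (- d * t)).
  apply Rle_lt_trans with (Rabs K * exp (- d * t)); [apply Rmult_le_compat_r; [lra|apply Rle_abs]|].
  apply Rlt_le_trans with (K' * exp (- d * t)); [apply Rmult_lt_compat_r; [auto|unfold K'; lra]|].
  apply Rmult_le_compat_l with (r := K') in E; [|lra]. replace (K' * (eps / K')) with eps in E by (field; lra). exact E.
Qed.

Lemma good_int f : good f -> exists I, is_int f I.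
Proof.
  intros [Hc [K [d [Hd H]]]].
  destruct (clim_Cauchy (fun n => CInt f (- INR n) (INR n))) as [I HI].
  - intros eps Heps. destruct (exp_small (2 * (K / d)) d (eps / 2) Hd) as [T [HT0 HT]]; [lra|].
    destruct (nfloor_ex T HT0) as [n0 [_ Hn0]]. exists (S n0).
    assert (B : forall n, (S n0 <= n)%nat -> Cmod (Cminus (CInt f (- INR n) (INR n)) (CInt f (- T) T)) < eps / 2).
    { intros n Hn. assert (T <= INR n) by (apply le_INR in Hn; rewrite S_INR in Hn; lra).
      eapply Rle_lt_trans; [apply CInt_tails with (K := K) (d := d); auto|]. apply HT. lra. }
    intros n m Hn Hm. pose proof (B n Hn). pose proof (B m Hm).
    replace (Cminus (CInt f (- INR m) (INR m)) (CInt f (- INR n) (INR n))) with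
      (Cminus (Cminus (CInt f (- INR m) (INR m)) (CInt f (- T) T)) (Cminus (CInt f (- INR n) (INR n)) (CInt f (- T) T))) by ring.
    eapply Rle_lt_trans; [apply Cmod_triangle_minus|]. lra.
  - exists I. intros eps Heps. destruct (exp_small (2 * (K / d)) d (eps / 3) Hd) as [T [HT0 HT]]; [lra|].
    exists T. intros a b Ha Hb. destruct (HI (eps / 3)) as [N HN]; [lra|].
    destruct (nfloor_ex T HT0) as [n0 [_ Hn0]].
    set (n := (N + S n0)%nat). specialize (HN n ltac:(unfold n; lia)).
    assert (T <= INR n) by (unfold n; rewrite plus_INR, S_INR; pose proof (pos_INR N); lra).
    pose proof (CInt_tails f K d T a b Hc Hd H HT0 ltac:(lra) ltac:(lra)) as B1.
    pose proof (CInt_tails f K d T (INR n) (INR n) Hc Hd H HT0 ltac:(lra) ltac:(lra)) as B2.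
    specialize (HT T (Rle_refl _)).
    replace (Cminus (CInt f (- a) b) I) with (Cplus (Cminus (Cminus (CInt f (- a) b) (CInt f (- T) T))
      (Cminus (CInt f (- INR n) (INR n)) (CInt f (- T) T))) (Cminus (CInt f (- INR n) (INR n)) I)) by ring.
    eapply Rle_lt_trans; [apply Cmod_triangle|].
    match goal with |- Cmod (Cminus ?a ?b) + _ < _ => pose proof (Cmod_triangle_minus a b) end. lra.
Qed.

Lemma Int_spec f : good f -> is_int f (Int f).
Proof. intros H. unfold Int. apply epsilon_spec. apply good_int; auto. Qed.

Lemma is_int_unique f I J : is_int f I -> is_int f J -> I = J.
Proof.
  intros H1 H2. apply Cmod_eq_intro. intros eps Heps.
  destruct (H1 (eps / 2)) as [T HT]; [lra|]. destruct (H2 (eps / 2)) as [T' HT']; [lra|].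
  set (a := Rmax T T' + 1). assert (T < a /\ T' < a) as [h1 h2].
  { unfold a. pose proof (Rmax_l T T'). pose proof (Rmax_r T T'). lra. }
  specialize (HT a a h1 h1). specialize (HT' a a h2 h2).
  replace (Cminus I J) with (Cminus (Cminus (CInt f (- a) a) J) (Cminus (CInt f (- a) a) I)) by ring.
  eapply Rle_trans; [apply Cmod_triangle_minus|]. lra.
Qed.

Lemma Int_unique f I : is_int f I -> Int f = I.
Proof.
  intros H. apply (is_int_unique f); auto. unfold Int. apply epsilon_spec. exists I; auto.
Qed.

Lemma Int_ext f g : (forall y, f y = g y) -> Int f = Int g.
Proof.
  intros E. f_equal. apply FunctionalExtensionality.functional_extensionality. exact E.
Qed.

Lemma is_int_plus f g I J : ccontR f -> ccontR g -> is_int f I -> is_int g J -> is_int (fun y => Cplus (f y) (g y)) (Cplus I J).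
Proof.
  intros Cf Cg H1 H2 eps Heps. destruct (H1 (eps / 2)) as [T HT]; [lra|]. destruct (H2 (eps / 2)) as [T' HT']; [lra|].
  exists (Rmax T T'). intros a b Ha Hb. pose proof (Rmax_l T T'). pose proof (Rmax_r T T').
  specialize (HT a b ltac:(lra) ltac:(lra)). specialize (HT' a b ltac:(lra) ltac:(lra)).
  rewrite CInt_plus by (apply ccontR_ex; auto).
  replace (Cminus _ _) with (Cplus (Cminus (CInt f (- a) b) I) (Cminus (CInt g (- a) b) J)) by ring.
  eapply Rle_lt_trans; [apply Cmod_triangle|]. lra.
Qed.

Lemma is_int_scal c f I : ccontR f -> is_int f I -> is_int (fun y => Cmult c (f y)) (Cmult c I).
Proof.
  intros Cf H eps Heps. pose proof (Cmod_ge_0 c). destruct (H (eps / (Cmod c + 1))) as [T HT]; [apply Rdiv_lt_0_compat; lra|].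
  exists T. intros a b Ha Hb. specialize (HT a b Ha Hb). rewrite CInt_scal by (apply ccontR_ex; auto).
  replace (Cminus _ _) with (Cmult c (Cminus (CInt f (- a) b) I)) by ring. rewrite Cmod_mult.
  apply Rle_lt_trans with (Cmod c * (eps / (Cmod c + 1))); [apply Rmult_le_compat_l; lra|].
  apply Rmult_lt_reg_r with (Cmod c + 1); [lra|]. field_simplify; [|lra]. nra.
Qed.

Lemma is_int_shift f v I : ccontR f -> is_int f I -> is_int (fun y => f (y + v)) I.
Proof.
  intros Cf H eps Heps. destruct (H eps Heps) as [T HT]. exists (T + Rabs v). intros a b Ha Hb.
  rewrite CInt_shift by auto. replace (- a + v) with (- (a - v)) by ring.
  apply HT; unfold Rabs in *; destruct (Rcase_abs v); lra.
Qed.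

Lemma edecay_weaken f K d d' : edecay f K d -> d' <= d -> edecay f K d'.
Proof.
  intros H Hd y. eapply Rle_trans; [apply H|]. apply Rmult_le_compat_l; [eapply edecay_nonneg; eauto|].
  apply exp_le. pose proof (Rabs_pos y). nra.
Qed.

Lemma good_plus f g : good f -> good g -> good (fun y => Cplus (f y) (g y)).
Proof.
  intros [Cf [K [d [Hd H]]]] [Cg [K' [d' [Hd' H']]]]. split; [intros t; cont; auto|].
  exists (K + K'), (Rmin d d'). split; [apply Rmin_pos; auto|]. intros y.
  eapply Rle_trans; [apply Cmod_triangle|]. rewrite Rmult_plus_distr_r. apply Rplus_le_compat.
  - apply (edecay_weaken f K d); auto. apply Rmin_l.
  - apply (edecay_weaken g K' d'); auto. apply Rmin_r.
Qed.

Lemma good_scal c f : good f -> good (fun y => Cmult c (f y)).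
Proof.
  intros [Cf [K [d [Hd H]]]]. split; [intros t; cont; auto|]. exists (Cmod c * K), d. split; auto. intros y.
  rewrite Cmod_mult, Rmult_assoc. apply Rmult_le_compat_l; [apply Cmod_ge_0|apply H].
Qed.

Lemma good_ext f g : (forall y, f y = g y) -> good f -> good g.
Proof.
  intros E H. replace g with f; auto. apply FunctionalExtensionality.functional_extensionality. exact E.
Qed.

Lemma good_minus f g : good f -> good g -> good (fun y => Cminus (f y) (g y)).
Proof.
  intros Hf Hg. apply good_ext with (fun y => Cplus (f y) (Cmult (RtoC (-1)) (g y))).
  - intros; apply Ceq_pair; cri; ring.
  - apply good_plus; auto. apply good_scal; auto.
Qed.

Lemma good_shift f v : good f -> good (fun y => f (y + v)).
Proof.
  intros [Cf [K [d [Hd H]]]]. split; [apply ccontR_shift; auto|].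
  exists (K * exp (d * Rabs v)), d. split; auto. intros y. eapply Rle_trans; [apply H|].
  rewrite Rmult_assoc, <- exp_plus. apply Rmult_le_compat_l; [eapply edecay_nonneg; eauto|]. apply exp_le.
  assert (Rabs y <= Rabs (y + v) + Rabs v).
  { replace y with ((y + v) + - v) at 1 by ring. eapply Rle_trans; [apply Rabs_triang|]. rewrite Rabs_Ropp. lra. }
  nra.
Qed.

Lemma Int_plus f g : good f -> good g -> Int (fun y => Cplus (f y) (g y)) = Cplus (Int f) (Int g).
Proof. intros Hf Hg. apply Int_unique. apply is_int_plus; try apply Int_spec; auto; [apply Hf|apply Hg]. Qed.
Lemma Int_scal c f : good f -> Int (fun y => Cmult c (f y)) = Cmult c (Int f).
Proof. intros Hf. apply Int_unique. apply is_int_scal; try apply Int_spec; auto; apply Hf. Qed.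
Lemma Int_minus f g : good f -> good g -> Int (fun y => Cminus (f y) (g y)) = Cminus (Int f) (Int g).
Proof.
  intros Hf Hg. rewrite (Int_ext _ (fun y => Cplus (f y) (Cmult (RtoC (-1)) (g y)))).
  - rewrite Int_plus, Int_scal; auto; [apply Ceq_pair; cri; ring|apply good_scal; auto].
  - intros; apply Ceq_pair; cri; ring.
Qed.
Lemma Int_shift f v : good f -> Int (fun y => f (y + v)) = Int f.
Proof. intros Hf. apply Int_unique. apply is_int_shift; try apply Int_spec; auto; apply Hf. Qed.

Lemma Cmod_Int_le f K d : ccontR f -> 0 < d -> edecay f K d -> Cmod (Int f) <= 2 * (K / d).
Proof.
  intros Hc Hd H. assert (G : good f) by (split; auto; exists K, d; auto).
  apply le_epsilon. intros eps Heps. destruct (Int_spec f G eps Heps) as [T HT].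
  set (a := Rmax T 0 + 1). assert (T < a /\ 0 < a) as [h1 h2].
  { unfold a. pose proof (Rmax_l T 0). pose proof (Rmax_r T 0). lra. }
  specialize (HT a a h1 h1). rewrite Cmod_minus_sym in HT.
  pose proof (CInt_tails f K d 0 a a Hc Hd H (Rle_refl _) ltac:(lra) ltac:(lra)) as B.
  rewrite Rmult_0_r, exp_0, Ropp_0 in B.
  assert (Z : CInt f 0 0 = RtoC 0) by (apply (@RInt_point CR)). rewrite Z in B.
  replace (Int f) with (Cplus (Cminus (Int f) (CInt f (- a) a)) (Cminus (CInt f (- a) a) (RtoC 0))) by ring.
  eapply Rle_trans; [apply Cmod_triangle|]. lra.
Qed.

Lemma csum_good f n : (forall k, good (f k)) -> good (fun y => csum (fun k => f k y) n).
Proof.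
  intros H. induction n; cbn [csum].
  - split; [intros t; apply continuous_Cconst|]. exists 0, 1. split; [lra|]. intros y. rewrite Cmod_0. lra.
  - apply good_plus; auto.
Qed.

Lemma Int_csum f n : (forall k, good (f k)) -> Int (fun y => csum (fun k => f k y) n) = csum (fun k => Int (f k)) n.
Proof.
  intros H. induction n; cbn [csum].
  - apply Int_unique. intros eps Heps. exists 0. intros. rewrite CInt_const.
    replace (Cminus _ _) with (RtoC 0) by ring. rewrite Cmod_0. auto.
  - rewrite Int_plus; auto; [rewrite IHn; auto|apply csum_good; auto].
Qed.

(** As all terms share the rate [d], the remainder of the series decays at that rate with the
    constant [B - rsum c n], and [Cmod_Int_le] turns this into a small integral. Every exchange of
    sum and integral over the line goes through this lemma. *)
Lemma cser_Int (f : nat -> R -> C) (F : R -> C) (c : nat -> R) d :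
  0 < d -> (forall n, ccontR (f n)) -> (forall n, edecay (f n) (c n) d) -> summable c ->
  ccontR F -> (forall y, cser (fun n => f n y) (F y)) ->
  good F /\ cser (fun n => Int (f n)) (Int F).
Proof.
  intros Hd Cf Hf Hc CF HF. destruct (summable_lim c Hc) as [B [HB0 [HB1 HB2]]].
  assert (Gf : forall n, good (f n)) by (intros n; split; auto; exists (c n), d; auto).
  assert (T : forall n y, Cmod (Cminus (F y) (csum (fun k => f k y) n)) <= (B - rsum c n) * exp (- d * Rabs y)).
  { intros n y. rewrite Rmult_minus_distr_r, (Rmult_comm (rsum c n)), <- rsum_scal.
    rewrite (Rmult_comm B). apply (cser_tail (fun k => f k y) (fun k => exp (- d * Rabs y) * c k) (F y) n (exp (- d * Rabs y) * B)).
    - intros k. rewrite Rmult_comm. apply Hf.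
    - apply HF.
    - intros m. rewrite rsum_scal. apply Rmult_le_compat_l; [left; apply exp_pos|auto]. }
  assert (GF : good F).
  { split; auto. exists B, d. split; auto. intros y. specialize (T O y). cbn [csum rsum] in T.
    replace (Cminus (F y) (RtoC 0)) with (F y) in T by ring. rewrite Rminus_0_r in T. exact T. }
  split; [exact GF|]. intros eps Heps. destruct (HB2 (eps * d / 2)) as [N HN]; [nra|]. exists N. intros n Hn.
  rewrite <- Int_csum by auto. rewrite Cmod_minus_sym, <- Int_minus by (auto; apply csum_good; auto).
  eapply Rle_lt_trans; [apply (Cmod_Int_le _ (B - rsum c n) d)|]; auto.
  - intros t. apply continuous_Cminus; [apply CF|]. apply csum_good; auto.
  - intros y. apply T.
  - specialize (HN n Hn). apply Rmult_lt_reg_r with (d / 2); [lra|]. field_simplify; lra.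
Qed.

(** * Two-sided Laplace transforms *)

(** In the variable t = e^y this is the Mellin transform at [s]; translations of y are dilations of
    t. *)
Definition Mel (f : R -> C) (s : C) : C := Int (fun y => Cmult (cexp (Cmult s (RtoC y))) (f y)).

Definition mdec (f : R -> C) (sg : R) : Prop := exists K d, 0 < d /\ forall y, exp (sg * y) * Cmod (f y) <= K * exp (- d * Rabs y).

Lemma Mel_good f s : ccontR f -> mdec f (Re s) -> good (fun y => Cmult (cexp (Cmult s (RtoC y))) (f y)).
Proof.
  intros Cf [K [d [Hd H]]]. split; [intros t; cont; apply Cf|]. exists K, d. split; auto. intros y.
  rewrite Cmod_mult, Cmod_cexp. replace (Re (Cmult s (RtoC y))) with (Re s * y) by (cri; ring). apply H.
Qed.

Lemma exp_ge_sqr x : 0 <= x -> x ^ 2 <= 2 * exp x.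
Proof.
  intros Hx. pose proof (exp_ineq1_le (x / 2)) as E. assert (H : (1 + x / 2) ^ 2 <= exp (x / 2) ^ 2) by (apply pow_incr; lra).
  replace (exp (x / 2) ^ 2) with (exp x) in H by (simpl; rewrite Rmult_1_r, <- exp_plus; f_equal; lra).
  assert (x ^ 2 <= 4 * exp x) by nra.
  destruct (Rle_dec x 2).
  - assert (1 + x <= exp x) by (apply exp_ineq1_le). nra.
  - pose proof (exp_ineq1_le (x / 3)) as E3. assert (H3 : (1 + x / 3) ^ 3 <= exp (x / 3) ^ 3) by (apply pow_incr; lra).
    replace (exp (x / 3) ^ 3) with (exp x) in H3 by (simpl; rewrite Rmult_1_r, <- !exp_plus; f_equal; lra).
    nra.
Qed.

(** The exponent d / 2 is split in two: one d / 4 pays for |y|^2 by [exp_ge_sqr], whence 32 = 2 *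
    16, the other for exp (|h| |y|). *)
Lemma cexp_taylor_weight (h : C) (y d : R) : 0 < d -> Cmod h <= d / 4 ->
  Cmod (Cminus (Cminus (cexp (Cmult h (RtoC y))) (RtoC 1)) (Cmult h (RtoC y))) <=
   Cmod h ^ 2 * (32 / d ^ 2) * exp (d / 2 * Rabs y).
Proof.
  intros Hd Hh. eapply Rle_trans; [apply Cmod_cexp_taylor|]. rewrite Cmod_mult, Cmod_R.
  pose proof (Cmod_ge_0 h). pose proof (Rabs_pos y).
  pose proof (exp_ge_sqr (d / 4 * Rabs y) ltac:(nra)) as E.
  assert (E1 : exp (Cmod h * Rabs y) <= exp (d / 4 * Rabs y)) by (apply exp_le; nra).
  assert (E2 : Rabs y ^ 2 <= 32 / d ^ 2 * exp (d / 4 * Rabs y)).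
  { apply Rmult_le_reg_r with (d ^ 2 / 16); [apply Rdiv_lt_0_compat; [apply pow_lt; auto|lra]|].
    replace (32 / d ^ 2 * exp (d / 4 * Rabs y) * (d ^ 2 / 16)) with (2 * exp (d / 4 * Rabs y)) by (field; lra).
    eapply Rle_trans; [|exact E]. right. field. }
  replace (d / 2 * Rabs y) with (d / 4 * Rabs y + d / 4 * Rabs y) by field. rewrite exp_plus, Rpow_mult_distr.
  rewrite !Rmult_assoc. apply Rmult_le_compat_l; [apply pow2_ge_0|]. rewrite <- Rmult_assoc.
  apply Rmult_le_compat; [apply pow2_ge_0|left; apply exp_pos| |exact E1]. exact E2.
Qed.

(** Differentiation under the integral: the derivative is the integral with an extra factor y. The
    Taylor remainder costs only half of the rate [d] and is of second order in h, uniformly by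
    [cexp_taylor_weight]. *)
Lemma Mel_cdiff f s : ccontR f -> mdec f (Re s) -> cdiff (Mel f) s.
Proof.
  intros Cf [K [d [Hd H]]].
  set (g := fun y => Cmult (cexp (Cmult s (RtoC y))) (f y)).
  assert (Hg : edecay g K d).
  { intros y. unfold g. rewrite Cmod_mult, Cmod_cexp. replace (Re (Cmult s (RtoC y))) with (Re s * y) by (cri; ring). apply H. }
  pose proof (edecay_nonneg _ _ _ Hg) as HK.
  assert (Cg : ccontR g) by (intros t; unfold g; cont; apply Cf).
  assert (Gg : good g) by (split; auto; exists K, d; auto).
  assert (Gyg : good (fun y => Cmult (RtoC y) (g y))).
  { split; [intros t; cont; apply Cg|]. exists (K * (2 / d)), (d / 2). split; [lra|]. intros y. rewrite Cmod_mult, Cmod_R.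
    specialize (Hg y). pose proof (Rabs_pos y). pose proof (exp_ineq1_le (d / 2 * Rabs y)) as E.
    assert (Ey : Rabs y <= 2 / d * exp (d / 2 * Rabs y)).
    { apply Rmult_le_reg_l with (d / 2); [lra|]. replace (d / 2 * (2 / d * exp (d / 2 * Rabs y))) with (exp (d / 2 * Rabs y)) by (field; lra). lra. }
    apply Rle_trans with (2 / d * exp (d / 2 * Rabs y) * (K * exp (- d * Rabs y))).
    - apply Rmult_le_compat; auto. apply Cmod_ge_0.
    - right. replace (- (d / 2) * Rabs y) with (d / 2 * Rabs y + - d * Rabs y) by field. rewrite exp_plus. ring. }
  exists (Int (fun y => Cmult (RtoC y) (g y))). intros eps Heps.
  set (A := 2 * (K * (32 / d ^ 2) / (d / 2))).
  assert (HA : 0 <= A).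
  { unfold A. apply Rmult_le_pos; [lra|]. apply Rdiv_le_0_compat; [|lra]. apply Rmult_le_pos; auto.
    apply Rdiv_le_0_compat; [lra|apply pow_lt; auto]. }
  exists (Rmin (d / 4) (eps / (A + 1))). split; [apply Rmin_pos; [lra|apply Rdiv_lt_0_compat; lra]|].
  intros w Hw. set (h := Cminus w s) in *.
  assert (h1 : Cmod h <= d / 4) by (left; eapply Rlt_le_trans; [apply Hw|apply Rmin_l]).
  assert (h2 : Cmod h < eps / (A + 1)) by (eapply Rlt_le_trans; [apply Hw|apply Rmin_r]).
  assert (Gw : good (fun y => Cmult (cexp (Cmult w (RtoC y))) (f y))).
  { split; [intros t; cont; apply Cf|]. exists K, (d / 2). split; [lra|]. intros y.
    replace w with (Cplus h s) by (unfold h; ring).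
    replace (Cmult (Cplus h s) (RtoC y)) with (Cplus (Cmult h (RtoC y)) (Cmult s (RtoC y))) by ring.
    rewrite cexp_add, <- Cmult_assoc, Cmod_mult. fold (g y).
    rewrite Cmod_cexp. specialize (Hg y).
    assert (exp (Re (Cmult h (RtoC y))) <= exp (d / 2 * Rabs y)).
    { apply exp_le. eapply Rle_trans; [apply Rle_abs|]. eapply Rle_trans; [apply re_le_Cmod|]. rewrite Cmod_mult, Cmod_R.
      pose proof (Rabs_pos y). nra. }
    apply Rle_trans with (exp (d / 2 * Rabs y) * (K * exp (- d * Rabs y))).
    - apply Rmult_le_compat; auto; [left; apply exp_pos|apply Cmod_ge_0].
    - right. replace (- (d / 2) * Rabs y) with (d / 2 * Rabs y + - d * Rabs y) by field. rewrite exp_plus. ring. }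
  unfold Mel. fold g. set (gw := fun y => Cmult (cexp (Cmult w (RtoC y))) (f y)) in *.
  rewrite <- (Int_minus gw g Gw Gg), <- (Int_scal h _ Gyg).
  rewrite <- (Int_minus _ _ (good_minus _ _ Gw Gg) (good_scal h _ Gyg)).
  rewrite (Int_ext _ (fun y => Cmult (Cminus (Cminus (cexp (Cmult h (RtoC y))) (RtoC 1)) (Cmult h (RtoC y))) (g y))).
  2:{ intros y. unfold gw, g. replace w with (Cplus h s) by (unfold h; ring).
      replace (Cmult (Cplus h s) (RtoC y)) with (Cplus (Cmult h (RtoC y)) (Cmult s (RtoC y))) by ring. rewrite cexp_add. ring. }
  eapply Rle_trans; [apply (Cmod_Int_le _ (Cmod h ^ 2 * (K * (32 / d ^ 2))) (d / 2)); [|lra|]|].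
  - intros t. cont. apply Cg.
  - intros y. rewrite Cmod_mult. pose proof (cexp_taylor_weight h y d Hd h1) as B. specialize (Hg y).
    apply Rle_trans with (Cmod h ^ 2 * (32 / d ^ 2) * exp (d / 2 * Rabs y) * (K * exp (- d * Rabs y))).
    + apply Rmult_le_compat; auto; apply Cmod_ge_0.
    + right. replace (- (d / 2) * Rabs y) with (d / 2 * Rabs y + - d * Rabs y) by field. rewrite exp_plus. ring.
  - replace (2 * (Cmod h ^ 2 * (K * (32 / d ^ 2)) / (d / 2))) with (Cmod h * A * Cmod h) by (unfold A; field; lra).
    apply Rmult_le_compat_r; [apply Cmod_ge_0|].
    apply Rle_trans with (eps / (A + 1) * A); [apply Rmult_le_compat_r; lra|].
    apply Rmult_le_reg_r with (A + 1); [lra|]. field_simplify; [|lra]. nra.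
Qed.

(** * Complex trigonometry and the basic Mellin integral *)

Lemma Cmult_eq_reg_l (c a b : C) : c <> RtoC 0 -> Cmult c a = Cmult c b -> a = b.
Proof.
  intros Hc H. replace a with (Cdiv (Cmult c a) c) by cfield. rewrite H. cfield.
Qed.

Lemma csin_zero (w : C) : csin w = RtoC 0 -> exists k : Z, w = RtoC (IZR k * PI).
Proof.
  intros H. destruct w as [a b]. unfold csin in H.
  assert (E : Cminus (cexp (Cmult Ci (a, b))) (cexp (Copp (Cmult Ci (a, b)))) = RtoC 0).
  { match type of H with Cdiv ?u ?v = _ => replace u with (Cmult (Cdiv u v) v) by cfield; rewrite H end. ring. }
  unfold cexp in E.
  assert (E1 := f_equal Re E). assert (E2 := f_equal Im E). clear E H.
  rewrite Re_minus in E1. rewrite Im_minus in E2. rewrite !Re_opp, !Im_opp, !Re_mult, !Im_mult, Re_Ci, Im_Ci, Re_RtoC in E1.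
  rewrite !Re_opp, !Im_opp, !Re_mult, !Im_mult, Re_Ci, Im_Ci, Im_RtoC in E2.
  simpl in E1, E2.
  replace (0 * a - 1 * b) with (- b) in * by ring. replace (0 * b + 1 * a) with a in * by ring.
  rewrite Ropp_involutive, cos_neg, sin_neg in *.
  pose proof (exp_pos b). pose proof (exp_pos (- b)).
  (* The imaginary part is (e^b + e^(-b)) sin a and the real part (e^(-b) - e^b) cos a, so first sin
     a = 0 and then b = 0. *)
  assert (S : sin a = 0) by nra. destruct (sin_eq_0_0 a S) as [k Hk]. exists k.
  assert (Cn : cos a <> 0) by (intros Cz; pose proof (sin2_cos2 a) as T; unfold Rsqr in T; rewrite S, Cz in T; lra).
  assert (Eb : exp (- b) = exp b) by nra. apply exp_inv in Eb.
  apply Ceq_pair; simpl; lra.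
Qed.

Lemma cexp_Ci_PI2 : cexp (Cmult Ci (RtoC (PI / 2))) = Ci.
Proof. rewrite cexp_Ci, cos_PI2, sin_PI2. reflexivity. Qed.

Lemma Ci_inv' : Cinv Ci = Copp Ci.
Proof. apply Ci_inv. Qed.

Lemma csin_PI2_minus (w : C) : csin (Cminus (RtoC (PI / 2)) w) = ccos w.
Proof.
  unfold csin, ccos.
  replace (Cmult Ci (Cminus (RtoC (PI / 2)) w)) with (Cplus (Cmult Ci (RtoC (PI / 2))) (Copp (Cmult Ci w))) by ring.
  replace (Copp (Cplus (Cmult Ci (RtoC (PI / 2))) (Copp (Cmult Ci w)))) with (Cplus (Copp (Cmult Ci (RtoC (PI / 2)))) (Cmult Ci w)) by ring.
  rewrite !cexp_add, (cexp_opp (Cmult Ci (RtoC (PI / 2)))), cexp_Ci_PI2, Ci_inv'. field_simplify_eq; [ring|repeat split; auto using Ci_neq, C2_neq].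
Qed.

Lemma csin_opp (w : C) : csin (Copp w) = Copp (csin w).
Proof. unfold csin. replace (Copp (Cmult Ci (Copp w))) with (Cmult Ci w) by ring. replace (Cmult Ci (Copp w)) with (Copp (Cmult Ci w)) by ring. unfold Cdiv. ring. Qed.

Lemma cexp_Ci_PI : cexp (Cmult Ci (RtoC PI)) = Copp (RtoC 1).
Proof. rewrite cexp_Ci, cos_PI, sin_PI. apply Ceq_pair; simpl; ring. Qed.

Lemma csin_plus_PI (w : C) : csin (Cplus w (RtoC PI)) = Copp (csin w).
Proof.
  unfold csin.
  replace (Cmult Ci (Cplus w (RtoC PI))) with (Cplus (Cmult Ci w) (Cmult Ci (RtoC PI))) by ring.
  replace (Copp (Cplus (Cmult Ci w) (Cmult Ci (RtoC PI)))) with (Cplus (Copp (Cmult Ci w)) (Copp (Cmult Ci (RtoC PI)))) by ring.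
  rewrite !cexp_add, (cexp_opp (Cmult Ci (RtoC PI))), cexp_Ci_PI.
  replace (Cinv (Copp (RtoC 1))) with (Copp (RtoC 1)) by (field; intros E; apply (f_equal Re) in E; simpl in E; lra).
  unfold Cdiv. ring.
Qed.

Lemma csin_double (w : C) : csin (Cmult (RtoC 2) w) = Cmult (RtoC 2) (Cmult (csin w) (ccos w)).
Proof.
  unfold csin, ccos.
  replace (Cmult Ci (Cmult (RtoC 2) w)) with (Cplus (Cmult Ci w) (Cmult Ci w)) by ring.
  replace (Copp (Cplus (Cmult Ci w) (Cmult Ci w))) with (Cplus (Copp (Cmult Ci w)) (Copp (Cmult Ci w))) by ring.
  rewrite !cexp_add. cfield.
Qed.

Lemma ccos_double (w : C) : ccos (Cmult (RtoC 2) w) = Cminus (Cmult (RtoC 2) (Cmult (ccos w) (ccos w))) (RtoC 1).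
Proof.
  unfold ccos.
  replace (Cmult Ci (Cmult (RtoC 2) w)) with (Cplus (Cmult Ci w) (Cmult Ci w)) by ring.
  replace (Copp (Cplus (Cmult Ci w) (Cmult Ci w))) with (Cplus (Copp (Cmult Ci w)) (Copp (Cmult Ci w))) by ring.
  rewrite !cexp_add, !cexp_opp. field. apply cexp_neq_0.
Qed.

Lemma ccos_eul (w : C) : Cplus (ccos w) (Cmult Ci (csin w)) = cexp (Cmult Ci w).
Proof. unfold ccos, csin. cfield. Qed.

Lemma ccos_eul' (w : C) : Cminus (ccos w) (Cmult Ci (csin w)) = cexp (Copp (Cmult Ci w)).
Proof. unfold ccos, csin. cfield. Qed.

Lemma csin_strip_neq (w : C) : 0 < Re w < PI -> csin w <> RtoC 0.
Proof.
  intros H E. destruct (csin_zero w E) as [k ->]. simpl in H. pose proof PI_RGT_0.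
  assert (0 < IZR k < 1) by (split; nra). destruct H1 as [h1 h2]. apply lt_IZR in h1. apply lt_IZR in h2. lia.
Qed.

Lemma sq_neq_strip (z : C) : 0 < Re z < 1 -> forall k : nat, Cmult z z <> RtoC (INR (S k) ^ 2).
Proof.
  intros H k E.
  assert (F : Cmult (Cminus z (RtoC (INR (S k)))) (Cplus z (RtoC (INR (S k)))) = RtoC 0).
  { replace (Cmult (Cminus z (RtoC (INR (S k)))) (Cplus z (RtoC (INR (S k))))) with (Cminus (Cmult z z) (Cmult (RtoC (INR (S k))) (RtoC (INR (S k))))) by ring.
    rewrite E, <- RtoC_mult, <- RtoC_minus. f_equal. ring. }
  pose proof (pos_INR k). assert (INR (S k) >= 1) by (rewrite S_INR; lra).
  revert F. apply Cmult_neq_0.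
  - intros F. apply (f_equal Re) in F. rewrite Re_minus, !Re_RtoC in F. lra.
  - intros F. apply (f_equal Re) in F. rewrite Re_plus, !Re_RtoC in F. lra.
Qed.

(** * Partial fractions of the cosecant *)

Definition csgn (k : nat) : C := Cpow (Copp (RtoC 1)) k.

Lemma csgn_even M : csgn (2 * M) = RtoC 1.
Proof. unfold csgn. rewrite Cpow_mult_r. replace (Cpow (Copp (RtoC 1)) 2) with (RtoC 1) by (simpl; ring). apply Cpow_1_l. Qed.

Lemma csgn_S k : csgn (S k) = Copp (csgn k).
Proof. unfold csgn. simpl. ring. Qed.

Lemma Cmod_csgn k : Cmod (csgn k) = 1.
Proof. unfold csgn. rewrite Cmod_pow, Cmod_opp, Cmod_1. apply pow1. Qed.

(** The finite form of pi / sin (pi z) = pi cot (pi z / 2) - pi cot (pi z), with M terms of the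
    first cotangent and 2 M of the second. The sum pairs the poles - k and k + 1 instead of - k and
    k, and this leaves the term 1 / (z + 2 M). *)
Lemma csc_partial (z : C) : 0 < Re z < 1 -> forall M,
  csum (fun k => Cmult (csgn k) (Cplus (Cinv (Cplus z (RtoC (INR k)))) (Cinv (Cminus (RtoC (INR (S k))) z)))) (2 * M)
  = Cminus (Cminus (Cminus (Cinv (Cdiv z (RtoC 2)))
        (csum (fun k => Cdiv (Cmult (RtoC 2) (Cdiv z (RtoC 2))) (Cminus (RtoC (INR (S k) ^ 2)) (Cmult (Cdiv z (RtoC 2)) (Cdiv z (RtoC 2))))) M))
      (Cminus (Cinv z) (csum (fun k => Cdiv (Cmult (RtoC 2) z) (Cminus (RtoC (INR (S k) ^ 2)) (Cmult z z))) (2 * M))))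
      (Cinv (Cplus z (RtoC (INR (2 * M))))).
Proof.
  intros Hz.
  assert (Nz : forall r, (r >= 0 \/ r <= -1) -> Cplus z (RtoC r) <> RtoC 0).
  { intros r Hr E. apply (f_equal Re) in E. rewrite Re_plus, !Re_RtoC in E. lra. }
  assert (z0 : z <> RtoC 0) by (intros E; rewrite E in Hz; simpl in Hz; lra).
  induction M.
  - change (2 * 0)%nat with O. cbn [csum]. replace (Cplus z (RtoC (INR 0))) with z by (simpl; ring).
    field; auto.
  - replace (2 * S M)%nat with (S (S (2 * M))) by lia. cbn [csum]. rewrite IHM.
    rewrite csgn_S, csgn_even.
    match goal with |- Cplus (Cplus (Cminus (Cminus (Cminus _ ?A) (Cminus _ ?B)) _) _) _ = _ => generalize A B; intros A' B' end.
    rewrite !S_INR, mult_INR. change (INR 2) with 2. set (m := INR M). assert (Hm : 0 <= m) by apply pos_INR.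
    pose proof (Nz (2 * m) ltac:(lra)) as N1. pose proof (Nz (2 * m + 1) ltac:(lra)) as N2. pose proof (Nz (2 * m + 2) ltac:(lra)) as N3.
    pose proof (Nz (- (2 * m + 1)) ltac:(lra)) as N4. pose proof (Nz (- (2 * m + 2)) ltac:(lra)) as N5.
    replace (2 * m + 1 + 1) with (2 * m + 2) by ring.
    replace (RtoC ((m + 1) ^ 2)) with (Cmult (Cplus (RtoC m) (RtoC 1)) (Cplus (RtoC m) (RtoC 1))) by (rewrite <- RtoC_plus, <- RtoC_mult; f_equal; ring).
    replace (RtoC ((2 * m + 1) ^ 2)) with (Cmult (RtoC (2 * m + 1)) (RtoC (2 * m + 1))) by (rewrite <- RtoC_mult; f_equal; ring).
    replace (RtoC ((2 * m + 2) ^ 2)) with (Cmult (RtoC (2 * m + 2)) (RtoC (2 * m + 2))) by (rewrite <- RtoC_mult; f_equal; ring).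
    rewrite RtoC_opp in N4, N5. rewrite !RtoC_plus, !RtoC_mult in *. set (mm := RtoC m) in *.
    assert (F : forall a b : C, Cplus z a <> RtoC 0 -> Cplus z (Copp a) <> RtoC 0 -> b = Cmult a a -> Cminus b (Cmult z z) <> RtoC 0).
    { intros a b Ha Hb -> E. assert (E2 : Cmult (Cplus z a) (Cplus z (Copp a)) = RtoC 0).
      { replace (Cmult (Cplus z a) (Cplus z (Copp a))) with (Copp (Cminus (Cmult a a) (Cmult z z))) by ring. rewrite E. ring. }
      revert E2. apply Cmult_neq_0; auto. }
    assert (G : forall a : C, Cplus z (Copp a) <> RtoC 0 -> Cminus a z <> RtoC 0).
    { intros a Ha E. apply Ha. replace (Cplus z (Copp a)) with (Copp (Cminus a z)) by ring. rewrite E. ring. }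
    pose proof (F _ _ N2 N4 eq_refl) as D1. pose proof (F _ _ N3 N5 eq_refl) as D2.
    pose proof (G _ N4) as D3. pose proof (G _ N5) as D4.
    assert (D5 : Cminus (Cmult (Cplus mm (RtoC 1)) (Cplus mm (RtoC 1))) (Cmult (Cdiv z (RtoC 2)) (Cdiv z (RtoC 2))) <> RtoC 0).
    { intros E. apply D2.
      replace (Cminus (Cmult (Cplus (Cmult (RtoC 2) mm) (RtoC 2)) (Cplus (Cmult (RtoC 2) mm) (RtoC 2))) (Cmult z z)) with
        (Cmult (Cmult (RtoC 2) (RtoC 2)) (Cminus (Cmult (Cplus mm (RtoC 1)) (Cplus mm (RtoC 1))) (Cmult (Cdiv z (RtoC 2)) (Cdiv z (RtoC 2))))) by cfield.
      rewrite E. ring. }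
    set (q := Cminus (Cmult (Cplus mm (RtoC 1)) (Cplus mm (RtoC 1))) (Cmult (Cdiv z (RtoC 2)) (Cdiv z (RtoC 2)))) in *.
    assert (Hq : Cdiv (Cmult (RtoC 2) (Cdiv z (RtoC 2))) q = Cmult (RtoC 2) (Cminus (Cinv (Cminus (Cplus (Cmult (RtoC 2) mm) (RtoC 2)) z)) (Cinv (Cplus z (Cplus (Cmult (RtoC 2) mm) (RtoC 2)))))).
    { apply (Cmult_eq_reg_l q); auto. unfold q at 3. field. repeat split; auto. }
    assert (P1 : Cdiv (Cmult (RtoC 2) z) (Cminus (Cmult (Cplus (Cmult (RtoC 2) mm) (RtoC 1)) (Cplus (Cmult (RtoC 2) mm) (RtoC 1))) (Cmult z z))
      = Cminus (Cinv (Cminus (Cplus (Cmult (RtoC 2) mm) (RtoC 1)) z)) (Cinv (Cplus z (Cplus (Cmult (RtoC 2) mm) (RtoC 1))))) by (field; auto).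
    assert (P2 : Cdiv (Cmult (RtoC 2) z) (Cminus (Cmult (Cplus (Cmult (RtoC 2) mm) (RtoC 2)) (Cplus (Cmult (RtoC 2) mm) (RtoC 2))) (Cmult z z))
      = Cminus (Cinv (Cminus (Cplus (Cmult (RtoC 2) mm) (RtoC 2)) z)) (Cinv (Cplus z (Cplus (Cmult (RtoC 2) mm) (RtoC 2))))) by (field; auto).
    rewrite Hq, P1, P2. ring.
Qed.

Lemma csum_re_sub (a : nat -> C) (u : nat -> nat) l : (forall n, (n <= u n)%nat) -> clim (csum a) l -> clim (fun n => csum a (u n)) l.
Proof.
  intros Hu H eps Heps. destruct (H eps Heps) as [N HN]. exists N. intros n Hn. apply HN. specialize (Hu n). lia.
Qed.

Lemma clim_inv_INR (f : nat -> C) (c : R) : (forall n, INR n <= c * Cmod (f n)) -> clim (fun n => Cinv (f n)) (RtoC 0).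
Proof.
  intros Hf. assert (Hc : 0 < c).
  { specialize (Hf 1%nat). simpl in Hf. pose proof (Cmod_ge_0 (f 1%nat)). apply Rnot_le_lt. intros h. nra. }
  intros eps Heps. destruct (nfloor_ex (c / eps)) as [N [_ HN]]; [apply Rdiv_le_0_compat; lra|].
  exists (S N). intros n Hn. replace (Cminus (Cinv (f n)) (RtoC 0)) with (Cinv (f n)) by ring.
  assert (H1 : c / eps < INR n) by (eapply Rlt_le_trans; [exact HN|]; rewrite <- S_INR; apply le_INR; auto).
  assert (H0 : 0 < c / eps) by (apply Rdiv_lt_0_compat; lra).
  specialize (Hf n). assert (Hp : 0 < Cmod (f n)) by nra.
  rewrite Cmod_inv by (apply Cmod_pos_neq; auto).
  apply Rmult_lt_reg_r with (Cmod (f n)); auto. rewrite Rinv_l by lra.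
  apply Rmult_lt_reg_l with (c / eps); auto. replace (c / eps * (eps * Cmod (f n))) with (c * Cmod (f n)) by (field; lra). lra.
Qed.

Lemma csc_expansion (z : C) : 0 < Re z < 1 ->
  clim (fun M => csum (fun k => Cmult (csgn k) (Cplus (Cinv (Cplus z (RtoC (INR k)))) (Cinv (Cminus (RtoC (INR (S k))) z)))) (2 * M))
   (Cdiv (RtoC PI) (csin (Cmult (RtoC PI) z))).
Proof.
  intros Hz. pose proof PI_RGT_0 as HP.
  set (z2 := Cdiv z (RtoC 2)).
  assert (Hz2 : Re z2 = Re z / 2) by (unfold z2; replace (Cdiv z (RtoC 2)) with (Cmult z (RtoC (/ 2))) by (rewrite RtoC_inv by lra; reflexivity); cri; field).
  assert (N : forall w : C, 0 < Re w < 1 -> w <> RtoC 0) by (intros w Hw E; rewrite E in Hw; simpl in Hw; lra).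
  assert (Rw : forall w, Re (Cmult (RtoC PI) w) = PI * Re w) by (intros; cri; ring).
  assert (T1 : 0 < Re (Cmult (RtoC PI) z) < PI) by (rewrite Rw; split; nra).
  assert (T2 : 0 < Re (Cmult (RtoC PI) z2) < PI) by (rewrite Rw, Hz2; split; nra).
  pose proof (cot_expansion z (N z Hz) (csin_strip_neq _ T1) (sq_neq_strip z Hz)) as S1.
  pose proof (cot_expansion z2 (N z2 ltac:(lra)) (csin_strip_neq _ T2) (sq_neq_strip z2 ltac:(lra))) as S2.
  eapply clim_ext; [intros M; symmetry; apply csc_partial; auto|]. fold z2.
  set (w := Cmult (RtoC PI) z2).
  assert (Sw : csin w <> RtoC 0) by (apply csin_strip_neq; unfold w; rewrite Rw, Hz2; split; nra).
  assert (Ew : Cmult (RtoC PI) z = Cmult (RtoC 2) w) by (unfold w, z2; cfield).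
  assert (S2w : csin (Cmult (RtoC 2) w) <> RtoC 0) by (rewrite <- Ew; apply csin_strip_neq; rewrite Rw; split; nra).
  assert (Cw : ccos w <> RtoC 0).
  { intros E. apply S2w. rewrite csin_double, E. ring. }
  replace (Cdiv (RtoC PI) (csin (Cmult (RtoC PI) z))) with
   (Cminus (Cminus (Cminus (Cinv z2) (Cminus (Cinv z2) (Cmult (RtoC PI) (ccot (Cmult (RtoC PI) z2)))))
       (Cminus (Cinv z) (Cminus (Cinv z) (Cmult (RtoC PI) (ccot (Cmult (RtoC PI) z)))))) (RtoC 0)).
  2:{ fold w. unfold ccot. rewrite Ew. rewrite csin_double, ccos_double.
      field; repeat split; auto; apply N; lra. }
  apply clim_minus; [apply clim_minus; apply clim_minus; try apply clim_const|].
  - exact S2.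
  - apply csum_re_sub; [intros; lia|exact S1].
  - apply (clim_inv_INR _ 1). intros n. rewrite Rmult_1_l.
    eapply Rle_trans; [|apply re_le_Cmod]. rewrite Re_plus, Re_RtoC. eapply Rle_trans; [|apply Rle_abs].
    assert (INR n <= INR (2 * n)) by (apply le_INR; lia). lra.
Qed.

(** * The Mellin transform of 1 / (1 + t^2) and of its dilates *)

Definition halfG (l : C) (y : R) : C := Cmult (cexp (Cmult (Copp l) (RtoC y))) (Cinv (RtoC (1 + exp (-2 * y)))).

Lemma exp_pos1 (y : R) : 1 + exp y <> 0. Proof. pose proof (exp_pos y); lra. Qed.

Lemma halfG_cont l : ccontR (halfG l).
Proof. intros t. unfold halfG. cont. apply RtoC_neq, exp_pos1. Qed.

Lemma CInt_cexp_neg (l : C) b : l <> RtoC 0 ->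
  CInt (fun y => cexp (Cmult (Copp l) (RtoC y))) 0 b = Cdiv (Cminus (RtoC 1) (cexp (Cmult (Copp l) (RtoC b)))) l.
Proof.
  intros Hl. rewrite (CInt_FTC (fun y => Cmult (Copp (Cinv l)) (cexp (Cmult (Copp l) (RtoC y))))).
  - rewrite (Cmult_0_r (Copp l)), cexp_0. unfold Cdiv. ring.
  - intros t _. eapply is_derC_eq.
    + apply (is_derC_Cmult (fun _ => Copp (Cinv l))); [apply is_derC_const|]. apply is_derC_cexp, is_derC_lin.
    + cbv beta. cfield.
  - intros t _. cont.
Qed.

(** One step of the geometric series: 1 / (1 + q) = 1 - q / (1 + q) with q = e^(-2 y). *)
Lemma halfG_step l b : l <> RtoC 0 ->
  CInt (halfG l) 0 b = Cminus (Cdiv (Cminus (RtoC 1) (cexp (Cmult (Copp l) (RtoC b)))) l) (CInt (halfG (Cplus l (RtoC 2))) 0 b).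
Proof.
  intros Hl. rewrite <- CInt_cexp_neg by auto. rewrite <- CInt_minus.
  - apply CInt_ext. intros y. unfold halfG.
    replace (Cmult (Copp (Cplus l (RtoC 2))) (RtoC y)) with (Cplus (Cmult (Copp l) (RtoC y)) (RtoC (-2 * y))).
    + rewrite cexp_add, cexp_RtoC. rewrite RtoC_plus. field. cbv beta. rewrite <- RtoC_plus. apply RtoC_neq, exp_pos1.
    + apply Ceq_pair; cri; ring.
  - apply ccontR_ex. intros t. cont.
  - apply ccontR_ex, halfG_cont.
Qed.

Lemma Cmod_halfG l b : 0 < Re l -> 0 <= b -> Cmod (CInt (halfG l) 0 b) <= / Re l.
Proof.
  intros Hl Hb. eapply Rle_trans.
  - apply (Cmod_CInt_le _ (fun y => 1 * exp (- Re l * y))); [auto|apply ccontR_ex, halfG_cont|eexists; apply RInt_exp_decay; auto|].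
    intros t Ht. unfold halfG. rewrite Cmod_mult, Cmod_cexp, Rmult_1_l.
    rewrite Cmod_inv by (apply RtoC_neq, exp_pos1). rewrite Cmod_R. pose proof (exp_pos (-2 * t)).
    rewrite Rabs_pos_eq by lra.
    replace (Re (Cmult (Copp l) (RtoC t))) with (- Re l * t) by (cri; ring).
    rewrite <- (Rmult_1_r (exp (- Re l * t))) at 2. apply Rmult_le_compat_l; [left; apply exp_pos|].
    rewrite <- Rinv_1. apply Rinv_le_contravar; lra.
  - rewrite (is_RInt_unique _ _ _ _ (RInt_exp_decay 1 (Re l) 0 b Hl)).
    rewrite Rmult_0_r, exp_0. pose proof (exp_pos (- Re l * b)). unfold Rdiv. rewrite Rmult_1_l.
    assert (0 < / Re l) by (apply Rinv_0_lt_compat; auto). nra.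
Qed.

Lemma halfG_expand l b K : 0 < Re l -> 0 <= b ->
  CInt (halfG l) 0 b = Cplus (csum (fun k => Cmult (csgn k) (Cdiv (Cminus (RtoC 1) (cexp (Cmult (Copp (Cplus l (RtoC (2 * INR k)))) (RtoC b)))) (Cplus l (RtoC (2 * INR k))))) K)
     (Cmult (csgn K) (CInt (halfG (Cplus l (RtoC (2 * INR K)))) 0 b)).
Proof.
  intros Hl Hb. induction K.
  - cbn [csum]. replace (Cplus l (RtoC (2 * INR 0))) with l by (simpl INR; apply Ceq_pair; cri; ring). unfold csgn. cbn [Cpow]. ring.
  - cbn [csum]. rewrite IHK. rewrite (halfG_step (Cplus l (RtoC (2 * INR K)))).
    + replace (Cplus (Cplus l (RtoC (2 * INR K))) (RtoC 2)) with (Cplus l (RtoC (2 * INR (S K)))) by (rewrite S_INR; apply Ceq_pair; cri; ring).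
      rewrite csgn_S. ring.
    + intros E. apply (f_equal Re) in E. rewrite Re_plus, !Re_RtoC in E. pose proof (pos_INR K). lra.
Qed.

Lemma Cmod_csum_const (a : nat -> C) B n : (forall k, Cmod (a k) <= B) -> Cmod (csum a n) <= INR n * B.
Proof.
  intros H. induction n; [cbn [csum]; rewrite Cmod_0; simpl; lra|]. cbn [csum]. rewrite S_INR.
  eapply Rle_trans; [apply Cmod_triangle|]. specialize (H n). lra.
Qed.

(** The geometric series is not summed to infinity, since its ratio has modulus 1 at y = 0. Its
    remainder after K terms is kept as an integral and gives the first error term; the second comes
    from stopping at [b] in each of the K terms. *)
Lemma halfG_approx l b K : 0 < Re l -> 0 <= b ->
  Cmod (Cminus (CInt (halfG l) 0 b) (csum (fun k => Cmult (csgn k) (Cinv (Cplus l (RtoC (2 * INR k))))) K))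
    <= / (Re l + 2 * INR K) + INR K * (/ Re l * exp (- Re l * b)).
Proof.
  intros Hl Hb. rewrite (halfG_expand l b K) by auto.
  match goal with |- Cmod (Cminus (Cplus ?a ?r) ?c) <= _ => replace (Cminus (Cplus a r) c) with (Cplus r (Cminus a c)) by ring end.
  eapply Rle_trans; [apply Cmod_triangle|]. apply Rplus_le_compat.
  - rewrite Cmod_mult, Cmod_csgn, Rmult_1_l. eapply Rle_trans; [apply Cmod_halfG; auto|].
    + rewrite Re_plus, Re_RtoC. pose proof (pos_INR K). lra.
    + rewrite Re_plus, Re_RtoC. lra.
  - rewrite <- csum_minus. apply Cmod_csum_const. intros k. pose proof (pos_INR k) as Hk.
    assert (L : Re l <= Cmod (Cplus l (RtoC (2 * INR k)))).
    { eapply Rle_trans; [|apply re_le_Cmod]. rewrite Re_plus, Re_RtoC. eapply Rle_trans; [|apply Rle_abs]. lra. }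
    assert (N : Cplus l (RtoC (2 * INR k)) <> RtoC 0) by (apply Cmod_pos_neq; lra).
    match goal with |- Cmod ?t <= _ => replace t with (Copp (Cmult (csgn k) (Cmult (Cinv (Cplus l (RtoC (2 * INR k)))) (cexp (Cmult (Copp (Cplus l (RtoC (2 * INR k)))) (RtoC b)))))) by (unfold Cdiv; ring) end.
    rewrite Cmod_opp, !Cmod_mult, Cmod_csgn, Rmult_1_l, Cmod_inv, Cmod_cexp by auto.
    apply Rmult_le_compat; [left; apply Rinv_0_lt_compat; lra|left; apply exp_pos|apply Rinv_le_contravar; auto|].
    apply exp_le. replace (Re (Cmult (Copp (Cplus l (RtoC (2 * INR k)))) (RtoC b))) with (- (Re l + 2 * INR k) * b) by (cri; ring). nra.
Qed.

Definition kern (v y : R) : C := Cinv (RtoC (exp (2 * y) + v ^ 2)).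

Lemma kern_pos v y : 0 < exp (2 * y) + v ^ 2.
Proof. pose proof (exp_pos (2 * y)). pose proof (pow2_ge_0 v). lra. Qed.

Lemma kern_cont v : ccontR (kern v).
Proof. intros t. unfold kern. cont. apply RtoC_neq. pose proof (kern_pos v t). lra. Qed.

(** Split at y = 0: the left half is the integral of [halfG s] and the right half that of
    [halfG (2 - s)]. Their two alternating series together are half the cosecant expansion at s /
    2. *)
Lemma Mel_kern_1 s : 0 < Re s < 2 ->
  is_int (fun y => Cmult (cexp (Cmult s (RtoC y))) (kern 1 y)) (Cdiv (RtoC PI) (Cmult (RtoC 2) (csin (Cmult (RtoC (PI / 2)) s)))).
Proof.
  intros Hs. set (sg := Re s) in *. set (L := Cdiv _ _).
  set (s' := Cminus (RtoC 2) s). assert (Hs' : Re s' = 2 - sg) by (unfold s'; cri; unfold sg; ring).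
  assert (Hsp : csin (Cmult (RtoC (PI / 2)) s) <> RtoC 0).
  { apply csin_strip_neq. cri. fold sg. pose proof PI_RGT_0. split; nra. }
  assert (HL : clim (fun M => Cplus (csum (fun k => Cmult (csgn k) (Cinv (Cplus s (RtoC (2 * INR k))))) (2 * M))
                                (csum (fun k => Cmult (csgn k) (Cinv (Cplus s' (RtoC (2 * INR k))))) (2 * M))) L).
  { assert (Hz : 0 < Re (Cdiv s (RtoC 2)) < 1).
    { replace (Cdiv s (RtoC 2)) with (Cmult s (RtoC (/ 2))) by (rewrite RtoC_inv by lra; reflexivity). cri. fold sg. lra. }
    pose proof (csc_expansion _ Hz) as H. apply (clim_scal (RtoC (/ 2))) in H.
    replace (Cmult (RtoC (/ 2)) (Cdiv (RtoC PI) (csin (Cmult (RtoC PI) (Cdiv s (RtoC 2)))))) with L in H.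
    - revert H. apply clim_ext. intros M. rewrite <- csum_plus, <- csum_scal. apply csum_ext. intros k.
      pose proof (pos_INR k) as Hk.
      assert (N1 : Cplus s (RtoC (2 * INR k)) <> RtoC 0) by (intros E; apply (f_equal Re) in E; rewrite Re_plus, !Re_RtoC in E; fold sg in E; lra).
      assert (N2 : Cplus s' (RtoC (2 * INR k)) <> RtoC 0) by (intros E; apply (f_equal Re) in E; rewrite Re_plus, !Re_RtoC in E; rewrite Hs' in E; lra).
      replace (Cplus (Cdiv s (RtoC 2)) (RtoC (INR k))) with (Cdiv (Cplus s (RtoC (2 * INR k))) (RtoC 2)) by (rewrite RtoC_mult; cfield).
      replace (Cminus (RtoC (INR (S k))) (Cdiv s (RtoC 2))) with (Cdiv (Cplus s' (RtoC (2 * INR k))) (RtoC 2)) by (unfold s'; rewrite S_INR, RtoC_mult, RtoC_plus; cfield).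
      rewrite RtoC_inv by lra. cfield.
    - unfold L. replace (Cmult (RtoC PI) (Cdiv s (RtoC 2))) with (Cmult (RtoC (PI / 2)) s) by (rewrite RtoC_div by lra; cfield).
      rewrite RtoC_inv by lra. cfield. }
  intros eps Heps. destruct (HL (eps / 4)) as [M0 HM0]; [lra|].
  destruct (nfloor_ex (4 / eps)) as [M1 [_ HM1]]; [apply Rdiv_le_0_compat; lra|].
  set (M := (M0 + S M1)%nat). specialize (HM0 M ltac:(unfold M; lia)). set (K := (2 * M)%nat) in *.
  assert (HK : 4 / eps < INR K).
  { eapply Rlt_le_trans; [exact HM1|]. rewrite <- S_INR. apply le_INR. unfold K, M. lia. }
  assert (HK0 : 0 < 4 / eps) by (apply Rdiv_lt_0_compat; lra).
  assert (Hinv : forall r, 0 < r -> / (r + 2 * INR K) <= eps / 4).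
  { intros r Hr. replace (eps / 4) with (/ (4 / eps)) by (field; lra). apply Rinv_le_contravar; lra. }
  (* K is fixed before the endpoints, because the truncation error carries the factor [INR K]. *)
  destruct (exp_small (INR K * / sg) sg (eps / 8)) as [T1 [HT1 HT1']]; [lra|lra|].
  destruct (exp_small (INR K * / (2 - sg)) (2 - sg) (eps / 8)) as [T2 [HT2 HT2']]; [lra|lra|].
  exists (T1 + T2). intros a b Ha Hb.
  set (f := fun y => Cmult (cexp (Cmult s (RtoC y))) (kern 1 y)).
  assert (Cf : ccontR f) by (intros t; unfold f; cont; apply kern_cont).
  assert (E1 : CInt f (- a) 0 = CInt (halfG s) 0 a).
  { replace 0 with (- 0) at 1 by ring. rewrite <- CInt_neg by auto. apply CInt_ext. intros y. unfold f, halfG, kern.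
    replace (Cmult s (RtoC (- y))) with (Cmult (Copp s) (RtoC y)) by (rewrite RtoC_opp; ring). do 3 f_equal.
    replace (2 * - y) with (-2 * y) by ring. ring. }
  assert (E2 : CInt f 0 b = CInt (halfG s') 0 b).
  { apply CInt_ext. intros y. unfold f, halfG, kern, s'.
    replace (Cmult (Copp (Cminus (RtoC 2) s)) (RtoC y)) with (Cplus (Cmult s (RtoC y)) (RtoC (- (2 * y)))) by (apply Ceq_pair; cri; ring).
    rewrite cexp_add, cexp_RtoC. rewrite <- Cmult_assoc. f_equal.
    replace (-2 * y) with (- (2 * y)) by ring. rewrite exp_Ropp. pose proof (exp_pos (2 * y)).
    rewrite <- !RtoC_inv by (try (pose proof (Rinv_0_lt_compat _ H)); lra). rewrite <- RtoC_mult. f_equal. field. split; lra. }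
  rewrite (CInt_Chasles f (- a) 0 b), E1, E2 by (apply ccontR_ex; auto).
  pose proof (halfG_approx s a K ltac:(fold sg; lra) ltac:(lra)) as A1. pose proof (halfG_approx s' b K ltac:(lra) ltac:(lra)) as A2.
  fold sg in A1. rewrite Hs' in A2. specialize (HT1' a ltac:(lra)). specialize (HT2' b ltac:(lra)).
  pose proof (Hinv sg ltac:(lra)) as I1. pose proof (Hinv (2 - sg) ltac:(lra)) as I2.
  rewrite <- Rmult_assoc in A1, A2.
  set (u1 := csum (fun k => Cmult (csgn k) (Cinv (Cplus s (RtoC (2 * INR k))))) K) in *.
  set (u2 := csum (fun k => Cmult (csgn k) (Cinv (Cplus s' (RtoC (2 * INR k))))) K) in *.
  replace (Cminus (Cplus (CInt (halfG s) 0 a) (CInt (halfG s') 0 b)) L) with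
    (Cplus (Cplus (Cminus (CInt (halfG s) 0 a) u1) (Cminus (CInt (halfG s') 0 b) u2)) (Cminus (Cplus u1 u2) L)) by ring.
  eapply Rle_lt_trans; [apply Cmod_triangle|].
  match goal with |- Cmod (Cplus ?p ?q) + _ < _ => pose proof (Cmod_triangle p q) end. lra.
Qed.

Lemma kern_bound v sg : 0 < v -> 0 < sg < 2 -> exists K d, 0 < d /\ forall y, exp (sg * y) * Cmod (kern v y) <= K * exp (- d * Rabs y).
Proof.
  intros Hv Hs. exists (1 + / v ^ 2), (Rmin sg (2 - sg)). split; [apply Rmin_pos; lra|]. intros y.
  pose proof (kern_pos v y) as P. pose proof (exp_pos (2 * y)) as P2. assert (Pv : 0 < v ^ 2) by (apply pow_lt; auto).
  unfold kern. rewrite Cmod_inv, Cmod_R, Rabs_pos_eq by (try apply RtoC_neq; lra).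
  assert (Iv : 0 < / v ^ 2) by (apply Rinv_0_lt_compat; auto).
  destruct (Rle_dec 0 y) as [h|h].
  - rewrite Rabs_pos_eq by auto. apply Rle_trans with (1 * exp ((sg - 2) * y)).
    + rewrite Rmult_1_l. replace ((sg - 2) * y) with (sg * y + - (2 * y)) by ring. rewrite exp_plus, exp_Ropp.
      apply Rmult_le_compat_l; [left; apply exp_pos|]. apply Rinv_le_contravar; lra.
    + apply Rmult_le_compat; [lra|left; apply exp_pos|lra|]. apply exp_le. pose proof (Rmin_r sg (2 - sg)). nra.
  - rewrite Rabs_left by lra. apply Rle_trans with (/ v ^ 2 * exp (sg * y)).
    + rewrite Rmult_comm. apply Rmult_le_compat_r; [left; apply exp_pos|]. apply Rinv_le_contravar; lra.
    + apply Rmult_le_compat; [lra|left; apply exp_pos|lra|]. apply exp_le. pose proof (Rmin_l sg (2 - sg)). nra.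
Qed.

(** The case v = 1 translated by ln v, which is the dilation of t by v. *)
Lemma Mel_kern v s : 0 < v -> 0 < Re s < 2 ->
  Mel (kern v) s = Cmult (cpow v (Cminus s (RtoC 2))) (Cdiv (RtoC PI) (Cmult (RtoC 2) (csin (Cmult (RtoC (PI / 2)) s)))).
Proof.
  intros Hv Hs. pose proof (Mel_kern_1 s Hs) as H.
  assert (C1 : ccontR (fun y => Cmult (cexp (Cmult s (RtoC y))) (kern 1 y))) by (intros t; cont; apply kern_cont).
  apply (is_int_shift _ (- ln v) _ C1) in H.
  apply (is_int_scal (cpow v (Cminus s (RtoC 2)))) in H; [|exact (ccontR_shift _ (- ln v) C1)].
  unfold Mel. rewrite <- (Int_unique _ _ H). apply Int_ext. intros y. unfold kern, cpow.
  rewrite Cmult_assoc, <- cexp_add.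
  replace (Cplus (Cmult (Cminus s (RtoC 2)) (RtoC (ln v))) (Cmult s (RtoC (y + - ln v)))) with (Cplus (Cmult s (RtoC y)) (RtoC (- (2 * ln v)))) by (apply Ceq_pair; cri; ring).
  rewrite cexp_add, <- Cmult_assoc. f_equal. rewrite cexp_RtoC, <- RtoC_inv, <- RtoC_inv, <- RtoC_mult.
  - f_equal. replace (2 * (y + - ln v)) with (2 * y + - (2 * ln v)) by ring. rewrite exp_plus, exp_Ropp.
    replace (2 * ln v) with (ln v + ln v) by ring. rewrite exp_plus, exp_ln by auto.
    pose proof (exp_pos (2 * y)). field. assert (0 < v * v) by (apply Rmult_lt_0_compat; auto). split; lra.
  - pose proof (kern_pos 1 (y + - ln v)). lra.
  - pose proof (kern_pos v y). lra.
Qed.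

(** * The generating function of the characters *)

Definition qth (th t : R) : C := cexp (Cmult (RtoC (2 * PI)) (Cminus (Cmult Ci (RtoC th)) (RtoC t))).
(** For t > 0 the sum over n >= 1 of exp (2 pi n (i th - t)). The closed form also makes sense at t
    = 0, where a nonintegral [th] keeps the denominator away from 0. *)
Definition Lth (th t : R) : C := Cdiv (qth th t) (Cminus (RtoC 1) (qth th t)).

Lemma qth_pair th t : qth th t = (exp (- (2 * PI * t)) * cos (2 * PI * th), exp (- (2 * PI * t)) * sin (2 * PI * th)).
Proof.
  unfold qth, cexp. replace (Re _) with (- (2 * PI * t)) by (cri; ring). replace (Im _) with (2 * PI * th) by (cri; ring). reflexivity.
Qed.

Lemma Cmod_qth th t : Cmod (qth th t) = exp (- (2 * PI * t)).
Proof. unfold qth. rewrite Cmod_cexp. f_equal. cri. ring. Qed.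

Lemma pow_incr_inv2 a b : 0 <= b -> a ^ 2 <= b ^ 2 -> a <= b.
Proof. intros Hb H. apply Rnot_lt_le. intros h. nra. Qed.

(** With r = |q| and c = cos (2 pi th) < 1, the square of the modulus is 1 - 2 r c + r^2. This is at
    least 1 - c^2 in general and at least 1 for c < 0, down to t = 0. *)
Lemma one_minus_qth th : 0 < th < 1 -> exists c, 0 < c /\ forall t, 0 <= t -> c <= Cmod (Cminus (RtoC 1) (qth th t)).
Proof.
  intros Hth. pose proof PI_RGT_0 as HP. set (c := cos (2 * PI * th)).
  assert (Hc : c < 1).
  { unfold c. replace (2 * PI * th) with (2 * (PI * th)) by ring. rewrite cos_2a_sin.
    assert (0 < sin (PI * th)) by (apply sin_gt_0; nra). nra. }
  assert (Hsq : forall t, (Cmod (Cminus (RtoC 1) (qth th t))) ^ 2 = 1 - 2 * exp (- (2 * PI * t)) * c + exp (- (2 * PI * t)) ^ 2).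
  { intros t. rewrite Cmod2_alt, qth_pair. cri. simpl. fold c. pose proof (sin2_cos2 (2 * PI * th)) as S. unfold Rsqr in S. fold c in S.
    set (r := exp _). set (s := sin _) in *.
    assert (E : r * r * (s * s) = r * r * (1 - c * c)) by (f_equal; lra). lra. }
  destruct (Rle_dec 0 c) as [h|h].
  - assert (H1 : 0 < 1 - c ^ 2) by nra. exists (sqrt (1 - c ^ 2)). split; [apply sqrt_lt_R0; auto|].
    intros t Ht. rewrite <- (sqrt_pow2 (Cmod _)) by apply Cmod_ge_0. apply sqrt_le_1_alt. rewrite Hsq.
    pose proof (pow2_ge_0 (exp (- (2 * PI * t)) - c)). nra.
  - exists 1. split; [lra|]. intros t Ht. apply pow_incr_inv2; [apply Cmod_ge_0|]. rewrite Hsq.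
    pose proof (exp_pos (- (2 * PI * t))). pose proof (pow2_ge_0 (exp (- (2 * PI * t)))). nra.
Qed.

Lemma one_minus_qth_neq th t : 0 < th < 1 -> 0 <= t -> Cminus (RtoC 1) (qth th t) <> RtoC 0.
Proof. intros H Ht. destruct (one_minus_qth th H) as [c [Hc K]]. apply Cmod_pos_neq. specialize (K t Ht). lra. Qed.

Lemma Lth_exp_cont th : 0 < th < 1 -> ccontR (fun y => Lth th (exp y)).
Proof.
  intros H t. assert (N := one_minus_qth_neq th (exp t) H ltac:(left; apply exp_pos)).
  unfold Lth, qth in *. cont; try apply continuous_exp. exact N.
Qed.

Lemma Lth_bound th : 0 < th < 1 -> exists K, 0 < K /\
  (forall t, 0 <= t -> Cmod (Lth th t) <= K * exp (- (2 * PI * t))) /\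
  (forall t, 0 <= t -> Cmod (Cminus (Lth th t) (Lth th 0)) <= K * t) /\
  (forall t, 0 <= t -> Cmod (Cminus (Lth th t) (Lth th 0)) <= K).
Proof.
  intros H. pose proof PI_RGT_0 as HP. destruct (one_minus_qth th H) as [c [Hc B]].
  exists (/ c + 2 * PI / c ^ 2 + 2 / c).
  assert (P1 : 0 < / c) by (apply Rinv_0_lt_compat; auto).
  assert (P2 : 0 < 2 * PI / c ^ 2) by (apply Rdiv_lt_0_compat; [lra|apply pow_lt; auto]).
  assert (P3 : 0 < 2 / c) by (apply Rdiv_lt_0_compat; lra).
  assert (B1 : forall t, 0 <= t -> Cmod (Lth th t) <= / c * exp (- (2 * PI * t))).
  { intros t Ht. unfold Lth. rewrite Cmod_div by (apply one_minus_qth_neq; auto). rewrite Cmod_qth. unfold Rdiv. rewrite (Rmult_comm (exp _)).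
    apply Rmult_le_compat_r; [left; apply exp_pos|]. apply Rinv_le_contravar; auto. }
  assert (E1 : forall t, 0 <= t -> exp (- (2 * PI * t)) <= 1).
  { intros t Ht. rewrite <- exp_0. apply exp_le. nra. }
  split; [lra|]. split; [|split].
  - intros t Ht. eapply Rle_trans; [apply B1; auto|]. apply Rmult_le_compat_r; [left; apply exp_pos|lra].
  - intros t Ht.
    pose proof (one_minus_qth_neq th t H Ht) as N1. pose proof (one_minus_qth_neq th 0 H (Rle_refl _)) as N0.
    replace (Cminus (Lth th t) (Lth th 0)) with (Cdiv (Cminus (qth th t) (qth th 0)) (Cmult (Cminus (RtoC 1) (qth th t)) (Cminus (RtoC 1) (qth th 0)))) by (unfold Lth; field; auto).
    rewrite Cmod_div by (apply Cmult_neq_0; auto). rewrite Cmod_mult.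
    assert (Q : Cmod (Cminus (qth th t) (qth th 0)) <= 2 * PI * t).
    { replace (qth th t) with (Cmult (RtoC (exp (- (2 * PI * t)))) (qth th 0)).
      - replace (Cminus (Cmult (RtoC (exp (- (2 * PI * t)))) (qth th 0)) (qth th 0)) with (Cmult (RtoC (exp (- (2 * PI * t)) - 1)) (qth th 0)) by (rewrite RtoC_minus; ring).
        rewrite Cmod_mult, Cmod_R, Cmod_qth, Rmult_0_r, Ropp_0, exp_0, Rmult_1_r.
        specialize (E1 t Ht). rewrite Rabs_left1 by lra. pose proof (exp_ineq1_le (- (2 * PI * t))). lra.
      - rewrite !qth_pair. rewrite Rmult_0_r, Ropp_0, exp_0. apply Ceq_pair; cri; simpl; ring. }
    pose proof (B t Ht) as Bt. pose proof (B 0 (Rle_refl _)) as B0.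
    apply Rle_trans with (2 * PI / c ^ 2 * t); [|apply Rmult_le_compat_r; lra].
    unfold Rdiv. replace (2 * PI * / c ^ 2 * t) with (2 * PI * t * / c ^ 2) by ring.
    apply Rmult_le_compat; [apply Cmod_ge_0| |auto|].
    + left. apply Rinv_0_lt_compat. apply Rmult_lt_0_compat; lra.
    + apply Rinv_le_contravar; [apply pow_lt; auto|]. simpl. rewrite Rmult_1_r. apply Rmult_le_compat; lra.
  - intros t Ht. eapply Rle_trans; [apply Cmod_triangle_minus|].
    pose proof (B1 t Ht) as Bt. pose proof (B1 0 (Rle_refl _)) as B0. pose proof (E1 t Ht). pose proof (E1 0 (Rle_refl _)).
    assert (/ c * exp (- (2 * PI * t)) <= / c) by nra. assert (/ c * exp (- (2 * PI * 0)) <= / c) by nra.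
    unfold Rdiv in *. lra.
Qed.

(** The poles of [Lth th] in t are the points i (m + th) for all integers m. Each index pairs one
    above the real axis with one below, because the two single sums diverge. *)
Definition pairf (th t : R) (m : nat) : C :=
  Cplus (Cinv (Cminus (RtoC t) (Cmult Ci (RtoC (INR m + th))))) (Cinv (Cplus (RtoC t) (Cmult Ci (RtoC (INR m + (1 - th)))))).

(** With z = th + i t one has q = exp (2 pi i z), and 2 pi (L + 1/2) = i pi cot (pi z). Regrouping
    the terms of [cot_expansion] from the pairs (k, - k) to (m, - m - 1) leaves 1 / (z + M), which
    tends to 0. *)
Lemma Lth_expansion th t : 0 < th < 1 -> 0 <= t ->
  cser (pairf th t) (Cmult (RtoC (2 * PI)) (Cplus (Lth th t) (RtoC (/ 2)))).
Proof.
  intros Hth Ht. set (z := (th, t) : C). pose proof PI_RGT_0 as HP.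
  assert (Hz : 0 < Re z < 1) by exact Hth.
  assert (Nz : forall r, (r >= 0 \/ r <= -1) -> Cplus z (RtoC r) <> RtoC 0).
  { intros r Hr E. apply (f_equal Re) in E. rewrite Re_plus, !Re_RtoC in E. lra. }
  assert (z0 : z <> RtoC 0) by (intros E; rewrite E in Hz; simpl in Hz; lra).
  assert (Rw : forall w, Re (Cmult (RtoC PI) w) = PI * Re w) by (intros; cri; ring).
  assert (S0 : csin (Cmult (RtoC PI) z) <> RtoC 0) by (apply csin_strip_neq; rewrite Rw; split; nra).
  pose proof (cot_expansion z z0 S0 (sq_neq_strip z Hz)) as HS.
  set (a := fun k => Cdiv (Cmult (RtoC 2) z) (Cminus (RtoC (INR (S k) ^ 2)) (Cmult z z))) in *.
  assert (Epair : forall m, pairf th t m = Cmult Ci (Cplus (Cinv (Cplus z (RtoC (INR m)))) (Cinv (Cminus z (RtoC (INR (S m))))))).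
  { intros m. unfold pairf. pose proof (pos_INR m) as Hm.
    assert (N1 := Nz (INR m) ltac:(lra)). assert (N2 := Nz (- INR (S m)) ltac:(rewrite S_INR; lra)).
    rewrite RtoC_opp in N2. change (Cplus z (Copp (RtoC (INR (S m))))) with (Cminus z (RtoC (INR (S m)))) in N2.
    replace (Cminus (RtoC t) (Cmult Ci (RtoC (INR m + th)))) with (Cmult (Copp Ci) (Cplus z (RtoC (INR m)))) by (unfold z; apply Ceq_pair; cri; simpl; ring).
    replace (Cplus (RtoC t) (Cmult Ci (RtoC (INR m + (1 - th))))) with (Cmult (Copp Ci) (Cminus z (RtoC (INR (S m))))) by (rewrite S_INR; unfold z; apply Ceq_pair; cri; simpl; ring).
    assert (Nc : Copp Ci <> RtoC 0) by (intros E; apply (f_equal Im) in E; simpl in E; lra).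
    apply (Cmult_eq_reg_l (Copp Ci)); [exact Nc|].
    transitivity (Cplus (Cinv (Cplus z (RtoC (INR m)))) (Cinv (Cminus z (RtoC (INR (S m)))))).
    - set (u := Copp Ci) in *. field. repeat split; auto.
    - transitivity (Cmult (Copp (Cmult Ci Ci)) (Cplus (Cinv (Cplus z (RtoC (INR m)))) (Cinv (Cminus z (RtoC (INR (S m))))))); [rewrite Ci_sqr; ring|ring]. }
  assert (Part : forall M, csum (pairf th t) M = Cmult Ci (Cminus (Cminus (Cinv z) (csum a M)) (Cinv (Cplus z (RtoC (INR M)))))).
  { induction M.
    - cbn [csum]. replace (Cplus z (RtoC (INR 0))) with z by (simpl; ring). ring.
    - cbn [csum]. rewrite IHM, Epair. pose proof (pos_INR M) as Hm.
      assert (N2 := Nz (- INR (S M)) ltac:(rewrite S_INR; lra)). assert (N3 := Nz (INR (S M)) ltac:(rewrite S_INR; lra)).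
      rewrite RtoC_opp in N2. change (Cplus z (Copp (RtoC (INR (S M))))) with (Cminus z (RtoC (INR (S M)))) in N2.
      assert (Ha : a M = Copp (Cplus (Cinv (Cplus z (RtoC (INR (S M))))) (Cinv (Cminus z (RtoC (INR (S M))))))).
      { unfold a. replace (RtoC (INR (S M) ^ 2)) with (Cmult (RtoC (INR (S M))) (RtoC (INR (S M)))) by (rewrite <- RtoC_mult; f_equal; ring).
        set (w := RtoC (INR (S M))) in *. field. repeat split; auto.
        replace (Cminus (Cmult w w) (Cmult z z)) with (Copp (Cmult (Cplus z w) (Cminus z w))) by ring.
        intros E. apply (Cmult_neq_0 _ _ N3 N2). rewrite <- (Copp_involutive (Cmult _ _)), E. ring. }
      rewrite Ha. ring. }
  unfold cser. eapply clim_ext; [intros n; symmetry; apply Part|].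
  replace (Cmult (RtoC (2 * PI)) (Cplus (Lth th t) (RtoC (/ 2)))) with
    (Cmult Ci (Cminus (Cminus (Cinv z) (Cminus (Cinv z) (Cmult (RtoC PI) (ccot (Cmult (RtoC PI) z))))) (RtoC 0))).
  - apply clim_scal. apply clim_minus; [apply clim_minus; [apply clim_const|exact HS]|].
    apply (clim_inv_INR _ 1). intros n. rewrite Rmult_1_l.
    eapply Rle_trans; [|apply re_le_Cmod]. rewrite Re_plus, Re_RtoC. eapply Rle_trans; [|apply Rle_abs]. lra.
  - pose proof (one_minus_qth_neq th t Hth Ht) as Nq.
    unfold Lth, ccot, ccos, csin in *. set (w := Cmult (RtoC PI) z) in *.
    assert (Eq : qth th t = Cmult (cexp (Cmult Ci w)) (cexp (Cmult Ci w))).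
    { unfold qth. rewrite <- cexp_add. f_equal. unfold w, z. apply Ceq_pair; cri; simpl; ring. }
    rewrite Eq in *. rewrite cexp_opp in *. pose proof (cexp_neq_0 (Cmult Ci w)) as Ne. set (e := cexp (Cmult Ci w)) in *.
    rewrite RtoC_mult, RtoC_inv by lra.
    assert (Nd : Cminus (Cmult e e) (RtoC 1) <> RtoC 0).
    { intros E. apply Nq. rewrite <- (Copp_involutive (Cminus (RtoC 1) (Cmult e e))).
      replace (Copp (Cminus (RtoC 1) (Cmult e e))) with (Cminus (Cmult e e) (RtoC 1)) by ring. rewrite E. ring. }
    replace (Cmult Ci (Cminus (Cminus (Cinv z) (Cminus (Cinv z) (Cmult (RtoC PI) (Cdiv (Cdiv (Cplus e (Cinv e)) (RtoC 2)) (Cdiv (Cminus e (Cinv e)) (Cmult (RtoC 2) Ci)))))) (RtoC 0)))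
      with (Cmult (Cmult Ci Ci) (Cmult (RtoC PI) (Cdiv (Cplus (Cmult e e) (RtoC 1)) (Cminus (Cmult e e) (RtoC 1))))).
    + rewrite Ci_sqr. field. repeat split; auto.
    + field. repeat split; auto using Ci_neq.
Qed.

(** * The Hurwitz zeta function *)

Definition zser (a : R) (s : C) : C := CSeries (fun n => cpow (INR n + a) (Copp s)).

Lemma Rpower_pos x p : 0 < Rpower x p. Proof. apply exp_pos. Qed.

Lemma zser_cser a s : 0 < a -> 1 < Re s -> cser (fun n => cpow (INR n + a) (Copp s)) (zser a s).
Proof.
  intros Ha Hs. destruct (cser_compare (fun n => cpow (INR n + a) (Copp s)) (fun n => Rpower (INR n + a) (- Re s))) as [l Hl].
  - intros n. rewrite Cmod_cpow. rewrite Re_opp. lra.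
  - apply summable_power; auto.
  - unfold zser. rewrite (cser_CSeries _ _ Hl). exact Hl.
Qed.

Lemma exp_abs_le (d y : R) : exp (d * Rabs y) <= exp (d * y) + exp (- (d * y)).
Proof.
  pose proof (exp_pos (d * y)). pose proof (exp_pos (- (d * y))).
  unfold Rabs. destruct (Rcase_abs y); [replace (d * - y) with (- (d * y)) by ring|]; lra.
Qed.

Lemma zser_cdiff a s : 0 < a -> 1 < Re s -> cdiff (zser a) s.
Proof.
  intros Ha Hs. set (sg := Re s) in *. set (d := sg - 1). assert (Hd : 0 < d) by (unfold d; lra).
  set (v := fun n => INR n + a). assert (Hv : forall n, 0 < v n) by (intros n; unfold v; pose proof (pos_INR n); lra).
  (* The factor exp (d / 2 |ln v|) of [cexp_taylor_weight] is at most v^(d/2) + v^(-d/2). With d =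
     sg - 1 both shifted exponents still exceed 1. *)
  set (b := fun n => Rpower (v n) (- (sg - d / 2)) + Rpower (v n) (- (sg + d / 2))).
  assert (Sb : summable b).
  { apply summable_plus; apply summable_power; auto; unfold d; lra. }
  assert (Wb : forall n, exp (d / 2 * Rabs (- ln (v n))) * Rpower (v n) (- sg) <= b n).
  { intros n. unfold b. eapply Rle_trans; [apply Rmult_le_compat_r; [left; apply exp_pos|apply exp_abs_le]|].
    unfold Rpower. rewrite Rmult_plus_distr_r, <- !exp_plus. right. rewrite Rplus_comm. f_equal; f_equal; ring. }
  destruct (summable_lim b Sb) as [B [HB0 [HB _]]].
  destruct (cser_compare (fun n => Cmult (RtoC (- ln (v n))) (cpow (v n) (Copp s))) (fun n => 2 / d * b n)) as [l Hl].
  { intros n. rewrite Cmod_mult, Cmod_R, Cmod_cpow, Re_opp. fold sg.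
    pose proof (exp_ineq1_le (d / 2 * Rabs (- ln (v n)))) as E.
    assert (Ey : Rabs (- ln (v n)) <= 2 / d * exp (d / 2 * Rabs (- ln (v n)))).
    { apply Rmult_le_reg_l with (d / 2); [lra|]. replace (d / 2 * (2 / d * exp (d / 2 * Rabs (- ln (v n))))) with (exp (d / 2 * Rabs (- ln (v n)))) by (field; lra). lra. }
    eapply Rle_trans; [apply Rmult_le_compat_r; [left; apply exp_pos|exact Ey]|]. rewrite Rmult_assoc.
    apply Rmult_le_compat_l; [left; apply Rdiv_lt_0_compat; lra|]. apply Wb. }
  { apply summable_scal; auto. left; apply Rdiv_lt_0_compat; lra. }
  exists l. intros eps Heps. set (A := 32 / d ^ 2 * B).
  assert (HA : 0 <= A) by (unfold A; apply Rmult_le_pos; auto; apply Rdiv_le_0_compat; [lra|apply pow_lt; auto]).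
  exists (Rmin (d / 4) (eps / (A + 1))). split; [apply Rmin_pos; [lra|apply Rdiv_lt_0_compat; lra]|].
  intros w Hw. set (h := Cminus w s) in *.
  assert (h1 : Cmod h <= d / 4) by (left; eapply Rlt_le_trans; [apply Hw|apply Rmin_l]).
  assert (h2 : Cmod h < eps / (A + 1)) by (eapply Rlt_le_trans; [apply Hw|apply Rmin_r]).
  assert (Hw1 : 1 < Re w).
  { replace w with (Cplus s h) by (unfold h; ring). rewrite Re_plus. fold sg. pose proof (re_le_Cmod h).
    apply Rabs_le_between in H. unfold d in *. lra. }
  pose proof (zser_cser a w Ha Hw1) as S1. pose proof (zser_cser a s Ha Hs) as S2.
  pose proof (cser_minus _ _ _ _ (cser_minus _ _ _ _ S1 S2) (cser_scal h _ _ Hl)) as S3.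
  eapply Rle_trans; [apply (cser_bound _ (fun n => Cmod h ^ 2 * (32 / d ^ 2) * b n) _ (Cmod h ^ 2 * (32 / d ^ 2) * B) ) with (2 := S3)|].
  - intros n. fold (v n).
    match goal with |- Cmod ?t <= _ => replace t with (Cmult (Cminus (Cminus (cexp (Cmult h (RtoC (- ln (v n))))) (RtoC 1)) (Cmult h (RtoC (- ln (v n))))) (cpow (v n) (Copp s))) end.
    + rewrite Cmod_mult, Cmod_cpow, Re_opp. fold sg.
      eapply Rle_trans; [apply Rmult_le_compat_r; [left; apply exp_pos|apply (cexp_taylor_weight h _ d Hd h1)]|].
      rewrite Rmult_assoc. apply Rmult_le_compat_l; [|apply Wb].
      apply Rmult_le_pos; [apply pow2_ge_0|]. apply Rdiv_le_0_compat; [lra|apply pow_lt; auto].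
    + replace (cpow (v n) (Copp w)) with (Cmult (cexp (Cmult h (RtoC (- ln (v n))))) (cpow (v n) (Copp s))).
      * ring.
      * unfold cpow. rewrite <- cexp_add. f_equal. unfold h. rewrite RtoC_opp. ring.
  - intros n. rewrite rsum_scal. apply Rmult_le_compat_l; [|apply HB].
    apply Rmult_le_pos; [apply pow2_ge_0|]. apply Rdiv_le_0_compat; [lra|apply pow_lt; auto].
  - replace (Cmod h ^ 2 * (32 / d ^ 2) * B) with (Cmod h * A * Cmod h) by (unfold A; ring).
    apply Rmult_le_compat_r; [apply Cmod_ge_0|].
    apply Rle_trans with (eps / (A + 1) * A); [apply Rmult_le_compat_r; lra|].
    apply Rmult_le_reg_r with (A + 1); [lra|]. field_simplify; [|lra]. nra.
Qed.

(** A weighted geometric mean of e^(2 y) and v^2 is at most the larger of them. Read as a lower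
    bound for the denominator, it trades powers of t = e^y for powers of v, with [al] free. *)
Lemma weighted_amgm (y v al : R) : 0 < v -> 0 <= al <= 2 -> exp ((2 - al) * y) * Rpower v al <= exp (2 * y) + v ^ 2.
Proof.
  intros Hv Ha. pose proof (exp_pos (2 * y)). assert (0 < v ^ 2) by (apply pow_lt; auto).
  unfold Rpower. rewrite <- exp_plus.
  assert (E : v ^ 2 = exp (2 * ln v)) by (replace (2 * ln v) with (ln v + ln v) by ring; rewrite exp_plus, exp_ln by auto; ring).
  destruct (Rle_dec y (ln v)).
  - apply Rle_trans with (exp (2 * ln v)); [apply exp_le; nra|lra].
  - apply Rle_trans with (exp (2 * y)); [apply exp_le; nra|lra].
Qed.

(* [1 / (t - i u) - 1 / (- i u)] for [u] of either sign. *)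
Definition gk (u t : R) : C := Cdiv (RtoC t) (Cmult (Cmult Ci (RtoC u)) (Cminus (RtoC t) (Cmult Ci (RtoC u)))).

Lemma tiu_neq u t : u <> 0 -> Cminus (RtoC t) (Cmult Ci (RtoC u)) <> RtoC 0.
Proof. intros Hu E. apply (f_equal Im) in E. rewrite Im_minus, Im_mult, !Im_RtoC, Re_Ci, Im_Ci, Re_RtoC in E. lra. Qed.

Lemma Ciu_neq u : u <> 0 -> Cmult Ci (RtoC u) <> RtoC 0.
Proof. intros. apply Cmult_neq_0; [apply Ci_neq|apply RtoC_neq; auto]. Qed.

Lemma gk_cont u : u <> 0 -> ccontR (fun y => gk u (exp y)).
Proof.
  intros Hu t. unfold gk. cont; try apply continuous_exp. apply Cmult_neq_0; [apply Ciu_neq; auto|apply tiu_neq; auto].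
Qed.

(** [weighted_amgm] with exponent 2 be bounds |t - i u|^2 = t^2 + u^2 from below. *)
Lemma Cmod_gk u y be : u <> 0 -> 0 <= be <= 1 -> Cmod (gk u (exp y)) <= exp (be * y) * Rpower (Rabs u) (- (1 + be)).
Proof.
  intros Hu Hb. assert (Ha : 0 < Rabs u) by (apply Rabs_pos_lt; auto). pose proof (exp_pos y) as Hy.
  unfold gk. pose proof (tiu_neq u (exp y) Hu) as N. rewrite Cmod_div by (apply Cmult_neq_0; [apply Ciu_neq; auto|auto]).
  rewrite !Cmod_mult, Cmod_Ci, !Cmod_R, Rmult_1_l, (Rabs_pos_eq (exp y)) by lra.
  assert (L : exp ((1 - be) * y) * Rpower (Rabs u) be <= Cmod (Cminus (RtoC (exp y)) (Cmult Ci (RtoC u)))).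
  { apply pow_incr_inv2; [apply Cmod_ge_0|]. rewrite Cmod2_alt. cri.
    pose proof (weighted_amgm y (Rabs u) (2 * be) Ha ltac:(lra)) as W.
    replace ((exp ((1 - be) * y) * Rpower (Rabs u) be) ^ 2) with (exp ((2 - 2 * be) * y) * Rpower (Rabs u) (2 * be)).
    - eapply Rle_trans; [exact W|]. rewrite pow2_abs. replace (exp (2 * y)) with (exp y * exp y) by (rewrite <- exp_plus; f_equal; ring). right. ring.
    - unfold Rpower. simpl. rewrite Rmult_1_r, <- !exp_plus. f_equal. ring. }
  assert (P : 0 < exp ((1 - be) * y) * Rpower (Rabs u) be) by (apply Rmult_lt_0_compat; apply exp_pos).
  apply Rle_trans with (exp y * / (Rabs u * (exp ((1 - be) * y) * Rpower (Rabs u) be))).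
  - apply Rmult_le_compat_l; [lra|]. apply Rinv_le_contravar; [apply Rmult_lt_0_compat; auto|]. apply Rmult_le_compat_l; lra.
  - right. assert (E1 : exp (ln (Rabs u)) = Rabs u) by (apply exp_ln; auto). rewrite <- E1 at 1. unfold Rpower.
    rewrite <- !exp_plus, <- exp_Ropp, <- exp_plus. f_equal. ring.
Qed.

(* Choosing the exponent of the weighted AM-GM inequality on each side of the origin turns
   it into exponential decay in [y], summable in [u]. *)
Lemma gk_weight u y sg d : u <> 0 -> 0 < d -> 1 <= sg - d -> sg + d <= 2 ->
  exp ((1 - sg) * y) * Cmod (gk u (exp y)) <= (Rpower (Rabs u) (- (sg - d)) + Rpower (Rabs u) (- (sg + d))) * exp (- d * Rabs y).
Proof.
  intros Hu Hd H1 H2. pose proof (Rpower_pos (Rabs u) (- (sg - d))). pose proof (Rpower_pos (Rabs u) (- (sg + d))).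
  pose proof (exp_pos (- d * Rabs y)).
  destruct (Rle_dec 0 y).
  - apply Rle_trans with (Rpower (Rabs u) (- (sg - d)) * exp (- d * Rabs y)); [|apply Rmult_le_compat_r; lra].
    eapply Rle_trans; [apply Rmult_le_compat_l; [left; apply exp_pos|apply (Cmod_gk u y (sg - 1 - d)); auto; lra]|].
    rewrite <- Rmult_assoc, <- exp_plus, Rmult_comm. right. rewrite (Rabs_pos_eq y) by auto. f_equal; f_equal; ring.
  - apply Rle_trans with (Rpower (Rabs u) (- (sg + d)) * exp (- d * Rabs y)); [|apply Rmult_le_compat_r; lra].
    eapply Rle_trans; [apply Rmult_le_compat_l; [left; apply exp_pos|apply (Cmod_gk u y (sg - 1 + d)); auto; lra]|].
    rewrite <- Rmult_assoc, <- exp_plus, Rmult_comm. right. rewrite (Rabs_left y) by lra. f_equal; f_equal; ring.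
Qed.

(** The transform of 1 / (1 + t^2) for 0 < Re s < 2, used as a meromorphic function on all of C. *)
Definition kap (s : C) : C := Cdiv (RtoC PI) (Cmult (RtoC 2) (csin (Cmult (RtoC (PI / 2)) s))).

Lemma Mel_kern_kap v s : 0 < v -> 0 < Re s < 2 -> Mel (kern v) s = Cmult (cpow v (Cminus s (RtoC 2))) (kap s).
Proof. apply Mel_kern. Qed.

Lemma kern_mdec v sg : 0 < v -> 0 < sg < 2 -> mdec (kern v) sg.
Proof. apply kern_bound. Qed.

Lemma kern_abs u y : kern (Rabs u) y = kern u y.
Proof. unfold kern. rewrite pow2_abs. reflexivity. Qed.

Lemma gk_kern u y : u <> 0 -> gk u (exp y) =
  Cmult (Cinv (Cmult Ci (RtoC u))) (Cplus (Cmult (RtoC (exp (2 * y))) (kern (Rabs u) y)) (Cmult (Cmult Ci (RtoC u)) (Cmult (RtoC (exp y)) (kern (Rabs u) y)))).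
Proof.
  intros Hu. rewrite kern_abs. unfold gk, kern. pose proof (tiu_neq u (exp y) Hu) as N1. pose proof (tiu_neq (- u) (exp y) ltac:(lra)) as N2.
  rewrite RtoC_opp in N2. replace (exp (2 * y)) with (exp y * exp y) by (rewrite <- exp_plus; f_equal; ring).
  replace (RtoC (exp y * exp y + u ^ 2)) with (Cmult (Cminus (RtoC (exp y)) (Cmult Ci (RtoC u))) (Cminus (RtoC (exp y)) (Cmult Ci (Copp (RtoC u))))).
  - pose proof (Ciu_neq u Hu) as N3. rewrite RtoC_mult. set (t := RtoC (exp y)) in *.
    replace (Cmult Ci (Copp (RtoC u))) with (Copp (Cmult Ci (RtoC u))) in * by ring.
    set (w := Cmult Ci (RtoC u)) in *. field. repeat split; auto.
  - apply Ceq_pair; cri; ring.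
Qed.

Lemma Mel_gk u s : u <> 0 -> 1 < Re s < 2 ->
  Mel (fun y => gk u (exp y)) (Cminus (RtoC 1) s) = Cmult (cpow (Rabs u) (Copp s))
    (Cplus (kap (Cminus (RtoC 2) s)) (Cmult (Cinv (Cmult Ci (RtoC (u / Rabs u)))) (kap (Cminus (RtoC 3) s)))).
Proof.
  intros Hu Hs. set (v := Rabs u). assert (Hv : 0 < v) by (apply Rabs_pos_lt; auto).
  assert (R3 : 0 < Re (Cminus (RtoC 3) s) < 2) by (cri; lra). assert (R2 : 0 < Re (Cminus (RtoC 2) s) < 2) by (cri; lra).
  pose proof (Mel_good _ _ (kern_cont v) (kern_mdec v _ Hv R3)) as G3. pose proof (Mel_good _ _ (kern_cont v) (kern_mdec v _ Hv R2)) as G2.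
  set (w := Cmult Ci (RtoC u)). assert (Hw : w <> RtoC 0) by (apply Ciu_neq; auto).
  unfold Mel. rewrite (Int_ext _ (fun y => Cmult (Cinv w) (Cplus (Cmult (cexp (Cmult (Cminus (RtoC 3) s) (RtoC y))) (kern v y))
      (Cmult w (Cmult (cexp (Cmult (Cminus (RtoC 2) s) (RtoC y))) (kern v y)))))).
  - rewrite Int_scal by (apply good_plus; [auto|apply good_scal; auto]).
    rewrite Int_plus by (auto; apply good_scal; auto). rewrite Int_scal by auto.
    fold (Mel (kern v) (Cminus (RtoC 3) s)). fold (Mel (kern v) (Cminus (RtoC 2) s)). rewrite !Mel_kern_kap by auto.
    replace (Cminus (Cminus (RtoC 3) s) (RtoC 2)) with (Cplus (Copp s) (RtoC 1)) by (apply Ceq_pair; cri; ring).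
    replace (Cminus (Cminus (RtoC 2) s) (RtoC 2)) with (Copp s) by ring.
    rewrite cpow_add, cpow_1 by auto. unfold w in *. rewrite RtoC_div by lra.
    assert (RtoC v <> RtoC 0) by (apply RtoC_neq; lra). assert (RtoC u <> RtoC 0) by (apply RtoC_neq; lra).
    fold v. generalize (kap (Cminus (RtoC 3) s)) (kap (Cminus (RtoC 2) s)) (cpow v (Copp s)). intros k3 k2 c.
    field. repeat split; auto using Ci_neq.
  - intros y. rewrite gk_kern by auto. fold v w.
    replace (Cmult (Cminus (RtoC 3) s) (RtoC y)) with (Cplus (Cmult (Cminus (RtoC 1) s) (RtoC y)) (RtoC (2 * y))) by (apply Ceq_pair; cri; ring).
    replace (Cmult (Cminus (RtoC 2) s) (RtoC y)) with (Cplus (Cmult (Cminus (RtoC 1) s) (RtoC y)) (RtoC y)) by (apply Ceq_pair; cri; ring).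
    rewrite !cexp_add, !cexp_RtoC. ring.
Qed.

Definition Ldiff (th y : R) : C := Cminus (Lth th (exp y)) (Lth th 0).

Lemma pairf_diff th t m : 0 < th < 1 -> Cminus (pairf th t m) (pairf th 0 m) = Cplus (gk (INR m + th) t) (gk (- (INR m + (1 - th))) t).
Proof.
  intros H. pose proof (pos_INR m) as Hm. unfold pairf, gk.
  pose proof (tiu_neq (INR m + th) t ltac:(lra)) as N1. pose proof (tiu_neq (INR m + th) 0 ltac:(lra)) as N2.
  pose proof (tiu_neq (- (INR m + (1 - th))) t ltac:(lra)) as N3. pose proof (tiu_neq (- (INR m + (1 - th))) 0 ltac:(lra)) as N4.
  pose proof (Ciu_neq (INR m + th) ltac:(lra)) as N5. pose proof (Ciu_neq (- (INR m + (1 - th))) ltac:(lra)) as N6.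
  set (v := RtoC (INR m + th)) in *. rewrite !RtoC_opp in *. set (v' := RtoC (INR m + (1 - th))) in *.
  replace (Cmult Ci (Copp v')) with (Copp (Cmult Ci v')) in * by ring. set (w := Cmult Ci v) in *. set (w' := Cmult Ci v') in *.
  assert (N7 : Cplus (RtoC t) w' <> RtoC 0) by (replace (Cplus (RtoC t) w') with (Cminus (RtoC t) (Copp w')) by ring; auto).
  assert (N8 : w' <> RtoC 0) by (intros E; apply N6; rewrite E; ring).
  replace (Cminus (RtoC 0) w) with (Copp w) by ring. replace (Cplus (RtoC 0) w') with w' by ring.
  replace (Cminus (RtoC t) (Copp w')) with (Cplus (RtoC t) w') by ring.
  field. repeat split; auto.
Qed.

Lemma Ldiff_cser th y : 0 < th < 1 ->
  cser (fun m => Cplus (gk (INR m + th) (exp y)) (gk (- (INR m + (1 - th))) (exp y))) (Cmult (RtoC (2 * PI)) (Ldiff th y)).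
Proof.
  intros H. pose proof (exp_pos y).
  pose proof (cser_minus _ _ _ _ (Lth_expansion th (exp y) H ltac:(lra)) (Lth_expansion th 0 H (Rle_refl _))) as S.
  replace (Cmult (RtoC (2 * PI)) (Ldiff th y)) with (Cminus (Cmult (RtoC (2 * PI)) (Cplus (Lth th (exp y)) (RtoC (/ 2))))
     (Cmult (RtoC (2 * PI)) (Cplus (Lth th 0) (RtoC (/ 2))))) by (unfold Ldiff; ring).
  eapply cser_ext; [|exact S]. intros m. cbv beta. apply pairf_diff; auto.
Qed.

Definition kapp (s : C) : C := Cplus (kap (Cminus (RtoC 2) s)) (Cmult (Cinv Ci) (kap (Cminus (RtoC 3) s))).
Definition kapm (s : C) : C := Cplus (kap (Cminus (RtoC 2) s)) (Cmult (Cinv (Copp Ci)) (kap (Cminus (RtoC 3) s))).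

Lemma Ldiff_cont th : 0 < th < 1 -> ccontR (Ldiff th).
Proof. intros H t. unfold Ldiff. apply continuous_Cminus; [apply Lth_exp_cont; auto|apply continuous_Cconst]. Qed.

(** Subtracting the value at t = 0 gives a transform at 1 - s for 1 < Re s < 2, where the expansion
    into [gk] can be integrated termwise. The poles on the positive imaginary axis sum to zeta (s,
    th), those on the negative one to zeta (s, 1 - th). *)
Lemma Mel_Ldiff th s : 0 < th < 1 -> 1 < Re s < 2 ->
  good (fun y => Cmult (cexp (Cmult (Cminus (RtoC 1) s) (RtoC y))) (Ldiff th y)) /\
  Cmult (RtoC (2 * PI)) (Mel (Ldiff th) (Cminus (RtoC 1) s)) = Cplus (Cmult (kapp s) (zser th s)) (Cmult (kapm s) (zser (1 - th) s)).
Proof.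
  intros H Hs. set (sg := Re s) in *. set (d := Rmin (sg - 1) (2 - sg) / 2).
  assert (Hd : 0 < d) by (unfold d; apply Rdiv_lt_0_compat; [apply Rmin_pos; lra|lra]).
  assert (Hd1 : 1 < sg - d) by (unfold d; pose proof (Rmin_l (sg - 1) (2 - sg)); lra).
  assert (Hd2 : sg + d <= 2) by (unfold d; pose proof (Rmin_r (sg - 1) (2 - sg)); lra).
  set (u1 := fun m => INR m + th). set (u2 := fun m => - (INR m + (1 - th))).
  assert (Hu1 : forall m, 0 < u1 m) by (intros m; unfold u1; pose proof (pos_INR m); lra).
  assert (Hu2 : forall m, u2 m < 0) by (intros m; unfold u2; pose proof (pos_INR m); lra).
  set (e := fun y => cexp (Cmult (Cminus (RtoC 1) s) (RtoC y))).
  set (c := fun u => Rpower (Rabs u) (- (sg - d)) + Rpower (Rabs u) (- (sg + d))).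
  assert (Re1 : forall y, Cmod (e y) = exp ((1 - sg) * y)).
  { intros y. unfold e. rewrite Cmod_cexp. f_equal. cri. fold sg. ring. }
  assert (W : forall u, u <> 0 -> edecay (fun y => Cmult (e y) (gk u (exp y))) (c u) d).
  { intros u Hu y. rewrite Cmod_mult, Re1. apply gk_weight; auto; lra. }
  assert (Cc : forall u, u <> 0 -> ccontR (fun y => Cmult (e y) (gk u (exp y)))).
  { intros u Hu t. apply continuous_Cmult; [unfold e; cont|apply gk_cont; auto]. }
  assert (Gg : forall u, u <> 0 -> good (fun y => Cmult (e y) (gk u (exp y)))).
  { intros u Hu. split; auto. exists (c u), d. split; auto. }
  destruct (cser_Int (fun m y => Cplus (Cmult (e y) (gk (u1 m) (exp y))) (Cmult (e y) (gk (u2 m) (exp y))))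
     (fun y => Cmult (RtoC (2 * PI)) (Cmult (e y) (Ldiff th y))) (fun m => c (u1 m) + c (u2 m)) d Hd) as [G S].
  - intros m t. apply continuous_Cplus; apply Cc; [specialize (Hu1 m)|specialize (Hu2 m)]; lra.
  - intros m y. eapply Rle_trans; [apply Cmod_triangle|]. rewrite Rmult_plus_distr_r.
    apply Rplus_le_compat; apply W; [specialize (Hu1 m)|specialize (Hu2 m)]; lra.
  - apply summable_plus; unfold c; apply summable_plus.
    + eapply summable_le; [|apply (summable_power th (sg - d)); lra]. intros m. specialize (Hu1 m). rewrite Rabs_pos_eq by lra. split; [left; apply exp_pos|unfold u1; lra].
    + eapply summable_le; [|apply (summable_power th (sg + d)); lra]. intros m. specialize (Hu1 m). rewrite Rabs_pos_eq by lra. split; [left; apply exp_pos|unfold u1; lra].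
    + eapply summable_le; [|apply (summable_power (1 - th) (sg - d)); lra]. intros m. specialize (Hu2 m). rewrite Rabs_left by lra. split; [left; apply exp_pos|unfold u2; rewrite Ropp_involutive; lra].
    + eapply summable_le; [|apply (summable_power (1 - th) (sg + d)); lra]. intros m. specialize (Hu2 m). rewrite Rabs_left by lra. split; [left; apply exp_pos|unfold u2; rewrite Ropp_involutive; lra].
  - intros t. apply continuous_Cmult; [apply continuous_Cconst|]. apply continuous_Cmult; [unfold e; cont|apply Ldiff_cont; auto].
  - intros y. pose proof (cser_scal (e y) _ _ (Ldiff_cser th y H)) as S.
    replace (Cmult (RtoC (2 * PI)) (Cmult (e y) (Ldiff th y))) with (Cmult (e y) (Cmult (RtoC (2 * PI)) (Ldiff th y))) by ring.
    eapply cser_ext; [|exact S]. intros m. unfold u1, u2. ring.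
  - assert (HP : RtoC (2 * PI) <> RtoC 0) by (apply RtoC_neq; pose proof PI_RGT_0; lra).
    assert (Gm : good (fun y => Cmult (e y) (Ldiff th y))).
    { apply (good_scal (Cinv (RtoC (2 * PI)))) in G. eapply good_ext; [|exact G]. intros y. cbv beta. field. auto. }
    split; [exact Gm|].
    rewrite Int_scal in S by exact Gm.
    change (Mel (Ldiff th) (Cminus (RtoC 1) s)) with (Int (fun y => Cmult (e y) (Ldiff th y))).
    eapply cser_unique; [exact S|].
    eapply cser_ext; [|exact (cser_plus _ _ _ _ (cser_scal (kapp s) _ _ (zser_cser th s ltac:(lra) ltac:(fold sg; lra))) (cser_scal (kapm s) _ _ (zser_cser (1 - th) s ltac:(lra) ltac:(fold sg; lra))))].
    intros m. cbv beta. specialize (Hu1 m). specialize (Hu2 m).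
    rewrite Int_plus by (apply Gg; lra).
    pose proof (Mel_gk (u1 m) s ltac:(lra) Hs) as M1. pose proof (Mel_gk (u2 m) s ltac:(lra) Hs) as M2.
    change (Mel (fun y : R => gk (u1 m) (exp y)) (Cminus (RtoC 1) s)) with (Int (fun y => Cmult (e y) (gk (u1 m) (exp y)))) in M1. change (Mel (fun y : R => gk (u2 m) (exp y)) (Cminus (RtoC 1) s)) with (Int (fun y => Cmult (e y) (gk (u2 m) (exp y)))) in M2.
    rewrite M1, M2.
    rewrite (Rabs_pos_eq (u1 m)), (Rabs_left (u2 m)) by lra.
    replace (u1 m / u1 m) with 1 by (field; lra). replace (u2 m / - u2 m) with (-1) by (field; lra).
    unfold kapp, kapm. fold (u1 m). replace (INR m + (1 - th)) with (- u2 m) by (unfold u2; ring).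
    replace (Cmult Ci (RtoC 1)) with Ci by ring. replace (Cmult Ci (RtoC (-1))) with (Copp Ci) by (apply Ceq_pair; cri; ring).
    ring.
Qed.

Lemma exp_double_decay (k y : R) : 0 <= y -> exp (k * y) * exp (- (2 * PI * exp y)) <= exp (k ^ 2 / 2).
Proof.
  intros Hy. rewrite <- exp_plus. apply exp_le. pose proof (exp_ge_sqr y Hy). pose proof PI2_1. pose proof (exp_pos y).
  assert (2 * PI * exp y >= exp y) by nra. pose proof (pow2_ge_0 (y - k)). nra.
Qed.

Lemma Lth_mdec th sg : 0 < th < 1 -> 0 < sg -> mdec (fun y => Lth th (exp y)) sg.
Proof.
  intros H Hs. destruct (Lth_bound th H) as [K [HK [B1 _]]].
  exists (K * (exp ((2 * sg) ^ 2 / 2) + 1)), sg. split; auto. intros y. pose proof (exp_pos y).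
  pose proof (exp_pos ((2 * sg) ^ 2 / 2)) as HE.
  specialize (B1 (exp y) ltac:(lra)).
  apply Rle_trans with (exp (sg * y) * (K * exp (- (2 * PI * exp y)))); [apply Rmult_le_compat_l; [left; apply exp_pos|auto]|].
  replace (exp (sg * y) * (K * exp (- (2 * PI * exp y)))) with (K * (exp (sg * y) * exp (- (2 * PI * exp y)))) by ring.
  rewrite (Rmult_assoc K). apply Rmult_le_compat_l; [lra|].
  destruct (Rle_dec 0 y).
  - rewrite Rabs_pos_eq by auto. pose proof (exp_double_decay (2 * sg) y ltac:(auto)) as D.
    replace (exp (sg * y)) with (exp (2 * sg * y) * exp (- sg * y)) by (rewrite <- exp_plus; f_equal; ring).
    pose proof (exp_pos (- sg * y)). pose proof (exp_pos (2 * sg * y)). pose proof (exp_pos (- (2 * PI * exp y))). nra.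
  - rewrite Rabs_left by lra. replace (- sg * - y) with (sg * y) by ring.
    assert (E : exp (- (2 * PI * exp y)) <= 1) by (rewrite <- exp_0; apply exp_le; pose proof PI_RGT_0; nra).
    pose proof (exp_pos (sg * y)). pose proof (exp_pos (- (2 * PI * exp y))). nra.
Qed.

(** The value at t = 0 is removed by means of 1 / (1 + t^2). The difference vanishes at least to
    first order at t = 0 and decays like t^(-2), so its transform exists for real parts between -1
    and 2; this bridges the line Re s = 1. *)
Definition Lmid (th y : R) : C := Cminus (Lth th (exp y)) (Cmult (Lth th 0) (kern 1 y)).

Lemma Lmid_cont th : 0 < th < 1 -> ccontR (Lmid th).
Proof.
  intros H t. unfold Lmid. apply continuous_Cminus; [apply Lth_exp_cont; auto|].
  apply continuous_Cmult; [apply continuous_Cconst|apply kern_cont].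
Qed.

Lemma kern_1_bound y : Cmod (kern 1 y) <= exp (-2 * y) /\ Cmod (Cminus (RtoC 1) (kern 1 y)) <= exp (2 * y).
Proof.
  pose proof (kern_pos 1 y). pose proof (exp_pos (2 * y)). unfold kern. rewrite <- RtoC_inv, <- RtoC_minus, !Cmod_R by lra.
  assert (0 < / (exp (2 * y) + 1 ^ 2)) by (apply Rinv_0_lt_compat; auto).
  assert (/ (exp (2 * y) + 1 ^ 2) <= 1) by (apply Rle_trans with (/ 1); [apply Rinv_le_contravar; lra|rewrite Rinv_1; lra]).
  split.
  - rewrite Rabs_pos_eq by lra. replace (-2 * y) with (- (2 * y)) by ring. rewrite exp_Ropp. apply Rinv_le_contravar; lra.
  - rewrite Rabs_pos_eq by lra.
    replace (1 - / (exp (2 * y) + 1 ^ 2)) with (exp (2 * y) * / (exp (2 * y) + 1 ^ 2)) by (field; lra). nra.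
Qed.

Lemma Lmid_mdec th sg : 0 < th < 1 -> -1 < sg < 2 -> mdec (Lmid th) sg.
Proof.
  intros H Hs. destruct (Lth_bound th H) as [K [HK [B1 [B2 _]]]]. set (l := Cmod (Lth th 0)). assert (Hl : 0 <= l) by apply Cmod_ge_0.
  exists (K * (exp (2 ^ 2 / 2) + 1) + l), (Rmin (sg + 1) (2 - sg)). split; [apply Rmin_pos; lra|].
  intros y. pose proof (exp_pos y) as Ey. pose proof (exp_pos (2 ^ 2 / 2)) as HE. destruct (kern_1_bound y) as [k1 k2].
  pose proof (Rmin_l (sg + 1) (2 - sg)). pose proof (Rmin_r (sg + 1) (2 - sg)). set (d := Rmin _ _) in *.
  destruct (Rle_dec 0 y) as [h|h].
  - assert (E : Cmod (Lmid th y) <= (K * (exp (2 ^ 2 / 2) + 1) + l) * exp (-2 * y)).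
    { unfold Lmid. eapply Rle_trans; [apply Cmod_triangle_minus|]. rewrite Cmod_mult. fold l. rewrite Rmult_plus_distr_r.
      apply Rplus_le_compat; [|apply Rmult_le_compat_l; auto].
      eapply Rle_trans; [apply B1; lra|]. rewrite (Rmult_assoc K). apply Rmult_le_compat_l; [lra|].
      pose proof (exp_double_decay 2 y h) as D. pose proof (exp_pos (-2 * y)).
      replace (exp (- (2 * PI * exp y))) with (exp (2 * y) * exp (- (2 * PI * exp y)) * exp (-2 * y)) by (rewrite <- !exp_plus; f_equal; ring).
      apply Rmult_le_compat_r; lra. }
    apply Rle_trans with (exp (sg * y) * ((K * (exp (2 ^ 2 / 2) + 1) + l) * exp (-2 * y))); [apply Rmult_le_compat_l; [left; apply exp_pos|auto]|].
    replace (exp (sg * y) * ((K * (exp (2 ^ 2 / 2) + 1) + l) * exp (-2 * y))) with ((K * (exp (2 ^ 2 / 2) + 1) + l) * exp (sg * y + -2 * y)) by (rewrite exp_plus; ring).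
    apply Rmult_le_compat_l; [nra|]. apply exp_le. rewrite Rabs_pos_eq by auto. nra.
  - assert (E : Cmod (Lmid th y) <= (K * (exp (2 ^ 2 / 2) + 1) + l) * exp y).
    { unfold Lmid. replace (Cminus (Lth th (exp y)) (Cmult (Lth th 0) (kern 1 y))) with
        (Cplus (Cminus (Lth th (exp y)) (Lth th 0)) (Cmult (Lth th 0) (Cminus (RtoC 1) (kern 1 y)))) by ring.
      eapply Rle_trans; [apply Cmod_triangle|]. rewrite Cmod_mult. fold l. rewrite Rmult_plus_distr_r.
      apply Rplus_le_compat.
      - eapply Rle_trans; [apply B2; lra|]. apply Rmult_le_compat_r; [lra|nra].
      - apply Rmult_le_compat_l; auto. eapply Rle_trans; [exact k2|]. apply exp_le. lra. }
    apply Rle_trans with (exp (sg * y) * ((K * (exp (2 ^ 2 / 2) + 1) + l) * exp y)); [apply Rmult_le_compat_l; [left; apply exp_pos|auto]|].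
    replace (exp (sg * y) * ((K * (exp (2 ^ 2 / 2) + 1) + l) * exp y)) with ((K * (exp (2 ^ 2 / 2) + 1) + l) * exp (sg * y + y)) by (rewrite exp_plus; ring).
    apply Rmult_le_compat_l; [nra|]. apply exp_le. rewrite Rabs_left by lra. nra.
Qed.

Definition Mmid (th : R) (s : C) : C := Cplus (Mel (Lmid th) (Cminus (RtoC 1) s)) (Cmult (Lth th 0) (kap (Cminus (RtoC 1) s))).
Definition Mleft (th : R) (s : C) : C := Mel (fun y => Lth th (exp y)) (Cminus (RtoC 1) s).

(** Hurwitz's formula: the combination of the transforms for [th] and [1 - th] that isolates zeta
    (s, th). *)
Definition zcomb (M : R -> C -> C) (th : R) (s : C) : C :=
  Cmult (Copp Ci) (Cminus (Cmult (cexp (Cmult Ci (Cmult (RtoC (PI / 2)) s))) (M th s))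
                          (Cmult (cexp (Copp (Cmult Ci (Cmult (RtoC (PI / 2)) s)))) (M (1 - th) s))).

Lemma Mmid_left th s : 0 < th < 1 -> -1 < Re s < 1 -> Mmid th s = Mleft th s.
Proof.
  intros H Hs. unfold Mmid, Mleft.
  assert (R1 : 0 < Re (Cminus (RtoC 1) s) < 2) by (cri; lra).
  assert (K : Mel (kern 1) (Cminus (RtoC 1) s) = kap (Cminus (RtoC 1) s)).
  { rewrite Mel_kern_kap by (lra || auto). rewrite cpow_1_base. ring. }
  rewrite <- K. unfold Mel.
  pose proof (Mel_good _ _ (Lmid_cont th H) (Lmid_mdec th (Re (Cminus (RtoC 1) s)) H ltac:(lra))) as G1.
  pose proof (Mel_good _ _ (kern_cont 1) (kern_mdec 1 _ Rlt_0_1 R1)) as G2.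
  rewrite <- Int_scal by exact G2. rewrite <- (Int_plus _ _ G1 (good_scal _ _ G2)).
  apply Int_ext. intros y. unfold Lmid. ring.
Qed.

Lemma kap_shift (s : C) : kap (Cplus s (RtoC 2)) = Copp (kap s).
Proof.
  unfold kap. replace (Cmult (RtoC (PI / 2)) (Cplus s (RtoC 2))) with (Cplus (Cmult (RtoC (PI / 2)) s) (RtoC PI)) by (apply Ceq_pair; cri; field).
  rewrite csin_plus_PI. destruct (Ceq_dec (csin (Cmult (RtoC (PI / 2)) s)) (RtoC 0)) as [E|E].
  (* At a pole both sides are 0, because [Cinv] sends 0 to 0; so the shift holds without
     exception. *)
  - rewrite E. replace (Copp (RtoC 0)) with (RtoC 0) by ring. rewrite Cmult_0_r. unfold Cdiv.
    replace (Cinv (RtoC 0)) with (RtoC 0). ring. unfold Cinv. apply Ceq_pair; simpl; unfold Rdiv; ring.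
  - field. auto.
Qed.

(** Here 1 - 1 / (1 + t^2) = t^2 / (1 + t^2) has at 1 - s the transform kap (3 - s) = - kap (1 - s).
    The sign is exactly what lets one formula serve on both sides of Re s = 1. *)
Lemma Mmid_right th s : 0 < th < 1 -> 1 < Re s < 2 -> Mmid th s = Mel (Ldiff th) (Cminus (RtoC 1) s).
Proof.
  intros H Hs. unfold Mmid.
  assert (R1 : -1 < Re (Cminus (RtoC 1) s) < 2) by (cri; lra). assert (R3 : 0 < Re (Cminus (RtoC 3) s) < 2) by (cri; lra).
  assert (K : Mel (kern 1) (Cminus (RtoC 3) s) = Copp (kap (Cminus (RtoC 1) s))).
  { rewrite Mel_kern_kap by (lra || auto). rewrite cpow_1_base. rewrite <- kap_shift. rewrite Cmult_1_l. f_equal. apply Ceq_pair; cri; ring. }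
  replace (kap (Cminus (RtoC 1) s)) with (Copp (Mel (kern 1) (Cminus (RtoC 3) s))) by (rewrite K; ring). unfold Mel.
  pose proof (Mel_good _ _ (Lmid_cont th H) (Lmid_mdec th _ H R1)) as G1.
  pose proof (Mel_good _ _ (kern_cont 1) (kern_mdec 1 _ Rlt_0_1 R3)) as G2.
  replace (Cmult (Lth th 0) (Copp (Int (fun y => Cmult (cexp (Cmult (Cminus (RtoC 3) s) (RtoC y))) (kern 1 y)))))
    with (Cmult (Copp (Lth th 0)) (Int (fun y => Cmult (cexp (Cmult (Cminus (RtoC 3) s) (RtoC y))) (kern 1 y)))) by ring.
  rewrite <- Int_scal by exact G2. rewrite <- (Int_plus _ _ G1 (good_scal _ _ G2)).
  apply Int_ext. intros y. unfold Lmid, Ldiff.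
  replace (Cmult (Cminus (RtoC 3) s) (RtoC y)) with (Cplus (Cmult (Cminus (RtoC 1) s) (RtoC y)) (RtoC (2 * y))) by (apply Ceq_pair; cri; ring).
  rewrite cexp_add, cexp_RtoC. unfold kern. pose proof (kern_pos 1 y) as P. rewrite RtoC_plus in *.
  assert (N : Cplus (RtoC (exp (2 * y))) (RtoC (1 ^ 2)) <> RtoC 0) by (rewrite <- RtoC_plus; apply RtoC_neq; lra).
  replace (1 ^ 2) with 1 in * by ring. field. auto.
Qed.

(** [Mel_Ldiff] at [th] and at [1 - th] is a linear system for the two zeta series, with
    coefficients pi / (2 sin w) and pi / (2 cos w), w = pi s / 2; [zcomb] is its solution. *)
Lemma zcomb_right th s : 0 < th < 1 -> 1 < Re s < 2 -> zcomb Mmid th s = zser th s.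
Proof.
  intros H Hs. pose proof PI_RGT_0 as HP.
  assert (H1 : 0 < 1 - th < 1) by lra.
  destruct (Mel_Ldiff th s H Hs) as [_ E1]. destruct (Mel_Ldiff (1 - th) s H1 Hs) as [_ E2].
  replace (1 - (1 - th)) with th in E2 by ring.
  unfold zcomb. rewrite !Mmid_right by auto.
  set (X := Mel (Ldiff th) _) in *. set (Y := Mel (Ldiff (1 - th)) _) in *.
  set (w := Cmult (RtoC (PI / 2)) s).
  assert (NP : RtoC PI <> RtoC 0) by (apply RtoC_neq; lra).
  assert (Sn : csin w <> RtoC 0) by (apply csin_strip_neq; unfold w; cri; split; nra).
  assert (K2 : kap (Cminus (RtoC 2) s) = Cdiv (RtoC PI) (Cmult (RtoC 2) (csin w))).
  { unfold kap. replace (Cmult (RtoC (PI / 2)) (Cminus (RtoC 2) s)) with (Cplus (Copp w) (RtoC PI)) by (unfold w; apply Ceq_pair; cri; field).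
    rewrite csin_plus_PI, csin_opp, Copp_involutive. reflexivity. }
  assert (K3 : kap (Cminus (RtoC 3) s) = Copp (Cdiv (RtoC PI) (Cmult (RtoC 2) (ccos w)))).
  { replace (Cminus (RtoC 3) s) with (Cplus (Cminus (RtoC 1) s) (RtoC 2)) by (apply Ceq_pair; cri; ring). rewrite kap_shift.
    unfold kap. replace (Cmult (RtoC (PI / 2)) (Cminus (RtoC 1) s)) with (Cminus (RtoC (PI / 2)) w) by (unfold w; apply Ceq_pair; cri; field).
    rewrite csin_PI2_minus. reflexivity. }
  assert (Cn : ccos w <> RtoC 0).
  { rewrite <- csin_PI2_minus. replace (Cminus (RtoC (PI / 2)) w) with (Copp (Cminus w (RtoC (PI / 2)))) by ring. rewrite csin_opp.
    assert (csin (Cminus w (RtoC (PI / 2))) <> RtoC 0) by (apply csin_strip_neq; unfold w; cri; split; nra).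
    intros E. apply H0. rewrite <- (Copp_involutive (csin _)), E. ring. }
  unfold kapp, kapm in E1, E2. rewrite K2, K3 in E1, E2.
  rewrite <- ccos_eul, <- ccos_eul'. set (Z := zser th s) in *. set (Z' := zser (1 - th) s) in *.
  apply (Cmult_eq_reg_l (RtoC (2 * PI))); [apply RtoC_neq; lra|].
  transitivity (Cmult (Copp Ci) (Cminus (Cmult (Cplus (ccos w) (Cmult Ci (csin w))) (Cmult (RtoC (2 * PI)) X))
                          (Cmult (Cminus (ccos w) (Cmult Ci (csin w))) (Cmult (RtoC (2 * PI)) Y)))); [ring|].
  rewrite E1, E2. assert (NC : Copp Ci <> RtoC 0) by (intros E; apply (f_equal Im) in E; simpl in E; lra).
  replace (Cinv (Copp Ci)) with Ci by (apply (Cmult_eq_reg_l (Copp Ci)); auto; rewrite Cinv_r by auto; transitivity (Copp (Cmult Ci Ci)); [ring|rewrite Ci_sqr; ring]).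
  rewrite Ci_inv'. rewrite RtoC_mult. set (c := ccos w) in *. set (sn := csin w) in *.
  apply (Cmult_eq_reg_l (Cmult sn c)); [apply Cmult_neq_0; auto|].
  field_simplify_eq; [|repeat split; auto].
  replace (Cpow Ci 4) with (RtoC 1) by (simpl; rewrite !Cmult_1_r; transitivity (Cmult (Cmult Ci Ci) (Cmult Ci Ci)); [rewrite Ci_sqr; ring|ring]).
  replace (Cpow Ci 2) with (Copp (RtoC 1)) by (simpl; rewrite !Cmult_1_r; rewrite Ci_sqr; ring).
  ring.
Qed.

Lemma Mel_cdiff_comp f (g : C -> C) s : ccontR f -> mdec f (Re (g s)) -> cdiff g s -> cdiff (fun s => Mel f (g s)) s.
Proof. intros. apply (cdiff_comp (Mel f) g); auto. apply Mel_cdiff; auto. Qed.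

Lemma kap_cdiff (g : C -> C) s : cdiff g s -> csin (Cmult (RtoC (PI / 2)) (g s)) <> RtoC 0 -> cdiff (fun s => kap (g s)) s.
Proof.
  intros Hg Hn. unfold kap. apply cdiff_div; [apply cdiff_const| |apply Cmult_neq_0; auto using C2_neq].
  apply cdiff_mult; [apply cdiff_const|]. apply cdiff_csin. apply cdiff_mult; [apply cdiff_const|auto].
Qed.

Lemma Mmid_cdiff th s : 0 < th < 1 -> -1 < Re s < 2 -> s <> RtoC 1 -> cdiff (Mmid th) s.
Proof.
  intros H Hs Hn. unfold Mmid. apply cdiff_plus.
  - apply Mel_cdiff_comp; [apply Lmid_cont; auto|apply Lmid_mdec; auto; cri; lra|cdiffs].
  - apply cdiff_mult; [apply cdiff_const|]. apply kap_cdiff; [cdiffs|].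
    intros E. destruct (csin_zero _ E) as [k Hk]. pose proof PI_RGT_0 as HP.
    assert (E1 := f_equal Re Hk). assert (E2 := f_equal Im Hk). revert E1 E2. cri. intros E1 E2.
    assert (K : -1 < IZR k < 1) by (split; nra). destruct K as [k1 k2]. apply lt_IZR in k1. apply lt_IZR in k2.
    assert (k = 0%Z) as -> by lia. apply Hn. apply Ceq_pair; simpl; nra.
Qed.

Lemma Mleft_cdiff th s : 0 < th < 1 -> Re s < 1 -> cdiff (Mleft th) s.
Proof.
  intros H Hs. unfold Mleft. apply (Mel_cdiff_comp _ (fun s => Cminus (RtoC 1) s)); [apply Lth_exp_cont; auto|apply Lth_mdec; auto; cri; lra|cdiffs].
Qed.

Lemma zcomb_cdiff M th s : cdiff (M th) s -> cdiff (M (1 - th)) s -> cdiff (zcomb M th) s.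
Proof. intros H1 H2. unfold zcomb. cdiffs; assumption. Qed.

Definition zfun (th : R) (s : C) : C :=
  if Rlt_dec (Re s) 1 then zcomb Mleft th s else if Rlt_dec 1 (Re s) then zser th s else zcomb Mmid th s.

Lemma Re_near (w s : C) r : Cmod (Cminus w s) < r -> Re s - r < Re w < Re s + r.
Proof. intros H. pose proof (re_le_Cmod (Cminus w s)) as K. rewrite Re_minus in K. apply Rabs_le_between in K. lra. Qed.

(** Off the line Re s = 1 a single piece is in force. Around a point of the line the disc of radius
    1 stays in 0 < Re s < 2, where [zcomb Mmid] agrees with all three pieces. *)
Lemma zfun_cdiff th s : 0 < th < 1 -> s <> RtoC 1 -> cdiff (zfun th) s.
Proof.
  intros H Hs. assert (H1 : 0 < 1 - th < 1) by lra.
  destruct (Rlt_dec (Re s) 1) as [h|h]; [|destruct (Rlt_dec 1 (Re s)) as [h'|h']].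
  - apply cdiff_loc with (f := zcomb Mleft th) (r := 1 - Re s); [lra| |].
    + intros w Hw. apply Re_near in Hw. unfold zfun. destruct (Rlt_dec (Re w) 1); [auto|lra].
    + apply zcomb_cdiff; apply Mleft_cdiff; auto.
  - apply cdiff_loc with (f := zser th) (r := Re s - 1); [lra| |].
    + intros w Hw. apply Re_near in Hw. unfold zfun. destruct (Rlt_dec (Re w) 1); [lra|]. destruct (Rlt_dec 1 (Re w)); [auto|lra].
    + apply zser_cdiff; lra.
  - apply cdiff_loc with (f := zcomb Mmid th) (r := 1); [lra| |].
    + intros w Hw. apply Re_near in Hw. unfold zfun. destruct (Rlt_dec (Re w) 1) as [l|l].
      * unfold zcomb. rewrite !Mmid_left by (auto; lra). reflexivity.
      * destruct (Rlt_dec 1 (Re w)); [|reflexivity]. apply zcomb_right; auto; lra.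
    + apply zcomb_cdiff; apply Mmid_cdiff; auto; lra.
Qed.

Lemma zfun_series th s : 1 < Re s -> zfun th s = zser th s.
Proof. intros H. unfold zfun. destruct (Rlt_dec (Re s) 1); [lra|]. destruct (Rlt_dec 1 (Re s)); [auto|lra]. Qed.

Lemma hurwitz_zeta_eq th s : 0 < th < 1 -> s <> RtoC 1 -> hurwitz_zeta s th = zfun th s.
Proof.
  intros H Hs. unfold hurwitz_zeta.
  match goal with |- epsilon ?i ?P = _ => assert (HP : P (epsilon i P)) end.
  { apply epsilon_spec. exists (zfun th s), (zfun th). repeat split.
    - intros z Hz. apply cdiff_ex_derive. apply zfun_cdiff; auto.
    - intros z Hz. apply cser_is_series. rewrite zfun_series by auto. apply zser_cser; auto; lra. }
  destruct HP as [f [H1 [H2 H3]]]. rewrite <- H3.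
  apply Ceq_minus.
  apply (identity_theorem (fun z => Cminus (f z) (zfun th z))); auto.
  - intros z Hz. apply cdiff_minus; [apply cdiff_ex_derive; auto|apply zfun_cdiff; auto].
  - intros z Hz. rewrite zfun_series by auto.
    rewrite (cser_unique _ _ _ (proj2 (cser_is_series _ _) (H2 z Hz)) (zser_cser th z ltac:(lra) Hz)). ring.
Qed.

Lemma hurwitz_series th s : 0 < th < 1 -> 1 < Re s -> cser (fun n => cpow (INR n + th) (Copp s)) (hurwitz_zeta s th).
Proof.
  intros H Hs. assert (s <> RtoC 1) by (intros E; rewrite E in Hs; simpl in Hs; lra).
  rewrite hurwitz_zeta_eq, zfun_series by auto. apply zser_cser; auto; lra.
Qed.

Lemma hurwitz_left th s : 0 < th < 1 -> Re s < 1 -> hurwitz_zeta s th = zcomb Mleft th s.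
Proof.
  intros H Hs. assert (s <> RtoC 1) by (intros E; rewrite E in Hs; simpl in Hs; lra).
  rewrite hurwitz_zeta_eq by auto. unfold zfun. destruct (Rlt_dec (Re s) 1); [auto|lra].
Qed.

Lemma hurwitz_cdiff th s : 0 < th < 1 -> s <> RtoC 1 -> cdiff (fun z => hurwitz_zeta z th) s.
Proof.
  intros H Hs. apply cdiff_loc with (f := zfun th) (r := Cmod (Cminus s (RtoC 1))).
  - apply Cmod_gt_0. intros E. apply Hs, Ceq_minus. auto.
  - intros w Hw. symmetry. apply hurwitz_zeta_eq; auto. intros ->. rewrite Cmod_minus_sym in Hw. lra.
  - apply zfun_cdiff; auto.
Qed.

(** * The even combination *)

(* [sum_(n >= 1) cos (2 pi n th) exp (- 2 pi n t)] for [t > 0] *)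
Definition Aev (th t : R) : C := Cmult (RtoC (/ 2)) (Cplus (Lth th t) (Lth (1 - th) t)).

Definition Zev (th : R) (s : C) : C := Cplus (hurwitz_zeta s th) (hurwitz_zeta s (1 - th)).

Lemma Aev_cont th : 0 < th < 1 -> ccontR (fun y => Aev th (exp y)).
Proof.
  intros H t. unfold Aev. apply continuous_Cmult; [apply continuous_Cconst|].
  apply continuous_Cplus; apply Lth_exp_cont; lra.
Qed.

(** In the sum over [th] and [1 - th] the two exponentials of [zcomb] combine to 2 sin (pi s / 2),
    and [Aev] is half the sum of the two generating functions. *)
Lemma Zev_left th s : 0 < th < 1 -> Re s < 1 ->
  Zev th s = Cmult (Cmult (RtoC 4) (csin (Cmult (RtoC (PI / 2)) s))) (Mel (fun y => Aev th (exp y)) (Cminus (RtoC 1) s)).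
Proof.
  intros H Hs. assert (H1 : 0 < 1 - th < 1) by lra. unfold Zev. rewrite !hurwitz_left by auto.
  assert (G : forall th, 0 < th < 1 -> good (fun y => Cmult (cexp (Cmult (Cminus (RtoC 1) s) (RtoC y))) (Lth th (exp y)))).
  { intros th' H'. apply Mel_good; [apply Lth_exp_cont; auto|apply Lth_mdec; auto; cri; lra]. }
  assert (E : Mel (fun y => Aev th (exp y)) (Cminus (RtoC 1) s) = Cmult (RtoC (/ 2)) (Cplus (Mleft th s) (Mleft (1 - th) s))).
  { unfold Mleft, Mel. rewrite <- (Int_plus _ _ (G _ H) (G _ H1)), <- (Int_scal _ _ (good_plus _ _ (G _ H) (G _ H1))).
    apply Int_ext. intros y. unfold Aev. ring. }
  rewrite E. unfold zcomb. replace (1 - (1 - th)) with th by ring. set (X := Mleft th s). set (Y := Mleft (1 - th) s).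
  unfold csin. set (a := cexp _). set (b := cexp _). rewrite RtoC_inv by lra.
  replace (RtoC 4) with (Cmult (RtoC 2) (RtoC 2)) by (rewrite <- RtoC_mult; f_equal; ring).
  rewrite <- (Ci_inv'). field. apply Ci_neq.
Qed.

Definition pair2 (th t : R) (m : nat) : C :=
  Cplus (RtoC (t / (t ^ 2 + (INR m + th) ^ 2))) (RtoC (t / (t ^ 2 + (INR m + (1 - th)) ^ 2))).

Lemma Aev_expansion th t : 0 < th < 1 -> 0 <= t ->
  cser (pair2 th t) (Cmult (RtoC (2 * PI)) (Cplus (Aev th t) (RtoC (/ 2)))).
Proof.
  intros H Ht. pose proof (cser_scal (RtoC (/ 2)) _ _ (cser_plus _ _ _ _ (Lth_expansion th t H Ht) (Lth_expansion (1 - th) t ltac:(lra) Ht))) as S.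
  replace (Cmult (RtoC (2 * PI)) (Cplus (Aev th t) (RtoC (/ 2)))) with
   (Cmult (RtoC (/ 2)) (Cplus (Cmult (RtoC (2 * PI)) (Cplus (Lth th t) (RtoC (/ 2)))) (Cmult (RtoC (2 * PI)) (Cplus (Lth (1 - th) t) (RtoC (/ 2)))))).
  2:{ unfold Aev. rewrite RtoC_inv by lra. field. }
  eapply cser_ext; [|exact S]. intros m. cbv beta. unfold pairf, pair2. pose proof (pos_INR m) as Hm.
  replace (1 - (1 - th)) with th by ring.
  assert (K : forall v, 0 < v -> Cplus (Cinv (Cminus (RtoC t) (Cmult Ci (RtoC v)))) (Cinv (Cplus (RtoC t) (Cmult Ci (RtoC v)))) = Cmult (RtoC 2) (RtoC (t / (t ^ 2 + v ^ 2)))).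
  { intros v Hv. assert (P : 0 < t ^ 2 + v ^ 2) by (pose proof (pow2_ge_0 t); assert (0 < v ^ 2) by (apply pow_lt; auto); lra).
    pose proof (tiu_neq v t ltac:(lra)) as N1. pose proof (tiu_neq (- v) t ltac:(lra)) as N2. rewrite RtoC_opp in N2.
    replace (Cminus (RtoC t) (Cmult Ci (Copp (RtoC v)))) with (Cplus (RtoC t) (Cmult Ci (RtoC v))) in N2 by ring.
    rewrite RtoC_div by lra.
    replace (RtoC (t ^ 2 + v ^ 2)) with (Cmult (Cminus (RtoC t) (Cmult Ci (RtoC v))) (Cplus (RtoC t) (Cmult Ci (RtoC v)))).
    - field. auto.
    - apply Ceq_pair; cri; ring. }
  rewrite RtoC_inv by lra.
  pose proof (K (INR m + th) ltac:(lra)) as K1. pose proof (K (INR m + (1 - th)) ltac:(lra)) as K2.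
  match goal with |- Cmult (Cinv (RtoC 2)) (Cplus (Cplus ?a ?b) (Cplus ?c ?d)) = _ =>
    replace (Cplus (Cplus a b) (Cplus c d)) with (Cplus (Cplus a d) (Cplus c b)) by ring end.
  rewrite K1, K2. field.
Qed.

(** * The Bessel function and the left-hand side *)

Definition ek (nu : C) (p q y : R) : C := Cmult (cexp (Cmult nu (RtoC y))) (RtoC (exp (- (p * exp y + q * exp (- y))))).

Lemma ek_cont nu p q : ccontR (ek nu p q).
Proof. intros t. unfold ek. cont; apply continuous_exp. Qed.

Lemma double_exp_decay (sg p q : R) : 0 < p -> 0 < q -> exists K, 0 < K /\ forall y,
  exp (sg * y) * exp (- (p * exp y + q * exp (- y))) <= K * exp (- 1 * Rabs y).
Proof.
  intros Hp Hq. set (m := Rmin p q). assert (Hm : 0 < m) by (apply Rmin_pos; auto).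
  assert (mp : m <= p) by apply Rmin_l. assert (mq : m <= q) by apply Rmin_r.
  set (s := Rabs sg + 1). exists (exp (s ^ 2 / (2 * m))). split; [apply exp_pos|]. intros y.
  rewrite <- !exp_plus. apply exp_le. pose proof (Rabs_pos sg) as Hs. pose proof (Rabs_pos y) as Hy.
  pose proof (exp_ge_sqr (Rabs y) Hy) as E. pose proof (exp_pos y). pose proof (exp_pos (- y)).
  assert (E2 : m * exp (Rabs y) <= p * exp y + q * exp (- y)).
  { unfold Rabs. destruct (Rcase_abs y); nra. }
  assert (E3 : sg * y <= Rabs sg * Rabs y) by (rewrite <- Rabs_mult; apply Rle_abs).
  assert (E4 : s * Rabs y - m * (Rabs y ^ 2 / 2) <= s ^ 2 / (2 * m)).
  { apply Rmult_le_reg_r with (2 * m); [lra|]. replace (s ^ 2 / (2 * m) * (2 * m)) with (s ^ 2) by (field; lra).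
    pose proof (pow2_ge_0 (s - m * Rabs y)). nra. }
  assert (E5 : m * (Rabs y ^ 2 / 2) <= m * exp (Rabs y)) by (apply Rmult_le_compat_l; lra).
  unfold s in *. lra.
Qed.

Lemma ek_good nu p q : 0 < p -> 0 < q -> good (ek nu p q).
Proof.
  intros Hp Hq. split; [apply ek_cont|]. destruct (double_exp_decay (Re nu) p q Hp Hq) as [K [HK H]].
  exists K, 1. split; [lra|]. intros y. unfold ek. rewrite Cmod_mult, Cmod_cexp, Cmod_R, Rabs_pos_eq by (left; apply exp_pos).
  replace (Re (Cmult nu (RtoC y))) with (Re nu * y) by (cri; ring). apply H.
Qed.

(** Folding the line at 0 turns e^(nu y) into 2 cosh (nu y). *)
Lemma BesselK_Int nu z : 0 < z -> Cmult (RtoC 2) (BesselK nu z) = Int (ek nu (z / 2) (z / 2)).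
Proof.
  intros Hz. set (f := ek nu (z / 2) (z / 2)). assert (G : good f) by (apply ek_good; lra).
  pose proof (Int_spec f G) as HI. set (I := Int f) in *.
  set (g := fun t => Cmult (RtoC (exp (- z * cosh t))) (ccosh (Cmult nu (RtoC t)))).
  assert (Efg : forall t, Cplus (f t) (f (- t)) = Cmult (RtoC 2) (g t)).
  { intros t. unfold f, g, ek, ccosh, cosh. rewrite Ropp_involutive.
    replace (- (z / 2 * exp t + z / 2 * exp (- t))) with (- z * ((exp t + exp (- t)) / 2)) by field.
    replace (- (z / 2 * exp (- t) + z / 2 * exp t)) with (- z * ((exp t + exp (- t)) / 2)) by field.
    replace (Cmult nu (RtoC (- t))) with (Copp (Cmult nu (RtoC t))) by (rewrite RtoC_opp; ring). field. }
  assert (Cf : ccontR f) by apply G.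
  assert (Cg : ccontR g).
  { assert (Eg : forall s : R, Cmult (RtoC (/ 2)) (Cplus (f s) (f (- s))) = g s) by (intros s; rewrite Efg, RtoC_inv by lra; field).
    intros t. apply continuous_ext with (fun t => Cmult (RtoC (/ 2)) (Cplus (f t) (f (- t)))).
    - exact Eg.
    - apply continuous_Cmult; [apply continuous_Cconst|]. apply continuous_Cplus; [apply Cf|apply ccontR_neg; auto]. }
  assert (Eint : forall b, CInt f (- b) b = Cmult (RtoC 2) (CInt g 0 b)).
  { intros b. rewrite (CInt_Chasles f (- b) 0 b) by (apply ccontR_ex; auto).
    replace 0 with (- 0) at 1 by ring. rewrite <- CInt_neg by auto. rewrite <- CInt_scal by (apply ccontR_ex; auto).
    rewrite <- CInt_plus by (apply ccontR_ex; auto; apply ccontR_neg; auto).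
    apply CInt_ext. intros t. rewrite <- Efg. ring. }
  assert (HB : BesselK nu z = Cmult (RtoC (/ 2)) I).
  { unfold BesselK. apply (@is_RInt_gen_unique CR); [apply Proper_StrongProper, at_point_filter|apply Proper_StrongProper, Rbar_locally_filter|].
    intros P [eps HP]. destruct (HI (eps)) as [T HT]; [apply cond_pos|].
    apply Filter_prod with (Q := fun a => a = 0) (R := fun b => T < b).
    - reflexivity.
    - exists T. auto.
    - intros a b -> Hb. exists (CInt g 0 b). split.
      + apply (@RInt_correct CR). apply ccontR_ex; auto.
      + apply HP. specialize (HT b b Hb Hb). rewrite Eint in HT.
        assert (D : Cmod (Cminus (CInt g 0 b) (Cmult (RtoC (/ 2)) I)) < eps).
        { replace (Cminus (CInt g 0 b) (Cmult (RtoC (/ 2)) I)) with (Cmult (RtoC (/ 2)) (Cminus (Cmult (RtoC 2) (CInt g 0 b)) I)) by (rewrite RtoC_inv by lra; field).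
          rewrite Cmod_mult, Cmod_R, Rabs_pos_eq by lra. pose proof (Cmod_ge_0 (Cminus (Cmult (RtoC 2) (CInt g 0 b)) I)). lra. }
        split; [eapply Rle_lt_trans; [apply (re_le_Cmod (Cminus (CInt g 0 b) (Cmult (RtoC (/ 2)) I)))|exact D]|].
        eapply Rle_lt_trans; [apply (im_le_Cmod (Cminus (CInt g 0 b) (Cmult (RtoC (/ 2)) I)))|exact D]. }
  rewrite HB, RtoC_inv by lra. field.
Qed.

(** Translation by c = ln (q / p) / 2 makes both coefficients equal to sqrt (p q) and brings out the
    power of q / p. *)
Lemma ek_Bessel nu p q : 0 < p -> 0 < q ->
  Int (ek nu p q) = Cmult (Cmult (RtoC 2) (cpow (q / p) (Cdiv nu (RtoC 2)))) (BesselK nu (2 * sqrt (p * q))).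
Proof.
  intros Hp Hq. set (r := sqrt (p * q)). assert (Hpq : 0 < p * q) by nra. assert (Hr : 0 < r) by (apply sqrt_lt_R0; auto).
  assert (Hr2 : r * r = p * q) by (apply sqrt_sqrt; lra).
  set (c := / 2 * ln (q / p)).
  assert (Ec : exp c = r / p).
  { assert (E2 : exp c * exp c = q / p) by (unfold c; rewrite <- exp_plus; rewrite <- (exp_ln (q / p)) at 3 by (apply Rdiv_lt_0_compat; auto); f_equal; field).
    assert (E3 : (r / p) * (r / p) = q / p) by (replace ((r / p) * (r / p)) with (r * r / (p * p)) by (field; lra); rewrite Hr2; field; lra).
    apply Rsqr_inj; [left; apply exp_pos|apply Rdiv_le_0_compat; lra|unfold Rsqr; lra]. }
  assert (Ec' : exp (- c) = r / q).
  { rewrite exp_Ropp, Ec. apply Rmult_eq_reg_r with (r * r); [|nra]. rewrite Hr2 at 2. field. split; lra. }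
  pose proof (BesselK_Int nu (2 * r) ltac:(lra)) as B. replace (2 * r / 2) with r in B by field.
  rewrite <- (Int_shift (ek nu r r) (- c)) in B by (apply ek_good; auto).
  transitivity (Cmult (cpow (q / p) (Cdiv nu (RtoC 2))) (Cmult (RtoC 2) (BesselK nu (2 * r)))); [|ring].
  rewrite B. rewrite <- Int_scal by (apply (good_shift (ek nu r r) (- c)), ek_good; auto).
  apply Int_ext. intros y. unfold ek.
  replace (cpow (q / p) (Cdiv nu (RtoC 2))) with (cexp (Cmult nu (RtoC c))).
  - rewrite Cmult_assoc, <- cexp_add. f_equal.
    + f_equal. rewrite RtoC_plus, RtoC_opp. ring.
    + do 3 f_equal. replace (- (y + - c)) with (- y + c) by ring. rewrite !exp_plus, Ec, Ec'.
      replace (r * (exp y * (r / q))) with (exp y * (r * r / q)) by (field; lra). replace (r * (exp (- y) * (r / p))) with (exp (- y) * (r * r / p)) by (field; lra).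
      rewrite Hr2. field. split; lra.
  - unfold cpow, c. f_equal. rewrite RtoC_mult, RtoC_inv by lra. field.
Qed.

Lemma cser_geom (q : C) : Cmod q < 1 -> cser (fun k => Cpow q (S k)) (Cdiv q (Cminus (RtoC 1) q)).
Proof.
  intros Hq. assert (N : Cminus (RtoC 1) q <> RtoC 0).
  { intros E. assert (q = RtoC 1) as -> by (symmetry; apply Ceq_minus; auto). rewrite Cmod_1 in Hq. lra. }
  unfold cser. apply clim_ext with (fun n => Cmult (Cdiv q (Cminus (RtoC 1) q)) (Cminus (RtoC 1) (Cpow q n))).
  - induction n; cbn [csum]; [unfold Cdiv; simpl; ring|]. rewrite <- IHn. rewrite Cpow_S. field. auto.
  - replace (Cdiv q (Cminus (RtoC 1) q)) with (Cmult (Cdiv q (Cminus (RtoC 1) q)) (Cminus (RtoC 1) (RtoC 0))) at 1 by ring.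
    apply clim_scal. apply clim_minus; [apply clim_const|].
    intros eps Heps. assert (Ha : Rabs (Cmod q) < 1) by (rewrite Rabs_pos_eq by apply Cmod_ge_0; auto).
    destruct (pow_lt_1_zero _ Ha eps Heps) as [M HM]. exists M. intros n Hn. specialize (HM n Hn).
    replace (Cminus (Cpow q n) (RtoC 0)) with (Cpow q n) by ring. rewrite Cmod_pow. eapply Rle_lt_trans; [apply Rle_abs|exact HM].
Qed.

Lemma qth_pow th t k : Cpow (qth th t) k = qth (INR k * th) (INR k * t).
Proof.
  induction k.
  - unfold qth. rewrite !Rmult_0_l. cbn [Cpow]. rewrite <- cexp_0. f_equal. ring.
  - rewrite Cpow_S, IHk, S_INR. unfold qth. rewrite <- cexp_add. f_equal. rewrite !Rmult_plus_distr_r, !RtoC_plus, !Rmult_1_l. ring.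
Qed.

Definition acoef (th t : R) (d : nat) : R := cos (2 * PI * INR d * th) * exp (- (2 * PI * INR d * t)).

Lemma Aev_series th t : 0 < th < 1 -> 0 < t -> cser (fun k => RtoC (acoef th t (S k))) (Aev th t).
Proof.
  intros H Ht. pose proof PI_RGT_0 as HP.
  assert (Q : forall th, Cmod (qth th t) < 1).
  { intros th'. rewrite Cmod_qth. rewrite <- exp_0. apply exp_increasing. nra. }
  pose proof (cser_scal (RtoC (/ 2)) _ _ (cser_plus _ _ _ _ (cser_geom _ (Q th)) (cser_geom _ (Q (1 - th))))) as S.
  unfold Aev, Lth. eapply cser_ext; [|exact S]. intros k. cbv beta. rewrite !qth_pow, !qth_pair. unfold acoef.
  replace (2 * PI * (INR (Datatypes.S k) * (1 - th))) with (- (2 * PI * INR (Datatypes.S k) * th) + 2 * INR (Datatypes.S k) * PI) by ring.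
  rewrite cos_period, sin_period, cos_neg, sin_neg.
  replace (2 * PI * (INR (Datatypes.S k) * th)) with (2 * PI * INR (Datatypes.S k) * th) by ring.
  replace (2 * PI * (INR (Datatypes.S k) * t)) with (2 * PI * INR (Datatypes.S k) * t) by ring.
  apply Ceq_pair; cri; unfold Re, Im, RtoC; cbn [fst snd]; field.
Qed.

Lemma acoef_bound th t d : Rabs (acoef th t d) <= exp (- (2 * PI * INR d * t)).
Proof.
  unfold acoef. rewrite Rabs_mult, (Rabs_pos_eq (exp _)) by (left; apply exp_pos).
  pose proof (COS_bound (2 * PI * INR d * th)). pose proof (exp_pos (- (2 * PI * INR d * t))).
  assert (Rabs (cos (2 * PI * INR d * th)) <= 1) by (apply Rabs_le; lra). nra.
Qed.

Lemma rsum_geom r n : 0 <= r < 1 -> rsum (fun k => r ^ S k) n <= r / (1 - r).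
Proof.
  intros H. assert (E : rsum (fun k => r ^ S k) n = r / (1 - r) * (1 - r ^ n)).
  { induction n; cbn [rsum]; [simpl; field; lra|]. rewrite IHn. simpl. field. lra. }
  rewrite E. assert (0 <= r ^ n) by (apply pow_le; lra). assert (0 <= r / (1 - r)) by (apply Rdiv_le_0_compat; lra). nra.
Qed.

Lemma summable_exp c : 0 < c -> summable (fun k => exp (- (c * INR (S k)))).
Proof.
  intros Hc. split; [intros; left; apply exp_pos|]. exists (exp (- c) / (1 - exp (- c))). intros n.
  assert (E : exp (- c) < 1) by (rewrite <- exp_0; apply exp_increasing; lra).
  eapply Rle_trans; [|apply (rsum_geom (exp (- c)) n); split; [left; apply exp_pos|auto]].
  apply rsum_le. intros k. right. rewrite <- Rpower_pow by apply exp_pos. unfold Rpower. rewrite ln_exp. f_equal. ring.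
Qed.

Lemma Csum_list_app l l' f : Csum_list (l ++ l') f = Cplus (Csum_list l f) (Csum_list l' f).
Proof.
  unfold Csum_list. induction l as [|a l IH]; cbn [app fold_right]; [ring|]. rewrite IH. ring.
Qed.

Lemma Csum_list_filter (P : nat -> bool) f n :
  Csum_list (filter P (seq 1 n)) f = csum (fun k => if P (S k) then f (S k) else RtoC 0) n.
Proof.
  induction n as [|n IH]; [reflexivity|]. rewrite seq_S, filter_app, Csum_list_app, IH. cbn [csum]. f_equal.
  cbn [filter]. change (1 + n)%nat with (S n). destruct (P (S n)); unfold Csum_list; cbn [fold_right]; ring.
Qed.

Lemma sum_1_to_csum N f : sum_1_to N f = csum (fun k => f (S k)) N.
Proof.
  unfold sum_1_to. induction N as [|n IH]; [reflexivity|]. rewrite seq_S, Csum_list_app, IH. cbn [csum]. f_equal.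
  unfold Csum_list. cbn [fold_right]. change (1 + n)%nat with (S n). ring.
Qed.

(** * Dirichlet convolution of two absolutely convergent series *)

Lemma div_succ (M d : nat) : (0 < d)%nat -> (S M / d = M / d + (if S M mod d =? 0 then 1 else 0))%nat.
Proof.
  intros Hd. pose proof (Nat.div_mod_eq M d) as E. pose proof (Nat.mod_upper_bound M d ltac:(lia)) as B.
  set (q := (M / d)%nat) in *. set (r := (M mod d)%nat) in *.
  destruct (Nat.eq_dec (S r) d) as [h|h].
  - assert (E1 : (S M = d * S q + 0)%nat) by nia.
    rewrite <- (Nat.div_unique (S M) d (S q) 0) by lia. rewrite <- (Nat.mod_unique (S M) d (S q) 0) by lia. simpl. lia.
  - assert (E1 : (S M = d * q + S r)%nat) by nia.
    rewrite <- (Nat.div_unique (S M) d q (S r)) by lia. rewrite <- (Nat.mod_unique (S M) d q (S r)) by lia. simpl. lia.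
Qed.

Definition dconv (al be : nat -> C) (n : nat) : C :=
  csum (fun k => if Nat.eqb (n mod S k) 0 then Cmult (al (S k)) (be (n / S k)%nat) else RtoC 0) n.

(** Both sides run over the pairs (d, e) with d e <= M. Passing to M + 1 lengthens the inner sum of
    d exactly when d divides M + 1. *)
Lemma dconv_partial al be M :
  csum (fun n => dconv al be (S n)) M = csum (fun k => Cmult (al (S k)) (csum (fun j => be (S j)) (M / S k))) M.
Proof.
  induction M as [|M IH]; [reflexivity|]. cbn [csum]. rewrite IH.
  assert (E : forall k, csum (fun j => be (S j)) (S M / S k) =
     Cplus (csum (fun j => be (S j)) (M / S k)) (if Nat.eqb (S M mod S k) 0 then be (S M / S k)%nat else RtoC 0)).
  { intros k. rewrite (div_succ M (S k)) by lia. destruct (Nat.eqb (S M mod S k) 0).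
    - rewrite Nat.add_1_r. cbn [csum]. reflexivity.
    - rewrite Nat.add_0_r. ring. }
  assert (Z : Cmult (al (S M)) (csum (fun j => be (S j)) (M / S M)) = RtoC 0).
  { rewrite Nat.div_small by lia. cbn [csum]. ring. }
  transitivity (csum (fun k => Cmult (al (S k)) (csum (fun j => be (S j)) (S M / S k))) (S M)); [|reflexivity].
  rewrite (csum_ext (fun k => Cmult (al (S k)) (csum (fun j => be (S j)) (S M / S k))) (fun k => Cplus (Cmult (al (S k)) (csum (fun j => be (S j)) (M / S k)))
     (if Nat.eqb (S M mod S k) 0 then Cmult (al (S k)) (be (S M / S k)%nat) else RtoC 0))).
  - rewrite csum_plus. cbn [csum]. rewrite Z. unfold dconv. cbn [csum]. ring.
  - intros k. rewrite E. destruct (Nat.eqb (S M mod S k) 0); ring.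
Qed.

Lemma rsum_mono b n m : (forall k, 0 <= b k) -> (n <= m)%nat -> rsum b n <= rsum b m.
Proof. intros H Hnm. induction Hnm; [lra|]. cbn [rsum]. specialize (H m). lra. Qed.

(** After [dconv_partial] the inner sum for d has floor (M / d) terms. For d <= D it is long, since
    M >= D K, and hence close to B; the indices beyond D have small total weight in [a]. *)
Lemma cser_dconv al be (a b : nat -> R) A B :
  (forall k, Cmod (al (S k)) <= a k) -> (forall k, Cmod (be (S k)) <= b k) -> summable a -> summable b ->
  cser (fun k => al (S k)) A -> cser (fun k => be (S k)) B ->
  cser (fun n => dconv al be (S n)) (Cmult A B).
Proof.
  intros Ha Hb Sa Sb SA SB.
  destruct (summable_lim a Sa) as [A0 [HA0 [HA1 HA2]]]. destruct (summable_lim b Sb) as [B0 [HB0 [HB1 HB2]]].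
  assert (pa : forall k, 0 <= a k) by apply Sa. assert (pb : forall k, 0 <= b k) by apply Sb.
  set (T := fun k => B0 - rsum b k).
  assert (TT : forall k, Cmod (Cminus B (csum (fun j => be (S j)) k)) <= T k) by (intros k; apply cser_tail; auto).
  assert (T0 : forall k, 0 <= T k <= B0).
  { intros k. unfold T. specialize (HB1 k). pose proof (rsum_mono b 0 k pb ltac:(lia)). simpl in H. lra. }
  intros eps Heps.
  destruct (HA2 (eps / (4 * (B0 + 1)))) as [D HD]; [apply Rdiv_lt_0_compat; lra|].
  destruct (HB2 (eps / (4 * (A0 + 1)))) as [K HK]; [apply Rdiv_lt_0_compat; lra|].
  destruct (SA (eps / (4 * (B0 + 1)))) as [N1 HN1]; [apply Rdiv_lt_0_compat; lra|].
  exists (N1 + D + D * K + 1)%nat. intros M HM. rewrite dconv_partial.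
  specialize (HN1 M ltac:(lia)).
  replace (Cminus (csum (fun k => Cmult (al (S k)) (csum (fun j => be (S j)) (M / S k))) M) (Cmult A B))
    with (Cplus (Cmult (Cminus (csum (fun k => al (S k)) M) A) B)
           (Cminus (csum (fun k => Cmult (al (S k)) (Cminus (csum (fun j => be (S j)) (M / S k)) B)) M) (RtoC 0))).
  2:{ rewrite (csum_ext (fun k => Cmult (al (S k)) (Cminus (csum (fun j => be (S j)) (M / S k)) B))
        (fun k => Cminus (Cmult (al (S k)) (csum (fun j => be (S j)) (M / S k))) (Cmult B (al (S k))))) by (intros; ring).
      rewrite csum_minus, csum_scal. ring. }
  eapply Rle_lt_trans; [apply Cmod_triangle|]. rewrite Cmod_mult.
  assert (BB : Cmod B <= B0).
  { specialize (TT O). unfold T in TT. cbn [csum rsum] in TT. replace (Cminus B (RtoC 0)) with B in TT by ring. lra. }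
  assert (P1 : Cmod (Cminus (csum (fun k => al (S k)) M) A) * Cmod B <= eps / 4).
  { apply Rle_trans with (eps / (4 * (B0 + 1)) * B0).
    - apply Rmult_le_compat; [apply Cmod_ge_0|apply Cmod_ge_0|lra|auto].
    - apply Rmult_le_reg_r with (4 * (B0 + 1)); [lra|]. field_simplify; [|lra]. nra. }
  assert (P2 : Cmod (Cminus (csum (fun k => Cmult (al (S k)) (Cminus (csum (fun j => be (S j)) (M / S k)) B)) M) (RtoC 0)) <= eps / 2).
  { assert (Q : forall k, Cmod (Cmult (al (S k)) (Cminus (csum (fun j => be (S j)) (M / S k)) B)) <= a k * T (M / S k)%nat).
    { intros k. rewrite Cmod_mult, Cmod_minus_sym. apply Rmult_le_compat; auto; apply Cmod_ge_0. }
    pose proof (Cmod_csum_le _ _ M O Q ltac:(lia)) as C1. cbn [csum rsum] in C1. rewrite Rminus_0_r in C1.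
    eapply Rle_trans; [exact C1|].
    assert (W : forall m, (m <= M)%nat -> rsum (fun k => a k * T (M / S k)%nat) m <=
        eps / (4 * (A0 + 1)) * rsum a (Nat.min m D) + B0 * (rsum a m - rsum a (Nat.min m D))).
    { induction m as [|m IH]; intros Hm; [simpl; lra|]. cbn [rsum]. specialize (IH ltac:(lia)).
      destruct (le_lt_dec (S m) D) as [l|l].
      - rewrite !Nat.min_l in * by lia. cbn [rsum].
        assert (HKm : (K <= M / S m)%nat).
        { apply Nat.div_le_lower_bound; [lia|]. nia. }
        specialize (HK _ HKm). fold (T (M / S m)%nat) in HK. specialize (pa m).
        assert (a m * T (M / S m)%nat <= a m * (eps / (4 * (A0 + 1)))) by (apply Rmult_le_compat_l; lra). lra.
      - rewrite !Nat.min_r in * by lia. specialize (pa m). specialize (T0 (M / S m)%nat).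
        assert (a m * T (M / S m)%nat <= a m * B0) by (apply Rmult_le_compat_l; lra). lra. }
    specialize (W M ltac:(lia)). rewrite Nat.min_r in W by lia. eapply Rle_trans; [exact W|].
    specialize (HD D (le_n D)). pose proof (HA1 M) as A1. pose proof (HA1 D) as A2.
    assert (eps / (4 * (A0 + 1)) * rsum a D <= eps / 4).
    { apply Rle_trans with (eps / (4 * (A0 + 1)) * A0); [apply Rmult_le_compat_l; [left; apply Rdiv_lt_0_compat; lra|auto]|].
      apply Rmult_le_reg_r with (4 * (A0 + 1)); [lra|]. field_simplify; [|lra]. nra. }
    assert (B0 * (rsum a M - rsum a D) <= eps / 4).
    { apply Rle_trans with (B0 * (eps / (4 * (B0 + 1)))); [apply Rmult_le_compat_l; lra|].
      apply Rmult_le_reg_r with (4 * (B0 + 1)); [lra|]. field_simplify; [|lra]. nra. }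
    lra. }
  lra.
Qed.

Ltac pos_prod := repeat (lazymatch goal with |- 0 < Rmult _ _ => apply Rmult_lt_0_compat end); try lra.

(** From e^(u/6) >= 1 + u/6 follows e^(-u) <= (6 / u)^6. With u = 2 pi sqrt (n x) this is of order
    n^(-3), and the sixth power is chosen so that n^(-2) remains after the factor n. *)
Lemma exp_sqrt_summable (x : R) : 0 < x -> summable (fun n => INR (S n) * exp (- (2 * PI * sqrt (INR (S n) * x)))).
Proof.
  intros Hx. pose proof PI_RGT_0 as HP.
  apply summable_le with (b := fun n => (6 / (2 * PI)) ^ 6 / x ^ 3 * Rpower (INR n + 1) (Ropp 2)).
  - intros n. assert (Hn : 0 < INR (S n)) by (apply lt_0_INR; lia). split; [apply Rmult_le_pos; [lra|left; apply exp_pos]|].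
    assert (Hnx : 0 < INR (S n) * x) by (apply Rmult_lt_0_compat; auto).
    assert (Hs : 0 < sqrt (INR (S n) * x)) by (apply sqrt_lt_R0; auto).
    set (s := sqrt (INR (S n) * x)) in *. assert (Hss : s ^ 2 = INR (S n) * x) by (unfold s; apply pow2_sqrt; lra).
    assert (E : exp (- (2 * PI * s)) <= (6 / (2 * PI)) ^ 6 / (s ^ 2) ^ 3).
    { set (u := 2 * PI * s). assert (Hu : 0 < u) by (unfold u; pos_prod).
      rewrite exp_Ropp.
      assert (E1 : (u / 6) ^ 6 <= exp u).
      { replace (exp u) with (exp (u / 6) ^ 6).
        - apply pow_incr. split; [lra|]. pose proof (exp_ineq1_le (u / 6)). lra.
        - rewrite <- Rpower_pow by apply exp_pos. unfold Rpower. rewrite ln_exp. f_equal. simpl INR. field. }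
      apply Rle_trans with (/ (u / 6) ^ 6).
      - apply Rinv_le_contravar; [apply pow_lt; lra|auto].
      - right. unfold u. field. repeat split; lra. }
    rewrite Hss in E. rewrite <- S_INR.
    replace (Ropp 2) with (- INR 2) by (simpl; ring). rewrite Rpower_Ropp, Rpower_pow by auto.
    apply Rle_trans with (INR (S n) * ((6 / (2 * PI)) ^ 6 / (INR (S n) * x) ^ 3)); [apply Rmult_le_compat_l; lra|].
    right. field. repeat split; lra.
  - apply summable_scal; [|apply (summable_power 1 2); lra].
    apply Rdiv_le_0_compat; [|apply pow_lt; auto]. apply pow_le. apply Rdiv_le_0_compat; [lra|pos_prod].
Qed.

(** * The Bessel series as a single integral *)

Definition mainF (nu : C) (x th ps y : R) : C :=
  Cmult (cexp (Cmult nu (RtoC y))) (Cmult (Aev th (exp y)) (Aev ps (x * exp (- y)))).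

Lemma ccontR_comp_R (f : R -> C) (g : R -> R) : ccontR f -> (forall t, continuous g t) -> ccontR (fun t => f (g t)).
Proof. intros Hf Hg t. apply (@continuous_comp R_UniformSpace R_UniformSpace C_R_NormedModule g f t); [apply Hg|apply Hf]. Qed.

Lemma Aev_refl_cont ps x : 0 < ps < 1 -> 0 < x -> ccontR (fun y => Aev ps (x * exp (- y))).
Proof.
  intros H Hx. assert (C0 : ccontR (fun y => Aev ps (exp (ln x + - y)))).
  { apply (ccontR_comp_R (fun y => Aev ps (exp y)) (fun y => ln x + - y)); [apply Aev_cont; auto|intros t; cont]. }
  intros t. eapply continuous_ext; [|apply C0]. intros y. cbv beta. rewrite exp_plus, exp_ln by auto. reflexivity.
Qed.

Lemma mainF_cont nu x th ps : 0 < x -> 0 < th < 1 -> 0 < ps < 1 -> ccontR (mainF nu x th ps).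
Proof.
  intros Hx Ht Hp t. unfold mainF. apply continuous_Cmult; [cont|]. apply continuous_Cmult; [apply Aev_cont; auto|apply Aev_refl_cont; auto].
Qed.

Section Lhs.
Variables (nu : C) (x th ps : R).
Hypotheses (Hx : 0 < x) (Hth : 0 < th < 1) (Hps : 0 < ps < 1).

Definition alc (y : R) (d : nat) : C := RtoC (acoef th (exp y) d).
Definition bec (y : R) (e : nat) : C := RtoC (acoef ps (x * exp (- y)) e).

Lemma dconv_term n k y : (0 < n)%nat -> Nat.eqb (n mod S k) 0 = true ->
  Cmult (cexp (Cmult nu (RtoC y))) (Cmult (alc y (S k)) (bec y (n / S k))) =
  Cmult (RtoC (cos (2 * PI * INR (S k) * th) * cos (2 * PI * INR n * ps / INR (S k)))) (ek nu (2 * PI * INR (S k)) (2 * PI * INR (n / S k) * x) y).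
Proof.
  intros Hn H. apply Nat.eqb_eq in H. pose proof (Nat.div_mod_eq n (S k)) as E. rewrite H, Nat.add_0_r in E.
  assert (EI : INR n = INR (S k) * INR (n / S k)) by (rewrite <- mult_INR; f_equal; exact E).
  assert (Hk : 0 < INR (S k)) by (apply lt_0_INR; lia).
  unfold alc, bec, acoef, ek. replace (2 * PI * INR n * ps / INR (S k)) with (2 * PI * INR (n / S k) * ps) by (rewrite EI; field; lra).
  replace (- (2 * PI * INR (S k) * exp y + 2 * PI * INR (n / S k) * x * exp (- y)))
    with (- (2 * PI * INR (S k) * exp y) + - (2 * PI * INR (n / S k) * (x * exp (- y)))) by ring.
  rewrite exp_plus, !RtoC_mult. ring.
Qed.

Lemma divisor_pos n k : (0 < n)%nat -> (k < n)%nat -> Nat.eqb (n mod S k) 0 = true -> 1 <= INR (n / S k) /\ INR n = INR (S k) * INR (n / S k).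
Proof.
  intros Hn Hk H. apply Nat.eqb_eq in H. pose proof (Nat.div_mod_eq n (S k)) as E. rewrite H, Nat.add_0_r in E.
  split; [|rewrite <- mult_INR; f_equal; exact E]. assert (1 <= n / S k)%nat by nia. apply le_INR in H0. exact H0.
Qed.

(** For n = d e, [ek_Bessel] has p = 2 pi d and q = 2 pi e x. So 2 sqrt (p q) = 4 pi sqrt (n x)
    depends on n only, while q / p = n x / d^2 produces the factor d^(-nu). *)
Lemma Int_ek_divisor n k : (0 < n)%nat -> (k < n)%nat -> Nat.eqb (n mod S k) 0 = true ->
  Int (ek nu (2 * PI * INR (S k)) (2 * PI * INR (n / S k) * x)) =
  Cmult (Cmult (RtoC 2) (cpow x (Cdiv nu (RtoC 2)))) (Cmult (Cmult (cpow (INR n) (Cdiv nu (RtoC 2))) (BesselK nu (4 * PI * sqrt (INR n * x)))) (cpow (INR (S k)) (Copp nu))).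
Proof.
  intros Hn Hk H. destruct (divisor_pos n k Hn Hk H) as [He EI]. pose proof PI_RGT_0 as HP.
  assert (Hd : 0 < INR (S k)) by (apply lt_0_INR; lia). set (d := INR (S k)) in *. set (e := INR (n / S k)) in *.
  assert (Hin : 0 < INR n) by (apply lt_0_INR; auto).
  rewrite ek_Bessel by (pos_prod).
  replace (2 * PI * d * (2 * PI * e * x)) with ((2 * PI) * (2 * PI) * (INR n * x)) by (rewrite EI; ring).
  rewrite sqrt_mult, sqrt_square by nra. replace (2 * (2 * PI * sqrt (INR n * x))) with (4 * PI * sqrt (INR n * x)) by ring.
  replace (2 * PI * e * x / (2 * PI * d)) with (x * (INR n / (d * d))) by (rewrite EI; field; lra).
  rewrite cpow_mult_base, cpow_div_base, cpow_mult_base by (try apply Rdiv_lt_0_compat; nra).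
  replace (cpow d (Copp nu)) with (Cinv (Cmult (cpow d (Cdiv nu (RtoC 2))) (cpow d (Cdiv nu (RtoC 2))))).
  - unfold Cdiv. ring.
  - rewrite <- cpow_add, cpow_opp. do 2 f_equal. field.
Qed.

Definition lhs_term (n : nat) : C :=
    Cmult (Cmult (cpow (INR n) (Cdiv nu (RtoC 2)))
                 (BesselK nu (4 * PI * sqrt (INR n * x))))
      (divisor_sum n (fun d =>
         Cmult (Cmult (cpow (INR d) (Copp nu)) (RtoC (cos (2 * PI * INR d * th))))
               (RtoC (cos (2 * PI * INR n * ps / INR d))))).

Definition termF (n : nat) (y : R) : C := Cmult (cexp (Cmult nu (RtoC y))) (dconv (alc y) (bec y) n).

Lemma good_zero : good (fun _ => RtoC 0).
Proof. split; [intros t; apply continuous_Cconst|]. exists 0, 1. split; [lra|]. intros y. rewrite Cmod_0. lra. Qed.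

Lemma Int_zero : Int (fun _ => RtoC 0) = RtoC 0.
Proof.
  apply Int_unique. intros eps Heps. exists 0. intros. rewrite CInt_const.
  replace (Cminus _ _) with (RtoC 0) by ring. rewrite Cmod_0. auto.
Qed.

Lemma termF_sum n y : (0 < n)%nat -> termF n y = csum (fun k => if Nat.eqb (n mod S k) 0 then
   Cmult (RtoC (cos (2 * PI * INR (S k) * th) * cos (2 * PI * INR n * ps / INR (S k)))) (ek nu (2 * PI * INR (S k)) (2 * PI * INR (n / S k) * x) y) else RtoC 0) n.
Proof.
  intros Hn. unfold termF, dconv. rewrite <- csum_scal. apply csum_ext. intros k. destruct (Nat.eqb _ 0) eqn:E; [|ring].
  apply dconv_term; auto.
Qed.

Lemma Int_termF n : (0 < n)%nat -> good (termF n) /\ Int (termF n) = Cmult (Cmult (RtoC 2) (cpow x (Cdiv nu (RtoC 2)))) (lhs_term n).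
Proof.
  intros Hn. pose proof PI_RGT_0 as HP.
  (* The additional test k < n makes every [f k] provably good, as [csum_good] and [Int_csum] ask
     for all indices. *)
  set (f := fun k y => if andb (Nat.eqb (n mod S k) 0) (Nat.ltb k n) then
   Cmult (RtoC (cos (2 * PI * INR (S k) * th) * cos (2 * PI * INR n * ps / INR (S k)))) (ek nu (2 * PI * INR (S k)) (2 * PI * INR (n / S k) * x) y) else RtoC 0).
  assert (Gf : forall k, good (f k)).
  { intros k. unfold f. destruct (andb _ _) eqn:E; [|apply good_zero]. apply andb_prop in E. destruct E as [E1 E2]. apply Nat.ltb_lt in E2.
    destruct (divisor_pos n k Hn E2 E1) as [H1 _]. apply good_scal. apply ek_good.
    - assert (0 < INR (S k)) by (apply lt_0_INR; lia). nra.
    - pos_prod. }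
  assert (Ef : forall y, csum (fun k => f k y) n = termF n y).
  { intros y. rewrite termF_sum by auto. apply csum_ext_lt. intros k Hk. unfold f.
    apply Nat.ltb_lt in Hk. rewrite Hk, Bool.andb_true_r. reflexivity. }
  split; [eapply good_ext; [exact Ef|apply csum_good; auto]|].
  rewrite <- (Int_ext _ _ Ef). rewrite Int_csum by auto.
  unfold lhs_term, divisor_sum. rewrite Csum_list_filter, <- csum_scal, <- csum_scal. apply csum_ext_lt. intros k Hk.
  unfold f. apply Nat.ltb_lt in Hk as Hk'. rewrite Hk', Bool.andb_true_r. destruct (Nat.eqb (n mod S k) 0) eqn:E.
  - destruct (divisor_pos n k Hn Hk E) as [H1 _].
    rewrite Int_scal.
    + rewrite Int_ek_divisor by auto. rewrite RtoC_mult. ring.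
    + apply ek_good; [|pos_prod]. assert (0 < INR (S k)) by (apply lt_0_INR; lia). nra.
  - rewrite Int_zero. ring.
Qed.

(** Half of the exponent 2 pi (d e^y + e x e^(-y)), where d e = n, is at least 2 pi sqrt (n x) by
    the arithmetic-geometric mean and gives summability in n. The other half is at least pi (e^y + x
    e^(-y)) and gives decay in y. The factor n bounds the number of divisors. *)
Lemma termF_bound : exists K, 0 < K /\ forall n y, Cmod (termF (S n) y) <= K * (INR (S n) * exp (- (2 * PI * sqrt (INR (S n) * x)))) * exp (- 1 * Rabs y).
Proof.
  pose proof PI_RGT_0 as HP.
  destruct (double_exp_decay (Re nu) PI (PI * x) HP ltac:(nra)) as [K [HK B]]. exists K. split; auto. intros n y.
  unfold termF. rewrite Cmod_mult, Cmod_cexp. replace (Re (Cmult nu (RtoC y))) with (Re nu * y) by (cri; ring).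
  set (N := S n). set (s := sqrt (INR N * x)). assert (HN : 0 < INR N) by (apply lt_0_INR; unfold N; lia).
  set (c := exp (- (PI * exp y + PI * x * exp (- y))) * exp (- (2 * PI * s))).
  assert (D : Cmod (dconv (alc y) (bec y) N) <= INR N * c).
  { unfold dconv.
    rewrite (csum_ext_lt _ (fun k => if Nat.ltb k N then (if Nat.eqb (N mod S k) 0 then Cmult (alc y (S k)) (bec y (N / S k)) else RtoC 0) else RtoC 0))
      by (intros k Hk; apply Nat.ltb_lt in Hk; rewrite Hk; reflexivity).
    apply Cmod_csum_const. intros k. assert (Hc : 0 < c) by (apply Rmult_lt_0_compat; apply exp_pos).
    destruct (Nat.ltb k N) eqn:Hk; [|rewrite Cmod_0; lra]. destruct (Nat.eqb (N mod S k) 0) eqn:E; [|rewrite Cmod_0; lra].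
    apply Nat.ltb_lt in Hk. destruct (divisor_pos N k ltac:(unfold N; lia) Hk E) as [H1 EI].
    rewrite Cmod_mult. unfold alc, bec. rewrite !Cmod_R.
    eapply Rle_trans; [apply Rmult_le_compat; try apply Rabs_pos; apply acoef_bound|].
    unfold c. rewrite <- !exp_plus. apply exp_le.
    assert (Hd : 1 <= INR (S k)) by (rewrite S_INR; pose proof (pos_INR k); lra).
    set (d := INR (S k)) in *. set (e := INR (N / S k)) in *. pose proof (exp_pos y) as Y1. pose proof (exp_pos (- y)) as Y2.
    assert (YY : exp y * exp (- y) = 1) by (rewrite <- exp_plus, Rplus_opp_r, exp_0; auto).
    set (X := d * exp y). set (Y := e * (x * exp (- y))).
    assert (HX : exp y <= X) by (unfold X; nra). assert (HXp : 0 < X) by lra.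
    assert (xy : 0 < x * exp (- y)) by nra. assert (HY : x * exp (- y) <= Y) by (unfold Y; nra).
    assert (HXY : X * Y = INR N * x).
    { unfold X, Y. rewrite EI. transitivity (d * e * x * (exp y * exp (- y))); [ring|rewrite YY; ring]. }
    assert (AG : 2 * s <= X + Y).
    { apply pow_incr_inv2; [lra|]. unfold s. replace ((2 * sqrt (INR N * x)) ^ 2) with (4 * (sqrt (INR N * x)) ^ 2) by ring.
      rewrite pow2_sqrt by nra. rewrite <- HXY. pose proof (pow2_ge_0 (X - Y)). nra. }
    replace (2 * PI * d * exp y) with (2 * PI * X) by (unfold X; ring). replace (2 * PI * e * (x * exp (- y))) with (2 * PI * Y) by (unfold Y; ring).
    assert (PI * (2 * s) <= PI * (X + Y)) by (apply Rmult_le_compat_l; lra).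
    assert (PI * (exp y + x * exp (- y)) <= PI * (X + Y)) by (apply Rmult_le_compat_l; lra). lra. }
  specialize (B y). pose proof (exp_pos (Re nu * y)).
  apply Rle_trans with (exp (Re nu * y) * (INR N * c)); [apply Rmult_le_compat_l; lra|].
  unfold c. replace (exp (Re nu * y) * (INR N * (exp (- (PI * exp y + PI * x * exp (- y))) * exp (- (2 * PI * s)))))
    with (INR N * exp (- (2 * PI * s)) * (exp (Re nu * y) * exp (- (PI * exp y + PI * x * exp (- y))))) by ring.
  replace (K * (INR N * exp (- (2 * PI * s))) * exp (-1 * Rabs y)) with (INR N * exp (- (2 * PI * s)) * (K * exp (-1 * Rabs y))) by ring.
  apply Rmult_le_compat_l; [|exact B]. apply Rmult_le_pos; [lra|left; apply exp_pos].
Qed.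

(** Under the integral sign the divisor sums form the Dirichlet convolution of the coefficients of
    the two generating functions, so their series is the product of the two. *)
Lemma lhs_cser : good (mainF nu x th ps) /\ exists l, cser (fun n => lhs_term (S n)) l /\
  Cmult (Cmult (RtoC 2) (cpow x (Cdiv nu (RtoC 2)))) l = Int (mainF nu x th ps).
Proof.
  pose proof PI_RGT_0 as HP. destruct termF_bound as [K [HK B]].
  destruct (cser_Int (fun n => termF (S n)) (mainF nu x th ps) (fun n => K * (INR (S n) * exp (- (2 * PI * sqrt (INR (S n) * x))))) 1) as [G S].
  - lra.
  - intros n. apply (Int_termF (S n)). lia.
  - intros n y. apply B.
  - apply summable_scal; [lra|apply exp_sqrt_summable; auto].
  - apply mainF_cont; auto.
  - intros y. unfold mainF, termF. apply cser_scal. pose proof (exp_pos y) as Y1. pose proof (exp_pos (- y)) as Y2.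
    assert (xy : 0 < x * exp (- y)) by nra.
    apply (cser_dconv _ _ (fun k => exp (- (2 * PI * exp y * INR (S k)))) (fun k => exp (- (2 * PI * (x * exp (- y)) * INR (S k))))).
    + intros k. unfold alc. rewrite Cmod_R. eapply Rle_trans; [apply acoef_bound|]. right. f_equal. ring.
    + intros k. unfold bec. rewrite Cmod_R. eapply Rle_trans; [apply acoef_bound|]. right. f_equal. ring.
    + apply summable_exp. nra.
    + apply summable_exp. nra.
    + apply Aev_series; auto.
    + apply Aev_series; auto.
  - split; [exact G|]. set (c := Cmult (RtoC 2) (cpow x (Cdiv nu (RtoC 2)))) in *.
    assert (Nc : c <> RtoC 0) by (apply Cmult_neq_0; [apply C2_neq|apply cpow_neq_0]).
    exists (Cdiv (Int (mainF nu x th ps)) c). split.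
    + pose proof (cser_scal (Cinv c) _ _ S) as S'. replace (Cdiv (Int (mainF nu x th ps)) c) with (Cmult (Cinv c) (Int (mainF nu x th ps))) by (unfold Cdiv; ring).
      eapply cser_ext; [|exact S']. intros n. cbv beta. destruct (Int_termF (Datatypes.S n)) as [_ E]; [lia|]. rewrite E. fold c. field. auto.
    + field. auto.
Qed.
End Lhs.

(** * Remainder terms *)

(** The remainder, up to the sign (-1)^N, of the geometric expansion of w / (w^2 + u^2) in powers of
    w / u after N terms. *)
Definition rterm (N : nat) (w u : R) : R := w ^ (2 * N + 1) / (u ^ (2 * N) * (u ^ 2 + w ^ 2)).

Lemma rsign_geom N w u : 0 < u -> w / (w ^ 2 + u ^ 2) =
  rsum (fun k => (-1) ^ k * (w ^ (2 * k + 1) / u ^ (2 * (k + 1)))) N + (-1) ^ N * rterm N w u.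
Proof.
  intros Hu. assert (P : 0 < u ^ 2 + w ^ 2) by (pose proof (pow2_ge_0 w); assert (0 < u ^ 2) by (apply pow_lt; auto); lra).
  induction N as [|N IH].
  - unfold rterm. simpl. simpl in P. field. nra.
  - cbn [rsum]. rewrite IH, Rplus_assoc. f_equal. unfold rterm.
    replace (2 * S N + 1)%nat with (2 * N + 1 + 2)%nat by lia. replace (2 * S N)%nat with (2 * N + 2)%nat by lia.
    replace (2 * (N + 1))%nat with (2 * N + 2)%nat by lia. rewrite !pow_add.
    assert (u ^ (2 * N) <> 0) by (apply pow_nonzero; lra). set (W := w ^ (2 * N + 1)) in *. set (U := u ^ (2 * N)) in *. set (M := (-1) ^ N).
    change ((-1) ^ S N) with (-1 * M). field. repeat split; auto; simpl in *; nra.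
Qed.

Lemma rterm_pos N w u : 0 < w -> 0 < u -> 0 < rterm N w u.
Proof.
  intros Hw Hu. unfold rterm. apply Rdiv_lt_0_compat; [apply pow_lt; auto|]. apply Rmult_lt_0_compat; [apply pow_lt; auto|].
  assert (0 < u ^ 2) by (apply pow_lt; auto). pose proof (pow2_ge_0 w). lra.
Qed.

Definition rpair (N : nat) (ps w : R) (n : nat) : C := RtoC (rterm N w (INR n + ps) + rterm N w (INR n + (1 - ps))).

(** The factor (-1)^N makes this a sum of positive terms [rterm]. For N = 0 it is the full cotangent
    expansion. *)
Definition Rrem (N : nat) (ps w : R) : C :=
  Cmult (csgn N) (Cminus (Cmult (RtoC (2 * PI)) (Cplus (Aev ps w) (RtoC (/ 2))))
    (csum (fun k => Cmult (csgn k) (Cmult (RtoC (w ^ (2 * k + 1))) (Zev ps (RtoC (INR (2 * (k + 1))))))) N)).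

Lemma csgn_RtoC k : csgn k = RtoC ((-1) ^ k).
Proof. unfold csgn. rewrite RtoC_pow. f_equal. apply Ceq_pair; cri; ring. Qed.

Lemma csgn_sqr k : Cmult (csgn k) (csgn k) = RtoC 1.
Proof. rewrite csgn_RtoC, <- RtoC_mult. f_equal. rewrite <- pow_add. replace (k + k)%nat with (2 * k)%nat by lia. rewrite pow_mult. replace ((-1) ^ 2) with 1 by ring. apply pow1. Qed.

Lemma csum_RtoC a n : csum (fun k => RtoC (a k)) n = RtoC (rsum a n).
Proof. induction n; cbn [csum rsum]; [auto|]. rewrite IHn, RtoC_plus. auto. Qed.

Lemma cser_csum (f : nat -> nat -> C) (g : nat -> C) N : (forall k, (k < N)%nat -> cser (fun n => f k n) (g k)) ->
  cser (fun n => csum (fun k => f k n) N) (csum g N).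
Proof.
  induction N; intros H; cbn [csum].
  - intros eps Heps. exists O. intros n _. replace (csum (fun _ => RtoC 0) n) with (RtoC 0).
    + replace (Cminus (RtoC 0) (RtoC 0)) with (RtoC 0) by ring. rewrite Cmod_0. auto.
    + clear. induction n; cbn [csum]; auto. rewrite <- IHn. ring.
  - apply cser_plus; auto.
Qed.

Lemma Zev_even ps k : 0 < ps < 1 ->
  cser (fun n => RtoC (/ (INR n + ps) ^ (2 * (k + 1)) + / (INR n + (1 - ps)) ^ (2 * (k + 1)))) (Zev ps (RtoC (INR (2 * (k + 1))))).
Proof.
  intros H. assert (Hs : 1 < Re (RtoC (INR (2 * (k + 1))))).
  { rewrite Re_RtoC. replace 1 with (INR 1) by reflexivity. apply lt_INR. lia. }
  unfold Zev. eapply cser_ext; [|exact (cser_plus _ _ _ _ (hurwitz_series ps _ H Hs) (hurwitz_series (1 - ps) _ ltac:(lra) Hs))].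
  intros n. cbv beta. pose proof (pos_INR n).
  assert (E : forall u, 0 < u -> cpow u (Copp (RtoC (INR (2 * (k + 1))))) = RtoC (/ u ^ (2 * (k + 1)))).
  { intros u Hu. rewrite cpow_opp, cpow_INR by auto. rewrite RtoC_inv; auto. apply pow_nonzero; lra. }
  rewrite !E by lra. rewrite RtoC_plus. auto.
Qed.

Lemma Rrem_cser N ps w : 0 < ps < 1 -> 0 <= w -> cser (rpair N ps w) (Rrem N ps w).
Proof.
  intros H Hw. unfold Rrem.
  assert (S1 : cser (fun n => csum (fun k => Cmult (csgn k) (Cmult (RtoC (w ^ (2 * k + 1))) (RtoC (/ (INR n + ps) ^ (2 * (k + 1)) + / (INR n + (1 - ps)) ^ (2 * (k + 1)))))) N)
     (csum (fun k => Cmult (csgn k) (Cmult (RtoC (w ^ (2 * k + 1))) (Zev ps (RtoC (INR (2 * (k + 1))))))) N)).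
  { apply (cser_csum (fun k n => Cmult (csgn k) (Cmult (RtoC (w ^ (2 * k + 1))) (RtoC (/ (INR n + ps) ^ (2 * (k + 1)) + / (INR n + (1 - ps)) ^ (2 * (k + 1))))))).
    intros k _. apply cser_scal. apply cser_scal. apply Zev_even; auto. }
  pose proof (cser_scal (csgn N) _ _ (cser_minus _ _ _ _ (Aev_expansion ps w H Hw) S1)) as S2.
  eapply cser_ext; [|exact S2]. intros n. cbv beta. pose proof (pos_INR n) as Hn.
  unfold pair2, rpair. rewrite (rsign_geom N w (INR n + ps)), (rsign_geom N w (INR n + (1 - ps))) by lra.
  rewrite (csum_ext _ (fun k => RtoC ((-1) ^ k * (w ^ (2 * k + 1) / (INR n + ps) ^ (2 * (k + 1))) + (-1) ^ k * (w ^ (2 * k + 1) / (INR n + (1 - ps)) ^ (2 * (k + 1)))))).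
  - rewrite csum_RtoC, rsum_plus. rewrite !RtoC_plus, !RtoC_mult, <- csgn_RtoC.
    set (a := RtoC (rsum _ _)). set (b := RtoC (rsum _ _)).
    transitivity (Cmult (Cmult (csgn N) (csgn N)) (Cplus (RtoC (rterm N w (INR n + ps))) (RtoC (rterm N w (INR n + (1 - ps)))))); [ring|].
    rewrite csgn_sqr. ring.
  - intros k. rewrite csgn_RtoC, <- !RtoC_mult. f_equal. unfold Rdiv. ring.
Qed.

Lemma Rrem_cont N ps x : 0 < ps < 1 -> 0 < x -> ccontR (fun y => Rrem N ps (x * exp (- y))).
Proof.
  intros H Hx t. unfold Rrem. apply continuous_Cmult; [apply continuous_Cconst|]. apply continuous_Cminus.
  - apply continuous_Cmult; [apply continuous_Cconst|]. apply continuous_Cplus; [apply Aev_refl_cont; auto|apply continuous_Cconst].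
  - induction N; cbn [csum]; [apply continuous_Cconst|]. apply continuous_Cplus; [auto|].
    apply continuous_Cmult; [apply continuous_Cconst|]. apply continuous_Cmult; [|apply continuous_Cconst].
    apply continuous_RtoC. cont.
Qed.

Lemma ln_x_exp x y : 0 < x -> ln (x * exp (- y)) = ln x - y.
Proof. intros. rewrite ln_mult, ln_exp by (auto; apply exp_pos). ring. Qed.

(** With w = x e^(-y) and k = 2 N + 1 - al this reads w^k u^(-(k+1)). Every k from 2 N - 1 to 2 N +
    1 is allowed; the two extremes are the orders of the remainder for large and for small w. *)
Lemma rterm_bound N x y u al : 0 < x -> 0 < u -> 0 <= al <= 2 ->
  rterm N (x * exp (- y)) u <= Rpower x (2 * INR N + 1 - al) * Rpower u (- (2 * INR N + 2 - al)) * exp (- (2 * INR N + 1 - al) * y).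
Proof.
  intros Hx Hu Ha. set (w := x * exp (- y)). assert (Hw : 0 < w) by (apply Rmult_lt_0_compat; [auto|apply exp_pos]).
  pose proof (weighted_amgm (ln w) u (2 - al) Hu ltac:(lra)) as W.
  replace (exp (2 * ln w)) with (w ^ 2) in W by (replace (2 * ln w) with (ln w + ln w) by ring; rewrite exp_plus, exp_ln by auto; ring).
  replace (2 - (2 - al)) with al in W by ring. set (D := exp (al * ln w) * Rpower u (2 - al)) in *.
  assert (HD : 0 < D) by (apply Rmult_lt_0_compat; apply exp_pos).
  assert (Hun : 0 < u ^ (2 * N)) by (apply pow_lt; auto).
  unfold rterm. apply Rle_trans with (w ^ (2 * N + 1) / (u ^ (2 * N) * D)).
  - unfold Rdiv. apply Rmult_le_compat_l; [left; apply pow_lt; auto|]. apply Rinv_le_contravar; [apply Rmult_lt_0_compat; auto|].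
    apply Rmult_le_compat_l; lra.
  - right. unfold D. rewrite <- !Rpower_pow by auto. unfold Rdiv, Rpower. rewrite <- !exp_plus, <- exp_Ropp, <- !exp_plus. f_equal.
    rewrite plus_INR, mult_INR. simpl (INR 2). simpl (INR 1). unfold w. rewrite ln_x_exp by auto. ring.
Qed.

Lemma pterm_bound y v be : 0 < v -> 0 <= be <= 2 ->
  exp y / ((exp y) ^ 2 + v ^ 2) <= Rpower v (- (2 - be)) * exp ((1 - be) * y).
Proof.
  intros Hv Hb. pose proof (weighted_amgm y v (2 - be) Hv ltac:(lra)) as W.
  replace (exp (2 * y)) with (exp y ^ 2) in W by (replace (2 * y) with (y + y) by ring; rewrite exp_plus; ring).
  replace (2 - (2 - be)) with be in W by ring. set (D := exp (be * y) * Rpower v (2 - be)) in *.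
  assert (HD : 0 < D) by (apply Rmult_lt_0_compat; apply exp_pos).
  apply Rle_trans with (exp y / D).
  - unfold Rdiv. apply Rmult_le_compat_l; [left; apply exp_pos|]. apply Rinv_le_contravar; auto.
  - right. unfold D, Rdiv, Rpower. rewrite <- !exp_plus, <- exp_Ropp, <- !exp_plus. f_equal. ring.
Qed.

(** * Termwise integration of the remainder, alone and against the second expansion *)

Section Exchange.
Variables (N : nat) (nu : C) (x th ps : R).
Hypotheses (Hx : 0 < x) (Hth : 0 < th < 1) (Hps : 0 < ps < 1).
Let sg := Re nu.

Definition Rr (y : R) : C := Rrem N ps (x * exp (- y)).
Definition eN (y : R) : C := cexp (Cmult nu (RtoC y)).

Lemma Cmod_eN y : Cmod (eN y) = exp (sg * y).
Proof. unfold eN. rewrite Cmod_cexp. f_equal. unfold sg. cri. ring. Qed.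

Lemma eN_cont : ccontR eN.
Proof. intros t. unfold eN. cont. Qed.

Lemma Rr_cont : ccontR Rr.
Proof. exact (Rrem_cont N ps x Hps Hx). Qed.

Lemma xexp_pos y : 0 < x * exp (- y).
Proof. apply Rmult_lt_0_compat; [auto|apply exp_pos]. Qed.

Definition rel (u : R) (y : R) : C := Cmult (eN y) (RtoC (rterm N (x * exp (- y)) u)).
Definition tel (u v : R) (y : R) : C := Cmult (eN y) (Cmult (RtoC (exp y / (exp y ^ 2 + v ^ 2))) (RtoC (rterm N (x * exp (- y)) u))).

Lemma rterm_xcont u : 0 < u -> forall t, continuous (fun y => rterm N (x * exp (- y)) u) t.
Proof.
  intros Hu t. unfold rterm. cont. assert (0 < u ^ (2 * N) * (u ^ 2 + (x * exp (- t)) ^ 2)); [|lra].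
  apply Rmult_lt_0_compat; [apply pow_lt; auto|]. assert (0 < u ^ 2) by (apply pow_lt; auto). pose proof (pow2_ge_0 (x * exp (- t))). lra.
Qed.

Lemma rel_cont u : 0 < u -> ccontR (rel u).
Proof. intros Hu t. unfold rel. apply continuous_Cmult; [apply eN_cont|]. apply continuous_RtoC. apply rterm_xcont; auto. Qed.

Lemma tel_cont u v : 0 < u -> 0 < v -> ccontR (tel u v).
Proof.
  intros Hu Hv t. unfold tel. apply continuous_Cmult; [apply eN_cont|]. apply continuous_Cmult; apply continuous_RtoC; [|apply rterm_xcont; auto].
  cont; try apply continuous_exp. assert (0 < v ^ 2) by (apply pow_lt; auto). pose proof (pow2_ge_0 (exp t)). lra.
Qed.

(** [rterm_bound] is used with k = sg + d for y >= 0 and with k = sg - d for y < 0; each leaves a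
    factor e^(-d |y|). The constant retains both powers of u so that one bound covers the line. *)
Lemma rel_decay d u : 0 < d -> d < sg -> 2 * INR N - 1 <= sg - d -> sg + d <= 2 * INR N + 1 -> 0 < u ->
  edecay (rel u) ((Rpower x (sg - d) + Rpower x (sg + d)) * (Rpower u (- (sg - d + 1)) + Rpower u (- (sg + d + 1)))) d.
Proof.
  intros Hd Hds H1 H2 Hu y. unfold rel. rewrite Cmod_mult, Cmod_eN, Cmod_R, Rabs_pos_eq by (left; apply rterm_pos; auto; apply xexp_pos).
  pose proof (Rpower_pos x (sg - d)) as X1. pose proof (Rpower_pos x (sg + d)) as X2.
  pose proof (Rpower_pos u (- (sg - d + 1))) as U1. pose proof (Rpower_pos u (- (sg + d + 1))) as U2. pose proof (exp_pos (- d * Rabs y)) as EE.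
  destruct (Rle_dec 0 y) as [h|h].
  - pose proof (rterm_bound N x y u (2 * INR N + 1 - (sg + d)) Hx Hu ltac:(lra)) as B.
    replace (2 * INR N + 1 - (2 * INR N + 1 - (sg + d))) with (sg + d) in B by ring. replace (2 * INR N + 2 - (2 * INR N + 1 - (sg + d))) with (sg + d + 1) in B by ring.
    apply Rle_trans with (exp (sg * y) * (Rpower x (sg + d) * Rpower u (- (sg + d + 1)) * exp (- (sg + d) * y))); [apply Rmult_le_compat_l; [left; apply exp_pos|auto]|].
    replace (exp (sg * y) * (Rpower x (sg + d) * Rpower u (- (sg + d + 1)) * exp (- (sg + d) * y))) with (Rpower x (sg + d) * Rpower u (- (sg + d + 1)) * exp (- d * Rabs y)).
    + apply Rmult_le_compat_r; [lra|]. apply Rmult_le_compat; lra.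
    + rewrite Rabs_pos_eq by auto. replace (- d * y) with (sg * y + - (sg + d) * y) by ring. rewrite exp_plus. ring.
  - pose proof (rterm_bound N x y u (2 * INR N + 1 - (sg - d)) Hx Hu ltac:(lra)) as B.
    replace (2 * INR N + 1 - (2 * INR N + 1 - (sg - d))) with (sg - d) in B by ring. replace (2 * INR N + 2 - (2 * INR N + 1 - (sg - d))) with (sg - d + 1) in B by ring.
    apply Rle_trans with (exp (sg * y) * (Rpower x (sg - d) * Rpower u (- (sg - d + 1)) * exp (- (sg - d) * y))); [apply Rmult_le_compat_l; [left; apply exp_pos|auto]|].
    replace (exp (sg * y) * (Rpower x (sg - d) * Rpower u (- (sg - d + 1)) * exp (- (sg - d) * y))) with (Rpower x (sg - d) * Rpower u (- (sg - d + 1)) * exp (- d * Rabs y)).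
    + apply Rmult_le_compat_r; [lra|]. apply Rmult_le_compat; lra.
    + rewrite Rabs_left by lra. replace (- d * - y) with (sg * y + - (sg - d) * y) by ring. rewrite exp_plus. ring.
Qed.

(** Between 2 N - 1 and 2 N + 1 each single remainder has a transform at [nu]; a positive [sg] makes
    the sum of u^(-(sg+1)) converge. *)
Lemma Rr_exchange : 0 < sg -> 2 * INR N - 1 < sg < 2 * INR N + 1 ->
  good (fun y => Cmult (eN y) (Rr y)) /\
  (forall u, 0 < u -> good (rel u)) /\
  cser (fun n => Cplus (Int (rel (INR n + ps))) (Int (rel (INR n + (1 - ps))))) (Mel Rr nu).
Proof.
  (* Half the distance of [sg] from the nearest of 0, 2 N - 1 and 2 N + 1. *)
  intros H0 H1. set (d := Rmin sg (Rmin (sg - (2 * INR N - 1)) (2 * INR N + 1 - sg)) / 2).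
  assert (D : 0 < d /\ d < sg /\ d < sg - (2 * INR N - 1) /\ d < 2 * INR N + 1 - sg).
  { unfold d. pose proof (Rmin_l sg (Rmin (sg - (2 * INR N - 1)) (2 * INR N + 1 - sg))). pose proof (Rmin_r sg (Rmin (sg - (2 * INR N - 1)) (2 * INR N + 1 - sg))).
    pose proof (Rmin_l (sg - (2 * INR N - 1)) (2 * INR N + 1 - sg)). pose proof (Rmin_r (sg - (2 * INR N - 1)) (2 * INR N + 1 - sg)).
    assert (0 < Rmin sg (Rmin (sg - (2 * INR N - 1)) (2 * INR N + 1 - sg))) by (repeat apply Rmin_pos; lra). lra. }
  destruct D as [D0 [D1 [D2 D3]]].
  set (cx := Rpower x (sg - d) + Rpower x (sg + d)). assert (Hcx : 0 < cx) by (unfold cx; pose proof (Rpower_pos x (sg - d)); pose proof (Rpower_pos x (sg + d)); lra).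
  set (c := fun u => cx * (Rpower u (- (sg - d + 1)) + Rpower u (- (sg + d + 1)))).
  assert (W : forall u, 0 < u -> edecay (rel u) (c u) d) by (intros u Hu; apply rel_decay; auto; lra).
  assert (G : forall u, 0 < u -> good (rel u)) by (intros u Hu; split; [apply rel_cont; auto|exists (c u), d; auto]).
  destruct (cser_Int (fun n y => Cplus (rel (INR n + ps) y) (rel (INR n + (1 - ps)) y)) (fun y => Cmult (eN y) (Rr y)) (fun n => c (INR n + ps) + c (INR n + (1 - ps))) d D0) as [GF S].
  - intros n t. pose proof (pos_INR n). apply continuous_Cplus; apply rel_cont; lra.
  - intros n y. pose proof (pos_INR n). eapply Rle_trans; [apply Cmod_triangle|]. rewrite Rmult_plus_distr_r. apply Rplus_le_compat; apply W; lra.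
  - apply summable_plus; unfold c; apply summable_scal; try lra; apply summable_plus; apply summable_power; lra.
  - intros t. exact (continuous_Cmult eN Rr t (eN_cont t) (Rr_cont t)).
  - intros y. pose proof (cser_scal (eN y) _ _ (Rrem_cser N ps (x * exp (- y)) Hps ltac:(left; apply xexp_pos))) as S.
    eapply cser_ext; [|exact S]. intros n. cbv beta. unfold rpair, rel. rewrite RtoC_plus. ring.
  - split; [exact GF|]. split; [exact G|]. eapply cser_ext; [|exact S]. intros n. cbv beta. pose proof (pos_INR n).
    apply Int_plus; apply G; lra.
Qed.

(** The first kernel is at most v^(-(2-be)) t^(1-be), the remainder at most a constant times
    u^(-(k+1)) t^(-k). The total exponent of t is therefore sg + 1 - be - k, to be - d on y >= 0,
    where k = kp, and d on y < 0, where k = km. *)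
Lemma tel_decay be kp km d u v : 0 <= be <= 2 -> 0 < d -> 2 * INR N - 1 <= kp <= 2 * INR N + 1 -> 2 * INR N - 1 <= km <= 2 * INR N + 1 ->
  sg + 1 - be - kp = - d -> sg + 1 - be - km = d -> 0 < u -> 0 < v ->
  edecay (tel u v) ((Rpower x kp + Rpower x km) * Rpower v (- (2 - be)) * (Rpower u (- (kp + 1)) + Rpower u (- (km + 1)))) d.
Proof.
  intros Hb Hd Hp Hm Ep Em Hu Hv y. unfold tel.
  assert (Pv : 0 < exp y / (exp y ^ 2 + v ^ 2)).
  { apply Rdiv_lt_0_compat; [apply exp_pos|]. assert (0 < v ^ 2) by (apply pow_lt; auto). pose proof (pow2_ge_0 (exp y)). lra. }
  rewrite !Cmod_mult, Cmod_eN, !Cmod_R, (Rabs_pos_eq (exp y / _)) by lra. rewrite Rabs_pos_eq by (left; apply rterm_pos; auto; apply xexp_pos).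
  pose proof (pterm_bound y v be Hv Hb) as B1.
  pose proof (Rpower_pos x kp) as X1. pose proof (Rpower_pos x km) as X2. pose proof (Rpower_pos v (- (2 - be))) as V1.
  pose proof (Rpower_pos u (- (kp + 1))) as U1. pose proof (Rpower_pos u (- (km + 1))) as U2. pose proof (exp_pos (- d * Rabs y)) as EE.
  assert (G : forall k, 2 * INR N - 1 <= k <= 2 * INR N + 1 -> (sg + 1 - be - k) * y = - d * Rabs y ->
    exp (sg * y) * (exp y / (exp y ^ 2 + v ^ 2) * rterm N (x * exp (- y)) u) <= Rpower x k * Rpower v (- (2 - be)) * Rpower u (- (k + 1)) * exp (- d * Rabs y)).
  { intros k Hk E. pose proof (rterm_bound N x y u (2 * INR N + 1 - k) Hx Hu ltac:(lra)) as B.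
    replace (2 * INR N + 1 - (2 * INR N + 1 - k)) with k in B by ring. replace (2 * INR N + 2 - (2 * INR N + 1 - k)) with (k + 1) in B by ring.
    apply Rle_trans with (exp (sg * y) * ((Rpower v (- (2 - be)) * exp ((1 - be) * y)) * (Rpower x k * Rpower u (- (k + 1)) * exp (- k * y)))).
    - apply Rmult_le_compat_l; [left; apply exp_pos|]. apply Rmult_le_compat; [lra|left; apply rterm_pos; auto; apply xexp_pos|auto|auto].
    - right. rewrite <- E. replace ((sg + 1 - be - k) * y) with (sg * y + (1 - be) * y + - k * y) by ring. rewrite !exp_plus. ring. }
  destruct (Rle_dec 0 y) as [h|h].
  - eapply Rle_trans; [apply (G kp Hp); rewrite Ep, Rabs_pos_eq by auto; ring|]. apply Rmult_le_compat_r; [lra|].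
    apply Rmult_le_compat; try lra; [nra|]. apply Rmult_le_compat_r; lra.
  - eapply Rle_trans; [apply (G km Hm); rewrite Em, Rabs_left by lra; ring|]. apply Rmult_le_compat_r; [lra|].
    apply Rmult_le_compat; try lra; [nra|]. apply Rmult_le_compat_r; lra.
Qed.

Definition G2 (y : R) : C := Cmult (Cmult (RtoC (2 * PI)) (Cplus (Aev th (exp y)) (RtoC (/ 2)))) (Rr y).

Definition tel4 (m n : nat) (y : R) : C :=
  Cplus (Cplus (tel (INR n + ps) (INR m + th) y) (tel (INR n + (1 - ps)) (INR m + th) y))
        (Cplus (tel (INR n + ps) (INR m + (1 - th)) y) (tel (INR n + (1 - ps)) (INR m + (1 - th)) y)).

(** The additional kernel t / (t^2 + v^2) leaves room at both ends of the line, so that, unlike in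
    [Rr_exchange], the left ends [sg = 0] and [sg = 2 N - 1] are included. The bounds have the
    product form a (v) b (u), which permits summing over n first and over m afterwards. *)
Lemma double_exchange : 0 <= sg -> 2 * INR N - 1 <= sg < 2 * INR N + 1 ->
  mdec G2 sg /\ (forall u v, 0 < u -> 0 < v -> good (tel u v)) /\
  exists U : nat -> C, (forall m, cser (fun n => Int (tel4 m n)) (U m)) /\ cser U (Mel G2 nu).
Proof.
  (* Four constraints govern the exponents: be < 1 for the sum over v, km > 0 for the sum over u,
     and both kp and km between 2 N - 1 and 2 N + 1. Here [bb] is the least nonnegative number with
     bb + e >= 0, that is, with kp <= 2 N + 1. *)
  intros H0 H1. set (e := 2 * INR N - sg). set (bb := Rmax 0 (- e)).
  assert (Hbb : 0 <= bb < 1) by (unfold bb, e, Rmax; destruct (Rle_dec 0 (- (2 * INR N - sg))); lra).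
  assert (Hbe : 0 <= bb + e <= 1) by (unfold bb, e, Rmax; destruct (Rle_dec 0 (- (2 * INR N - sg))); lra).
  assert (HN0 : N = O -> bb + e = 0).
  { intros E. unfold bb, e. rewrite E in *. simpl INR in *. unfold Rmax. destruct (Rle_dec 0 (- (2 * 0 - sg))); lra. }
  (* The bound (1 - bb) / 2 keeps be = bb + eta below 1; the bound 1/4 keeps km positive and at
     least 2 N - 1. For N = 0 positivity also uses bb + e = 0. *)
  set (eta := Rmin (/ 4) ((1 - bb) / 2)).
  assert (He : 0 < eta) by (apply Rmin_pos; lra). assert (He1 : eta <= / 4) by apply Rmin_l. assert (He2 : eta <= (1 - bb) / 2) by apply Rmin_r.
  set (be := bb + eta). set (kp := 2 * INR N + 1 - (bb + e)). set (km := 2 * INR N + 1 - (bb + e + 2 * eta)).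
  assert (Hkm : 0 < km).
  { unfold km. destruct (Nat.eq_dec N 0) as [E|E]; [rewrite (HN0 E), E; simpl; lra|]. assert (1 <= INR N) by (replace 1 with (INR 1) by reflexivity; apply le_INR; lia). lra. }
  assert (Hkp : 0 < kp) by (unfold kp, km in *; lra).
  set (cx := Rpower x kp + Rpower x km). assert (Hcx : 0 < cx) by (unfold cx; pose proof (Rpower_pos x kp); pose proof (Rpower_pos x km); lra).
  set (a := fun v => Rpower v (- (2 - be))). set (b := fun u => Rpower u (- (kp + 1)) + Rpower u (- (km + 1))).
  assert (W : forall u v, 0 < u -> 0 < v -> edecay (tel u v) (cx * a v * b u) eta).
  { intros u v Hu Hv. apply tel_decay; auto; unfold be, kp, km, e in *; lra. }
  assert (pa : forall v, 0 < a v) by (intros; apply Rpower_pos). assert (pb : forall u, 0 < b u) by (intros u; unfold b; pose proof (Rpower_pos u (- (kp + 1))); pose proof (Rpower_pos u (- (km + 1))); lra).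
  assert (G : forall u v, 0 < u -> 0 < v -> good (tel u v)) by (intros u v Hu Hv; split; [apply tel_cont; auto|exists (cx * a v * b u), eta; auto]).
  set (am := fun m => a (INR m + th) + a (INR m + (1 - th))). set (bn := fun n => b (INR n + ps) + b (INR n + (1 - ps))).
  assert (Sa : summable am) by (apply summable_plus; apply summable_power; unfold be; lra).
  assert (Sb : summable bn) by (apply summable_plus; unfold b; apply summable_plus; apply summable_power; lra).
  assert (pam : forall m, 0 < am m) by (intros m; unfold am; specialize (pa (INR m + th)) as p1; specialize (pa (INR m + (1 - th))) as p2; lra).
  assert (W4 : forall m n, edecay (tel4 m n) (cx * am m * bn n) eta).
  { intros m n y. pose proof (pos_INR m). pose proof (pos_INR n). unfold tel4. eapply Rle_trans; [apply Cmod_triangle|].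
    eapply Rle_trans; [apply Rplus_le_compat; apply Cmod_triangle|].
    pose proof (W (INR n + ps) (INR m + th) ltac:(lra) ltac:(lra) y). pose proof (W (INR n + (1 - ps)) (INR m + th) ltac:(lra) ltac:(lra) y).
    pose proof (W (INR n + ps) (INR m + (1 - th)) ltac:(lra) ltac:(lra) y). pose proof (W (INR n + (1 - ps)) (INR m + (1 - th)) ltac:(lra) ltac:(lra) y).
    unfold am, bn. set (EE := exp (- eta * Rabs y)) in *. lra. }
  assert (C4 : forall m n, ccontR (tel4 m n)).
  { intros m n t. pose proof (pos_INR m). pose proof (pos_INR n). unfold tel4.
    refine (continuous_Cplus (fun y => Cplus (tel (INR n + ps) (INR m + th) y) (tel (INR n + (1 - ps)) (INR m + th) y)) (fun y => Cplus (tel (INR n + ps) (INR m + (1 - th)) y) (tel (INR n + (1 - ps)) (INR m + (1 - th)) y)) t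
      (continuous_Cplus _ _ t (tel_cont _ _ _ _ t) (tel_cont _ _ _ _ t)) (continuous_Cplus _ _ t (tel_cont _ _ _ _ t) (tel_cont _ _ _ _ t))); lra. }
  destruct (summable_lim bn Sb) as [B [HB0 [HB _]]].
  set (Um := fun m y => Cmult (eN y) (Cmult (pair2 th (exp y) m) (Rr y))).
  assert (CU : forall m, ccontR (Um m)).
  { intros m t. pose proof (pos_INR m).
    refine (continuous_Cmult eN (fun y => Cmult (pair2 th (exp y) m) (Rr y)) t (eN_cont t) (continuous_Cmult (fun y => pair2 th (exp y) m) Rr t _ (Rr_cont t))).
    unfold pair2. apply continuous_Cplus; apply continuous_RtoC; cont; try apply continuous_exp.
    - assert (0 < (INR m + th) ^ 2) by (apply pow_lt; lra). pose proof (pow2_ge_0 (exp t)). lra.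
    - assert (0 < (INR m + (1 - th)) ^ 2) by (apply pow_lt; lra). pose proof (pow2_ge_0 (exp t)). lra. }
  assert (SU : forall m y, cser (fun n => tel4 m n y) (Um m y)).
  { intros m y. unfold Um. pose proof (cser_scal (Cmult (eN y) (pair2 th (exp y) m)) _ _ (Rrem_cser N ps (x * exp (- y)) Hps ltac:(left; apply xexp_pos))) as S.
    rewrite Cmult_assoc. eapply cser_ext; [|exact S]. intros n. cbv beta. unfold tel4, tel, pair2, rpair. rewrite RtoC_plus. ring. }
  assert (Inner : forall m, good (Um m) /\ cser (fun n => Int (tel4 m n)) (Int (Um m))).
  { intros m. apply (cser_Int (tel4 m) (Um m) (fun n => cx * am m * bn n) eta); auto.
    apply summable_scal; auto. specialize (pam m). nra. }
  assert (DU : forall m, edecay (Um m) (cx * B * am m) eta).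
  { intros m y. replace (cx * B * am m * exp (- eta * Rabs y)) with (cx * am m * exp (- eta * Rabs y) * B) by ring.
    eapply (cser_bound _ (fun n => cx * am m * exp (- eta * Rabs y) * bn n)); [|apply SU|].
    - intros n. eapply Rle_trans; [apply W4|]. right. ring.
    - intros n. rewrite rsum_scal. apply Rmult_le_compat_l; [|apply HB]. pose proof (exp_pos (- eta * Rabs y)). specialize (pam m).
      repeat apply Rmult_le_pos; lra. }
  assert (CG : ccontR (fun y => Cmult (eN y) (G2 y))).
  { intros t.
    refine (continuous_Cmult eN G2 t (eN_cont t) (continuous_Cmult (fun y => Cmult (RtoC (2 * PI)) (Cplus (Aev th (exp y)) (RtoC (/ 2)))) Rr t _ (Rr_cont t))).
    apply continuous_Cmult; [apply continuous_Cconst|]. apply continuous_Cplus; [apply Aev_cont; auto|apply continuous_Cconst]. }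
  assert (SG : forall y, cser (fun m => Um m y) (Cmult (eN y) (G2 y))).
  { intros y. unfold Um, G2. pose proof (exp_pos y).
    pose proof (cser_scal (Cmult (eN y) (Rr y)) _ _ (Aev_expansion th (exp y) Hth ltac:(lra))) as S.
    replace (Cmult (eN y) (Cmult (Cmult (RtoC (2 * PI)) (Cplus (Aev th (exp y)) (RtoC (/ 2)))) (Rr y)))
      with (Cmult (Cmult (eN y) (Rr y)) (Cmult (RtoC (2 * PI)) (Cplus (Aev th (exp y)) (RtoC (/ 2))))) by ring.
    eapply cser_ext; [|exact S]. intros m. cbv beta. ring. }
  destruct (cser_Int Um (fun y => Cmult (eN y) (G2 y)) (fun m => cx * B * am m) eta) as [GG S]; auto.
  { apply summable_scal; auto. nra. }
  split; [|split; [exact G|]].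
  - destruct (summable_lim am Sa) as [A [HA0 [HA _]]]. exists (cx * B * A), eta. split; auto. intros y.
    rewrite <- Cmod_eN, <- Cmod_mult.
    replace (cx * B * A * exp (- eta * Rabs y)) with (cx * B * exp (- eta * Rabs y) * A) by ring.
    eapply (cser_bound _ (fun m => cx * B * exp (- eta * Rabs y) * am m)); [|apply SG|].
    + intros m. eapply Rle_trans; [apply DU|]. right. ring.
    + intros m. rewrite rsum_scal. apply Rmult_le_compat_l; [|apply HA]. pose proof (exp_pos (- eta * Rabs y)).
      repeat apply Rmult_le_pos; lra.
  - exists (fun m => Int (Um m)). split; [intros m; apply Inner|]. exact S.
Qed.
End Exchange.

(** * The integral of a product of two kernels *)

Lemma good_tail F : good F -> forall eps, 0 < eps -> exists T, forall y, T <= Rabs y -> Cmod (F y) < eps.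
Proof.
  intros [_ [K [d [Hd H]]]] eps He. destruct (exp_small K d eps Hd He) as [T [_ HT]]. exists T.
  intros y Hy. eapply Rle_lt_trans; [apply H|]. apply HT; auto.
Qed.

Lemma Int_deriv F f : good F -> ccontR f -> (forall t, is_derC F t (f t)) -> Int f = RtoC 0.
Proof.
  intros HF Hf D. apply Int_unique. intros eps He. destruct (good_tail F HF (eps / 2) ltac:(lra)) as [T HT].
  exists (Rmax T 0). intros a b Ha Hb. pose proof (Rmax_l T 0). pose proof (Rmax_r T 0).
  rewrite (CInt_FTC F f (- a) b) by auto.
  replace (Cminus (Cminus (F b) (F (- a))) (RtoC 0)) with (Cplus (F b) (Copp (F (- a)))) by ring.
  eapply Rle_lt_trans; [apply Cmod_triangle|]. rewrite Cmod_opp.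
  pose proof (HT b ltac:(rewrite Rabs_pos_eq by lra; lra)). pose proof (HT (- a) ltac:(rewrite Rabs_Ropp, Rabs_pos_eq by lra; lra)). lra.
Qed.

(** Serves to reach a boundary line from the open strip on its right: the line Re s = 2 for two
    kernels, and the left boundary in [FE_closed]. *)
Lemma right_limit_eq (f g : C -> C) s r : 0 < r -> cdiff f s -> cdiff g s ->
  (forall e, 0 < e < r -> f (Cplus s (RtoC e)) = g (Cplus s (RtoC e))) -> f s = g s.
Proof.
  intros Hr Df Dg E. apply Cmod_eq_intro. intros eps He.
  destruct (cdiff_continuous f s Df (eps / 2) ltac:(lra)) as [d1 [H1 K1]]. destruct (cdiff_continuous g s Dg (eps / 2) ltac:(lra)) as [d2 [H2 K2]].
  set (e := Rmin r (Rmin d1 d2) / 2). assert (He0 : 0 < Rmin r (Rmin d1 d2)) by (repeat apply Rmin_pos; auto).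
  pose proof (Rmin_l r (Rmin d1 d2)). pose proof (Rmin_r r (Rmin d1 d2)). pose proof (Rmin_l d1 d2). pose proof (Rmin_r d1 d2).
  assert (M : Cmod (Cminus (Cplus s (RtoC e)) s) = e).
  { replace (Cminus (Cplus s (RtoC e)) s) with (RtoC e) by ring. rewrite Cmod_R, Rabs_pos_eq; unfold e; lra. }
  specialize (K1 (Cplus s (RtoC e)) ltac:(rewrite M; unfold e; lra)). specialize (K2 (Cplus s (RtoC e)) ltac:(rewrite M; unfold e; lra)).
  rewrite E in K1 by (unfold e; lra). set (z := g (Cplus s (RtoC e))) in *.
  replace (Cminus (f s) (g s)) with (Cplus (Copp (Cminus z (f s))) (Cminus z (g s))) by ring.
  eapply Rle_trans; [apply Cmod_triangle|]. rewrite Cmod_opp. lra.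
Qed.

Definition kk (v w y : R) : C := Cmult (kern v y) (kern w y).

Lemma kk_cont v w : ccontR (kk v w).
Proof. intros t. exact (continuous_Cmult (kern v) (kern w) t (kern_cont v t) (kern_cont w t)). Qed.

Lemma kk_mdec v w sg : 0 < v -> 0 < w -> 0 < sg < 4 -> mdec (kk v w) sg.
Proof.
  intros Hv Hw Hs. destruct (kern_mdec v (sg / 2) Hv ltac:(lra)) as [K [d [Hd B]]]. destruct (kern_mdec w (sg / 2) Hw ltac:(lra)) as [K' [d' [Hd' B']]].
  exists (K * K'), (d + d'). split; [lra|]. intros y. specialize (B y). specialize (B' y). unfold kk. rewrite Cmod_mult.
  replace (exp (sg * y) * (Cmod (kern v y) * Cmod (kern w y))) with ((exp (sg / 2 * y) * Cmod (kern v y)) * (exp (sg / 2 * y) * Cmod (kern w y))).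
  - replace (K * K' * exp (- (d + d') * Rabs y)) with ((K * exp (- d * Rabs y)) * (K' * exp (- d' * Rabs y))).
    + apply Rmult_le_compat; auto; apply Rmult_le_pos; try apply Cmod_ge_0; left; apply exp_pos.
    + replace (- (d + d') * Rabs y) with (- d * Rabs y + - d' * Rabs y) by ring. rewrite exp_plus. ring.
  - replace (sg * y) with (sg / 2 * y + sg / 2 * y) by field. rewrite exp_plus. ring.
Qed.

Definition kernS (s : C) (v y : R) : C := Cmult (cexp (Cmult s (RtoC y))) (kern v y).
Definition kkS (s : C) (v w y : R) : C := Cmult (cexp (Cmult s (RtoC y))) (kk v w y).

Lemma kernS_good s v : 0 < v -> 0 < Re s < 2 -> good (kernS s v).
Proof. intros Hv Hs. exact (Mel_good (kern v) s (kern_cont v) (kern_mdec v (Re s) Hv Hs)). Qed.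
Lemma kkS_good s v w : 0 < v -> 0 < w -> 0 < Re s < 4 -> good (kkS s v w).
Proof. intros Hv Hw Hs. exact (Mel_good (kk v w) s (kk_cont v w) (kk_mdec v w (Re s) Hv Hw Hs)). Qed.
Lemma Int_kernS s v : 0 < v -> 0 < Re s < 2 -> Int (kernS s v) = Cmult (cpow v (Cminus s (RtoC 2))) (kap s).
Proof. exact (Mel_kern_kap v s). Qed.

Lemma kern_inv v y : Cmult (kern v y) (Cplus (RtoC (exp (2 * y))) (RtoC (v ^ 2))) = RtoC 1.
Proof.
  unfold kern. rewrite <- RtoC_plus. apply Cinv_l. apply RtoC_neq. pose proof (kern_pos v y). lra.
Qed.

Lemma cexp_shift2 s y : cexp (Cmult s (RtoC y)) = Cmult (cexp (Cmult (Cminus s (RtoC 2)) (RtoC y))) (RtoC (exp (2 * y))).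
Proof. rewrite <- cexp_RtoC, <- cexp_add. f_equal. rewrite RtoC_mult. ring. Qed.

Lemma cpow_shift2 v s : 0 < v -> Cmult (RtoC (v ^ 2)) (cpow v (Cminus s (RtoC 2))) = cpow v s.
Proof.
  intros Hv. rewrite <- (cpow_INR v 2) by auto. rewrite <- cpow_add. f_equal. simpl INR. replace (1 + 1) with 2 by ring. ring.
Qed.

Lemma kap_shift_minus s : kap (Cminus s (RtoC 2)) = Copp (kap s).
Proof. pose proof (kap_shift (Cminus s (RtoC 2))) as H. replace (Cplus (Cminus s (RtoC 2)) (RtoC 2)) with s in H by ring. rewrite H. ring. Qed.

Lemma Mel_kk_cdiff v w s : 0 < v -> 0 < w -> 0 < Re s < 4 -> cdiff (Mel (kk v w)) s.
Proof. intros. apply Mel_cdiff; [apply kk_cont|apply kk_mdec; auto]. Qed.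

Section TwoKernels.
Variables (v w : R).
Hypotheses (Hv : 0 < v) (Hw : 0 < w) (Hvw : v <> w).

Lemma vw_neq : w ^ 2 - v ^ 2 <> 0.
Proof. replace (w ^ 2 - v ^ 2) with ((w - v) * (w + v)) by ring. apply Rmult_integral_contrapositive_currified; lra. Qed.

Definition kkval (s : C) : C :=
  Cmult (Cdiv (Cminus (cpow v (Cminus s (RtoC 2))) (cpow w (Cminus s (RtoC 2)))) (RtoC (w ^ 2 - v ^ 2))) (kap s).

Lemma Mel_kk_low s : 0 < Re s < 2 -> Mel (kk v w) s = kkval s.
Proof.
  intros Hs. pose proof vw_neq as Hn. apply (Cmult_eq_reg_l (RtoC (w ^ 2 - v ^ 2))); [apply RtoC_neq; auto|].
  change (Mel (kk v w) s) with (Int (kkS s v w)). rewrite <- (Int_scal _ _ (kkS_good s v w Hv Hw ltac:(lra))).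
  transitivity (Cminus (Int (kernS s v)) (Int (kernS s w))).
  - rewrite <- (Int_minus _ _ (kernS_good s v Hv Hs) (kernS_good s w Hw Hs)). apply Int_ext. intros y. unfold kkS, kernS, kk.
    pose proof (kern_inv v y) as E1. pose proof (kern_inv w y) as E2. rewrite RtoC_minus.
    set (a := kern v y) in *. set (b := kern w y) in *. set (X := cexp _). set (E := RtoC (exp (2 * y))) in *.
    set (V := RtoC (v ^ 2)) in *. set (W := RtoC (w ^ 2)) in *.
    transitivity (Cmult X (Cminus (Cmult a (Cmult b (Cplus E W))) (Cmult b (Cmult a (Cplus E V))))); [ring|]. rewrite E1, E2. ring.
  - rewrite !Int_kernS by auto. unfold kkval. assert (RtoC (w ^ 2 - v ^ 2) <> RtoC 0) by (apply RtoC_neq; auto). field. auto.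
Qed.

(** The partial fractions of [Mel_kk_low] have no transform here. Moving t^2 out of the Mellin
    weight reduces s to s - 2 and leads to t^2 / ((t^2 + v^2) (t^2 + w^2)), whose partial fractions
    do converge. *)
Lemma Mel_kk_high s : 2 < Re s < 4 -> Mel (kk v w) s = kkval s.
Proof.
  intros Hs. pose proof vw_neq as Hn. apply (Cmult_eq_reg_l (RtoC (w ^ 2 - v ^ 2))); [apply RtoC_neq; auto|].
  assert (Hs' : 0 < Re (Cminus s (RtoC 2)) < 2) by (cri; lra).
  change (Mel (kk v w) s) with (Int (kkS s v w)). rewrite <- (Int_scal _ _ (kkS_good s v w Hv Hw ltac:(lra))).
  set (s' := Cminus s (RtoC 2)) in *.
  transitivity (Cminus (Cmult (RtoC (w ^ 2)) (Int (kernS s' w))) (Cmult (RtoC (v ^ 2)) (Int (kernS s' v)))).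
  - pose proof (kernS_good s' v Hv Hs') as G1. pose proof (kernS_good s' w Hw Hs') as G2.
    rewrite <- (Int_scal _ _ G1), <- (Int_scal _ _ G2), <- (Int_minus _ _ (good_scal _ _ G2) (good_scal _ _ G1)).
    apply Int_ext. intros y. unfold kkS, kernS, kk. rewrite (cexp_shift2 s y). fold s'.
    pose proof (kern_inv v y) as E1. pose proof (kern_inv w y) as E2. rewrite RtoC_minus.
    set (a := kern v y) in *. set (b := kern w y) in *. set (X := cexp _). set (E := RtoC (exp (2 * y))) in *.
    set (V := RtoC (v ^ 2)) in *. set (W := RtoC (w ^ 2)) in *.
    transitivity (Cmult X (Cminus (Cmult W (Cmult b (Cmult a (Cplus E V)))) (Cmult V (Cmult a (Cmult b (Cplus E W)))))); [ring|]. rewrite E1, E2. ring.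
  - rewrite !Int_kernS by auto. rewrite !Cmult_assoc, !cpow_shift2 by auto. unfold s'. rewrite kap_shift_minus. unfold kkval.
    assert (RtoC (w ^ 2 - v ^ 2) <> RtoC 0) by (apply RtoC_neq; auto). field. auto.
Qed.

(** On the line Re s = 2, which belongs to neither open strip, the value is a limit from the right.
    The condition on the sine excludes s = 2, where [kkval] has a removable singularity. *)
Lemma Mel_kk s : 0 < Re s < 4 -> csin (Cmult (RtoC (PI / 2)) s) <> RtoC 0 -> Mel (kk v w) s = kkval s.
Proof.
  intros Hs Hn. destruct (Rtotal_order (Re s) 2) as [h|[h|h]]; [apply Mel_kk_low; lra| |apply Mel_kk_high; lra].
  apply (right_limit_eq _ _ s 2); [lra|apply Mel_kk_cdiff; auto| |intros e He; apply Mel_kk_high; cri; lra].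
  unfold kkval. pose proof vw_neq. apply cdiff_mult; [cdiffs; apply RtoC_neq; auto|]. apply (kap_cdiff (fun s => s)); auto. apply cdiff_id.
Qed.
End TwoKernels.

(** The limit of [kkval] as w tends to v; it corresponds to the value of [Gfun] at [u * v = x]. *)
Definition kksq (v : R) (s : C) : C :=
  Cmult (Cmult (Cdiv (Cminus (RtoC 2) s) (RtoC (2 * v ^ 2))) (cpow v (Cminus s (RtoC 2)))) (kap s).

Lemma is_derC_kern v t : is_derC (kern v) t (Copp (Cmult (RtoC (2 * exp (2 * t))) (kk v v t))).
Proof.
  apply (@is_derive_ext R_AbsRing C_R_NormedModule (fun t => RtoC (/ (exp (2 * t) + v ^ 2)))).
  - intros y. unfold kern. rewrite RtoC_inv; auto. pose proof (kern_pos v y). lra.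
  - pose proof (kern_pos v t) as P. eapply is_derC_eq.
    + apply is_derC_RtoC. auto_derive; [lra|reflexivity].
    + unfold kk, kern. rewrite <- !RtoC_inv by lra. rewrite <- !RtoC_mult, <- RtoC_opp. f_equal. field. simpl in P. lra.
Qed.

(** The derivative of e^(s y) / (e^(2 y) + v^2) integrates to 0, and it is a combination of the
    integrands for the kernel and for its square. *)
Lemma Mel_kk_sq_low v s : 0 < v -> 0 < Re s < 2 -> Mel (kk v v) s = kksq v s.
Proof.
  intros Hv Hs. pose proof (kernS_good s v Hv Hs) as G1. pose proof (kkS_good s v v Hv Hv ltac:(lra)) as G2.
  set (V := RtoC (2 * v ^ 2)). assert (HV : V <> RtoC 0) by (apply RtoC_neq; assert (0 < v ^ 2) by (apply pow_lt; auto); lra).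
  set (D := fun y => Cplus (Cmult (Cminus s (RtoC 2)) (kernS s v y)) (Cmult V (kkS s v v y))).
  assert (GD : good D) by exact (good_plus _ _ (good_scal _ _ G1) (good_scal _ _ G2)).
  assert (E : Int D = RtoC 0).
  { apply (Int_deriv (kernS s v)); [auto|apply GD|]. intros t. unfold kernS at 1. eapply is_derC_eq.
    - apply (is_derC_Cmult (fun y => cexp (Cmult s (RtoC y))) (kern v)); [apply is_derC_cexp, is_derC_lin|apply is_derC_kern].
    - unfold D, kernS, kkS, kk, V. pose proof (kern_inv v t) as E1. rewrite !RtoC_mult. set (a := kern v t) in *. set (X := cexp _).
      set (E := RtoC (exp (2 * t))) in *. set (W := RtoC (v ^ 2)) in *.
      transitivity (Cplus (Cmult (Cmult s X) a) (Cmult X (Cminus (Cmult (Cmult (RtoC 2) W) (Cmult a a)) (Cmult (RtoC 2) (Cmult a (Cmult a (Cplus E W))))))); [ring|].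
      rewrite E1. ring. }
  unfold D in E. rewrite (Int_plus _ _ (good_scal _ _ G1) (good_scal _ _ G2)), (Int_scal _ _ G1), (Int_scal _ _ G2), Int_kernS in E by auto.
  change (Mel (kk v v) s) with (Int (kkS s v v)). apply (Cmult_eq_reg_l V); auto. unfold kksq. fold V.
  transitivity (Cminus (RtoC 0) (Cmult (Cminus s (RtoC 2)) (Cmult (cpow v (Cminus s (RtoC 2))) (kap s)))); [rewrite <- E; ring|]. field. auto.
Qed.

(** From t^2 / (t^2 + v^2)^2 = 1 / (t^2 + v^2) - v^2 / (t^2 + v^2)^2, transformed at s - 2. *)
Lemma Mel_kk_sq_high v s : 0 < v -> 2 < Re s < 4 -> Mel (kk v v) s = kksq v s.
Proof.
  intros Hv Hs. assert (Hs' : 0 < Re (Cminus s (RtoC 2)) < 2) by (cri; lra).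
  pose proof (kernS_good _ v Hv Hs') as G1. pose proof (kkS_good (Cminus s (RtoC 2)) v v Hv Hv ltac:(lra)) as G2.
  pose proof (Mel_kk_sq_low v _ Hv Hs') as L. change (Mel (kk v v) (Cminus s (RtoC 2))) with (Int (kkS (Cminus s (RtoC 2)) v v)) in L.
  transitivity (Cminus (Int (kernS (Cminus s (RtoC 2)) v)) (Cmult (RtoC (v ^ 2)) (Int (kkS (Cminus s (RtoC 2)) v v)))).
  - rewrite <- (Int_scal _ _ G2), <- (Int_minus _ _ G1 (good_scal _ _ G2)). apply Int_ext. intros y. unfold kernS, kkS, kk.
    rewrite (cexp_shift2 s y). pose proof (kern_inv v y) as E1. set (a := kern v y) in *. set (X := cexp _).
    set (E := RtoC (exp (2 * y))) in *. set (W := RtoC (v ^ 2)) in *.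
    transitivity (Cmult X (Cminus (Cmult a (Cmult a (Cplus E W))) (Cmult W (Cmult a a)))); [ring|]. rewrite E1. ring.
  - rewrite L, Int_kernS by auto. unfold kksq. rewrite kap_shift_minus.
    rewrite <- (cpow_shift2 v (Cminus s (RtoC 2))) by auto. set (p := cpow v _).
    assert (RtoC v <> RtoC 0) by (apply RtoC_neq; lra).
    rewrite RtoC_mult, RtoC_pow. field. auto.
Qed.

Lemma Mel_kk_sq v s : 0 < v -> 0 < Re s < 4 -> csin (Cmult (RtoC (PI / 2)) s) <> RtoC 0 -> Mel (kk v v) s = kksq v s.
Proof.
  intros Hv Hs Hn. destruct (Rtotal_order (Re s) 2) as [h|[h|h]]; [apply Mel_kk_sq_low; auto; lra| |apply Mel_kk_sq_high; auto; lra].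
  apply (right_limit_eq _ _ s 2); [lra|apply Mel_kk_cdiff; auto| |intros e He; apply Mel_kk_sq_high; auto; cri; lra].
  unfold kksq. apply cdiff_mult; [cdiffs; apply RtoC_neq; assert (0 < v ^ 2) by (apply pow_lt; auto); lra|]. apply (kap_cdiff (fun s => s)); auto. apply cdiff_id.
Qed.

(** * Nonintegral parameters and the evaluation of the single terms *)

Definition nonint (s : C) : Prop := forall k : Z, s <> RtoC (IZR k).

Lemma nonint_plus s k : nonint s -> nonint (Cplus s (RtoC (IZR k))).
Proof.
  intros H j E. apply (H (j - k)%Z). rewrite minus_IZR, RtoC_minus, <- E. ring.
Qed.

Lemma csin_nonint s : nonint s -> csin (Cmult (RtoC (PI / 2)) s) <> RtoC 0.
Proof.
  intros H E. destruct (csin_zero _ E) as [k Hk]. apply (H (2 * k)%Z). pose proof PI_RGT_0 as HP.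
  apply (Cmult_eq_reg_l (RtoC (PI / 2))); [apply RtoC_neq; lra|]. rewrite Hk, mult_IZR. apply Ceq_pair; cri; field.
Qed.

Lemma csin_plus_PI2 w : csin (Cplus w (RtoC (PI / 2))) = ccos w.
Proof.
  replace (Cplus w (RtoC (PI / 2))) with (Cminus (RtoC (PI / 2)) (Copp w)) by ring. rewrite csin_PI2_minus.
  unfold ccos. replace (Cmult Ci (Copp w)) with (Copp (Cmult Ci w)) by ring. replace (Copp (Copp (Cmult Ci w))) with (Cmult Ci w) by ring.
  f_equal. apply Cplus_comm.
Qed.

Lemma ccos_kap s : kap (Cplus s (RtoC 1)) = Cdiv (RtoC PI) (Cmult (RtoC 2) (ccos (Cmult (RtoC (PI / 2)) s))).
Proof.
  unfold kap. rewrite <- csin_plus_PI2.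
  replace (Cmult (RtoC (PI / 2)) (Cplus s (RtoC 1))) with (Cplus (Cmult (RtoC (PI / 2)) s) (RtoC (PI / 2))) by ring. reflexivity.
Qed.

Lemma ccos_nonint s : nonint s -> ccos (Cmult (RtoC (PI / 2)) s) <> RtoC 0.
Proof.
  intros H. rewrite <- csin_plus_PI2. replace (Cplus (Cmult (RtoC (PI / 2)) s) (RtoC (PI / 2))) with (Cmult (RtoC (PI / 2)) (Cplus s (RtoC 1))) by ring.
  apply csin_nonint. apply (nonint_plus s 1); auto.
Qed.

Lemma kap_shiftN s N : kap (Cminus s (RtoC (2 * INR N))) = Cmult (csgn N) (kap s).
Proof.
  induction N as [|N IH].
  - simpl INR. replace (Cminus s (RtoC (2 * 0))) with s by (rewrite Rmult_0_r; ring). unfold csgn. simpl. ring.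
  - rewrite S_INR. replace (Cminus s (RtoC (2 * (INR N + 1)))) with (Cminus (Cminus s (RtoC (2 * INR N))) (RtoC 2)) by (apply Ceq_pair; cri; ring).
    rewrite kap_shift_minus, IH, csgn_S. ring.
Qed.

(** With w = x / t one has u^2 + w^2 = (u / t)^2 (t^2 + (x / u)^2), so the reflected remainder is
    again a kernel in t, with parameter x / u. *)
Lemma rterm_kern N x u y : 0 < x -> 0 < u ->
  RtoC (rterm N (x * exp (- y)) u) = Cmult (RtoC (x ^ (2 * N + 1) / u ^ (2 * N + 2))) (Cmult (cexp (Cmult (RtoC (1 - 2 * INR N)) (RtoC y))) (kern (x / u) y)).
Proof.
  intros Hx Hu. unfold kern. rewrite <- RtoC_mult, cexp_RtoC, <- RtoC_inv, <- !RtoC_mult by (pose proof (kern_pos (x / u) y); lra). f_equal.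
  unfold rterm. rewrite Rpow_mult_distr.
  assert (E : exp ((1 - 2 * INR N) * y) = exp (- y) ^ (2 * N + 1) * exp (2 * y)).
  { rewrite <- (Rpower_pow (2 * N + 1)) by apply exp_pos. unfold Rpower. rewrite ln_exp, <- exp_plus. f_equal. rewrite plus_INR, mult_INR. simpl INR. ring. }
  rewrite E. set (W := x ^ (2 * N + 1)). set (M := exp (- y) ^ (2 * N + 1)). rewrite pow_add. set (U := u ^ (2 * N)).
  assert (HU : U <> 0) by (apply pow_nonzero; lra).
  replace (exp (2 * y)) with (/ (exp (- y) ^ 2)).
  2:{ replace (2 * y) with (- (- y + - y)) by ring. rewrite (exp_Ropp (- y + - y)), exp_plus. f_equal. ring. }
  pose proof (exp_pos (- y)) as Pe. set (e := exp (- y)) in *.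
  assert (0 < u ^ 2) by (apply pow_lt; auto). assert (0 < x ^ 2) by (apply pow_lt; auto). assert (0 < e ^ 2) by (apply pow_lt; auto).
  assert (0 < x ^ 2 * e ^ 2) by (apply Rmult_lt_0_compat; auto).
  assert (0 < u * u) by nra. assert (0 < (x * e) * (x * e)) by nra.
  field. repeat split; auto; nra.
Qed.

Lemma pterm_kern v y : 0 < v -> RtoC (exp y / (exp y ^ 2 + v ^ 2)) = Cmult (cexp (Cmult (RtoC 1) (RtoC y))) (kern v y).
Proof.
  intros Hv. unfold kern. pose proof (kern_pos v y). rewrite <- RtoC_mult, cexp_RtoC, <- RtoC_inv, <- RtoC_mult by lra.
  f_equal. replace (exp (2 * y)) with (exp y ^ 2); [rewrite Rmult_1_l; reflexivity|]. replace (2 * y) with (y + y) by ring. rewrite exp_plus. ring.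
Qed.

Lemma Int_rel N nu x u : 0 < x -> 0 < u -> 2 * INR N - 1 < Re nu < 2 * INR N + 1 ->
  Int (rel N nu x u) = Cmult (Cmult (csgn N) (kap (Cplus nu (RtoC 1)))) (Cmult (cpow x nu) (cpow u (Copp (Cplus (RtoC 1) nu)))).
Proof.
  intros Hx Hu Hn. set (s := Cplus nu (RtoC (1 - 2 * INR N))). assert (Hs : 0 < Re s < 2) by (unfold s; cri; lra).
  assert (Hw : 0 < x / u) by (apply Rdiv_lt_0_compat; auto).
  transitivity (Cmult (RtoC (x ^ (2 * N + 1) / u ^ (2 * N + 2))) (Int (kernS s (x / u)))).
  - rewrite <- (Int_scal _ _ (kernS_good s _ Hw Hs)). apply Int_ext. intros y. unfold rel, eN, kernS, s.
    rewrite rterm_kern by auto. rewrite Cmult_plus_distr_r, cexp_add. ring.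
  - rewrite Int_kernS by auto. replace s with (Cminus (Cplus nu (RtoC 1)) (RtoC (2 * INR N))) by (unfold s; apply Ceq_pair; cri; ring).
    rewrite kap_shiftN, cpow_div_base by auto.
    rewrite RtoC_div by (apply pow_nonzero; lra). rewrite <- !cpow_INR by auto.
    replace (Cminus (Cminus (Cplus nu (RtoC 1)) (RtoC (2 * INR N))) (RtoC 2)) with (Cminus nu (RtoC (INR (2 * N + 1))))
      by (rewrite plus_INR, mult_INR; simpl INR; apply Ceq_pair; cri; ring).
    rewrite !cpow_minus, cpow_opp.
    replace (RtoC (INR (2 * N + 2))) with (Cplus (RtoC (INR (2 * N + 1))) (RtoC 1)) by (rewrite !plus_INR, !mult_INR; simpl INR; apply Ceq_pair; cri; ring).
    rewrite !cpow_add. pose proof (cpow_neq_0 x (RtoC (INR (2 * N + 1)))). pose proof (cpow_neq_0 u (RtoC (INR (2 * N + 1)))).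
    pose proof (cpow_neq_0 u nu). pose proof (cpow_neq_0 u (RtoC 1)). field. repeat split; auto.
Qed.

(** A product of two kernels with parameters v and x / u, transformed at nu + 2 - 2 N. After
    multiplication by a power of u, the difference v^a - (x / u)^a becomes (u v)^a - x^a, the
    numerator of G. The parameters coincide exactly when u v = x. *)
Lemma Int_tel N nu x u v : 0 < x -> 0 < u -> 0 < v -> nonint nu -> 2 * INR N - 2 < Re nu < 2 * INR N + 2 ->
  Int (tel N nu x u v) = Cmult (Cmult (csgn N) (kap nu)) (Cmult (RtoC (x ^ (2 * N + 1))) (Gfun x nu (Z.of_nat N) u v)).
Proof.
  intros Hx Hu Hv Hni Hn. set (s := Cplus nu (RtoC (2 - 2 * INR N))). assert (Hs : 0 < Re s < 4) by (unfold s; cri; lra).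
  assert (Hw : 0 < x / u) by (apply Rdiv_lt_0_compat; auto).
  assert (Hsn : csin (Cmult (RtoC (PI / 2)) s) <> RtoC 0).
  { apply csin_nonint. unfold s. replace (2 - 2 * INR N) with (IZR (2 - 2 * Z.of_nat N)); [apply nonint_plus; auto|].
    rewrite minus_IZR, mult_IZR, <- INR_IZR_INZ. reflexivity. }
  assert (Es : s = Cminus (Cminus nu (RtoC (2 * INR N))) (Copp (RtoC 2))) by (unfold s; apply Ceq_pair; cri; ring).
  set (a := Cminus nu (RtoC (2 * INR N))) in *.
  assert (Ek : kap s = Copp (Cmult (csgn N) (kap nu))).
  { replace s with (Cplus a (RtoC 2)) by (rewrite Es; ring). unfold a. rewrite kap_shift, kap_shiftN. auto. }
  assert (Es2 : Cminus s (RtoC 2) = a) by (rewrite Es; ring).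
  assert (HU : cpow u (Copp nu) = Cdiv (cpow u (Cminus (RtoC 2) a)) (RtoC (u ^ (2 * N + 2)))).
  { rewrite <- cpow_INR by auto. rewrite <- cpow_minus. f_equal. unfold a. rewrite plus_INR, mult_INR. simpl INR. apply Ceq_pair; cri; ring. }
  assert (HU2 : cpow u (Cminus (RtoC 2) a) = Cdiv (RtoC (u ^ 2)) (cpow u a)).
  { rewrite cpow_minus, <- (cpow_INR u 2) by auto. do 2 f_equal. }
  pose proof (cpow_neq_0 u a) as Nu. assert (N2 : RtoC (u ^ (2 * N + 2)) <> RtoC 0) by (apply RtoC_neq, pow_nonzero; lra).
  transitivity (Cmult (RtoC (x ^ (2 * N + 1) / u ^ (2 * N + 2))) (Int (kkS s v (x / u)))).
  - rewrite <- (Int_scal _ _ (kkS_good s _ _ Hv Hw Hs)). apply Int_ext. intros y. unfold tel, eN, kkS, kk.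
    rewrite rterm_kern, pterm_kern by auto.
    replace (Cmult s (RtoC y)) with (Cplus (Cmult nu (RtoC y)) (Cplus (Cmult (RtoC 1) (RtoC y)) (Cmult (RtoC (1 - 2 * INR N)) (RtoC y)))) by (unfold s; apply Ceq_pair; cri; ring).
    rewrite !cexp_add. ring.
  - rewrite RtoC_div by (apply pow_nonzero; lra). unfold Gfun. rewrite <- INR_IZR_INZ. fold a. rewrite HU, HU2.
    change (Int (kkS s v (x / u))) with (Mel (kk v (x / u)) s).
    assert (Ru : RtoC u <> RtoC 0) by (apply RtoC_neq; lra). assert (Rx : RtoC x <> RtoC 0) by (apply RtoC_neq; lra).
    destruct (Req_EM_T (u * v) x) as [E|E].
    + assert (Ev : v = x / u) by (rewrite <- E; field; lra). rewrite <- Ev.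
      rewrite Mel_kk_sq by auto. unfold kksq. rewrite Es2, Ek, Ev, cpow_div_base by auto.
      replace (Cminus (RtoC 2) s) with (Copp a) by (rewrite Es; ring).
      rewrite cpow_minus. replace (cpow x (RtoC 2)) with (RtoC (x ^ 2)) by (rewrite <- (cpow_INR x 2) by auto; f_equal).
      replace (2 * (x / u) ^ 2) with (2 * x ^ 2 / u ^ 2) by (field; lra). rewrite RtoC_div by (apply pow_nonzero; lra).
      rewrite RtoC_mult, !RtoC_pow. rewrite RtoC_pow in N2. field. repeat split; auto.
    + assert (Ev : v <> x / u) by (intros Q; apply E; rewrite Q; field; lra).
      rewrite Mel_kk by auto. unfold kkval. rewrite Es2, Ek, cpow_mult_base, cpow_div_base by auto.
      assert (D1 : (u * v) ^ 2 - x ^ 2 <> 0).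
      { replace ((u * v) ^ 2 - x ^ 2) with ((u * v - x) * (u * v + x)) by ring. assert (0 < u * v) by (apply Rmult_lt_0_compat; auto).
        apply Rmult_integral_contrapositive_currified; lra. }
      replace ((x / u) ^ 2 - v ^ 2) with (- ((u * v) ^ 2 - x ^ 2) / u ^ 2) by (field; lra). rewrite RtoC_div by (apply pow_nonzero; lra).
      rewrite RtoC_opp. apply RtoC_neq in D1. set (D := RtoC ((u * v) ^ 2 - x ^ 2)) in *. rewrite !RtoC_pow in *.
      field. repeat split; auto.
Qed.

(** * The functional equation *)

Lemma mdec_of_good f s : good (fun y => Cmult (cexp (Cmult s (RtoC y))) (f y)) -> mdec f (Re s).
Proof.
  intros [_ [K [d [Hd H]]]]. exists K, d. split; auto. intros y. specialize (H y). cbv beta in H. rewrite Cmod_mult, Cmod_cexp in H.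
  replace (Re (Cmult s (RtoC y))) with (Re s * y) in H by (cri; ring). exact H.
Qed.

Definition Ae (th y : R) : C := Aev th (exp y).
Definition ABf (x th ps y : R) : C := Cmult (Aev th (exp y)) (Aev ps (x * exp (- y))).

Lemma Ae_good th s : 0 < th < 1 -> 0 < Re s -> good (fun y => Cmult (cexp (Cmult s (RtoC y))) (Ae th y)).
Proof.
  intros H Hs. assert (H1 : 0 < 1 - th < 1) by lra.
  pose proof (Mel_good _ s (Lth_exp_cont th H) (Lth_mdec th _ H Hs)) as G1. pose proof (Mel_good _ s (Lth_exp_cont (1 - th) H1) (Lth_mdec (1 - th) _ H1 Hs)) as G2.
  refine (good_ext _ _ _ (good_scal (RtoC (/ 2)) _ (good_plus _ _ G1 G2))). intros y. unfold Ae, Aev. ring.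
Qed.

Lemma ABf_cont x th ps : 0 < x -> 0 < th < 1 -> 0 < ps < 1 -> ccontR (ABf x th ps).
Proof. intros Hx Ht Hp t. exact (continuous_Cmult _ _ t (Aev_cont th Ht t) (Aev_refl_cont ps x Hp Hx t)). Qed.

Section FE.
Variables (x th ps : R).
Hypotheses (Hx : 0 < x) (Hth : 0 < th < 1) (Hps : 0 < ps < 1).

Lemma ABf_good s : good (fun y => Cmult (cexp (Cmult s (RtoC y))) (ABf x th ps y)).
Proof. exact (proj1 (lhs_cser s x th ps Hx Hth Hps)). Qed.

Definition zcoef (k : nat) : C := Cmult (RtoC (x ^ (2 * k + 1))) (Zev ps (RtoC (INR (2 * (k + 1))))).

Lemma refl_pow_exp nu k y : Cmult (cexp (Cmult nu (RtoC y))) (RtoC ((x * exp (- y)) ^ (2 * k + 1))) =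
  Cmult (RtoC (x ^ (2 * k + 1))) (cexp (Cmult (Cminus nu (RtoC (INR (2 * k + 1)))) (RtoC y))).
Proof.
  rewrite Rpow_mult_distr, RtoC_mult. rewrite <- (Rpower_pow (2 * k + 1) (exp (- y))) by apply exp_pos. unfold Rpower. rewrite ln_exp.
  rewrite <- cexp_RtoC. replace (Cmult (Cminus nu (RtoC (INR (2 * k + 1)))) (RtoC y)) with (Cplus (Cmult nu (RtoC y)) (RtoC (INR (2 * k + 1) * - y))) by (apply Ceq_pair; cri; ring).
  rewrite cexp_add. ring.
Qed.

(** Write A and B for the two generating functions, P for the polynomial and q = (-1)^N. Then 2 pi B
    = P + q R - pi, so 4 pi A B = 2 A q R - 2 pi A + 2 A P, and 2 A R = (1 / pi) 2 pi (A + 1/2) R -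
    R. *)
Lemma Mel_AB_split N nu : 0 < Re nu -> 2 * INR N - 1 < Re nu < 2 * INR N + 1 ->
  Cmult (RtoC (4 * PI)) (Mel (ABf x th ps) nu) =
  Cplus (Cminus (Cmult (csgn N) (Cminus (Cmult (RtoC (/ PI)) (Mel (G2 N x th ps) nu)) (Mel (Rr N x ps) nu)))
    (Cmult (RtoC (2 * PI)) (Mel (Ae th) nu)))
    (csum (fun k => Cmult (Cmult (RtoC 2) (Cmult (csgn k) (zcoef k))) (Mel (Ae th) (Cminus nu (RtoC (INR (2 * k + 1)))))) N).
Proof.
  intros H0 H1. pose proof PI_RGT_0 as HP.
  pose proof (ABf_good nu) as GAB. pose proof (Ae_good th nu Hth H0) as GA.
  destruct (double_exchange N nu x th ps Hx Hth Hps ltac:(lra) ltac:(lra)) as [MG _].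
  destruct (Rr_exchange N nu x ps Hx Hps H0 H1) as [GR _].
  assert (CG : ccontR (G2 N x th ps)).
  { intros t. refine (continuous_Cmult (fun y => Cmult (RtoC (2 * PI)) (Cplus (Aev th (exp y)) (RtoC (/ 2)))) (Rr N x ps) t _ (Rr_cont N x ps Hx Hps t)).
    apply continuous_Cmult; [apply continuous_Cconst|]. apply continuous_Cplus; [apply Aev_cont; auto|apply continuous_Cconst]. }
  pose proof (Mel_good _ nu CG MG) as GG.
  (* The guard is needed for integrability: nu - (2 k + 1) has positive real part only for k < N. *)
  set (gk := fun k y => if Nat.ltb k N then Cmult (Cmult (RtoC 2) (Cmult (csgn k) (zcoef k))) (Cmult (cexp (Cmult (Cminus nu (RtoC (INR (2 * k + 1)))) (RtoC y))) (Ae th y)) else RtoC 0).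
  assert (Hk : forall k, (k < N)%nat -> 0 < Re (Cminus nu (RtoC (INR (2 * k + 1))))).
  { intros k Hk. cri. assert (INR (2 * k + 1) <= 2 * INR N - 1); [|lra].
    assert (INR (2 * k + 1 + 1) <= INR (2 * N)) by (apply le_INR; lia). rewrite (plus_INR (2 * k + 1) 1), (mult_INR 2 N) in H. simpl (INR 2) in H. simpl (INR 1) in H. lra. }
  assert (Gk : forall k, good (gk k)).
  { intros k. unfold gk. destruct (Nat.ltb_spec k N) as [h|h]; [|exact good_zero]. exact (good_scal _ _ (Ae_good th _ Hth (Hk k h))). }
  assert (Ek : csum (fun k => Cmult (Cmult (RtoC 2) (Cmult (csgn k) (zcoef k))) (Mel (Ae th) (Cminus nu (RtoC (INR (2 * k + 1)))))) N = Int (fun y => csum (fun k => gk k y) N)).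
  { rewrite (Int_csum gk N Gk). apply csum_ext_lt. intros k h. unfold gk. destruct (Nat.ltb_spec k N) as [h'|h']; [|lia].
    symmetry. exact (Int_scal _ _ (Ae_good th _ Hth (Hk k h))). }
  rewrite Ek. pose proof (csum_good gk N Gk) as GS.
  set (a := fun y => Cmult (csgn N) (Cminus (Cmult (RtoC (/ PI)) (Cmult (cexp (Cmult nu (RtoC y))) (G2 N x th ps y))) (Cmult (cexp (Cmult nu (RtoC y))) (Rr N x ps y)))).
  pose proof (good_minus _ _ (good_scal (RtoC (/ PI)) _ GG) GR : good (fun y => Cminus (Cmult (RtoC (/ PI)) (Cmult (cexp (Cmult nu (RtoC y))) (G2 N x th ps y))) (Cmult (cexp (Cmult nu (RtoC y))) (Rr N x ps y)))) as G0.
  assert (Ga : good a) by exact (good_scal (csgn N) _ G0).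
  assert (Ea : Int a = Cmult (csgn N) (Cminus (Cmult (RtoC (/ PI)) (Mel (G2 N x th ps) nu)) (Mel (Rr N x ps) nu))).
  { unfold a. rewrite (Int_scal _ _ G0). f_equal.
    transitivity (Cminus (Int (fun y => Cmult (RtoC (/ PI)) (Cmult (cexp (Cmult nu (RtoC y))) (G2 N x th ps y)))) (Mel (Rr N x ps) nu)).
    - exact (Int_minus _ _ (good_scal _ _ GG) GR).
    - f_equal. exact (Int_scal _ _ GG). }
  set (b := fun y => Cmult (RtoC (2 * PI)) (Cmult (cexp (Cmult nu (RtoC y))) (Ae th y))).
  assert (Gb : good b) by exact (good_scal _ _ GA).
  assert (Eb : Int b = Cmult (RtoC (2 * PI)) (Mel (Ae th) nu)) by exact (Int_scal _ _ GA).
  rewrite <- Ea, <- Eb, <- (Int_minus _ _ Ga Gb), <- (Int_plus _ _ (good_minus _ _ Ga Gb) GS).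
  transitivity (Int (fun y => Cmult (RtoC (4 * PI)) (Cmult (cexp (Cmult nu (RtoC y))) (ABf x th ps y)))); [symmetry; exact (Int_scal _ _ GAB)|].
  apply Int_ext. intros y. unfold a, b, ABf, G2, Ae.
  set (X := cexp (Cmult nu (RtoC y))). set (A := Aev th (exp y)).
  assert (Es : csum (fun k => gk k y) N = Cmult (Cmult (RtoC 2) (Cmult X A)) (csum (fun k => Cmult (csgn k) (Cmult (RtoC ((x * exp (- y)) ^ (2 * k + 1))) (Zev ps (RtoC (INR (2 * (k + 1))))))) N)).
  { rewrite <- csum_scal. apply csum_ext_lt. intros k h. unfold gk. destruct (Nat.ltb_spec k N) as [h'|h']; [|lia].
    unfold zcoef, Ae. fold A. pose proof (refl_pow_exp nu k y) as RP. fold X in RP.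
    set (Y := cexp (Cmult (Cminus nu _) _)) in *. set (Z := Zev ps _). set (P := RtoC ((x * _) ^ _)) in *. set (Q := RtoC (x ^ _)) in *.
    transitivity (Cmult (Cmult (Cmult (RtoC 2) (csgn k)) (Cmult Z A)) (Cmult Q Y)); [ring|]. rewrite <- RP. ring. }
  rewrite Es. unfold Rr, Rrem. set (B := Aev ps (x * exp (- y))). set (S := csum _ N).
  pose proof (csgn_sqr N) as Q. set (q := csgn N) in *. rewrite !RtoC_mult, RtoC_inv by lra. replace (RtoC 4) with (Cmult (RtoC 2) (RtoC 2)) by (rewrite <- RtoC_mult; f_equal; ring).
  rewrite RtoC_inv by lra. assert (RtoC PI <> RtoC 0) by (apply RtoC_neq; lra).
  transitivity (Cplus (Cminus (Cmult (Cmult q q) (Cmult (Cmult (RtoC 2) (Cmult X A)) (Cminus (Cmult (Cmult (RtoC 2) (RtoC PI)) (Cplus B (Cinv (RtoC 2)))) S))) (Cmult (Cmult (RtoC 2) (RtoC PI)) (Cmult X A))) (Cmult (Cmult (RtoC 2) (Cmult X A)) S)).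
  - rewrite Q. field.
  - field. auto.
Qed.

Lemma ccos_minus_PI w : ccos (Cminus w (RtoC PI)) = Copp (ccos w).
Proof.
  rewrite <- !csin_plus_PI2. replace (Cplus w (RtoC (PI / 2))) with (Cplus (Cplus (Cminus w (RtoC PI)) (RtoC (PI / 2))) (RtoC PI)) by ring.
  rewrite csin_plus_PI. ring.
Qed.

Lemma ccos_odd_shift nu k : ccos (Cmult (RtoC (PI / 2)) (Cminus nu (RtoC (INR (2 * k + 1))))) = Cmult (csgn k) (csin (Cmult (RtoC (PI / 2)) nu)).
Proof.
  induction k as [|k IH].
  - rewrite <- csin_plus_PI2. replace (Cplus (Cmult (RtoC (PI / 2)) (Cminus nu (RtoC (INR (2 * 0 + 1))))) (RtoC (PI / 2))) with (Cmult (RtoC (PI / 2)) nu) by (simpl INR; ring).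
    unfold csgn. simpl. ring.
  - replace (Cmult (RtoC (PI / 2)) (Cminus nu (RtoC (INR (2 * S k + 1))))) with (Cminus (Cmult (RtoC (PI / 2)) (Cminus nu (RtoC (INR (2 * k + 1))))) (RtoC PI)).
    + rewrite ccos_minus_PI, IH, csgn_S. ring.
    + replace (2 * S k + 1)%nat with (2 * k + 1 + 2)%nat by lia. rewrite (plus_INR (2 * k + 1) 2). simpl (INR 2). apply Ceq_pair; cri; field.
Qed.

Lemma Zev_Mel w : 0 < Re w -> Zev th (Cminus (RtoC 1) w) = Cmult (Cmult (RtoC 4) (ccos (Cmult (RtoC (PI / 2)) w))) (Mel (Ae th) w).
Proof.
  intros Hw. rewrite Zev_left by (auto; cri; lra).
  replace (Cmult (RtoC (PI / 2)) (Cminus (RtoC 1) w)) with (Cminus (RtoC (PI / 2)) (Cmult (RtoC (PI / 2)) w)) by ring. rewrite csin_PI2_minus.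
  replace (Cminus (RtoC 1) (Cminus (RtoC 1) w)) with w by ring. reflexivity.
Qed.

(** The four summands of the right-hand side as functions of [nu]. In [feG] the double series is
    still an integral, so that holomorphy in [nu] comes from [Mel_cdiff]. *)
Definition feA (nu : C) : C :=
  Copp (Cmult (Cdiv (Cmult (RtoC PI) (cpow x nu)) (Cmult (RtoC 2) (ccos (Cmult (RtoC (PI / 2)) nu)))) (Zev ps (Cplus (RtoC 1) nu))).
Definition feB (nu : C) : C :=
  Copp (Cmult (Cdiv (RtoC PI) (Cmult (RtoC 2) (ccos (Cmult (RtoC (PI / 2)) nu)))) (Zev th (Cminus (RtoC 1) nu))).
Definition feS (N : nat) (nu : C) : C :=
  Cmult (Cinv (Cmult (RtoC 2) (csin (Cmult (RtoC (PI / 2)) nu)))) (csum (fun k => Cmult (zcoef k) (Zev th (Cminus (RtoC (INR (2 * (k + 1)))) nu))) N).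
Definition feG (N : nat) (nu : C) : C := Cmult (Cmult (csgn N) (RtoC (/ PI))) (Mel (G2 N x th ps) nu).
Definition feRHS (N : nat) (nu : C) : C := Cplus (Cplus (Cplus (feA nu) (feB nu)) (feS N nu)) (feG N nu).

(** By [Int_rel] the term of u is a constant times u^(-(1+nu)), so the sum over u is a pair of
    Hurwitz series at 1 + nu; the constant kap (nu + 1) supplies the cosine. *)
Lemma Mel_Rr N nu : 0 < Re nu -> 2 * INR N - 1 < Re nu < 2 * INR N + 1 ->
  Cmult (csgn N) (Mel (Rr N x ps) nu) = Copp (feA nu).
Proof.
  intros H0 H1. destruct (Rr_exchange N nu x ps Hx Hps H0 H1) as [_ [_ S]].
  assert (H2 : 1 < Re (Cplus (RtoC 1) nu)) by (cri; lra).
  pose proof (cser_scal (Cmult (Cmult (csgn N) (kap (Cplus nu (RtoC 1)))) (cpow x nu)) _ _ (cser_plus _ _ _ _ (hurwitz_series ps _ Hps H2) (hurwitz_series (1 - ps) _ ltac:(lra) H2))) as S2.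
  assert (E : Mel (Rr N x ps) nu = Cmult (Cmult (Cmult (csgn N) (kap (Cplus nu (RtoC 1)))) (cpow x nu)) (Zev ps (Cplus (RtoC 1) nu))).
  { apply (cser_unique _ _ _ S). refine (cser_ext _ _ _ _ S2). intros n. cbv beta. pose proof (pos_INR n). rewrite !Int_rel by (auto; lra). ring. }
  rewrite E, ccos_kap. unfold feA. rewrite !Cmult_assoc, csgn_sqr. unfold Cdiv. ring.
Qed.

Lemma FE_open N nu : nonint nu -> 0 < Re nu -> 2 * INR N - 1 < Re nu < 2 * INR N + 1 ->
  Cmult (RtoC (4 * PI)) (Mel (ABf x th ps) nu) = feRHS N nu.
Proof.
  intros Hn H0 H1. pose proof PI_RGT_0 as HP. rewrite (Mel_AB_split N nu H0 H1).
  pose proof (Mel_Rr N nu H0 H1) as ER. pose proof (ccos_nonint nu Hn) as Hc. pose proof (csin_nonint nu Hn) as Hs.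
  assert (EB : Cmult (RtoC (2 * PI)) (Mel (Ae th) nu) = Copp (feB nu)).
  { unfold feB. rewrite (Zev_Mel nu H0). rewrite RtoC_mult. replace (RtoC 4) with (Cmult (RtoC 2) (RtoC 2)) by (rewrite <- RtoC_mult; f_equal; ring). field. auto. }
  (* [Zev_Mel] is applied at nu - (2 k + 1). The cosine there is (-1)^k sin (pi nu / 2), which
     absorbs the alternating sign and leaves a common denominator. *)
  assert (ES : csum (fun k => Cmult (Cmult (RtoC 2) (Cmult (csgn k) (zcoef k))) (Mel (Ae th) (Cminus nu (RtoC (INR (2 * k + 1)))))) N = feS N nu).
  { unfold feS. rewrite <- csum_scal. apply csum_ext_lt. intros k Hk.
    assert (Hw : 0 < Re (Cminus nu (RtoC (INR (2 * k + 1))))).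
    { cri. assert (INR (2 * k + 1) <= 2 * INR N - 1); [|lra].
      assert (INR (2 * k + 1 + 1) <= INR (2 * N)) by (apply le_INR; lia). rewrite (plus_INR (2 * k + 1) 1), (mult_INR 2 N) in H. simpl (INR 2) in H. simpl (INR 1) in H. lra. }
    pose proof (Zev_Mel _ Hw) as Z. rewrite ccos_odd_shift in Z.
    replace (Cminus (RtoC (INR (2 * (k + 1)))) nu) with (Cminus (RtoC 1) (Cminus nu (RtoC (INR (2 * k + 1))))).
    2:{ replace (2 * (k + 1))%nat with (2 * k + 1 + 1)%nat by lia. rewrite (plus_INR (2 * k + 1) 1). simpl (INR 1). apply Ceq_pair; cri; ring. }
    rewrite Z. set (M := Mel _ _). set (s := csin _) in *. pose proof (csgn_sqr k) as Q. set (q := csgn k) in *.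
    replace (RtoC 4) with (Cmult (RtoC 2) (RtoC 2)) by (rewrite <- RtoC_mult; f_equal; ring). field. auto. }
  rewrite ES, EB. unfold feRHS, feG.
  transitivity (Cplus (Cplus (Cplus (Copp (Cmult (csgn N) (Mel (Rr N x ps) nu))) (feB nu)) (feS N nu)) (Cmult (Cmult (csgn N) (RtoC (/ PI))) (Mel (G2 N x th ps) nu))); [ring|].
  rewrite ER. ring.
Qed.

Lemma Zev_cdiff t (g : C -> C) s : 0 < t < 1 -> cdiff g s -> g s <> RtoC 1 -> cdiff (fun s => Zev t (g s)) s.
Proof.
  intros Ht Hg Hn. unfold Zev. apply cdiff_plus.
  - apply (cdiff_comp (fun z => hurwitz_zeta z t) g); auto. apply hurwitz_cdiff; auto.
  - apply (cdiff_comp (fun z => hurwitz_zeta z (1 - t)) g); auto. apply hurwitz_cdiff; auto; lra.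
Qed.

Lemma csum_cdiff (f : nat -> C -> C) N s : (forall k, cdiff (f k) s) -> cdiff (fun s => csum (fun k => f k s) N) s.
Proof. intros H. induction N; cbn [csum]; [apply cdiff_const|]. apply cdiff_plus; auto. Qed.

(** A nonintegral [nu] keeps the sine and cosine away from 0 and all the arguments 1 + nu, 1 - nu
    and 2 j - nu away from the pole 1 of the zeta function. *)
Lemma feRHS_cdiff N nu : nonint nu -> 0 <= Re nu -> 2 * INR N - 1 <= Re nu < 2 * INR N + 1 -> cdiff (feRHS N) nu.
Proof.
  intros Hn H0 H1. destruct (double_exchange N nu x th ps Hx Hth Hps H0 H1) as [MG _].
  pose proof (ccos_nonint nu Hn) as Hc. pose proof (csin_nonint nu Hn) as Hs.
  assert (D1 : cdiff (fun s => ccos (Cmult (RtoC (PI / 2)) s)) nu) by (apply cdiff_ccos; cdiffs).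
  assert (D2 : cdiff (fun s => csin (Cmult (RtoC (PI / 2)) s)) nu) by (apply cdiff_csin; cdiffs).
  unfold feRHS. apply cdiff_plus; [apply cdiff_plus; [apply cdiff_plus|]|].
  - unfold feA. apply cdiff_opp. apply cdiff_mult.
    + apply cdiff_div; [cdiffs; apply (cdiff_cpow x (fun s => s)), cdiff_id|apply cdiff_mult; [apply cdiff_const|auto]|apply Cmult_neq_0; auto using C2_neq].
    + apply Zev_cdiff; auto; [cdiffs|]. intros E. apply (Hn 0%Z). transitivity (Cminus (Cplus (RtoC 1) nu) (RtoC 1)); [ring|]. rewrite E. ring.
  - unfold feB. apply cdiff_opp. apply cdiff_mult.
    + apply cdiff_div; [cdiffs|apply cdiff_mult; [apply cdiff_const|auto]|apply Cmult_neq_0; auto using C2_neq].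
    + apply Zev_cdiff; auto; [cdiffs|]. intros E. apply (Hn 0%Z). transitivity (Cminus (RtoC 1) (Cminus (RtoC 1) nu)); [ring|]. rewrite E. ring.
  - unfold feS. apply cdiff_mult; [apply cdiff_inv; [apply cdiff_mult; [apply cdiff_const|auto]|apply Cmult_neq_0; auto using C2_neq]|].
    apply (csum_cdiff (fun k s => Cmult (zcoef k) (Zev th (Cminus (RtoC (INR (2 * (k + 1)))) s)))). intros k.
    apply cdiff_mult; [apply cdiff_const|]. apply Zev_cdiff; auto; [cdiffs|]. intros E. apply (Hn (Z.of_nat (2 * (k + 1)) - 1)%Z).
    rewrite minus_IZR, <- INR_IZR_INZ, RtoC_minus. rewrite <- E. ring.
  - unfold feG. apply cdiff_mult; [apply cdiff_const|]. apply Mel_cdiff; auto.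
    intros t. refine (continuous_Cmult (fun y => Cmult (RtoC (2 * PI)) (Cplus (Aev th (exp y)) (RtoC (/ 2)))) (Rr N x ps) t _ (Rr_cont N x ps Hx Hps t)).
    apply continuous_Cmult; [apply continuous_Cconst|]. apply continuous_Cplus; [apply Aev_cont; auto|apply continuous_Cconst].
Qed.

Lemma FE_closed N nu : nonint nu -> 0 <= Re nu -> 2 * INR N - 1 <= Re nu < 2 * INR N + 1 ->
  Cmult (RtoC (4 * PI)) (Mel (ABf x th ps) nu) = feRHS N nu.
Proof.
  intros Hn H0 H1.
  destruct (Rlt_dec 0 (Re nu)) as [h0|h0]; [destruct (Rlt_dec (2 * INR N - 1) (Re nu)) as [h1|h1]; [apply FE_open; auto; lra|]|].
  all: assert (K : exists k, Re nu = IZR k) by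
    first [exists 0%Z; lra | exists (2 * Z.of_nat N - 1)%Z; rewrite minus_IZR, mult_IZR, <- INR_IZR_INZ; lra].
  (* On either boundary line [Re nu] is an integer, so a nonintegral [nu] is nonreal there and every
     nu + e stays nonintegral. *)
  all: assert (Hi : Im nu <> 0) by (destruct K as [k Ek]; intros Ei; apply (Hn k); apply Ceq_pair; rewrite ?Re_RtoC, ?Im_RtoC; auto).
  all: apply (right_limit_eq (fun s => Cmult (RtoC (4 * PI)) (Mel (ABf x th ps) s)) (feRHS N) nu (2 * INR N + 1 - Re nu)); [lra| | |].
  1,4: apply cdiff_mult; [apply cdiff_const|]; apply Mel_cdiff; [apply ABf_cont; auto|apply mdec_of_good, ABf_good].
  1,3: apply feRHS_cdiff; auto.
  all: intros e He; apply FE_open; [|cri; lra|cri; lra].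
  all: intros k E; apply Hi; apply (f_equal Im) in E; revert E; cri; lra.
Qed.
End FE.

(** * The double series *)

Definition gterm (x : R) (nu : C) (th ps : R) (N m n : nat) : C :=
  let G := Gfun x nu (Z.of_nat N) in
  Cplus (Cplus (G (INR n + ps) (INR m + th)) (G (INR n + (1 - ps)) (INR m + th)))
        (Cplus (G (INR n + ps) (INR m + (1 - th))) (G (INR n + (1 - ps)) (INR m + (1 - th)))).

(** An iterated sum, inner index n and outer index m, in the order of the theorem; [U] holds the
    inner sums. *)
Definition dser (a : nat -> nat -> C) (S : C) : Prop := exists U, (forall m, cser (a m) (U m)) /\ cser U S.

Lemma Gfun_step x nu N u v : 0 < x -> 0 < u -> 0 < v ->
  Gfun x nu (Z.of_nat (S N)) u v = Cmult (RtoC (/ x ^ 2)) (Cminus (Gfun x nu (Z.of_nat N) u v)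
     (Cmult (cpow u (Copp (RtoC (INR (2 * (N + 1)))))) (cpow v (Copp (Cminus (RtoC (INR (2 * (N + 1)))) nu))))).
Proof.
  intros Hx Hu Hv. unfold Gfun. rewrite <- !INR_IZR_INZ. set (a := Cminus nu (RtoC (2 * INR N))).
  replace (Cminus nu (RtoC (2 * INR (S N)))) with (Cminus a (RtoC 2)) by (unfold a; rewrite S_INR; apply Ceq_pair; cri; ring).
  replace (Copp (Cminus (RtoC (INR (2 * (N + 1)))) nu)) with (Cminus a (RtoC 2)) by (unfold a; rewrite mult_INR, plus_INR; simpl INR; apply Ceq_pair; cri; ring).
  replace (Copp (RtoC (INR (2 * (N + 1))))) with (Cplus (Copp nu) (Cminus a (RtoC 2))) by (unfold a; rewrite mult_INR, plus_INR; simpl INR; apply Ceq_pair; cri; ring).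
  rewrite cpow_add. rewrite <- !Cmult_assoc, <- cpow_mult_base by auto.
  assert (E2 : forall t z, 0 < t -> cpow t (Cminus z (RtoC 2)) = Cdiv (cpow t z) (RtoC (t ^ 2))).
  { intros t z Ht. rewrite cpow_minus. do 2 f_equal. rewrite <- (cpow_INR t 2) by auto. f_equal. }
  assert (Huv : 0 < u * v) by (apply Rmult_lt_0_compat; auto).
  assert (Rx : RtoC x <> RtoC 0) by (apply RtoC_neq; lra).
  destruct (Req_EM_T (u * v) x) as [E|E].
  (* The removable value is a x^(a-2) / 2 times a power of u, and a - (a - 2) = 2 gives the
     recursion here too. *)
  - rewrite E, !E2 by auto. rewrite RtoC_inv by (apply pow_nonzero; lra). rewrite !RtoC_pow. field. auto.
  - assert (D1 : (u * v) ^ 2 - x ^ 2 <> 0).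
    { replace ((u * v) ^ 2 - x ^ 2) with ((u * v - x) * (u * v + x)) by ring. apply Rmult_integral_contrapositive_currified; lra. }
    apply RtoC_neq in D1. assert (Ruv : RtoC (u * v) <> RtoC 0) by (apply RtoC_neq; lra). rewrite !E2 by auto.
    rewrite RtoC_inv by (apply pow_nonzero; lra). set (w := u * v) in *. rewrite RtoC_minus in *. rewrite !RtoC_pow in *. field. auto.
Qed.

Section Final.
Variables (x th ps : R) (nu : C).
Hypotheses (Hx : 0 < x) (Hth : 0 < th < 1) (Hps : 0 < ps < 1) (Hn : nonint nu) (H0 : 0 <= Re nu).

(** The expansion of [double_exchange] evaluated by [Int_tel]. The factor (-1)^N / pi of [feG] meets
    (-1)^N kap nu and leaves 1 / (2 sin (pi nu / 2)). *)
Lemma gterm_base N : 2 * INR N - 1 <= Re nu < 2 * INR N + 1 -> exists S, dser (gterm x nu th ps N) S /\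
  feG x th ps N nu = Cmult (Cmult (Cinv (Cmult (RtoC 2) (csin (Cmult (RtoC (PI / 2)) nu)))) (RtoC (x ^ (2 * N + 1)))) S.
Proof.
  intros H1. destruct (double_exchange N nu x th ps Hx Hth Hps H0 H1) as [_ [GT [U [HU HS]]]].
  pose proof PI_RGT_0 as HP. pose proof (csin_nonint nu Hn) as Hs.
  set (q := Cmult (Cmult (csgn N) (kap nu)) (RtoC (x ^ (2 * N + 1)))).
  assert (Rx : RtoC (x ^ (2 * N + 1)) <> RtoC 0) by (apply RtoC_neq, pow_nonzero; lra).
  assert (RP : RtoC PI <> RtoC 0) by (apply RtoC_neq; lra).
  assert (Hq : q <> RtoC 0).
  { unfold q, kap. apply Cmult_neq_0; [apply Cmult_neq_0|auto].
    - intros E. pose proof (csgn_sqr N) as Q. rewrite E in Q. apply (C1_nz). transitivity (Cmult (RtoC 0) (RtoC 0)); [symmetry; exact Q|ring].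
    - unfold Cdiv. apply Cmult_neq_0; auto. apply Cinv_neq_0. apply Cmult_neq_0; auto using C2_neq. }
  assert (ET : forall m n, Int (tel4 N nu x th ps m n) = Cmult q (gterm x nu th ps N m n)).
  { intros m n. pose proof (pos_INR m). pose proof (pos_INR n). unfold gterm, q.
    pose proof (fun u v hu hv => Int_tel N nu x u v Hx hu hv Hn ltac:(lra)) as IT.
    pose proof (GT (INR n + ps) (INR m + th) ltac:(lra) ltac:(lra)) as g1. pose proof (GT (INR n + (1 - ps)) (INR m + th) ltac:(lra) ltac:(lra)) as g2.
    pose proof (GT (INR n + ps) (INR m + (1 - th)) ltac:(lra) ltac:(lra)) as g3. pose proof (GT (INR n + (1 - ps)) (INR m + (1 - th)) ltac:(lra) ltac:(lra)) as g4.
    transitivity (Cplus (Cplus (Int (tel N nu x (INR n + ps) (INR m + th))) (Int (tel N nu x (INR n + (1 - ps)) (INR m + th))))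
       (Cplus (Int (tel N nu x (INR n + ps) (INR m + (1 - th)))) (Int (tel N nu x (INR n + (1 - ps)) (INR m + (1 - th)))))).
    - rewrite <- (Int_plus _ _ g1 g2), <- (Int_plus _ _ g3 g4), <- (Int_plus _ _ (good_plus _ _ g1 g2) (good_plus _ _ g3 g4)). reflexivity.
    - rewrite !IT by lra. ring. }
  exists (Cmult (Cinv q) (Mel (G2 N x th ps) nu)). split.
  - exists (fun m => Cmult (Cinv q) (U m)). split; [|apply cser_scal; auto].
    intros m. refine (cser_ext _ _ _ _ (cser_scal (Cinv q) _ _ (HU m))). intros n. cbv beta. rewrite ET, Cmult_assoc, Cinv_l by auto. ring.
  - unfold feG. unfold q, kap in *. rewrite RtoC_inv by lra. pose proof (csgn_sqr N) as Q. set (c := csgn N) in *.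
    assert (Hc : c <> RtoC 0) by (intros E; rewrite E in Q; apply C1_nz; transitivity (Cmult (RtoC 0) (RtoC 0)); [symmetry; exact Q|ring]).
    apply (Cmult_eq_reg_l c); auto. rewrite !Cmult_assoc, Q. field. auto.
Qed.

(** The defect in [Gfun_step] is a power of u times a power of v, so its double sum factors into two
    pairs of Hurwitz series, at 2 N + 2 and at 2 N + 2 - nu. The second converges because Re nu < 2
    N + 1. *)
Lemma gterm_step N S : Re nu < 2 * INR N + 1 -> dser (gterm x nu th ps N) S ->
  dser (gterm x nu th ps (N + 1)) (Cmult (RtoC (/ x ^ 2)) (Cminus S (Cmult (Zev ps (RtoC (INR (2 * (N + 1))))) (Zev th (Cminus (RtoC (INR (2 * (N + 1)))) nu))))).
Proof.
  intros H1 [U [HU HS]]. set (p := RtoC (INR (2 * (N + 1)))). set (r := Cminus p nu).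
  assert (IN : INR (2 * (N + 1)) = 2 * INR N + 2) by (rewrite mult_INR, plus_INR; simpl INR; ring). pose proof (pos_INR N) as HN.
  assert (Hp : 1 < Re p) by (unfold p; rewrite Re_RtoC, IN; lra). assert (Hr : 1 < Re r) by (unfold r, p; cri; rewrite IN; lra).
  pose proof (cser_plus _ _ _ _ (hurwitz_series ps p Hps Hp) (hurwitz_series (1 - ps) p ltac:(lra) Hp)) as Sp. fold (Zev ps p) in Sp.
  pose proof (cser_plus _ _ _ _ (hurwitz_series th r Hth Hr) (hurwitz_series (1 - th) r ltac:(lra) Hr)) as Sr. fold (Zev th r) in Sr.
  set (V := fun m => Cplus (cpow (INR m + th) (Copp r)) (cpow (INR m + (1 - th)) (Copp r))) in *.
  exists (fun m => Cmult (RtoC (/ x ^ 2)) (Cminus (U m) (Cmult (V m) (Zev ps p)))). split.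
  - intros m. refine (cser_ext _ _ _ _ (cser_scal (RtoC (/ x ^ 2)) _ _ (cser_minus _ _ _ _ (HU m) (cser_scal (V m) _ _ Sp)))).
    intros n. cbv beta. pose proof (pos_INR m). pose proof (pos_INR n). unfold gterm, V. replace (N + 1)%nat with (Datatypes.S N) by lia.
    rewrite !Gfun_step by lra. fold p. fold r. ring.
  - replace (Cmult (Zev ps p) (Zev th r)) with (Cmult (Zev ps p) (Zev th r)) by ring. apply cser_scal. apply cser_minus; auto.
    refine (cser_ext _ _ _ _ (cser_scal (Zev ps p) _ _ Sr)). intros m. cbv beta. unfold V. ring.
Qed.

Lemma FE_general N0 k : 2 * INR N0 - 1 <= Re nu < 2 * INR N0 + 1 -> exists S, dser (gterm x nu th ps (N0 + k)) S /\
  Cmult (RtoC (4 * PI)) (Mel (ABf x th ps) nu) =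
  Cplus (Cplus (Cplus (feA x ps nu) (feB th nu)) (feS x th ps (N0 + k) nu))
    (Cmult (Cmult (Cinv (Cmult (RtoC 2) (csin (Cmult (RtoC (PI / 2)) nu)))) (RtoC (x ^ (2 * (N0 + k) + 1)))) S).
Proof.
  intros H1. induction k as [|k IH].
  - rewrite Nat.add_0_r. destruct (gterm_base N0 H1) as [S [HS E]]. exists S. split; auto. rewrite <- E. apply FE_closed; auto.
  - destruct IH as [S [HS E]]. set (N := (N0 + k)%nat) in *. replace (N0 + Datatypes.S k)%nat with (N + 1)%nat by (unfold N; lia).
    assert (HN : Re nu < 2 * INR N + 1) by (unfold N; rewrite plus_INR; pose proof (pos_INR k); lra).
    eexists. split; [apply (gterm_step N S HN HS)|]. rewrite E. unfold feS. replace (N + 1)%nat with (Datatypes.S N) at 1 by lia. cbn [csum].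
    unfold zcoef. set (Z1 := Zev ps _). set (Z2 := Zev th _). set (i := Cinv (Cmult (RtoC 2) _)).
    (* Since x^(2N+3) / x^2 = x^(2N+1) is the power in the term j = N + 1 of the finite sum, the new
       term cancels against the change of the double series. *)
    replace (2 * (N + 1) + 1)%nat with (2 * N + 1 + 2)%nat by lia. rewrite (pow_add x (2 * N + 1) 2), RtoC_mult, RtoC_inv by (apply pow_nonzero; lra).
    assert (RtoC (x ^ 2) <> RtoC 0) by (apply RtoC_neq, pow_nonzero; lra). field. auto.
Qed.
End Final.

Theorem theorem3p7 (x theta psi : R) (nu : C) (N : Z)
  (hx : 0 < x)
  (htheta : 0 < theta < 1) (hpsi : 0 < psi < 1)
  (hnu_nonint : forall k : Z, nu <> RtoC (IZR k))
  (hnu_re : 0 <= Re nu)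
  (hN : (Int_part ((Re nu + 1) / 2) <= N)%Z)
  (hxset : forall n r : nat, (1 <= n)%nat -> (1 <= r)%nat ->
             x <> (INR n - theta) * (INR r - psi)) :
  let lhs_term := fun n : nat =>
    Cmult (Cmult (cpow (INR n) (Cdiv nu (RtoC 2)))
                 (BesselK nu (4 * PI * sqrt (INR n * x))))
      (divisor_sum n (fun d =>
         Cmult (Cmult (cpow (INR d) (Copp nu)) (RtoC (cos (2 * PI * INR d * theta))))
               (RtoC (cos (2 * PI * INR n * psi / INR d))))) in
  let Zc := fun s : C => Cplus (hurwitz_zeta s theta) (hurwitz_zeta s (1 - theta)) in
  let Zp := fun s : C => Cplus (hurwitz_zeta s psi) (hurwitz_zeta s (1 - psi)) in
  let c := ccos (Cdiv (Cmult (RtoC PI) nu) (RtoC 2)) in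
  let s := csin (Cdiv (Cmult (RtoC PI) nu) (RtoC 2)) in
  let G := Gfun x nu N in
  let gterm := fun m n : nat =>
    Cplus (Cplus (G (INR n + psi) (INR m + theta)) (G (INR n + 1 - psi) (INR m + theta)))
          (Cplus (G (INR n + psi) (INR m + 1 - theta)) (G (INR n + 1 - psi) (INR m + 1 - theta))) in
  Cex_series (fun n => lhs_term (S n)) /\
  (forall m : nat, Cex_series (fun n => gterm m n)) /\
  Cex_series (fun m => CSeries (fun n => gterm m n)) /\
  Cmult (Cmult (RtoC (8 * PI)) (cpow x (Cdiv nu (RtoC 2))))
        (CSeries (fun n => lhs_term (S n)))
  =
  Cplus (Cplus (Cplus
    (Copp (Cmult (Cdiv (Cmult (RtoC PI) (cpow x nu)) (Cmult (RtoC 2) c))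
                 (Zp (Cplus (RtoC 1) nu))))
    (Copp (Cmult (Cdiv (RtoC PI) (Cmult (RtoC 2) c))
                 (Zc (Cminus (RtoC 1) nu)))))
    (Cmult (Cinv (Cmult (RtoC 2) s))
       (sum_1_to (Z.to_nat N) (fun j =>
          Cmult (Cmult (RtoC (x ^ (2 * j - 1))) (Zp (RtoC (INR (2 * j)))))
                (Zc (Cminus (RtoC (INR (2 * j))) nu))))))
    (Cmult (Cmult (Cinv (Cmult (RtoC 2) s)) (RtoC (powerRZ x (2 * N + 1))))
       (CSeries (fun m => CSeries (fun n => gterm m n)))).
Proof.
  intros lhs_term Zc Zp c s G gterm0. pose proof PI_RGT_0 as HP.
  pose proof (base_Int_part ((Re nu + 1) / 2)) as [B1 B2]. set (M := Int_part ((Re nu + 1) / 2)) in *.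
  assert (HM : (0 <= M)%Z) by (assert (K : IZR (-1) < IZR M) by lra; apply lt_IZR in K; lia).
  (* The floor is the only N with 2 N - 1 <= Re nu < 2 N + 1. The given N is reached from it by [k]
     inductive steps. *)
  set (N0 := Z.to_nat M). assert (EN0 : INR N0 = IZR M) by (unfold N0; rewrite INR_IZR_INZ, Z2Nat.id; auto).
  set (k := (Z.to_nat N - N0)%nat). assert (Ek : Z.to_nat N = (N0 + k)%nat) by (unfold k, N0; lia).
  assert (EN : N = Z.of_nat (N0 + k)) by (rewrite <- Ek, Z2Nat.id; lia).
  destruct (FE_general x theta psi nu hx htheta hpsi hnu_nonint hnu_re N0 k ltac:(lra)) as [S [[U [HU HS]] E]].
  assert (Eg : forall m n, gterm x nu theta psi (N0 + k) m n = gterm0 m n).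
  { intros m n. unfold gterm, gterm0, G. rewrite <- EN. replace (INR n + 1 - psi) with (INR n + (1 - psi)) by ring.
    replace (INR m + 1 - theta) with (INR m + (1 - theta)) by ring. reflexivity. }
  assert (HU' : forall m, cser (fun n => gterm0 m n) (U m)) by (intros m; exact (cser_ext _ _ _ (Eg m) (HU m))).
  assert (HS' : cser (fun m => CSeries (fun n => gterm0 m n)) S).
  { refine (cser_ext _ _ _ _ HS). intros m. symmetry. apply cser_CSeries; auto. }
  destruct (lhs_cser nu x theta psi hx htheta hpsi) as [_ [l [Hl El]]].
  split; [exact (cser_ex _ _ Hl)|]. split; [intros m; exact (cser_ex _ _ (HU' m))|]. split; [exact (cser_ex _ _ HS')|].
  rewrite (cser_CSeries (fun n => lhs_term (Datatypes.S n)) l Hl), (cser_CSeries _ _ HS').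
  (* The integral of [lhs_cser] already contains the factor 2 x^(nu/2), so 8 pi becomes 4 pi. *)
  transitivity (Cmult (RtoC (4 * PI)) (Mel (ABf x theta psi) nu)).
  { change (Mel (ABf x theta psi) nu) with (Int (mainF nu x theta psi)). rewrite <- El.
    replace (8 * PI) with (4 * PI * 2) by ring. rewrite (RtoC_mult (4 * PI) 2). ring. }
  rewrite E. assert (Earg : Cdiv (Cmult (RtoC PI) nu) (RtoC 2) = Cmult (RtoC (PI / 2)) nu) by (rewrite RtoC_div by lra; field).
  assert (Ec : c = ccos (Cmult (RtoC (PI / 2)) nu)) by (unfold c; rewrite Earg; auto).
  assert (Es : s = csin (Cmult (RtoC (PI / 2)) nu)) by (unfold s; rewrite Earg; auto).
  unfold feA, feB, feS. rewrite <- Ec, <- Es. f_equal; [f_equal|].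
  - f_equal. rewrite sum_1_to_csum, Ek. apply csum_ext. intros j. unfold zcoef, Zp, Zc. fold (Zev psi (RtoC (INR (2 * Datatypes.S j)))).
    replace (2 * Datatypes.S j - 1)%nat with (2 * j + 1)%nat by lia. replace (j + 1)%nat with (Datatypes.S j) by lia. reflexivity.
  - do 3 f_equal. rewrite EN. replace (2 * Z.of_nat (N0 + k) + 1)%Z with (Z.of_nat (2 * (N0 + k) + 1)) by lia. apply pow_powerRZ.
Qed.
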